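(* Let $d\ge 1$, let $r\ge 1$ be an integer, let $s>0$ with $r\ge s$, and let $(X_i)_{i\ge 1}$ be an i.i.d. sequence of random variables in $\mathbb{R}^d$. Let $(h_n)_{n\ge1}$ be a sequence of positive bandwidths, written $h=h_n$. Assume: (i) $\varphi:\mathbb{R}^d\to\mathbb{R}$ belongs to the Nikol'ski class $\mathcal{H}_s$ on $\mathbb{R}^d$ and has compact support $Q$; (ii) $X_1$ has a bounded density $f$ on $\mathbb{R}^d$ whose $r$-th order derivatives exist and are bounded; (iii) there is $b>0$ such that $f(x)\ge b$ for every $x\in Q$; (iv) the kernel $K:\mathbb{R}^d\to\mathbb{R}$ is symmetric with order $r$, and there are constants $C_1,C_2>0$ such that $|K(x)|\le C_1\exp(-C_2\|x\|)$ for every $x\in\mathbb{R}^d$. Let $\widehat I(\varphi)$ and $\widehat I_{cor}(\varphi)$ be the estimators defined in the context. Then: (a) if $h^{s}+n^{1/2}h^{r}+n^{-1/2}h^{-d}\to 0$ as $n\to\infty$, then $$n^{1/2}\left(\widehat I(\varphi)-\int\varphi(x)\,dx\right)=O_{\mathbb{P}}\left(h^{s}+n^{1/2}h^{r}+n^{-1/2}h^{-d}\right);$$ (b) if $h^{s}+n^{1/2}h^{r}+n^{-1/2}h^{-d/2}+n^{-1}h^{-3d/2}\to 0$ as $n\to\infty$, then $$n^{1/2}\left(\widehat I_{cor}(\varphi)-\int\varphi(x)\,dx\right)=O_{\mathbb{P}}\left(h^{s}+n^{1/2}h^{r}+n^{-1/2}h^{-d/2}+n^{-1}h^{-3d/2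}\right).$$
   Context: Nikol'ski class: for $s>0$ write $s=k+\alpha$ with $k\in\{0,1,2,\dots\}$ and $0<\alpha\le 1$ (so $k=s-1$ if $s$ is an integer). $\mathcal{H}_s$ is the set of $k$ times differentiable functions $\varphi:\mathbb{R}^d\to\mathbb{R}$ for which there is a constant $C$ such that, for every multi-index $l=(l_1,\dots,l_d)$ with $\sum_i l_i\le k$ and every $u\in\mathbb{R}^d$, $$\int_{\mathbb{R}^d}\big(\varphi^{(l)}(x+u)-\varphi^{(l)}(x)\big)^2dx\le C|u|^{2\alpha},$$ where $\varphi^{(l)}$ is the partial derivative of multi-index $l$. Kernel: $K$ is symmetric if $K(-x)=K(x)$ for all $x$. $K$ has order $r$ if $\int K(x)\,dx=1$ and $\int P(x)K(x)\,dx=0$ for every non-constant monomial $P$ of degree at most $r$. Estimators, based on $X_1,\dots,X_n$ with bandwidth $h=h_n$: for $1\le i\le n$ and $x\in\mathbb{R}^d$, $$\widehat f^{(i)}(x)=(nh^d)^{-1}\sum_{j\ne i}K\big(h^{-1}(X_j-x)\big),$$ $$\widehat v^{(i)}(x)=\big((n-1)(n-2)\big)^{-1}\sum_{j\neq i}\Big(h^{-d}K\big(h^{-1}(x-X_j)\big)-\widehat f^{(i)}(x)\Big)^2,$$ where sums run over $j\in\{1,\dots,n\}\setminus\{i\}$, and $$\widehat I(\varphi)=n^{-1}\sum_{i=1}^n\frac{\varphi(X_i)}{\widehat f^{(i)}(X_i)},\qquad \widehat I_{cor}(\varphi)=n^{-1}\sum_{i=1}^n\frac{\varphi(X_i)}{\widehat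 f^{(i)}(X_i)}\left(1-\frac{\widehat v^{(i)}(X_i)}{\widehat f^{(i)}(X_i)^2}\right).$$ $Z_n=O_{\mathbb{P}}(a_n)$ means that $Z_n/a_n$ is bounded in probability (tight) as $n\to\infty$. *)

(* Defs.v *)
From HB Require Import structures.
From mathcomp Require Import all_boot all_order all_algebra.
From mathcomp Require Import all_classical all_reals all_analysis.

Set Implicit Arguments.
Unset Strict Implicit.
Unset Printing Implicit Defensive.

Import Order.TTheory GRing.Theory Num.Theory.
Import numFieldNormedType.Exports.

Local Open Scope classical_set_scope.
Local Open Scope ring_scope.

(** The library has no measure on ['rV[R]_d]: we equip row vectors with the
    product sigma-algebra (as the library does for tuples), i.e. the Borel
    sets of R^d, and build the d-dimensional Lebesgue measure [leb d]. *)

Definition measure_rV_display : measure_display -> measure_display.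
Proof. exact. Qed.

Section measurable_rV.
Context {disp : measure_display} {T : measurableType disp}.
Variable n : nat.

Definition rV_coord (i : 'I_n) (v : 'rV[T]_n) : T := v ord0 i.

Let rV_set0 : g_sigma_preimage rV_coord set0.
Proof. exact: sigma_algebra0. Qed.

Let rV_setC A : g_sigma_preimage rV_coord A -> g_sigma_preimage rV_coord (~` A).
Proof. exact: sigma_algebraC. Qed.

Let rV_bigcup (F : _^nat) : (forall i, g_sigma_preimage rV_coord (F i)) ->
  g_sigma_preimage rV_coord (\bigcup_i (F i)).
Proof. exact: sigma_algebra_bigcup. Qed.

HB.instance Definition _ := @isMeasurable.Build (measure_rV_display disp)
  ('rV[T]_n) (g_sigma_preimage rV_coord) rV_set0 rV_setC rV_bigcup.

Lemma measurable_rV_coord (i : 'I_n) :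
  measurable_fun [set: 'rV[T]_n] (rV_coord i).
Proof.
move=> _ Y mY; rewrite setTI; apply: sub_sigma_algebra => /=.
rewrite -bigcup_seq/=; exists i => /=; first by rewrite mem_index_enum.
by exists Y => //; rewrite setTI.
Qed.

Lemma measurable_fun_rV {d'} {S : measurableType d'} (g : S -> 'rV[T]_n) :
  (forall i, measurable_fun [set: S] (rV_coord i \o g)) ->
  measurable_fun [set: S] g.
Proof.
move=> mg _ Y mY.
suff : g_sigma_preimage (fun i => rV_coord i \o g) `<=` measurable.
  by rewrite g_sigma_preimage_comp; apply; exists Y.
apply: smallest_sub; first exact: sigma_algebra_measurable.
rewrite -bigcup_seq/=; apply: bigcup_sub => i _ B [C mC <-].
exact: mg.
Qed.

Definition rV_cons (p : T * 'rV[T]_n) : 'rV[T]_n.+1 :=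
  \row_i oapp (fun j => p.2 ord0 j) p.1 (unlift ord0 i).

End measurable_rV.

Lemma measurable_rV_cons {disp} {T : measurableType disp} n :
  measurable_fun [set: T * 'rV[T]_n] (@rV_cons disp T n).
Proof.
apply: measurable_fun_rV => i.
case: (unliftP ord0 i) => [j|] ->.
  rewrite (_ : _ \o _ = rV_coord j \o snd); last first.
    by apply/funext => p /=; rewrite /rV_coord mxE liftK.
  exact: measurableT_comp (measurable_rV_coord j) measurable_snd.
rewrite (_ : _ \o _ = fst); last first.
  by apply/funext => p /=; rewrite /rV_coord mxE unlift_none.
exact: measurable_fst.
Qed.

Section lebesgue_rV.
Variable R : realType.

Definition leb_succ n (mu : {sigma_finite_measure set 'rV[R]_n -> \bar R}) :
  set 'rV[R]_n.+1 -> \bar R :=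
  pushforward (lebesgue_measure \x mu)%E (@rV_cons _ R n).

Section leb_succ_sigma_finite.
Variables (n : nat) (mu : {sigma_finite_measure set 'rV[R]_n -> \bar R}).


Let leb_succ0 : leb_succ mu set0 = 0%E.
Proof. by rewrite /leb_succ /pushforward preimage_set0 measure0. Qed.

Let leb_succ_ge0 A : (0 <= leb_succ mu A)%E.
Proof. by rewrite /leb_succ /pushforward; exact: measure_ge0. Qed.

Let leb_succ_sigma_additive : semi_sigma_additive (leb_succ mu).
Proof.
move=> F mF tF mUF; rewrite /leb_succ /pushforward preimage_bigcup.
have mpre A : measurable A -> measurable (@rV_cons _ R n @^-1` A).
  by move=> mA; rewrite -[X in measurable X]setTI; exact: measurable_rV_cons.
apply: measure_semi_sigma_additive.
- by move=> i; exact: mpre.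
- apply/trivIsetP => /= i j _ _ ij; rewrite -preimage_setI.
  by move/trivIsetP : tF => /(_ _ _ _ _ ij) ->//; rewrite preimage_set0.
- by rewrite -preimage_bigcup; exact: mpre.
Qed.

HB.instance Definition _ := isMeasure.Build _ _ _ (leb_succ mu)
  leb_succ0 leb_succ_ge0 leb_succ_sigma_additive.

Let leb_succ_sigma_finite : sigma_finite setT (leb_succ mu).
Proof.
have /sigma_finiteP[F [TF ndF Foo]] := sigma_finiteT (@lebesgue_measure R).
have /sigma_finiteP[G [TG ndG Goo]] := sigma_finiteT mu.
pose g (v : 'rV[R]_n.+1) : R * 'rV[R]_n := (v ord0 ord0, \row_j v ord0 (lift ord0 j)).
have gK : cancel (@rV_cons _ R n) g.
  move=> [x v]; rewrite /g /rV_cons mxE unlift_none /=; congr pair.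
  by apply/rowP => j; rewrite !mxE liftK.
have mg : measurable_fun setT g.
  apply: measurable_fun_pair; first exact: (measurable_rV_coord ord0).
  apply: measurable_fun_rV => i.
  rewrite (_ : _ \o _ = rV_coord (lift ord0 i)); last first.
    by apply/funext => v /=; rewrite /rV_coord mxE.
  exact: measurable_rV_coord.
exists (fun k => g @^-1` (F k `*` G k)).
  rewrite -preimage_bigcup; apply/esym; rewrite -subTset => v _ /=.
  have [k _ Fk] : (\bigcup_k F k) (g v).1 by rewrite -TF.
  have [l _ Gl] : (\bigcup_k G k) (g v).2 by rewrite -TG.
  exists (maxn k l) => //; split => /=.
    by move: Fk; exact/subsetPset/ndF/leq_maxl.
  by move: Gl; exact/subsetPset/ndG/leq_maxr.
move=> k; have [mF Fk] := Foo k; have [mG Gk] := Goo k; split.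
  by rewrite -[X in measurable X]setTI; apply: mg => //; exact: measurableX.
rewrite /leb_succ /pushforward -comp_preimage.
rewrite (_ : g \o _ = id); last by apply/funext => p /=; rewrite gK.
by rewrite product_measure1E// lte_mul_pinfty// ge0_fin_numE.
Qed.

HB.instance Definition _ := Measure_isSigmaFinite.Build _ _ _ (leb_succ mu)
  leb_succ_sigma_finite.

End leb_succ_sigma_finite.

Fixpoint leb n : {sigma_finite_measure set 'rV[R]_n -> \bar R} :=
  match n with
  | 0 => \d_(0 : 'rV[R]_0)
  | n.+1 => leb_succ (leb n)
  end.

Lemma leb_box n (a b : 'I_n -> R) : (forall i, a i <= b i) ->
  leb n [set v | forall i, v ord0 i \in `[a i, b i]] =
  (\prod_(i < n) (b i - a i))%:E.
Proof.
elim: n a b => [|n IH] a b ab.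
  by rewrite big_ord0 /= diracE mem_set// => -[].
have E : @rV_cons _ R n @^-1` [set v | forall i, v ord0 i \in `[a i, b i]] =
    `[a ord0, b ord0] `*`
    [set v : 'rV[R]_n | forall i, v ord0 i \in `[a (lift ord0 i), b (lift ord0 i)]].
  apply/seteqP; split => [[x v] /= h|[x v] /= [hx hv] i].
    split=> [|i]; first by have := h ord0; rewrite mxE unlift_none.
    by have := h (lift ord0 i); rewrite mxE liftK.
  by rewrite mxE; case: unliftP => [j|] -> /=; [exact: hv|exact: hx].
rewrite -[LHS]/((lebesgue_measure \x leb n)%E (@rV_cons _ R n @^-1` _)).
transitivity ((lebesgue_measure \x leb n)%E (`[a ord0, b ord0] `*`
    [set v : 'rV[R]_n |
       forall i, v ord0 i \in `[a (lift ord0 i), b (lift ord0 i)]])).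
  exact: (congr1 (lebesgue_measure \x leb n)%E E).
rewrite product_measure1E//; last first.
  rewrite (_ : mkset _ = \bigcap_(i in [set: 'I_n])
     (rV_coord i @^-1` `[a (lift ord0 i), b (lift ord0 i)])); last first.
    by apply/seteqP; split => [v h i _|v h i]; [exact: h|exact: (h i I)].
  apply: fin_bigcap_measurable => // i _.
  by rewrite -[X in measurable X]setTI; exact: measurable_rV_coord.
rewrite IH//= big_ord_recl EFinM; congr (_ * _)%E.
rewrite lebesgue_measure_itv/= lte_fin.
case: ltP => // ba; have -> : a ord0 = b ord0 by apply/le_anti; rewrite ab ba.
by rewrite subrr.
Qed.

End lebesgue_rV.

Section analysis_on_rV.
Variables (R : realType) (d : nat).
Implicit Types (g K : 'rV[R]_d -> R) (l : 'I_d -> nat).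

(** The library norm on ['rV[R]_d] is the sup norm. *)
Definition enorm (x : 'rV[R]_d) : R := Num.sqrt (\sum_(i < d) x ord0 i ^+ 2).

Definition partial (i : 'I_d) g : 'rV[R]_d -> R :=
  fun x => 'D_(delta_mx ord0 i) g x.

Definition iter_partial (w : seq 'I_d) g : 'rV[R]_d -> R := foldr partial g w.

Definition mi_order l : nat := \sum_(i < d) l i.

Definition mi_partial l g : 'rV[R]_d -> R :=
  iter_partial (flatten [seq nseq (l i) i | i <- enum 'I_d]) g.

Definition monomial l (x : 'rV[R]_d) : R := \prod_(i < d) x ord0 i ^+ l i.

(** [g] is [k] times Frechet-differentiable on R^d: a function into a
    finite-dimensional space is differentiable iff its components are, so it
    suffices that all the iterated partial derivatives of order [< k] be
    differentiable. *)
Definition k_differentiable (k : nat) g : Prop :=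
  forall w : seq 'I_d, (size w < k)%N ->
    forall x, differentiable (iter_partial w g) x.

Definition partials_exist (r : nat) g : Prop :=
  forall (w : seq 'I_d) (i : 'I_d), (size w < r)%N ->
    forall x, derivable (iter_partial w g) x (delta_mx ord0 i).

(** Measurability of [g] is implicit in the L2 condition; it has to be
    required when [k = 0], and is inherited by the derivatives. *)
Definition nikolskii (s : R) g : Prop :=
  exists (k : nat) (alpha : R),
    [/\ s = k%:R + alpha, 0 < alpha <= 1,
        measurable_fun [set: 'rV[R]_d] g, k_differentiable k g &
        exists C : R, forall l (u : 'rV[R]_d), (mi_order l <= k)%N ->
          (\int[leb R d]_x ((mi_partial l g (x + u) - mi_partial l g x) ^+ 2)%:E
             <= (C * enorm u `^ (2 * alpha))%:E)%E].

Definition fun_support g : set 'rV[R]_d := closure [set x | g x != 0].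

Definition symmetric_kernel K : Prop := forall x, K (- x) = K x.

(** Integrability is implied: the extended-real integral of a measurable
    function that is not integrable is infinite ([+oo - +oo = -oo]). *)
Definition kernel_order (r : nat) K : Prop :=
  [/\ measurable_fun [set: 'rV[R]_d] K,
      (\int[leb R d]_x (K x)%:E = 1)%E &
      forall l, (0 < mi_order l <= r)%N ->
        (\int[leb R d]_x (monomial l x * K x)%:E = 0)%E].

End analysis_on_rV.

Section probability.
Context {disp : measure_display} {Omega : measurableType disp} {R : realType}.
Variable P : probability Omega R.

Definition mutually_independent {d'} {T : measurableType d'}
    (X : nat -> {RV P >-> T}) : Prop :=
  forall (J : seq nat) (A : nat -> set T), uniq J ->
    (forall j, measurable (A j)) ->
    P (\bigcap_(j in [set` J]) (X j @^-1` A j)) =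
    (\prod_(j <- J) P (X j @^-1` A j))%E.

Definition identically_distributed {d'} {T : measurableType d'}
    (X : nat -> {RV P >-> T}) : Prop :=
  forall (i j : nat) (A : set T), measurable A ->
    distribution P (X i) A = distribution P (X j) A.

Definition iid {d'} {T : measurableType d'} (X : nat -> {RV P >-> T}) : Prop :=
  mutually_independent X /\ identically_distributed X.

Definition has_density d (X : {RV P >-> 'rV[R]_d}) (f : 'rV[R]_d -> R) : Prop :=
  [/\ measurable_fun [set: 'rV[R]_d] f, forall x, 0 <= f x &
      forall A : set 'rV[R]_d, measurable A ->
        distribution P X A = (\int[leb R d]_(x in A) (f x)%:E)%E].

Definition bigO_P (Z : nat -> Omega -> R) (a : nat -> R) : Prop :=
  forall eps : R, 0 < eps -> exists M : R,
    \forall n \near \oo, (P [set w | (M < `|Z n w / a n|)%R] <= eps%:E)%E.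

End probability.

(** Samples are indexed from 0: [X 0, ..., X n.-1] stand for X_1, ..., X_n.
    As [x / 0 = 0], the estimators are total; a term whose leave-one-out
    density estimate vanishes counts for 0. *)
Section estimators.
Variables (R : realType) (d : nat) (K : 'rV[R]_d -> R) (h : R) (n : nat).
Variable X : nat -> 'rV[R]_d.

Definition fhat (i : nat) (x : 'rV[R]_d) : R :=
  (n%:R * h ^+ d)^-1 * \sum_(0 <= j < n | j != i) K (h^-1 *: (X j - x)).

Definition vhat (i : nat) (x : 'rV[R]_d) : R :=
  ((n%:R - 1) * (n%:R - 2))^-1 *
  \sum_(0 <= j < n | j != i) ((h ^+ d)^-1 * K (h^-1 *: (x - X j)) - fhat i x) ^+ 2.

Definition Ihat (phi : 'rV[R]_d -> R) : R :=
  n%:R^-1 * \sum_(0 <= i < n) phi (X i) / fhat i (X i).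

Definition Icor (phi : 'rV[R]_d -> R) : R :=
  n%:R^-1 * \sum_(0 <= i < n)
    phi (X i) / fhat i (X i) * (1 - vhat i (X i) / fhat i (X i) ^+ 2).

End estimators.

(* Main.v *)
(* Write [f_h(x)] for the mean of [h^-d K ((X_1 - x) / h)] and [delta_i] for the leave-one-out error
   [hat f^(i)(X_i) - f_h(X_i)].  Expanding [1 / hat f^(i)] around [f_h] leaves the linear statistic
   [n^-1 sum_i (phi / f_h - phi / f_h^2 * delta_i) (X_i)] and a remainder of the order of the mean of
   [|phi(X_i)| delta_i^2], that is [(n h^d)^-1].  For the corrected estimator, [hat v] removes the
   diagonal of [delta_i^2], so that only a degenerate statistic of order three and a cubic remainder,
   of the order of [(n h^d)^(-3/2)], are left.  The degenerate parts are bounded in [L^2] by counting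
   the pairs of tuples of indices that are not orthogonal.  The Hajek projection of the linear
   statistic is the centred function [phi / f_h - (phi f / f_h^2)_h], which vanishes up to
   [O(h^s)] in [L^2]: both terms are close to [phi / f] by Taylor expansion along the axes,
   the kernel having order [r >= s], where the Nikol'ski class controls the remainder in [L^2].
   Its mean differs from the integral of [phi] by [O(h^r)].

   Exponential moments, computed by integrating one coordinate of the sample at a time, bound the
   moments of [delta_i]; the sixth moment shows that every [hat f^(i)(X_i)] with [phi(X_i) <> 0]
   stays away from [0] outside an event of probability [O(n (n h^d)^-3)].  Markov's inequality
   combines all the terms. *)
Require Import Defs.
From HB Require Import structures.
From mathcomp Require Import all_boot all_order all_algebra.
From mathcomp Require Import all_classical all_reals all_analysis.
From mathcomp Require Import measurable_realfun.
From mathcomp Require Import ring lra.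

Set Implicit Arguments.
Unset Strict Implicit.
Unset Printing Implicit Defensive.

Import Order.TTheory GRing.Theory Num.Theory.
Import numFieldNormedType.Exports.

Local Open Scope classical_set_scope.
Local Open Scope ring_scope.

(** The hypotheses give derivatives that exist everywhere but need not be continuous, so the
    integral form of a Taylor remainder is not at hand. It is replaced by an inequality: if
    [|F'| <= q] everywhere, then [F 1 - F 0] is at most the integral of [q]. Its quadratic version,
    iterated along one axis, yields the sup bounds for [f] and the L2 bounds for [phi] alike. The
    quotient [phi / f] is not handled through a regularity of its own: as [f] is bounded below only
    on [Q], an L2 expansion of [phi (x + t)] is multiplied by a uniform expansion of [1 / f] whose
    centre [x] may lie outside [Q]. Independence enters only through one identity, which replaces a
    coordinate of the sample by a fresh draw. With [nu = n^(-1/2)] and [eps = (n h^d)^(-1/2)], the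
    bounds before multiplication by [n^(1/2)] are [nu h^s + h^r + eps^2] in (a) and
    [nu h^s + h^r + eps nu + eps^3] in (b). *)

(** * A mean value inequality for derivatives that need not be continuous *)

(** Let [c] be the supremum of the points with [H a <= H x]. Monotonicity on the left of [c] puts
    [c] itself in this set, and monotonicity on its right would produce a larger element if
    [c < b]. *)
Lemma locally_increasing_le (R : realType) (H : R -> R) (a b : R) :
  a <= b ->
  (forall x, a <= x <= b -> exists2 e : R, 0 < e &
     forall y, a <= y <= b -> `|y - x| < e ->
       (x <= y -> H x <= H y) /\ (y <= x -> H y <= H x)) ->
  H a <= H b.
Proof.
move=> ab Hloc; pose S := [set x | a <= x <= b /\ H a <= H x].
have Sa : S a by rewrite /S/= lexx ab.
have supS : has_sup S.
  by split; [exists a|exists b => x [/andP[]]].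
pose c := sup S.
have ac : a <= c by exact: sup_upper_bound supS _ Sa.
have cb : c <= b by apply: ge_sup; [exists a|move=> x [/andP[]]].
have [e e0 He] := Hloc c (introT andP (conj ac cb)).
have Hc : H a <= H c.
  have [x Sx cex] := sup_adherent e0 supS.
  have xc : x <= c by exact: sup_upper_bound supS _ Sx.
  have xce : `|x - c| < e.
    by rewrite distrC ger0_norm ?subr_ge0// ltrBlDl -ltrBlDr.
  by have [_ /(_ xc)] := He x Sx.1 xce; exact: le_trans Sx.2.
have [cb'|cltb] : c = b \/ c < b by move: cb; rewrite le_eqVlt => /orP[/eqP|]; [left|right].
  by rewrite -cb'.
pose y := Num.min b (c + e / 2).
have cy : c < y by rewrite /y lt_min cltb ltrDl divr_gt0.
have yab : a <= y <= b by rewrite (le_trans ac (ltW cy)) /y ge_min lexx.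
have [Hy _] := He y yab ltac:(rewrite ger0_norm ?subr_ge0 ?ltW// ltrBlDl /y gt_min ltrD2l ltr_pdivrMr// ltr_pMr// ltr1n orbT//).
have : S y by split=> //; apply: le_trans Hc (Hy (ltW cy)).
by move=> /(sup_upper_bound supS); rewrite leNgt cy.
Qed.

Section mean_value_integral.
Context {R : realType}.
Local Notation mu := (@lebesgue_measure R).
Local Open Scope ereal_scope.

Let le_mu (A B : set R) : measurable A -> measurable B -> A `<=` B -> mu A <= mu B.
Proof. by move=> mA mB AB; apply: (le_measure (@lebesgue_measure R)); rewrite ?inE. Qed.

(* The argument of Vitali and Caratheodory: the level sets of [`|g|] are covered by open sets of
   nearly the same measure, which gives an increasing majorant of [F]. *)
Lemma is_derive_le_integral (F g q : R -> R) :
  (forall x : R, is_derive x 1%R F (g x)) -> measurable_fun [set: R] q ->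
  (forall x, `|g x| <= q x)%R ->
  (F 1%R - F 0%R)%:E <= \int[mu]_(x in `[0%R, 1%R]) (q x)%:E.
Proof.
move=> dF mq gq.
have q0 x : (0 <= q x)%R by exact: le_trans (gq x).
have mq' (D : set R) : measurable D -> measurable_fun D (fun x => (q x)%:E).
  by move=> mD; apply: measurable_funTS; apply/measurable_EFinP.
have [->|/eqP] := eqVneq (\int[mu]_(x in `[0%R, 1%R]) (q x)%:E) +oo; first by rewrite leey.
move/eqP; rewrite -ltey => Ioo.
have Ifin : \int[mu]_(x in `[0%R, 1%R]) (q x)%:E \is a fin_num.
  by rewrite ge0_fin_numE// integral_ge0// => x _; rewrite lee_fin.
apply/lee_addgt0Pr => e e0; pose eta := (e / 2)%R.
have eta0 : (0 < eta)%R by rewrite divr_gt0.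
(* Slices on which [q] is known up to [eta]. At a point of [E k] the slope of [F] is at most [q],
   hence below [(k + 1) eta]. *)
pose E k := (`[0%R, 1%R]%classic : set R) `&` [set x | (k%:R * eta <= q x < k.+1%:R * eta)%R].
have mE k : measurable (E k).
  apply: measurableI => //.
  rewrite [X in measurable X](_ : _ = q @^-1` `[(k%:R * eta)%R, (k.+1%:R * eta)%R[); last first.
    by apply/seteqP; split=> x /=; rewrite in_itv.
  by rewrite -[X in measurable X]setTI; apply: mq.
have UE : \bigcup_k E k = `[0%R, 1%R]%classic.
  apply/seteqP; split=> [x [k _ []]//|x x01].
  have /truncn_itv : (0 <= q x / eta)%R by rewrite divr_ge0// ltW.
  rewrite ler_pdivlMr// ltr_pdivrMr// => H.
  by exists (Num.truncn (q x / eta)).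
have tE : trivIset setT E.
  move=> i j _ _ [x [[_ /andP[i1 i2]] [_ /andP[j1 j2]]]].
  have tr k : (k%:R * eta <= q x)%R -> (q x < k.+1%:R * eta)%R ->
      Num.truncn (q x / eta) = k.
    by move=> k1 k2; apply: truncn_def; rewrite ler_pdivlMr// ltr_pdivrMr// k1.
  by rewrite -(tr i)// -(tr j).
have Ele1 k : mu (E k) <= 1.
  apply: (@le_trans _ _ (mu `[0%R, 1%R])).
    by apply: le_mu => //; apply: subIsetl.
  by rewrite lebesgue_measure_itv/= lte_fin ltr01 sube0.
have ek0 k : (0 < (k.+1%:R * (2 ^ k.+1)%:R)^-1 :> R)%R.
  by rewrite invr_gt0 mulr_gt0// ltr0n expn_gt0.
(* The open set [V k] exceeds [E k] by less than [1 / ((k + 1) 2^(k + 1))] in measure; weighted by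
   the slope [(k + 1) eta] this costs [eta / 2^(k + 1)], hence [eta] in total. Rounding [q] up costs
   the other [eta], and [e = 2 eta]. *)
have /choice[V HV] k : exists U : set R, [/\ open U, E k `<=` U &
    mu (U `\` E k) < ((k.+1%:R * (2 ^ k.+1)%:R)^-1)%:E].
  by apply: lebesgue_regularity_outer => //; apply: le_lt_trans (Ele1 k) (ltry _).
have mV k : measurable (V k) by apply: open_measurable; have [] := HV k.
have ce0 k : 0 <= (k.+1%:R * eta)%:E by rewrite lee_fin mulr_ge0// ltW.
pose W x k := (k.+1%:R * eta)%:E * mu (V k `&` `[0%R, x]).
have W0 x k : 0 <= W x k by rewrite mule_ge0// lee_fin mulr_ge0// ltW.
have mW x k : measurable (V k `&` `[0%R, x]) by exact: measurableI.
have Wmono x y k : (x <= y)%R -> W x k <= W y k.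
  move=> xy; rewrite lee_wpmul2l//.
  apply: le_mu => //.
  apply: setIS => z /=; rewrite !in_itv/= => /andP[->] /le_trans; exact.
(* The increasing majorant: around a point of [E k], thus inside the open set [V k], it grows with
   slope at least [(k + 1) eta]. *)
pose U x := \sum_(k <oo) W x k.
have Ieta : \int[mu]_(x in `[0%R, 1%R]) eta%:E = eta%:E.
  transitivity (eta%:E * mu `[0%R, 1%R]); first exact: integral_cst.
  by rewrite lebesgue_measure_itv/= lte_fin ltr01 sube0 mule1.
have IqD : \int[mu]_(x in `[0%R, 1%R]) ((q x)%:E + eta%:E) = \int[mu]_(x in `[0%R, 1%R]) (q x)%:E + eta%:E.
  rewrite -[X in _ = _ + X]Ieta; apply: ge0_integralD => //.
  - by move=> x _; rewrite lee_fin.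
  - exact: mq'.
  - by move=> x _; rewrite lee_fin ltW.
have U1 : U 1%R <= \int[mu]_(x in `[0%R, 1%R]) (q x)%:E + e%:E.
  apply: (@le_trans _ _ (\sum_(k <oo) ((\int[mu]_(x in E k) ((q x)%:E + eta%:E)) + (eta / (2 ^ k.+1)%:R)%:E))).
    apply: lee_nneseries => // k _.
    apply: (@le_trans _ _ ((k.+1%:R * eta)%:E * (mu (E k) + ((k.+1%:R * (2 ^ k.+1)%:R)^-1)%:E))).
      rewrite lee_wpmul2l//.
      have [_ EV VE] := HV k.
      apply: (@le_trans _ _ (mu (E k) + mu (V k `\` E k))); last by rewrite leeD2l// ltW.
      apply: (@le_trans _ _ (mu (E k `|` (V k `\` E k)))).
        apply: le_mu => //.
          by apply: measurableU => //; exact: measurableD.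
        by rewrite setDUK// => x [].
      by apply: (measureU2 (@lebesgue_measure R)); [exact: mE|apply: measurableD; [exact: mV|exact: mE]].
    rewrite ge0_muleDr// ?lee_fin ?(ltW (ek0 _))//; apply: leeD; last first.
      rewrite -EFinM lee_fin invfM [X in (X <= _)%R](_ : _ = (eta / (2 ^ k.+1)%:R)%R)//.
      by rewrite mulrACA divff// mul1r.
    rewrite -(integral_cst mu (mE k)); apply: ge0_le_integral => //=.
    - exact: mE.
    - by apply: emeasurable_funD => //; apply: mq'; exact: mE.
    - by move=> x [_ /andP[H _]]; rewrite -EFinD lee_fin; move: H; rewrite -natr1 mulrDl mul1r; lra.
  apply: le_trans (epsilon_trick _ _ (ltW eta0)) _.
    by move=> k; apply: integral_ge0 => x _; rewrite -EFinD lee_fin addr_ge0// ltW.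
  rewrite -ge0_integral_bigcup//; last 2 first.
  - by rewrite UE; apply: emeasurable_funD => //; exact: mq'.
  - by move=> x _; rewrite -EFinD lee_fin addr_ge0// ltW.
  rewrite UE IqD -addeA leeD2l//.
  by rewrite -EFinD lee_fin /eta -splitr.
have Ufin x : (x <= 1)%R -> U x \is a fin_num.
  move=> x1; rewrite ge0_fin_numE ?nneseries_ge0//.
  apply: (@le_lt_trans _ _ (U 1%R)); first by apply: lee_nneseries => // k _; exact: Wmono.
  by apply: le_lt_trans U1 _; rewrite lte_add_pinfty ?ltry.
pose H x := (fine (U x) - F x)%R.
have Hinc : (H 0%R <= H 1%R)%R.
  apply: locally_increasing_le => // x /andP[x0 x1].
  have [k _ Ekx] : (\bigcup_k E k) x by rewrite UE/= in_itv/= x0.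
  have [oV EV _] := HV k.
  have /nbhs_ballP[e1 /= e10 e1V] : nbhs x (V k) by apply: open_nbhs_nbhs; split=> //; exact: EV.
  have [_ /andP[_ gx]] := Ekx.
  (* The slope function of Caratheodory bounds the increments of [F] on both sides of [x] at
     once. *)
  have /is_derive1_caratheodory[G [GF cG Gx]] := dF x.
  have /nbhs_ballP[e2 /= e20 e2G] : \forall z \near x, (`|G z| < k.+1%:R * eta)%R.
    have cN : (fun z => `|G z|%R) @ x --> `|G x|%R by apply: cvg_norm; exact: cG.
    by apply: (cvgr_lt _ cN); rewrite Gx (le_lt_trans (gq x)).
  exists (Num.min e1 e2) => [|y /andP[y0 y1]]; first by rewrite lt_min e10.
  rewrite lt_min => /andP[ye1 ye2].
  have Uinc z1 z2 : (0 <= z1)%R -> (z2 <= 1)%R -> (z1 <= z2)%R -> (forall z, (z1 <= z <= z2)%R -> V k z) ->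
      (fine (U z1) + (k.+1%:R * eta) * (z2 - z1) <= fine (U z2))%R.
    move=> z10 z21 z12 zV; rewrite -lee_fin EFinD !fineK ?Ufin//; last exact: le_trans z12 z21.
    rewrite [X in _ + X](_ : _ = \sum_(j <oo | j == k) ((k.+1%:R * eta) * (z2 - z1))%:E); last first.
      rewrite (nneseriesD1 (n := k))//; last first.
        by move=> j _; rewrite lee_fin !mulr_ge0// ?subr_ge0// ltW.
      rewrite eseries_pred0 ?adde0// => j.
      by case: eqP.
    rewrite [X in _ + X]eseries_mkcond -nneseriesD//; last first.
      by move=> j _ _; case: ifP; rewrite // lee_fin !mulr_ge0// ?subr_ge0// ltW.
    apply: lee_nneseries => j _.
      by move=> _; rewrite adde_ge0//; case: ifP; rewrite // lee_fin !mulr_ge0// ?subr_ge0// ltW.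
    case: eqP => [->|_]; last by rewrite adde0; exact: Wmono.
    rewrite /W [X in _ + X]EFinM -ge0_muleDr ?lee_fin ?subr_ge0// lee_wpmul2l//.
    rewrite [X in _ + X](_ : _ = mu `]z1, z2]); last first.
      rewrite lebesgue_measure_itv/= lte_fin; case: ltP => // z21'.
      by have -> : z1 = z2 by [apply/le_anti; rewrite z12]; rewrite subrr.
    rewrite -measureU//; [|exact: mW|]; last first.
      apply/seteqP; split=> [t [[_ /=]]|//]; rewrite !in_itv/= => /andP[_ t1] /andP[].
      by rewrite ltNge t1.
    apply: le_mu; [by apply: measurableU => //; exact: mW|exact: mW|].
    move=> t [[Vt]|]/=; rewrite !in_itv/=.
      by move=> /andP[-> t1]; split=> //; exact: le_trans t1 z12.
    move=> /andP[/ltW t1 t2]; split; first by apply: zV; rewrite t1.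
    by rewrite t2 (le_trans z10).
  have Fb : (`|F y - F x| <= k.+1%:R * eta * `|y - x|)%R.
    rewrite GF normrM ler_wpM2r// ltW//; apply: e2G.
    by rewrite /ball/= distrC.
  move: Fb; rewrite ler_norml => /andP[Fb1 Fb2].
  split=> [xy|yx]; rewrite /H.
    have := Uinc x y x0 y1 xy; rewrite ger0_norm ?subr_ge0// in Fb1 Fb2.
    have H1 z : (x <= z <= y)%R -> V k z.
      move=> /andP[z1 z2]; apply: e1V; rewrite /ball/= distrC ger0_norm ?subr_ge0//.
      by rewrite (le_lt_trans _ ye1)// ger0_norm ?subr_ge0// lerD2r.
    by move=> /(_ H1); move: Fb1 Fb2; clear; lra.
  have := Uinc y x y0 x1 yx; rewrite ler0_norm ?subr_le0// in Fb1 Fb2.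
  have H1 z : (y <= z <= x)%R -> V k z.
    move=> /andP[z1 z2]; apply: e1V; rewrite /ball/= ger0_norm ?subr_ge0//.
    by rewrite (le_lt_trans _ ye1)// ler0_norm ?subr_le0// opprB lerD2l lerN2.
  by move=> /(_ H1); move: Fb1 Fb2; clear; lra.
have : (F 1%R - F 0%R <= fine (U 1%R) - fine (U 0%R))%R by move: Hinc; rewrite /H; lra.
rewrite -lee_fin => /le_trans; apply; apply: le_trans U1.
by rewrite EFinB !fineK ?Ufin// leeBlDr ?Ufin// leeDl// nneseries_ge0.
Qed.

End mean_value_integral.

(** * Measurability of real and row-vector maps *)

(** The real power with exponent -1 is measurable and agrees with the inverse on nonnegative
    numbers, so the inverse is written [x * (x^2)^-1]; at 0 both sides are 0. *)
Lemma measurable_invr (R : realType) : measurable_fun [set: R] (fun x : R => x^-1).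
Proof.
rewrite (_ : (fun x : R => x^-1) = fun x => x * (x ^+ 2) `^ (-1)).
  apply: measurable_funM => //.
  apply: (measurableT_comp (@measurable_powR R (-1))).
  exact: measurable_funX.
apply/funext => x; rewrite powR_inv1 ?sqr_ge0//.
have [->|x0] := eqVneq x 0; first by rewrite invr0 mul0r.
by rewrite expr2 invfM mulrA divff// mul1r.
Qed.

Section measurable_row_vectors.
Context d (S : measurableType d) (R : realType) (n : nat).
Implicit Types f g : S -> 'rV[R]_n.

Lemma measurable_fun_rVD f g : measurable_fun [set: S] f -> measurable_fun [set: S] g ->
  measurable_fun [set: S] (fun x => f x + g x).
Proof.
move=> mf mg; apply: measurable_fun_rV => i.
rewrite (_ : _ \o _ = (rV_coord i \o f) \+ (rV_coord i \o g)); last first.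
  by apply/funext => x /=; rewrite /rV_coord mxE.
by apply: measurable_funD; apply: measurableT_comp => //; exact: measurable_rV_coord.
Qed.

Lemma measurable_fun_rVZ (c : S -> R) f : measurable_fun [set: S] c -> measurable_fun [set: S] f ->
  measurable_fun [set: S] (fun x => c x *: f x).
Proof.
move=> mc mf; apply: measurable_fun_rV => i.
rewrite (_ : _ \o _ = c \* (rV_coord i \o f)); last first.
  by apply/funext => x /=; rewrite /rV_coord mxE.
by apply: measurable_funM => //; apply: measurableT_comp => //; exact: measurable_rV_coord.
Qed.

Lemma measurable_fun_rVN f : measurable_fun [set: S] f -> measurable_fun [set: S] (fun x => - f x).
Proof.
move=> mf; rewrite (_ : (fun x => - f x) = fun x => (-1) *: f x).
  exact: measurable_fun_rVZ.
by apply/funext => x; rewrite scaleN1r.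
Qed.

End measurable_row_vectors.

Lemma measurable_fun_coord d (S : measurableType d) d' (T : measurableType d') n (f : S -> 'rV[T]_n)
  (i : 'I_n) : measurable_fun [set: S] f -> measurable_fun [set: S] (fun x => f x ord0 i).
Proof. by move=> mf; apply: (measurableT_comp (measurable_rV_coord i)). Qed.

Lemma measurable_fun_rowP d (S : measurableType d) d' (T : measurableType d') n (f : 'I_n -> S -> T) :
  (forall i, measurable_fun [set: S] (f i)) ->
  measurable_fun [set: S] (fun x => \row_i f i x).
Proof.
move=> mf; apply: measurable_fun_rV => i.
rewrite (_ : _ \o _ = f i) => //; apply/funext => x /=.
by rewrite /rV_coord mxE.
Qed.

Lemma measurable_fun2_comp d1 d2 d3 d4 (S : measurableType d1) (T1 : measurableType d2)
  (T2 : measurableType d3) (T : measurableType d4) (F : T1 -> T2 -> T) (f : S -> T1) (g : S -> T2) :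
  measurable_fun [set: T1 * T2] (fun p => F p.1 p.2) ->
  measurable_fun [set: S] f -> measurable_fun [set: S] g ->
  measurable_fun [set: S] (fun x => F (f x) (g x)).
Proof.
by move=> mF mf mg; exact: (measurableT_comp mF (measurable_fun_pair mf mg)).
Qed.

Lemma measurable_fun_sumr d (S : measurableType d) (R : realType) (I : Type) (s : seq I) (P : pred I)
  (f : I -> S -> R) : (forall i, measurable_fun [set: S] (f i)) ->
  measurable_fun [set: S] (fun x => \sum_(i <- s | P i) f i x).
Proof.
move=> mf; elim: s => [|i s IH].
  by rewrite (_ : (fun _ => _) = cst 0)//; apply/funext => x; rewrite big_nil.
rewrite (_ : (fun _ => _) = fun x => if P i then f i x + (\sum_(j <- s | P j) f j x)
   else \sum_(j <- s | P j) f j x); last by apply/funext => x; rewrite big_cons.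
by case: (P i) => //; exact: measurable_funD.
Qed.

Lemma measurable_fun_prodr d (S : measurableType d) (R : realType) (I : Type) (s : seq I) (P : pred I)
  (f : I -> S -> R) : (forall i, measurable_fun [set: S] (f i)) ->
  measurable_fun [set: S] (fun x => \prod_(i <- s | P i) f i x).
Proof.
move=> mf; elim: s => [|i s IH].
  by rewrite (_ : (fun _ => _) = cst 1)//; apply/funext => x; rewrite big_nil.
rewrite (_ : (fun _ => _) = fun x => if P i then f i x * (\prod_(j <- s | P j) f j x)
   else \prod_(j <- s | P j) f j x); last by apply/funext => x; rewrite big_cons.
by case: (P i) => //; exact: measurable_funM.
Qed.

(** Recursion on the syntax of the function. The row-vector operations are tried before the real
    ones, whose notations they share; hypotheses about opaque functions, of one variable or of a
    pair, come last. *)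
Ltac meas_step := match goal with
  | |- forall _, _ => move=> ?
  | |- measurable_fun _ (fun x => _%:E) => apply/measurable_EFinP
  | |- measurable_fun _ (fun _ => ?c) => exact: measurable_cst
  | |- measurable_fun _ (fun x => x) => exact: measurable_id
  | |- measurable_fun _ (fun x => x.1) => exact: measurable_fst
  | |- measurable_fun _ (fun x => x.2) => exact: measurable_snd
  | |- measurable_fun _ (fun x => (@?f x).1) => apply: (measurableT_comp measurable_fst)
  | |- measurable_fun _ (fun x => (@?f x).2) => apply: (measurableT_comp measurable_snd)
  | |- measurable_fun _ (fun x => (@?f x, @?g x)) => apply: (@measurable_fun_pair _ _ _ _ _ _ f g)
  | |- measurable_fun _ (fun x => (@?f x : 'rV__) + @?g x) => apply: (@measurable_fun_rVD _ _ _ _ f g)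
  | |- measurable_fun _ (fun x => - (@?f x : 'rV__)) => apply: (@measurable_fun_rVN _ _ _ _ f)
  | |- measurable_fun _ (fun x => (@?c x) *: (@?f x : 'rV__)) => apply: (@measurable_fun_rVZ _ _ _ _ c f)
  | |- measurable_fun _ (fun x => @?f x + @?g x) => apply: (@measurable_funD _ _ _ _ f g)
  | |- measurable_fun _ (fun x => @?f x * @?g x) => apply: (@measurable_funM _ _ _ _ f g)
  | |- measurable_fun _ (fun x => - @?f x) => apply: (@measurable_funN _ _ _ _ f)
  | |- measurable_fun _ (fun x => (@?f x)^-1) => apply: (measurableT_comp (@measurable_invr _) (g := f))
  | |- measurable_fun _ (fun x => (@?f x) ^+ ?n) => apply: (@measurable_funX _ _ _ _ f n)
  | |- measurable_fun _ (fun x => `|@?f x|) => apply: (measurableT_comp (@normr_measurable _ setT) (g := f))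
  | |- measurable_fun _ (fun x => expR (@?f x)) => apply: (measurableT_comp (@measurable_expR _) (g := f))
  | |- measurable_fun _ (fun x => @fun_of_matrix _ _ _ (@?f x) ord0 ?i) => apply: (@measurable_fun_coord _ _ _ _ _ f i)
  | |- measurable_fun _ (fun x => \row_i _) => apply: measurable_fun_rowP
  | |- measurable_fun _ (fun x => \sum_(i <- _ | _) _) => apply: measurable_fun_sumr
  | |- measurable_fun _ (fun x => \prod_(i <- _ | _) _) => apply: measurable_fun_prodr
  | |- measurable_fun _ (fun x => if ?b then _ else _) => case: b
  | H : is_true (measurable_fun _ ?f) |- measurable_fun _ ?f => exact: H
  | H : measurable_fun _ ?f |- measurable_fun _ ?f => exact: H
  | H : measurable_fun _ ?f |- measurable_fun _ (fun x => ?f (@?g x)) => apply: (measurableT_comp H (g := g))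
  | H : measurable_fun _ (fun p => ?F p.1 p.2) |- measurable_fun _ (fun x => ?F (@?f x) (@?g x)) =>
      apply: (measurable_fun2_comp (f := f) (g := g) H)
  end.
Ltac meas := repeat (meas_step; cbv beta).


(** * Integrals of real functions, Tonelli and Fubini *)

Section integral_toolkit.
Context d (T : measurableType d) (R : realType).
Local Open Scope ereal_scope.

Lemma measurable_fun_integral d' (T' : measurableType d') (mu : {sigma_finite_measure set T -> \bar R})
  (F : T' -> T -> \bar R) : measurable_fun [set: T' * T] (fun p => F p.1 p.2) ->
  measurable_fun [set: T'] (fun x => \int[mu]_y F x y).
Proof.
move=> mF; rewrite (_ : (fun x => _) = (fun x => \int[mu]_y (fun p => F p.1 p.2)^\+ (x, y)) \-
    (fun x => \int[mu]_y (fun p => F p.1 p.2)^\- (x, y))).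
  apply: emeasurable_funB.
    by apply: (measurable_fun_fubini_tonelli_F (fun p => F p.1 p.2)^\+) => //; exact: measurable_funepos.
  by apply: (measurable_fun_fubini_tonelli_F (fun p => F p.1 p.2)^\-) => //; exact: measurable_funeneg.
apply/funext => x; rewrite integralE; by congr (_ - _); apply: eq_integral => y _; rewrite ?funeposE ?funenegE.
Qed.

Lemma measurable_fun_Rintegral d' (T' : measurableType d') (mu : {sigma_finite_measure set T -> \bar R})
  (F : T' -> T -> R) : measurable_fun [set: T' * T] (fun p => F p.1 p.2) ->
  measurable_fun [set: T'] (fun x => (\int[mu]_y F x y)%R).
Proof.
move=> mF; apply: (@measurableT_comp _ _ _ _ _ _ (@fine R)) => //.
by apply: (@measurable_fun_integral _ _ mu (fun x y => (F x y)%:E)); apply/measurable_EFinP.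
Qed.

Variable mu : {measure set T -> \bar R}.
Implicit Types f g : T -> R.

Lemma le_int f g : measurable_fun setT f -> measurable_fun setT g ->
  (forall x, (0 <= f x)%R) -> (forall x, (f x <= g x)%R) ->
  \int[mu]_x (f x)%:E <= \int[mu]_x (g x)%:E.
Proof.
move=> mf mg f0 fg; apply: ge0_le_integral => //.
- by move=> x _; rewrite lee_fin.
- by meas.
- by meas.
- by move=> x _; rewrite lee_fin.
Qed.

Lemma intD f g : measurable_fun setT f -> measurable_fun setT g ->
  (forall x, (0 <= f x)%R) -> (forall x, (0 <= g x)%R) ->
  \int[mu]_x (f x + g x)%:E = \int[mu]_x (f x)%:E + \int[mu]_x (g x)%:E.
Proof.
move=> mf mg f0 g0; under eq_integral do rewrite EFinD.
by rewrite ge0_integralD//; try (by move=> x _; rewrite lee_fin); meas.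
Qed.

Lemma intZ (c : R) f : measurable_fun setT f -> (0 <= c)%R -> (forall x, (0 <= f x)%R) ->
  \int[mu]_x (c * f x)%:E = c%:E * \int[mu]_x (f x)%:E.
Proof.
move=> mf c0 f0; under eq_integral do rewrite EFinM.
by rewrite ge0_integralZl_EFin//; try (by move=> x _; rewrite lee_fin); meas.
Qed.

Lemma int_ge0 f : (forall x, (0 <= f x)%R) -> 0 <= \int[mu]_x (f x)%:E.
Proof. by move=> f0; apply: integral_ge0 => x _; rewrite lee_fin. Qed.

Lemma int_integrable f : measurable_fun setT f -> \int[mu]_x (`|f x|)%:E < +oo ->
  mu.-integrable setT (EFin \o f).
Proof. by move=> mf fi; apply/integrableP; split=> //; exact/measurable_EFinP. Qed.

End integral_toolkit.

Section fubini_tonelli_real.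
Context d1 d2 (T1 : measurableType d1) (T2 : measurableType d2) (R : realType).
Variables (m1 : {sigma_finite_measure set T1 -> \bar R}) (m2 : {sigma_finite_measure set T2 -> \bar R}).
Local Open Scope ereal_scope.

Lemma int_tonelli (F : T1 -> T2 -> R) : measurable_fun [set: T1 * T2] (fun p => F p.1 p.2) ->
  (forall x y, (0 <= F x y)%R) ->
  \int[m1]_x \int[m2]_y (F x y)%:E = \int[m2]_y \int[m1]_x (F x y)%:E.
Proof.
move=> mF F0; apply: (fubini_tonelli (fun p => (F p.1 p.2)%:E)).
  by meas.
by move=> p; rewrite lee_fin.
Qed.

Lemma int_fubini (F : T1 -> T2 -> R) : measurable_fun [set: T1 * T2] (fun p => F p.1 p.2) ->
  \int[m1]_x \int[m2]_y (`|F x y|%R)%:E < +oo ->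
  \int[m1]_x \int[m2]_y (F x y)%:E = \int[m2]_y \int[m1]_x (F x y)%:E.
Proof.
move=> mF Foo; apply: (@Fubini _ _ _ _ _ m1 m2 (fun p => (F p.1 p.2)%:E)).
by apply/integrable12ltyP => //; meas.
Qed.

End fubini_tonelli_real.

(** * Affine changes of variables *)

Section affine_change_of_variables.
Context {R : realType}.
Local Open Scope ereal_scope.
Local Notation lam := (@lebesgue_measure R).

Let affine (a u : R) : R -> measurableTypeR R := fun x => (a * x + u)%R.

Let measurable_affine a u : measurable_fun [set: measurableTypeR R] (affine a u).
Proof. by apply: measurable_funD => //; apply: measurable_funM. Qed.

(** Uniqueness of Lebesgue measure: its image under the affine map, scaled by [|a|], gives half-open
    intervals their length. The sign of [a] decides which end of the preimage is open. *)
Lemma lebesgue_measure_affine (a u : R) (A : set R) : a != 0%R -> measurable A ->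
  (`|a|^-1)%:E * lam A = lam ((fun x => a * x + u)%R @^-1` A).
Proof.
move=> a0 mA.
pose c : {nonneg R} := NngNum (normr_ge0 a).
have aN0 : `|a|%:E * (`|a|^-1)%:E = 1%:E.
  by rewrite -EFinM divff// normr_eq0.
suff -> : lam A = `|a|%:E * lam (affine a u @^-1` A).
  by rewrite muleA (muleC _ `|a|%:E) aN0 mul1e.
have E : forall A, measurable A -> lam A = mscale c (pushforward lam (affine a u)) A.
  move=> mf B mB; apply: lebesgue_measure_unique => //=.
  move=> _ [[x y]] _ <-; rewrite /mscale /pushforward/=.
  have [xy|yx] := ltP x y; last first.
    rewrite set_itv_ge ?preimage_set0 ?measure0 ?mule0//.
    by rewrite -leNgt bnd_simp.
  rewrite -[pushforward lam (affine a u) _]/(lam (affine a u @^-1` `]x, y])) lebesgue_measure_itv/= lte_fin xy.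
  have [ap|an|/eqP] := ltgtP 0%R a; last by rewrite eq_sym (negbTE a0).
    rewrite (_ : affine a u @^-1` _ = `]((x - u) / a)%R, ((y - u) / a)%R]%classic); last first.
      apply/seteqP; split=> t /=; rewrite /affine !in_itv/= ltr_pdivrMr// ler_pdivlMr//;
      by rewrite ltrBlDr lerBrDr (mulrC t).
    rewrite lebesgue_measure_itv/= lte_fin ltr_pM2r ?invr_gt0// ltrD2r xy.
    rewrite gtr0_norm// -!EFinD -EFinM; congr (_%:E).
    by field; rewrite gt_eqF.
  rewrite (_ : affine a u @^-1` _ = `[((y - u) / a)%R, ((x - u) / a)%R[%classic); last first.
    apply/seteqP; split=> t /=; rewrite /affine !in_itv/= ltr_ndivlMr// ler_ndivrMr//;
    by rewrite ltrBlDr lerBrDr (mulrC t) andbC.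
  rewrite lebesgue_measure_itv/= lte_fin ltr_nM2r ?invr_lt0// ltrD2r xy.
  rewrite ltr0_norm// -!EFinD -EFinM; congr (_%:E).
  by field; rewrite lt_eqF.
exact: (E (@measurable_affine a u)).
Qed.

Lemma int_affine1 (a u : R) (g : R -> R) : a != 0%R -> measurable_fun [set: R] g ->
  (forall x, (0 <= g x)%R) ->
  \int[lam]_x (g (a * x + u)%R)%:E = (`|a|^-1)%:E * \int[lam]_x (g x)%:E.
Proof.
move=> a0 mg g0.
have c0 : (0 <= `|a|^-1)%R by rewrite invr_ge0.
pose c : {nonneg R} := NngNum c0.
transitivity (\int[mscale c lam]_x (g x)%:E); last first.
  rewrite ge0_integral_mscale//; first by apply/measurable_EFinP.
  by move=> x _; rewrite lee_fin.
transitivity (\int[pushforward lam (affine a u)]_x (g x)%:E).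
  rewrite ge0_integral_pushforward//; first by apply/measurable_EFinP.
  by move=> x _; rewrite lee_fin.
by apply: eq_measure_integral => A mA _; rewrite /mscale/pushforward/=; exact/esym/lebesgue_measure_affine.
Qed.

End affine_change_of_variables.

Section affine_change_of_variables_rV.
Context {R : realType}.
Local Open Scope ereal_scope.

Lemma int_leb_succ n (g : 'rV[R]_n.+1 -> R) : measurable_fun setT g -> (forall x, (0 <= g x)%R) ->
  \int[leb R n.+1]_x (g x)%:E = \int[lebesgue_measure]_x \int[leb R n]_v (g (rV_cons (x, v)))%:E.
Proof.
move=> mg g0; rewrite -[LHS]/(\int[leb_succ (leb R n)]_x (g x)%:E).
have mc := @measurable_rV_cons _ R n.
rewrite /leb_succ ge0_integral_pushforward//; last 2 first.
- by apply/measurable_EFinP.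
- by move=> x _; rewrite lee_fin.
rewrite preimage_setT; etransitivity; last first.
  apply: (fubini_tonelli1 (m1 := lebesgue_measure) (m2 := leb R n) (fun p => (g (rV_cons p))%:E)).
    by apply/measurable_EFinP; exact: measurableT_comp.
  by move=> p; rewrite lee_fin.
by [].
Qed.

(** Induction on the dimension: the last [n] coordinates are rescaled by the induction hypothesis,
    then Tonelli makes the first coordinate the inner variable and the one-dimensional case
    applies. *)
Lemma int_affine n (a : R) (u : 'rV[R]_n) (g : 'rV[R]_n -> R) : a != 0%R ->
  measurable_fun setT g -> (forall x, (0 <= g x)%R) ->
  \int[leb R n]_x (g (a *: x + u)%R)%:E = (`|a| ^- n)%:E * \int[leb R n]_x (g x)%:E.
Proof.
move=> a0; elim: n u g => [|n IH] u g mg g0.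
  rewrite expr0 invr1 mul1e; apply: eq_integral => x _; congr (g _)%:E.
  by apply/rowP => -[].
have mgc : measurable_fun [set: R * 'rV[R]_n] (fun p => g (rV_cons p)).
  by apply: measurableT_comp => //; exact: measurable_rV_cons.
rewrite int_leb_succ//; last first.
  by meas.
pose u' : 'rV[R]_n := (\row_j u ord0 (lift ord0 j))%R.
transitivity (\int[lebesgue_measure]_x \int[leb R n]_v (g (rV_cons (a * x + u ord0 ord0, a *: v + u')))%R%:E).
  apply: eq_integral => x _; apply: eq_integral => v _; congr (g _)%:E.
  apply/rowP => i; rewrite !mxE; case: unliftP => [j|] ->//=.
  by rewrite !mxE.
transitivity (\int[lebesgue_measure]_x ((`|a| ^- n)%:E * \int[leb R n]_v (g (rV_cons (a * x + u ord0 ord0, v)))%R%:E)).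
  apply: eq_integral => x _.
  rewrite (IH u' (fun v => g (rV_cons ((a * x + u ord0 ord0)%R, v))))//.
  apply: (measurableT_comp mgc (g := fun v => ((a * x + u ord0 ord0)%R, v))).
  exact: measurable_fun_pair.
have an0 : (0 <= `|a| ^- n)%R by rewrite invr_ge0 exprn_ge0.
have mF : measurable_fun [set: R * 'rV[R]_n] (fun p => (g (rV_cons (a * p.1 + u ord0 ord0, p.2))))%R.
  apply: (measurableT_comp mgc (g := fun p => ((a * p.1 + u ord0 ord0)%R, p.2))).
  by apply: measurable_fun_pair => //; meas.
rewrite ge0_integralZl_EFin//; last 2 first.
- by move=> x _; apply: int_ge0.
- by apply: (@measurable_fun_integral _ _ _ _ _ (leb R n) (fun x v => (g (rV_cons ((a * x + u ord0 ord0)%R, v)))%:E)); apply/measurable_EFinP.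
rewrite exprS invfM EFinM (muleC (`|a|^-1)%:E) -muleA; congr (_ * _).
have mG : measurable_fun [set: 'rV[R]_n * R] (fun p => (g (rV_cons (p.2, p.1))))%R.
  by apply: (measurableT_comp mgc (g := fun p => (p.2, p.1))); exact: measurable_fun_pair.
transitivity (\int[leb R n]_v \int[lebesgue_measure]_x (g (rV_cons ((a * x + u ord0 ord0)%R, v)))%:E).
  by apply: (@int_tonelli _ _ _ _ _ lebesgue_measure (leb R n) (fun x v => g (rV_cons ((a * x + u ord0 ord0)%R, v)))).
transitivity (\int[leb R n]_v ((`|a|^-1)%:E * \int[lebesgue_measure]_x (g (rV_cons (x, v)))%:E)).
  apply: eq_integral => v _.
  rewrite (int_affine1 (u ord0 ord0) (g := fun x => g (rV_cons (x, v))))//.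
  by apply: (measurableT_comp mgc (g := fun x => (x, v))); exact: measurable_fun_pair.
rewrite ge0_integralZl_EFin ?invr_ge0//; last 2 first.
- by move=> x _; apply: int_ge0.
- by apply: (@measurable_fun_integral _ _ _ _ _ lebesgue_measure (fun v x => (g (rV_cons (x, v)))%:E)); apply/measurable_EFinP.
rewrite int_leb_succ//; congr (_ * _).
by apply: (@int_tonelli _ _ _ _ _ (leb R n) lebesgue_measure (fun v x => g (rV_cons (x, v)))).
Qed.

Lemma int_translate n (u : 'rV[R]_n) (g : 'rV[R]_n -> R) :
  measurable_fun setT g -> (forall x, (0 <= g x)%R) ->
  \int[leb R n]_x (g (x + u)%R)%:E = \int[leb R n]_x (g x)%:E.
Proof.
move=> mg g0; have := int_affine u (@oner_neq0 R) mg g0.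
rewrite normr1 expr1n invr1 mul1e => <-.
by apply: eq_integral => x _; rewrite scale1r.
Qed.

End affine_change_of_variables_rV.

(** * Derivatives along a line and squared increments *)

Section line_derivative.
Context {R : realType}.

Lemma is_derive_line n (g : 'rV[R]_n -> R) (x e : 'rV[R]_n) (tau s : R) :
  (forall y, derivable g y e) ->
  is_derive s 1 (fun s => g (x + (s * tau) *: e)) (tau * 'D_e g (x + (s * tau) *: e)).
Proof.
move=> dg; pose y := x + (s * tau) *: e.
pose F0 := fun h : R => g (h *: e + y).
have dF0 : is_derive (0 : R) 1 F0 ('D_e g y).
  apply: DeriveDef; first exact: (derivable1P g y e).1 (dg y).
  have E : (fun h : R => h^-1 *: ((F0 \o shift 0) (h *: (1 : R)) - F0 0)) =
      (fun h : R => h^-1 *: ((g \o shift y) (h *: e) - g y)).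
    apply/funext => t /=.
    by rewrite /F0 addr0 scale0r add0r; congr (_ *: (g (_ *: _ + _) - _)); exact: mulr1.
  by rewrite /derive E.
pose inner := fun s' : R => (s' - s) * tau.
have dinner : is_derive s 1 inner tau.
  rewrite /inner; apply: is_derive_eq.
  by rewrite subrr scale0r add0r subr0; exact: mulr1.
have i0 : inner s = 0 by rewrite /inner subrr mul0r.
rewrite -i0 in dF0.
have := @is_derive1_comp R F0 inner s _ _ dF0 dinner.
rewrite mulrC; congr (is_derive _ _ _ _); apply/funext => t /=.
by rewrite /F0 /inner /y addrCA; congr (g (_ + _)); rewrite -scalerDl mulrBl subrK.
Qed.

(** A partial derivative is the pointwise limit of the difference quotients with steps
    [1 / (k + 1)]. *)
Lemma measurable_partial n (g : 'rV[R]_n -> R) (i : 'I_n) :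
  measurable_fun setT g -> (forall x, derivable g x (delta_mx ord0 i)) ->
  measurable_fun setT (partial i g).
Proof.
move=> mg dg; set e : 'rV[R]_n := delta_mx ord0 i.
pose u (k : nat) : R := k.+1%:R^-1.
apply: (@measurable_fun_cvg _ _ _ setT (fun k x => (u k)^-1 * (g (u k *: e + x) - g x))).
  by move=> k; meas.
move=> x _.
have : h^-1 * (g (h *: e + x) - g x) @[h --> (0:R)^'] --> partial i g x by exact: dg.
move=> /cvgr_dnbhsP /(_ u); apply; split.
  by move=> k; rewrite /u invr_neq0.
exact: cvg_harmonic.
Qed.

End line_derivative.

Section is_derive_sqr.
Context {R : realType}.
Local Open Scope ereal_scope.
Local Notation mu := (@lebesgue_measure R).

(** After a change of sign [y = F 1 - F 0] is positive, and [y / 2 + g^2 / (2 y)] is a majorant of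
    [|g|] to which the linear inequality applies. It gives [y <= y / 2 + J / (2 y)], that is
    [y^2 <= J], with [J] the integral of [g^2]. *)
Lemma is_derive_sqr_le_integral (F g : R -> R) :
  (forall x : R, is_derive x 1%R F (g x)) -> measurable_fun [set: R] g ->
  (((F 1%R - F 0%R) ^+ 2)%R)%:E <= \int[mu]_(x in `[0%R, 1%R]) ((g x) ^+ 2)%:E.
Proof.
move=> dF mg.
wlog : F g dF mg / (F 0%R <= F 1%R)%R.
  move=> H; have [|/ltW F10] := leP (F 0%R) (F 1%R); first exact: H.
  have := H (\- F)%R (\- g)%R.
  have dNF (x : R) : is_derive x 1%R (\- F)%R ((\- g)%R x) by apply: is_deriveN.
  move=> /(_ dNF) H1.
  have {}H1 := H1 (measurable_funN mg).
  have {}H1 : (((- F 1 - - F 0) ^+ 2)%R)%:E <= \int[mu]_(x in `[0%R, 1%R]) ((- g x) ^+ 2)%:E.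
    by apply: H1 => /=; rewrite lerN2.
  rewrite -opprD sqrrN in H1; apply: le_trans H1 _.
  by under eq_integral do rewrite sqrrN.
rewrite le_eqVlt => /orP[/eqP ->|F01].
  by rewrite subrr expr0n/=; apply: integral_ge0 => x _; rewrite lee_fin sqr_ge0.
set y := (F 1%R - F 0%R)%R.
have y0 : (0 < y)%R by rewrite subr_gt0.
pose q x := (y / 2 + (2 * y)^-1 * g x ^+ 2)%R.
have gq x : (`|g x| <= q x)%R.
  rewrite /q -(real_normK (num_real (g x))) -subr_ge0.
  rewrite (_ : _ - _ = (2 * y)^-1 * (y - `|g x|) ^+ 2)%R; last by field; rewrite gt_eqF.
  by rewrite mulr_ge0 ?sqr_ge0// invr_ge0 mulr_ge0// ltW.
have mq : measurable_fun setT q by rewrite /q; meas.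
have := is_derive_le_integral dF mq gq; rewrite -/y.
have mg2 (D : set R) : measurable D -> measurable_fun D (fun x => (g x ^+ 2)%:E).
  by move=> _; apply: measurable_funTS; meas.
have -> : \int[mu]_(x in `[0%R, 1%R]) (q x)%:E = (y / 2)%:E + ((2 * y)^-1)%:E * \int[mu]_(x in `[0%R, 1%R]) (g x ^+ 2)%:E.
  rewrite -ge0_integralZl_EFin//; last 3 first.
  - by move=> x _; rewrite lee_fin sqr_ge0.
  - exact: mg2.
  - by rewrite invr_ge0 mulr_ge0// ltW.
  rewrite -[X in X + _]mule1.
  have <- : mu `[0%R, 1%R] = 1 by rewrite lebesgue_measure_itv/= lte_fin ltr01 sube0.
  rewrite -(integral_cst mu (measurable_itv _)) -ge0_integralD//.
  - by move=> x _; rewrite lee_fin divr_ge0// ltW.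
  - by move=> x _; rewrite -EFinM lee_fin mulr_ge0 ?sqr_ge0// invr_ge0 mulr_ge0// ltW.
  - apply: measurable_funTS; rewrite (_ : (fun x => _) = fun x => ((2 * y)^-1 * g x ^+ 2)%:E)//.
    by meas.
case: (\int[mu]_(x in `[0%R, 1%R]) (g x ^+ 2)%:E) => [J| |].
- rewrite -EFinM -EFinD !lee_fin => H.
  have : (y * (2 * y) <= (y / 2 + (2 * y)^-1 * J) * (2 * y))%R by rewrite ler_pM2r// mulr_gt0.
  rewrite (_ : (_ + _) * _ = y ^+ 2 + J)%R; last by field; rewrite gt_eqF.
  by rewrite expr2; lra.
- by rewrite leey.
- by rewrite gt0_muleNy ?lte_fin ?invr_gt0 ?mulr_gt0.
Qed.

End is_derive_sqr.

(** * Taylor remainders along one axis *)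

Section taylor_remainder.
Context {R : realType} {d : nat}.
Local Notation V := ('rV[R]_d).
Implicit Types (g : V -> R) (i : 'I_d) (w : seq 'I_d).

Definition axis_remainder (m : nat) g i (x : V) (tau : R) : R :=
  g (x + tau *: delta_mx ord0 i) - \sum_(j < m) tau ^+ j / j`!%:R * iter_partial (nseq j i) g x.

Lemma iter_partial_cat w w' g : iter_partial (w ++ w') g = iter_partial w (iter_partial w' g).
Proof. exact: foldr_cat. Qed.

Lemma iter_partial_nseqS j i g : iter_partial (nseq j i) (partial i g) = iter_partial (nseq j.+1 i) g.
Proof. have -> : nseq j.+1 i = nseq j i ++ [:: i] by rewrite -[[:: i]]/(nseq 1 i) -nseqD addn1.
by rewrite iter_partial_cat. Qed.

Lemma axis_remainder0 m g i x : axis_remainder m.+1 g i x 0 = 0.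
Proof.
rewrite /axis_remainder scale0r addr0 big_ord_recl expr0 fact0 invr1 !mul1r big1 ?addr0 ?subrr//.
by move=> j _; rewrite expr0n/= !mul0r.
Qed.

(** Differentiation in the step lowers the order by one and passes to the partial derivative; both
    Taylor estimates below are inductions along this identity. Writing the step as [s * tau] keeps
    the domain of integration equal to [[0, 1]] for either sign of [tau]. *)
Lemma is_derive_axis_remainder m g i (x : V) (tau s : R) :
  (forall y, derivable g y (delta_mx ord0 i)) ->
  is_derive s 1 (fun s => axis_remainder m.+1 g i x (s * tau))
    (tau * axis_remainder m (partial i g) i x (s * tau)).
Proof.
move=> dg; rewrite /axis_remainder mulrBr.
pose F1 := fun s => g (x + (s * tau) *: delta_mx ord0 i).
pose F2 := fun s => \sum_(j < m.+1) (s * tau) ^+ j / j`!%:R * iter_partial (nseq j i) g x.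
suff dF2 : is_derive s 1 F2 (tau * (\sum_(j < m) (s * tau) ^+ j / j`!%:R * iter_partial (nseq j i) (partial i g) x)).
  rewrite (_ : (fun _ => _) = F1 - F2)//; apply: is_deriveB.
  exact: is_derive_line.
rewrite /F2 {F1 F2}.
elim: m => [|m IH].
  rewrite big_ord0 mulr0 (_ : (fun _ => _) = cst (g x)); first exact: is_derive_cst.
  by apply/funext => t; rewrite big_ord1 expr0 fact0 invr1 !mul1r.
rewrite (_ : (fun _ => _) = (fun s => \sum_(j < m.+1) (s * tau) ^+ j / j`!%:R * iter_partial (nseq j i) g x)
   + (fun s => (s * tau) ^+ m.+1 / (m.+1)`!%:R * iter_partial (nseq m.+1 i) g x)); last first.
  by apply/funext => t /=; rewrite big_ord_recr.
rewrite big_ord_recr/= mulrDr; apply: is_deriveD; rewrite iter_partial_nseqS.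
set c := iter_partial _ _ _.
have dl : is_derive s 1 (fun s => s * tau) tau.
  by apply: is_derive_eq; rewrite scaler0 add0r; exact: mulr1.
rewrite (_ : (fun _ => _) = (m.+1`!%:R^-1 * c) *: ((fun s => s * tau) ^+ m.+1)); last first.
  have fX (f : R -> R) k t : (f ^+ k) t = f t ^+ k.
    by elim: k => [|k IHk]; rewrite ?expr0// !exprS -IHk.
  apply/funext => t; rewrite -[RHS]/((m.+1`!%:R^-1 * c) * ((fun s => s * tau) ^+ m.+1) t) fX.
  by rewrite -[partial i _ x]/c [RHS]mulrC mulrA.
apply: is_derive_eq.
rewrite factS natrM /GRing.scale/= -mulr_natl.
field.
by rewrite nat1r !pnatr_eq0 -lt0n fact_gt0.
Qed.

Lemma measurable_iter_partial_nseq m g i : measurable_fun setT g ->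
  (forall j, (j < m)%N -> forall y, derivable (iter_partial (nseq j i) g) y (delta_mx ord0 i)) ->
  forall j, (j <= m)%N -> measurable_fun setT (iter_partial (nseq j i) g).
Proof.
move=> mg dg; elim=> [//|j IH] jm; apply: measurable_partial; first by apply: IH; exact: ltnW.
by move=> x; exact: dg.
Qed.

Lemma measurable_axis_remainder m g i :
  (forall j, (j < m)%N -> measurable_fun setT (iter_partial (nseq j i) g)) ->
  measurable_fun setT g ->
  measurable_fun setT (fun p : V * R => axis_remainder m g i p.1 p.2).
Proof.
move=> mi mg; rewrite /axis_remainder; apply: measurable_funB; first by meas.
apply: measurable_fun_sumr => j; have mj := mi j (ltn_ord j).
by meas.
Qed.

Lemma axis_remainder_sqr_le m g i (x : V) (tau : R) : measurable_fun setT g ->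
  (forall y, derivable g y (delta_mx ord0 i)) ->
  (forall j, (j < m)%N -> forall y, derivable (iter_partial (nseq j i) g) y (delta_mx ord0 i)) ->
  ((axis_remainder m.+1 g i x tau ^+ 2)%:E <=
   \int[lebesgue_measure]_(s in `[0%R, 1%R]) ((tau * axis_remainder m (partial i g) i x (s * tau)) ^+ 2)%:E)%E.
Proof.
move=> mg dg0 dg.
have mpg : measurable_fun setT (partial i g) by exact: measurable_partial.
have mr : measurable_fun setT (fun p : V * R => axis_remainder m (partial i g) i p.1 p.2).
  apply: measurable_axis_remainder => // j jm; rewrite iter_partial_nseqS.
  exact: (measurable_iter_partial_nseq (m := m)).
have H (s : R) : is_derive s 1 (fun s => axis_remainder m.+1 g i x (s * tau))
    (tau * axis_remainder m (partial i g) i x (s * tau)) by exact: is_derive_axis_remainder.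
have := is_derive_sqr_le_integral H.
rewrite mul1r mul0r axis_remainder0 subr0; apply.
apply: measurable_funM => //.
apply: (measurable_fun2_comp (F := fun x tau => axis_remainder m (partial i g) i x tau) mr); meas.
Qed.

Lemma axis_remainder_le_sup m g i (M : R) : measurable_fun setT g ->
  (forall j, (j < m)%N -> forall y, derivable (iter_partial (nseq j i) g) y (delta_mx ord0 i)) ->
  (forall x, `|iter_partial (nseq m i) g x| <= M) ->
  forall x tau, `|axis_remainder m g i x tau| <= M * `|tau| ^+ m.
Proof.
elim: m g => [|m IH] g mg dg gM x tau.
  by rewrite /axis_remainder big_ord0 subr0 expr0 mulr1; exact: gM.
have M0 : 0 <= M by exact: le_trans (gM 0).
have dg0 y : derivable g y (delta_mx ord0 i) by exact: (dg 0%N).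
have {}IH : forall x tau, `|axis_remainder m (partial i g) i x tau| <= M * `|tau| ^+ m.
  apply: IH.
  - exact: measurable_partial.
  - by move=> j jm y; rewrite iter_partial_nseqS; exact: dg.
  - by move=> y; rewrite iter_partial_nseqS.
rewrite -(@ler_pXn2r _ 2)// ?nnegrE ?mulr_ge0 ?exprn_ge0//.
rewrite (real_normK (num_real _)) -lee_fin.
apply: le_trans (axis_remainder_sqr_le _ _ mg dg0 _) _; first by move=> j jm; apply: dg; exact: ltnW.
have <- : (\int[lebesgue_measure]_(s in `[0%R, 1%R]) ((M * `|tau| ^+ m.+1) ^+ 2)%:E = ((M * `|tau| ^+ m.+1) ^+ 2)%:E)%E.
  transitivity (((M * `|tau| ^+ m.+1) ^+ 2)%:E * lebesgue_measure (`[0%R, 1%R] : set R))%E; first exact: integral_cst.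
  by rewrite lebesgue_measure_itv/= lte_fin ltr01 sube0 mule1.
apply: ge0_le_integral => //.
- by move=> s _; rewrite lee_fin sqr_ge0.
- apply: measurable_funTS; apply/measurable_EFinP; apply: measurable_funX; apply: measurable_funM => //.
  apply: (measurable_fun2_comp (F := fun x tau => axis_remainder m (partial i g) i x tau)).
  + apply: measurable_axis_remainder => [j jm|]; last exact: measurable_partial.
    rewrite iter_partial_nseqS; apply: (measurable_iter_partial_nseq (m := m.+1)) => //.
    by rewrite ltnS; exact: ltnW.
  + by meas.
  + by meas.
- move=> s /=; rewrite in_itv/= => /andP[s0 s1]; rewrite lee_fin -(real_normK (num_real (tau * _))).
  rewrite ler_pXn2r// ?nnegrE ?mulr_ge0 ?exprn_ge0// normrM exprS mulrCA ler_wpM2l//.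
  apply: le_trans (IH _ _) _; rewrite ler_wpM2l// lerXn2r// ?nnegrE// normrM ler_piMl//.
  by rewrite ger0_norm.
Qed.

(** The pointwise inequality is integrated in [x]; after Tonelli, each slice in [s] is bounded by
    the hypothesis at the step [s tau], where [|s tau| <= |tau|]. The factor [tau] of the chain rule
    supplies the additional power. *)
Lemma axis_remainder_le_L2 m g i (C beta : R) : 0 <= beta -> 0 <= C -> measurable_fun setT g ->
  (forall y, derivable g y (delta_mx ord0 i)) ->
  (forall j, (j < m)%N -> forall y, derivable (iter_partial (nseq j i) g) y (delta_mx ord0 i)) ->
  (forall tau, \int[leb R d]_x (axis_remainder m (partial i g) i x tau ^+ 2)%:E <= ((C * `|tau| `^ beta) ^+ 2)%:E)%E ->
  (forall tau, \int[leb R d]_x (axis_remainder m.+1 g i x tau ^+ 2)%:E <= ((C * `|tau| `^ (beta + 1)) ^+ 2)%:E)%E.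
Proof.
move=> b0 C0 mg dg0 dg H tau.
have mpg : measurable_fun setT (partial i g) by exact: measurable_partial.
have mr : measurable_fun setT (fun p : V * R => axis_remainder m (partial i g) i p.1 p.2).
  apply: measurable_axis_remainder => // j jm; rewrite iter_partial_nseqS.
  exact: (measurable_iter_partial_nseq (m := m)).
have mr1 : measurable_fun setT (fun p : V * R => axis_remainder m.+1 g i p.1 p.2).
  apply: measurable_axis_remainder => // j jm.
  exact: (measurable_iter_partial_nseq (m := m)).
(* The indicator turns the integral over [[0, 1]] into one over the whole line, the form required by
   Tonelli. *)
pose I01 : R -> R := \1_(`[0%R, 1%R]%classic : set R).
have mI01 : measurable_fun setT I01 by exact: measurable_indic.
have mF : measurable_fun setT (fun p : V * R => (tau * axis_remainder m (partial i g) i p.1 (p.2 * tau)) ^+ 2 * I01 p.2).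
  apply: measurable_funM.
    apply: measurable_funX; apply: measurable_funM => //.
    by apply: (measurable_fun2_comp (F := fun x tau => axis_remainder m (partial i g) i x tau) mr); meas.
  by meas.
apply: (@le_trans _ _ (\int[leb R d]_x \int[lebesgue_measure]_s
   ((tau * axis_remainder m (partial i g) i x (s * tau)) ^+ 2 * I01 s)%:E)%E).
  apply: ge0_le_integral => //.
  - by move=> x _; rewrite lee_fin sqr_ge0.
  - apply/measurable_EFinP; apply: measurable_funX.
    by apply: (measurable_fun2_comp (F := fun x tau => axis_remainder m.+1 g i x tau) mr1); meas.
  - by apply: (@measurable_fun_integral _ _ _ _ _ lebesgue_measure (fun x s => ((tau * axis_remainder m (partial i g) i x (s * tau)) ^+ 2 * I01 s)%:E)); apply/measurable_EFinP.
  - move=> x _; apply: le_trans (axis_remainder_sqr_le _ _ mg dg0 dg) _ => //.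
    rewrite integral_mkcond le_eqVlt; apply/orP; left; apply/eqP; apply: eq_integral => s _.
    by rewrite /I01 /patch indicE; case: ifP => _; rewrite ?mulr1 ?mulr0.
rewrite int_tonelli//; last by move=> x s; rewrite mulr_ge0 ?sqr_ge0// /I01 indicE.
have <- : (\int[lebesgue_measure]_(s in `[0%R, 1%R]) ((C * `|tau| `^ (beta + 1)) ^+ 2)%:E = ((C * `|tau| `^ (beta + 1)) ^+ 2)%:E)%E.
  transitivity (((C * `|tau| `^ (beta + 1)) ^+ 2)%:E * lebesgue_measure (`[0%R, 1%R] : set R))%E; first exact: integral_cst.
  by rewrite lebesgue_measure_itv/= lte_fin ltr01 sube0 mule1.
rewrite [leRHS]integral_mkcond.
apply: ge0_le_integral => //.
- by move=> s _; apply: int_ge0 => x; rewrite mulr_ge0 ?sqr_ge0// /I01 indicE.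
- apply: (@measurable_fun_integral _ _ _ _ _ (leb R d) (fun (s : R) x => ((tau * axis_remainder m (partial i g) i x (s * tau)) ^+ 2 * I01 s)%:E)).
  apply/measurable_EFinP.
  exact: (measurableT_comp mF (measurable_fun_pair measurable_snd measurable_fst)).
- by apply/(measurable_restrictT _ _).1 => //; exact: measurable_cst.
- move=> s _; rewrite /patch; case: ifPn => sI; last first.
    by rewrite integral0_eq// => x _; rewrite /I01 indicE (negbTE sI) mulr0.
  under eq_integral do rewrite /I01 indicE sI mulr1 exprMn.
  rewrite intZ ?sqr_ge0//; last 2 first.
  - apply: measurable_funX.
    by apply: (measurable_fun2_comp (F := fun x tau => axis_remainder m (partial i g) i x tau) mr); meas.
  - by move=> x; rewrite sqr_ge0.
  apply: le_trans (lee_wpmul2l _ (H _)) _; first by rewrite lee_fin sqr_ge0.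
  rewrite -EFinM lee_fin -(real_normK (num_real tau)) -exprMn ler_pXn2r// ?nnegrE ?mulr_ge0 ?powR_ge0//.
  rewrite mulrCA ler_wpM2l// [beta + 1]addrC powRD; last first.
    by rewrite gt_eqF//= ltr_pwDl.
  rewrite powRr1// ler_wpM2l//.
  move: sI; rewrite inE/= in_itv/= => /andP[s0 s1].
  apply: ge0_ler_powR; rewrite ?nnegrE// normrM ler_piMl// ger0_norm//.
Qed.

End taylor_remainder.

(** * Polynomials in the increment *)

Section taylor_polynomials.
Context {R : realType} {d : nat}.
Local Notation V := ('rV[R]_d).

Definition norm1 (t : V) : R := \sum_(i < d) `|t ord0 i|.

Lemma norm1_ge0 t : 0 <= norm1 t.
Proof. exact: sumr_ge0. Qed.

Lemma norm1_ge_coord (t : V) i : `|t ord0 i| <= norm1 t.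
Proof. by rewrite /norm1 (bigD1 i)//= lerDl sumr_ge0. Qed.

Lemma norm1Z a t : norm1 (a *: t) = `|a| * norm1 t.
Proof. by rewrite /norm1 mulr_sumr; apply: eq_bigr => i _; rewrite mxE normrM. Qed.

Lemma measurable_norm1 : measurable_fun setT norm1.
Proof. by rewrite /norm1; meas. Qed.

(* Functions [P x t] that are polynomials in [t] of degree at most [k], with coefficients in [A]. *)
Inductive poly_le (A : set (V -> R)) (k : nat) : (V -> V -> R) -> Prop :=
| poly_le0 : poly_le A k (fun _ _ => 0)
| poly_leM a l : A a -> (mi_order l <= k)%N -> poly_le A k (fun x t => a x * monomial l t)
| poly_leD P Q : poly_le A k P -> poly_le A k Q -> poly_le A k (fun x t => P x t + Q x t).

Lemma poly_le_sum A k n (P : 'I_n -> V -> V -> R) : (forall j, poly_le A k (P j)) ->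
  poly_le A k (fun x t => \sum_(j < n) P j x t).
Proof.
elim: n P => [|n IH] P HP.
  rewrite (_ : (fun _ _ => _) = fun _ _ => 0); first exact: poly_le0.
  by apply/funext => x; apply/funext => t; rewrite big_ord0.
rewrite (_ : (fun _ _ => _) = fun x t => \sum_(j < n) P (widen_ord (leqnSn n) j) x t + P ord_max x t).
  by apply: poly_leD => //; exact: IH.
by apply/funext => x; apply/funext => t; rewrite big_ord_recr.
Qed.

Lemma poly_le_ext A k (P Q : V -> V -> R) : poly_le A k P -> (forall x t, P x t = Q x t) -> poly_le A k Q.
Proof. by move=> HP E; rewrite (_ : Q = P)//; apply/funext => x; apply/funext => t; rewrite E. Qed.

Lemma monomial_add l l' (t : V) : monomial (fun i => l i + l' i)%N t = monomial l t * monomial l' t.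
Proof. by rewrite /monomial -big_split/=; apply: eq_bigr => i _; rewrite exprD. Qed.

Lemma mi_order_add (l l' : 'I_d -> nat) : mi_order (fun i => l i + l' i)%N = (mi_order l + mi_order l')%N.
Proof. exact: big_split. Qed.

Lemma monomial0 (t : V) : monomial (fun=> 0%N) t = 1.
Proof. by rewrite /monomial big1. Qed.

Lemma mi_order0 : mi_order (fun _ : 'I_d => 0%N) = 0%N.
Proof. by rewrite /mi_order big1. Qed.

Definition mi_axis (i : 'I_d) (j : nat) : 'I_d -> nat := fun i' => if i' == i then j else 0%N.

Lemma monomial_axis i j (t : V) : monomial (mi_axis i j) t = t ord0 i ^+ j.
Proof.
rewrite /monomial (bigD1 i)//= /mi_axis eqxx big1 ?mulr1// => i' ii'.
by rewrite (negbTE ii') expr0.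
Qed.

Lemma mi_order_axis i j : mi_order (mi_axis i j) = j.
Proof.
rewrite /mi_order (bigD1 i)//= /mi_axis eqxx big1 ?addn0// => i' ii'.
by rewrite (negbTE ii').
Qed.

Lemma monomial_le l (t : V) : `|monomial l t| <= norm1 t ^+ mi_order l.
Proof.
rewrite /monomial normr_prod /mi_order -prodrXr; apply: ler_prod => i _.
by rewrite normr_ge0/= normrX lerXn2r ?nnegrE ?norm1_ge0//; exact: norm1_ge_coord.
Qed.

Lemma monomialZ l (a : R) (t : V) : monomial l (a *: t) = a ^+ mi_order l * monomial l t.
Proof.
rewrite /monomial /mi_order -prodrXr -big_split/=; apply: eq_bigr => i _.
by rewrite mxE exprMn.
Qed.

Lemma measurable_monomial l : measurable_fun setT (monomial l : V -> R).
Proof. by rewrite /monomial; meas. Qed.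

Lemma poly_leZ (A A' : set (V -> R)) k k' (c : V -> R) l (P : V -> V -> R) : (forall a, A a -> A' (fun x => c x * a x)) ->
  (mi_order l + k <= k')%N -> poly_le A k P ->
  poly_le A' k' (fun x t => c x * monomial l t * P x t).
Proof.
move=> Ac kk'; elim=> [|a l' Aa lk|P1 Q1 _ P1' _ Q1'].
- by apply: poly_le_ext (poly_le0 _ _) _ => x t; rewrite mulr0.
- apply: (@poly_le_ext _ _ (fun x t => (c x * a x) * monomial (fun i => l i + l' i)%N t)).
    apply: poly_leM; first exact: Ac.
    by rewrite mi_order_add (leq_trans _ kk')// leq_add2l.
  by move=> x t; rewrite monomial_add; ring.
- by apply: poly_le_ext (poly_leD P1' Q1') _ => x t; rewrite mulrDr.
Qed.

End taylor_polynomials.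

(** * Assembling axis remainders, for an abstract notion [B] of size *)

Section taylor_axes.
Context {R : realType} {d : nat}.
Local Notation V := ('rV[R]_d).
Variables (A : set (V -> R)) (B : (V -> R) -> R -> Prop).
Hypothesis AZ : forall (c : R) a, A a -> A (fun x => c * a x).
Hypothesis B0 : B (fun=> 0) 0.
Hypothesis Ble : forall g c c', B g c -> c <= c' -> B g c'.
Hypothesis BD : forall g g' c c', 0 <= c -> 0 <= c' -> B g c -> B g' c' -> B (fun x => g x + g' x) (2 * (c + c')).
Hypothesis BZ : forall a g c, B g c -> B (fun x => a * g x) (`|a| * c).
Hypothesis BT : forall u g c, B g c -> B (fun x => g (x + u)) c.

(** The factor 2 of the sum rule [BD] is the one of the L2 instance, proved from
    [(x + y)^2 <= 2 x^2 + 2 y^2]; it compounds to [2^n]. *)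
Lemma size_bound_sum n (g : 'I_n -> V -> R) (c : 'I_n -> R) : (forall j, 0 <= c j) ->
  (forall j, B (g j) (c j)) -> B (fun x => \sum_(j < n) g j x) (2 ^+ n * \sum_(j < n) c j).
Proof.
elim: n g c => [|n IH] g c c0 Bg.
  rewrite big_ord0 mulr0 (_ : (fun _ => _) = fun=> 0)//.
  by apply/funext => x; rewrite big_ord0.
rewrite (_ : (fun _ => _) = fun x => \sum_(j < n) g (widen_ord (leqnSn n) j) x + g ord_max x); last first.
  by apply/funext => x; rewrite big_ord_recr.
have H := IH (fun j => g (widen_ord (leqnSn n) j)) (fun j => c (widen_ord (leqnSn n) j)) (fun j => c0 _) (fun j => Bg _).
apply: Ble (BD _ (c0 ord_max) H (Bg ord_max)) _.
  by rewrite mulr_ge0 ?exprn_ge0 ?sumr_ge0.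
rewrite exprS -mulrA ler_pM2l// big_ord_recr/= mulrDr lerD2l ler_peMl//.
by rewrite exprn_ege1// ler1n.
Qed.

(** The axes keep the order of the enumeration, the one in which [mi_partial] differentiates. The
    expansion moves along the axes in this order, so that mixed derivatives never have to be
    exchanged. *)
Definition axis_word (l : 'I_d -> nat) (s : seq 'I_d) := flatten [seq nseq (l j) j | j <- s].

Definition restr (s : seq 'I_d) (t : V) : V := \sum_(j <- s) t ord0 j *: delta_mx ord0 j.

Lemma restr_enum t : restr (enum 'I_d) t = t.
Proof.
rewrite /restr big_enum/= [RHS]row_sum_delta; apply: eq_bigr => j _; congr (_ *: _).
Qed.

(** Induction on the list of axes along which the point may move. Along the last axis [i] the
    one-dimensional expansion is centred at the translated point [x + restr p t], and translations
    preserve size. Its coefficients, derivatives along [i] at that point, are expanded in the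
    earlier axes by the induction hypothesis, to the order that is left. *)
Lemma taylor_axes (phi : V -> R) (k : nat) (alpha : R) (C : R) : 0 < alpha -> 0 <= C ->
  (forall l s, (size (axis_word l s) <= k)%N -> A (iter_partial (axis_word l s) phi)) ->
  (forall l s p i, enum 'I_d = rcons p i ++ s -> (size (axis_word l s) <= k)%N -> forall tau,
     B (fun x => axis_remainder (k - size (axis_word l s)).+1 (iter_partial (axis_word l s) phi) i x tau)
       (C * `|tau| `^ ((k - size (axis_word l s))%:R + alpha))) ->
  exists P, poly_le A k P /\ exists2 D, 0 <= D & forall t,
    B (fun x => phi (x + t) - P x t) (D * norm1 t `^ (k%:R + alpha)).
Proof.
move=> al0 C0 HA HR.
suff H : forall p s, enum 'I_d = p ++ s -> forall l, (size (axis_word l s) <= k)%N ->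
    exists P, poly_le A (k - size (axis_word l s)) P /\ exists2 D, 0 <= D & forall t,
    B (fun x => iter_partial (axis_word l s) phi (x + restr p t) - P x t)
      (D * norm1 t `^ ((k - size (axis_word l s))%:R + alpha)).
  have [|P [PP [D D0 HD]]] := H (enum 'I_d) [::] _ (fun=> 0%N) (leq0n k); first by rewrite cats0.
  rewrite /= subn0 in PP HD; exists P; split => //; exists D => // t.
  by have := HD t; rewrite restr_enum.
elim/last_ind => [|p i IH] s eps l lk; set m := (k - _)%N; set g := iter_partial _ _.
  exists (fun x t => g x * monomial (fun=> 0%N) t); split.
    by apply: poly_leM; rewrite ?mi_order0//; exact: HA.
  exists 0 => // t; rewrite mul0r.
  suff -> : (fun x => g (x + restr [::] t) - g x * monomial (fun=> 0%N) t) = fun=> 0 by [].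
  by apply/funext => x; rewrite /restr big_nil addr0 monomial0 mulr1 subrr.
have is_ : i \notin s.
  have : uniq (rcons p i ++ s) by rewrite -eps enum_uniq.
  rewrite cat_uniq => /and3P[_ /hasPn H _]; apply/negP => /H.
  by rewrite /= mem_rcons inE eqxx.
(* As [i] is not in [s], prescribing its multiplicity leaves the word of [s] unchanged and puts [j]
   derivatives along [i] in front of it. *)
pose li j i' := if i' == i then j else l i'.
have wE j : axis_word (li j) (i :: s) = nseq j i ++ axis_word l s.
  rewrite /axis_word/= {1}/li eqxx; congr (_ ++ flatten _); apply/eq_in_map => i' i's.
  by rewrite /li; case: eqP => // ii'; rewrite ii' (negbTE is_) in i's.
have szE j : size (axis_word (li j) (i :: s)) = (j + size (axis_word l s))%N.
  by rewrite wE size_cat size_nseq.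
have jm (j : 'I_m.+1) : (size (axis_word (li j) (i :: s)) <= k)%N.
  by rewrite szE -[X in (_ <= X)%N](subnK lk) leq_add2r -ltnS.
have IHj (j : 'I_m.+1) := IH (i :: s) ltac:(by rewrite eps cat_rcons) (li j) (jm j).
have /choice[P HP] (j : 'I_m.+1) : exists P, poly_le A (m - j) P /\ exists2 D, 0 <= D & forall t,
    B (fun x => iter_partial (nseq j i) g (x + restr p t) - P x t) (D * norm1 t `^ ((m - j)%:R + alpha)).
  have [P [PP [D D0 HD]]] := IHj j; rewrite szE subnDA (subnAC k) -/m in PP HD.
  exists P; split => //; exists D => // t.
  by have := HD t; rewrite wE iter_partial_cat.
have /choice[D HD] (j : 'I_m.+1) : exists D, 0 <= D /\ forall t,
    B (fun x => iter_partial (nseq j i) g (x + restr p t) - P j x t) (D * norm1 t `^ ((m - j)%:R + alpha)).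
  by have [_ [D D0 HD]] := HP j; exists D.
exists (fun x t => \sum_(j < m.+1) (j`!%:R^-1) * monomial (mi_axis i j) t * P j x t); split.
  apply: poly_le_sum => j.
  apply: (@poly_leZ _ _ A A (m - j) m (fun=> j`!%:R^-1)); last by have [] := HP j.
    by move=> a; exact: AZ.
  by rewrite mi_order_axis subnKC// -ltnS.
exists (2 * (C + 2 ^+ m.+1 * \sum_(j < m.+1) D j)).
  by rewrite mulr_ge0// addr_ge0// mulr_ge0 ?exprn_ge0// sumr_ge0// => j _; have [] := HD j.
move=> t.
have pow0 a : 0 <= norm1 t `^ a by exact: powR_ge0.
(* The error is the axis remainder at the translated point plus the errors of the expanded
   coefficients, each multiplied by its power of [t_i]. *)
rewrite (_ : (fun _ => _) = fun x => axis_remainder m.+1 g i (x + restr p t) (t ord0 i) +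
   \sum_(j < m.+1) (t ord0 i ^+ j / j`!%:R) * (iter_partial (nseq j i) g (x + restr p t) - P j x t)); last first.
  apply/funext => x; rewrite /axis_remainder /restr -cats1 big_cat/= big_seq1 addrA -!addrA; congr (_ + _).
  rewrite -[RHS]opprK opprD opprK; congr (- _).
  apply/eqP; rewrite eq_sym subr_eq -big_split/=; apply/eqP; apply: eq_bigr => j _.
  by rewrite monomial_axis; ring.
have -> : 2 * (C + 2 ^+ m.+1 * \sum_(j < m.+1) D j) * norm1 t `^ (m%:R + alpha) =
   2 * (C * norm1 t `^ (m%:R + alpha) + 2 ^+ m.+1 * \sum_(j < m.+1) (D j * norm1 t `^ (m%:R + alpha))).
  by rewrite -mulr_suml; ring.
apply: BD.
- by rewrite mulr_ge0.
- by rewrite mulr_ge0 ?exprn_ge0// sumr_ge0// => j _; rewrite mulr_ge0//; have [] := HD j.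
- apply: Ble (BT _ (HR l s p i eps lk (t ord0 i))) _.
  rewrite ler_wpM2l// ge0_ler_powR ?nnegrE ?norm1_ge0 ?norm1_ge_coord//.
  by rewrite addr_ge0// ltW.
- apply: size_bound_sum => j; first by rewrite mulr_ge0//; have [] := HD j.
  have [D0 Hj] := HD j.
  apply: Ble (BZ (t ord0 i ^+ j / j`!%:R) (Hj t)) _.
  have jm' : (j <= m)%N by rewrite -ltnS.
  have -> : norm1 t `^ (m%:R + alpha) = norm1 t ^+ j * norm1 t `^ ((m - j)%:R + alpha).
    rewrite -powR_mulrn ?norm1_ge0// -powRD; last first.
      by rewrite gt_eqF// ltr_wpDl// ltr_wpDl.
    by rewrite addrA -natrD subnKC.
  rewrite mulrCA ler_wpM2l// ler_wpM2r//.
  rewrite normrM normrX [X in _ * X]ger0_norm ?invr_ge0//.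
  apply: le_trans (_ : `|t ord0 i| ^+ j <= _); last first.
    by rewrite lerXn2r ?nnegrE ?norm1_ge0 ?norm1_ge_coord.
  by rewrite ler_piMr ?exprn_ge0// invf_le1 ?ltr0n ?fact_gt0// ler1n fact_gt0.
Qed.

End taylor_axes.

(** * Uniform Taylor expansion of the density *)

Section taylor_sup.
Context {R : realType} {d : nat}.
Local Notation V := ('rV[R]_d).

(** Bounds on bounded sets are what is derived for the derivatives of intermediate order; they
    suffice because the coefficients are later cut off outside a ball around the support of
    [phi]. *)
Definition locally_bounded (a : V -> R) :=
  measurable_fun setT a /\ forall rho : R, exists c, forall x, norm1 x <= rho -> `|a x| <= c.

Lemma norm1D (x y : V) : norm1 (x + y) <= norm1 x + norm1 y.
Proof. by rewrite /norm1 -big_split/=; apply: ler_sum => i _; rewrite mxE ler_normD. Qed.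

Lemma restr_coord p (x : V) i : uniq p -> (restr p x) ord0 i = if i \in p then x ord0 i else 0.
Proof.
move=> up; rewrite /restr summxE; case: ifPn => ip.
  rewrite (bigD1_seq i)//= !mxE !eqxx mulr1 big1 ?addr0// => j ji.
  by rewrite !mxE eq_sym (negbTE ji) andbF mulr0.
rewrite big1_seq// => j /andP[_ jp]; rewrite !mxE.
by case: (eqVneq i j) => [ij|_]; [rewrite ij jp in ip|rewrite andbF mulr0].
Qed.

Lemma norm1_restr p i (x : V) (s : R) : uniq (rcons p i) -> 0 <= s <= 1 ->
  norm1 (restr p x + (s * x ord0 i) *: delta_mx ord0 i) <= norm1 x.
Proof.
rewrite rcons_uniq => /andP[ip up] /andP[s0 s1]; apply: ler_sum => j _.
rewrite !mxE restr_coord//=; case: (eqVneq j i) => [->|ji]/=.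
  rewrite (negbTE ip) add0r mulr1 normrM ger0_norm// ler_piMl//.
by rewrite mulr0 addr0; case: ifP; rewrite ?normr0.
Qed.

(** Mean value inequality along the path from 0 to [x] that switches on one coordinate at a time;
    [norm1_restr] keeps the path inside the ball. *)
Lemma local_bound_of_partials (g : V -> R) (rho c : R) : measurable_fun setT g ->
  (forall i x, derivable g x (delta_mx ord0 i)) ->
  (forall i x, norm1 x <= rho -> `|partial i g x| <= c) -> 0 <= c ->
  forall x, norm1 x <= rho -> `|g x| <= `|g 0| + c * norm1 x.
Proof.
move=> mg dg gc c0 x xr.
suff H p : uniq p -> `|g (restr p x)| <= `|g 0| + c * \sum_(i <- p) `|x ord0 i|.
  by have := H (enum 'I_d) (enum_uniq _); rewrite restr_enum big_enum.
elim/last_ind: p => [_|p i IH upi]; first by rewrite /restr !big_nil mulr0 addr0.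
have up : uniq p by move: upi; rewrite rcons_uniq => /andP[].
set y := restr p x; set t := x ord0 i.
have E : restr (rcons p i) x = y + t *: delta_mx ord0 i by rewrite /restr -cats1 big_cat big_seq1.
have H : `|g (y + t *: delta_mx ord0 i) - g y| <= c * `|t|.
  have -> : g (y + t *: delta_mx ord0 i) - g y = axis_remainder 1 g i y t.
    by rewrite /axis_remainder big_ord1 expr0 fact0 invr1 !mul1r.
  rewrite -(@ler_pXn2r _ 2)// ?nnegrE ?mulr_ge0// (real_normK (num_real _)) -lee_fin.
  apply: le_trans (axis_remainder_sqr_le _ _ mg (dg i) _) _ => //.
  have <- : (\int[lebesgue_measure]_(s in `[0%R, 1%R]) ((c * `|t|) ^+ 2)%:E = ((c * `|t|) ^+ 2)%:E)%E.
    transitivity (((c * `|t|) ^+ 2)%:E * lebesgue_measure (`[0%R, 1%R] : set R))%E; first exact: integral_cst.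
    by rewrite lebesgue_measure_itv/= lte_fin ltr01 sube0 mule1.
  have mpg : measurable_fun setT (partial i g) by exact: measurable_partial.
  apply: ge0_le_integral => //.
  - by move=> s _; rewrite lee_fin sqr_ge0.
  - apply: measurable_funTS; apply/measurable_EFinP; apply: measurable_funX; apply: measurable_funM => //.
    rewrite /axis_remainder; apply: measurable_funB; first by meas.
    by apply: measurable_fun_sumr => -[].
  - move=> s /=; rewrite in_itv/= => s01; rewrite lee_fin -(real_normK (num_real (t * _))).
    rewrite ler_pXn2r// ?nnegrE ?mulr_ge0// normrM mulrC ler_wpM2r//.
    rewrite /axis_remainder big_ord0 subr0; apply: gc; apply: le_trans xr.
    exact: norm1_restr.
rewrite E -cats1 big_cat/= big_seq1 mulrDr addrA.
rewrite -[X in `|X|](subrK (g y)) (le_trans (ler_normD _ _))// addrC lerD//.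
exact: IH.
Qed.

Lemma taylor_sup (f : V -> R) (r : nat) (M : R) : measurable_fun setT f -> partials_exist r.+1 f ->
  (forall w, size w = r.+1 -> forall x, `|iter_partial w f x| <= M) ->
  exists P, poly_le locally_bounded r P /\ exists2 D, 0 <= D & forall x t,
     `|f (x + t) - P x t| <= D * norm1 t ^+ r.+1.
Proof.
move=> mf pf; wlog M0 : M / 0 <= M => [H|] fM.
  by apply: (H `|M|) => // w wr x; exact: le_trans (fM w wr x) (ler_norm M).
have mfw w : (size w <= r.+1)%N -> measurable_fun setT (iter_partial w f).
  elim: w => [//|i w IH] /= wr; apply: measurable_partial; first by apply: IH; exact: ltnW.
  by move=> x; exact: pf.
have lbw w : (size w <= r.+1)%N -> locally_bounded (iter_partial w f).
  move=> wr; split; first exact: mfw.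
  (* Descending induction on the order of the derivative, starting from the bound [M] at the top
     order; each step down integrates along the axes. *)
  move=> rho; move En : (r.+1 - size w)%N => n; elim: n w wr En => [|n IH] w wr En.
    exists M => x _; apply: fM; apply/eqP; rewrite eqn_leq wr/=.
    by rewrite -subn_eq0 En.
  have wr' : (size w < r.+1)%N by rewrite -subn_gt0 En.
  have /choice[c Hc] i : exists c, forall x, norm1 x <= rho -> `|partial i (iter_partial w f) x| <= c.
    by apply: (IH (i :: w)) => //=; rewrite subnS En.
  pose c' := \sum_i `|c i|.
  have c'0 : 0 <= c' by exact: sumr_ge0.
  exists (`|iter_partial w f 0| + c' * rho) => x xr.
  apply: le_trans (local_bound_of_partials (rho := rho) (c := c') (mfw _ (ltnW wr')) _ _ c'0 xr) _.
  - by move=> i y; exact: pf.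
  - move=> i y yr; apply: le_trans (Hc i y yr) _; rewrite /c' (bigD1 i)//=.
    by rewrite (le_trans (ler_norm _))// lerDl sumr_ge0.
  - by rewrite lerD2l ler_wpM2l.
pose B (g : V -> R) c := forall x, `|g x| <= c.
(* The choice [alpha = 1] makes the error exponent [r + 1] for a polynomial of degree [r]. *)
have [P [PP [D D0 HD]]] : exists P, poly_le locally_bounded r P /\ exists2 D, 0 <= D & forall t,
    B (fun x => f (x + t) - P x t) (D * norm1 t `^ (r%:R + 1)).
  apply: (@taylor_axes R d locally_bounded B _ _ _ _ _ _ f r 1 M) => //.
  - move=> c a [ma ba]; split; first by meas.
    by move=> rho; have [c' Hc'] := ba rho; exists (`|c| * c') => x xr; rewrite normrM ler_wpM2l// Hc'.
  - by move=> x; rewrite normr0.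
  - by move=> g c c' Bg cc' x; apply: le_trans cc'; exact: Bg.
  - move=> g g' c c' c0 c0' Bg Bg' x; apply: le_trans (ler_normD _ _) _.
    by apply: le_trans (lerD (Bg x) (Bg' x)) _; rewrite mulr2n mulrDl mul1r lerDl addr_ge0.
  - by move=> a g c Bg x; rewrite normrM ler_wpM2l.
  - by move=> u g c Bg x; exact: Bg.
  - by move=> l s lr; apply: lbw; exact: leqW.
  - move=> l s p i _ ls tau x.
    rewrite natr1 powR_mulrn//.
    have E j : iter_partial (nseq j i) (iter_partial (axis_word l s) f) = iter_partial (nseq j i ++ axis_word l s) f.
      by rewrite iter_partial_cat.
    apply: axis_remainder_le_sup; first by apply: mfw; exact: leqW.
      move=> j jm y; rewrite E; apply: pf.
      rewrite size_cat size_nseq (leq_ltn_trans _ (ltnSn r))//.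
      by move: jm; rewrite ltnS => jm; rewrite -(subnK ls) leq_add2r.
    move=> y; rewrite E; apply: fM.
    by rewrite size_cat size_nseq addSn subnK.
exists P; split => //; exists D => // x t; have := HD t x.
by rewrite natr1 powR_mulrn ?norm1_ge0.
Qed.

End taylor_sup.

(** * Calculus of L2 bounds *)

Section L2_bounds.
Context {R : realType} d (T : measurableType d) (mu : {measure set T -> \bar R}).
Implicit Types g : T -> R.

Definition L2le g (c : R) := [/\ measurable_fun setT g, 0 <= c &
  (\int[mu]_x (g x ^+ 2)%:E <= (c ^+ 2)%:E)%E].

Lemma L2leW g c c' : L2le g c -> c <= c' -> L2le g c'.
Proof.
move=> [mg c0 gc] cc'; split => //; first exact: le_trans cc'.
by apply: le_trans gc _; rewrite lee_fin lerXn2r ?nnegrE//; exact: le_trans cc'.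
Qed.

Lemma L2leD g g' c c' : L2le g c -> L2le g' c' -> L2le (fun x => g x + g' x) (2 * (c + c')).
Proof.
move=> [mg c0 gc] [mg' c'0 gc']; split; [by meas|by rewrite mulr_ge0// addr_ge0|].
apply: (@le_trans _ _ (\int[mu]_x (2 * g x ^+ 2 + 2 * g' x ^+ 2)%:E)%E).
  apply: le_int; [by meas|by meas|by move=> x; exact: sqr_ge0|].
  move=> x; rewrite -subr_ge0 (_ : _ - _ = (g x - g' x) ^+ 2) ?sqr_ge0//; ring.
rewrite intD; [|by meas|by meas| |]; last 2 first.
- by move=> x; rewrite mulr_ge0 ?sqr_ge0.
- by move=> x; rewrite mulr_ge0 ?sqr_ge0.
rewrite !intZ//; [|by meas|by move=> x; exact: sqr_ge0|by meas|by move=> x; exact: sqr_ge0].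
apply: (@le_trans _ _ (2%:E * (c ^+ 2)%:E + 2%:E * (c' ^+ 2)%:E)%E).
  by apply: leeD; rewrite lee_wpmul2l// lee_fin.
by rewrite -!EFinM -EFinD lee_fin; have := mulr_ge0 c0 c'0; nra.
Qed.

Lemma L2leZ a g c : L2le g c -> L2le (fun x => a * g x) (`|a| * c).
Proof.
move=> [mg c0 gc]; split; [by meas|by rewrite mulr_ge0|].
under eq_integral do rewrite exprMn.
rewrite intZ ?sqr_ge0//; [|by meas|by move=> x; exact: sqr_ge0].
by rewrite exprMn (real_normK (num_real a)) [leRHS]EFinM lee_wpmul2l// lee_fin sqr_ge0.
Qed.

Lemma L2le_dom g g' c : measurable_fun setT g -> (forall x, `|g x| <= `|g' x|) -> L2le g' c -> L2le g c.
Proof.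
move=> mg gg' [mg' c0 gc]; split => //; apply: le_trans gc.
apply: le_int; [by meas|by meas|by move=> x; exact: sqr_ge0|].
by move=> x; rewrite -(real_normK (num_real (g x))) -(real_normK (num_real (g' x))) lerXn2r ?nnegrE.
Qed.

Lemma L2le0 : L2le (fun=> 0) 0.
Proof.
split => //; rewrite integral0_eq ?expr0n// => x _.
Qed.

Lemma L2leMb (c : R) (b g : T -> R) k : measurable_fun setT b -> (forall x, `|b x| <= k) -> 0 <= k -> L2le g c ->
  L2le (fun x => b x * g x) (k * c).
Proof.
move=> mb bk k0 Lg; have [mg _ _] := Lg.
rewrite -[k in k * c](ger0_norm k0); apply: L2le_dom (L2leZ k Lg); first by meas.
by move=> x; rewrite !normrM ler_wpM2r// (ger0_norm k0).
Qed.

End L2_bounds.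

(** * Taylor expansion in L2 for the Nikol'ski class *)

Section taylor_L2.
Context {R : realType} {d : nat}.
Local Notation V := ('rV[R]_d).

Lemma L2le_translate (g : V -> R) (u : V) c : L2le (leb R d) g c -> L2le (leb R d) (fun x => g (x + u)) c.
Proof.
move=> [mg c0 gc]; split => //; first by meas.
rewrite (int_translate u (g := fun x => g x ^+ 2))//; first by meas.
by move=> x; exact: sqr_ge0.
Qed.

Lemma enorm_axis (tau : R) (i : 'I_d) : enorm (tau *: delta_mx ord0 i) = `|tau|.
Proof.
rewrite /enorm (bigD1 i)//= !mxE !eqxx mulr1 big1 ?addr0 ?sqrtr_sqr// => j ji.
by rewrite !mxE (negbTE ji) andbF mulr0 expr0n.
Qed.

(** Setting the multiplicities outside the suffix [s] to 0 turns its word into that of a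
    multi-index, to which the Nikol'ski condition applies. *)
Lemma axis_word_mi (phi : V -> R) l p s : enum 'I_d = p ++ s ->
  exists l', mi_order l' = size (axis_word l s) /\ mi_partial l' phi = iter_partial (axis_word l s) phi.
Proof.
move=> eps; exists (fun i => if i \in s then l i else 0%N).
have us : uniq (p ++ s) by rewrite -eps enum_uniq.
have E : flatten [seq nseq (if i \in s then l i else 0%N) i | i <- enum 'I_d] = axis_word l s.
  rewrite eps map_cat flatten_cat (_ : flatten _ = [::]).
    by rewrite /axis_word/=; congr flatten; apply/eq_in_map => i ->.
  move: us; rewrite cat_uniq => /and3P[_ /hasPn H _].
  elim: p {eps} H => //= i p IH H; rewrite IH; last first.
    by move=> j js; have := H j js; rewrite inE negb_or => /andP[].
  by case: ifPn => // js; have := H i js; rewrite inE eqxx.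
split; last by rewrite /mi_partial E.
rewrite -E size_flatten /shape -map_comp sumnE big_map /mi_order big_enum/=.
by apply: eq_bigr => i _; rewrite size_nseq.
Qed.

(** The increments of the top derivative have exponent [alpha], and each integration along the axis
    raises the exponent by 1. *)
Lemma axis_remainder_L2 m (g : V -> R) i (C alpha : R) : 0 < alpha -> 0 <= C -> measurable_fun setT g ->
  (forall j, (j < m)%N -> forall y, derivable (iter_partial (nseq j i) g) y (delta_mx ord0 i)) ->
  (forall tau, \int[leb R d]_x ((iter_partial (nseq m i) g (x + tau *: delta_mx ord0 i) -
       iter_partial (nseq m i) g x) ^+ 2)%:E <= ((C * `|tau| `^ alpha) ^+ 2)%:E)%E ->
  (forall tau, \int[leb R d]_x (axis_remainder m.+1 g i x tau ^+ 2)%:E <= ((C * `|tau| `^ (m%:R + alpha)) ^+ 2)%:E)%E.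
Proof.
move=> al0 C0; elim: m g => [|m IH] g mg dg H tau.
  rewrite add0r; apply: le_trans (H tau); rewrite le_eqVlt; apply/orP; left; apply/eqP.
  by apply: eq_integral => x _; rewrite /axis_remainder big_ord1 expr0 fact0 invr1 !mul1r.
have dg0 y : derivable g y (delta_mx ord0 i) by exact: (dg 0%N).
rewrite -natr1 addrAC; apply: axis_remainder_le_L2 => //.
  by rewrite addr_ge0// ltW.
apply: IH; first exact: measurable_partial.
  by move=> j jm y; rewrite iter_partial_nseqS; exact: dg.
by move=> t; rewrite iter_partial_nseqS; exact: H.
Qed.

(** Every order [k0 <= k] is provided, with the same [alpha]: when [phi] is multiplied by a monomial
    of degree [j] in [t], the expansion of order [k - j] is the one to use. *)
Lemma taylor_L2 (s : R) (phi : V -> R) : nikolskii s phi ->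
  exists (k : nat) (alpha : R), [/\ s = k%:R + alpha, 0 < alpha <= 1 & forall k0, (k0 <= k)%N ->
    exists P, poly_le (fun a => measurable_fun setT a) k0 P /\ exists2 D, 0 <= D & forall t,
      L2le (leb R d) (fun x => phi (x + t) - P x t) (D * norm1 t `^ (k0%:R + alpha))].
Proof.
move=> [k [alpha [-> /andP[al0 al1] mphi kphi [C HC]]]]; exists k, alpha; split => //; first by rewrite al0 al1.
move=> k0 k0k.
have dphi w : (size w < k)%N -> forall i y, derivable (iter_partial w phi) y (delta_mx ord0 i).
  by move=> wk i y; apply: diff_derivable; exact: kphi.
have mw w : (size w <= k)%N -> measurable_fun setT (iter_partial w phi).
  elim: w => [//|i w IH] /= wk; apply: measurable_partial; first by apply: IH; exact: ltnW.
  by move=> x; exact: dphi.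
pose C' := Num.sqrt `|C|.
have C'0 : 0 <= C' by exact: sqrtr_ge0.
have HC' l s' p i : enum 'I_d = p ++ s' -> (size (axis_word l s') <= k)%N -> forall tau,
    (\int[leb R d]_x ((iter_partial (axis_word l s') phi (x + tau *: delta_mx ord0 i) -
       iter_partial (axis_word l s') phi x) ^+ 2)%:E <= ((C' * `|tau| `^ alpha) ^+ 2)%:E)%E.
  move=> eps lk tau; have [l' [l'E <-]] := axis_word_mi phi l eps.
  apply: le_trans (HC l' (tau *: delta_mx ord0 i) _) _; first by rewrite l'E.
  rewrite lee_fin enorm_axis exprMn sqr_sqrtr//.
  have -> : (`|tau| `^ alpha) ^+ 2 = `|tau| `^ (2 * alpha) by rewrite mulrC powRrM powR_mulrn ?powR_ge0.
  by rewrite ler_wpM2r ?powR_ge0// ler_norm.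
apply: (@taylor_axes R d _ (L2le (leb R d)) _ _ _ _ _ _ phi k0 alpha C') => //.
- by move=> c a ma; meas.
- exact: L2le0.
- by move=> g c c'; exact: L2leW.
- by move=> g g' c c' _ _; exact: L2leD.
- by move=> a g c; exact: L2leZ.
- by move=> u g c; exact: L2le_translate.
- by move=> l s' lk; apply: mw; exact: leq_trans k0k.
- move=> l s' p i eps lk tau; set w := axis_word l s'; set m := (k0 - size w)%N.
  have wk : (size w <= k)%N by exact: leq_trans k0k.
  have E j : iter_partial (nseq j i) (iter_partial w phi) = iter_partial (nseq j i ++ w) phi.
    by rewrite iter_partial_cat.
  have szE j : size (nseq j i ++ w) = (j + size w)%N by rewrite size_cat size_nseq.
  split; last 2 first.
  + by rewrite mulr_ge0 ?powR_ge0.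
  + apply: axis_remainder_L2 => //; first exact: mw.
      move=> j jm y; rewrite E; apply: dphi; rewrite szE (leq_trans _ k0k)//.
      by rewrite -(subnK lk) ltn_add2r.
    move=> t; rewrite E.
    pose l' i' := if i' == i then m else l i'.
    have is_ : i \notin s'.
      have : uniq (rcons p i ++ s') by rewrite -eps enum_uniq.
      rewrite cat_uniq => /and3P[_ /hasPn H _]; apply/negP => /H.
      by rewrite /= mem_rcons inE eqxx.
    have wE : axis_word l' (i :: s') = nseq m i ++ w.
      rewrite /w /axis_word/= {1}/l' eqxx; congr (_ ++ flatten _); apply/eq_in_map => i' i's.
      by rewrite /l'; case: eqP => // ii'; rewrite ii' (negbTE is_) in i's.
    rewrite -wE; apply: (HC' _ _ p); first by rewrite eps cat_rcons.
    by rewrite wE szE /m subnK.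
  + apply: (@measurableT_comp _ _ _ _ _ _ (fun p : V * R => axis_remainder m.+1 (iter_partial w phi) i p.1 p.2) _ (fun x => (x, tau))).
      apply: measurable_axis_remainder => [j jm|]; last exact: mw.
      rewrite E; apply: mw; rewrite szE (leq_trans _ k0k)// -(subnK lk) leq_add2r.
      by rewrite -ltnS.
    exact: measurable_fun_pair.
Qed.

End taylor_L2.

(** * Consequences of compact support *)

Section compact_support.
Context {R : realType} {d : nat}.
Local Notation V := ('rV[R]_d).

Lemma compact_support_bounded (phi : V -> R) : compact (fun_support phi) ->
  exists2 rho, 0 <= rho & forall x, phi x != 0 -> norm1 x <= rho.
Proof.
move=> cphi.
have sub x : phi x != 0 -> fun_support phi x by move=> px; apply: subset_closure.
have /choice[c Hc] (i : 'I_d) : exists c, 0 <= c /\ forall x, phi x != 0 -> `|x ord0 i| <= c.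
  have [[x0 Sx0]|] := pselect (fun_support phi !=set0); last first.
    by move=> S0; exists 0; split => // x /sub px; exfalso; apply: S0; exists x.
  have [||c Sc Hc] := @EVT_max_rV R d (fun x => `|x ord0 i|) (fun_support phi) _ cphi.
  - by exists x0.
  - apply: continuous_subspaceT => x.
    by apply: (@continuous_comp _ _ _ (fun M : V => M ord0 i) (fun y => `|y|)); [exact: coord_continuous|exact: norm_continuous].
  - exists `|c ord0 i|; split => // x /sub px; apply: Hc.
    by rewrite inE.
exists (\sum_i c i); first by apply: sumr_ge0 => i _; have [] := Hc i.
by move=> x px; apply: ler_sum => i _; have [_] := Hc i; exact.
Qed.

(** A translation by [u], longer than the diameter of the support along one axis, separates
    [phi (x + u)] from [phi x]. The cross term then vanishes and the Nikol'ski inequality for the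
    function itself bounds the integral of [phi^2]. *)
Lemma nikolskii_L2 (s : R) (phi : V -> R) : (1 <= d)%N -> nikolskii s phi -> compact (fun_support phi) ->
  exists c, L2le (leb R d) phi c.
Proof.
move=> d1 [k [alpha [_ _ mphi _ [C HC]]]] /compact_support_bounded[rho rho0 Hrho].
pose i0 : 'I_d := Ordinal d1.
pose u : V := (2 * rho + 1) *: delta_mx ord0 i0.
pose c := C * enorm u `^ (2 * alpha).
exists (Num.sqrt `|c|); split; [by []|exact: sqrtr_ge0|].
rewrite sqr_sqrtr//.
have E0 : mi_partial (fun=> 0%N) phi = phi.
  rewrite /mi_partial (_ : flatten _ = [::])//.
  by elim: (enum _).
have := HC (fun=> 0%N) u; rewrite mi_order0 E0 leq0n => /(_ isT) H.
apply: le_trans (le_trans H _); last by rewrite lee_fin ler_norm.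
apply: le_int; [by meas|by meas|by move=> x; exact: sqr_ge0|].
move=> x; have [->|px] := eqVneq (phi x) 0; first by rewrite expr0n sqr_ge0.
have [->|pxu] := eqVneq (phi (x + u)) 0; first by rewrite sub0r sqrrN.
have h1 := le_trans (norm1_ge_coord _ i0) (Hrho _ px).
have h2 := le_trans (norm1_ge_coord _ i0) (Hrho _ pxu).
exfalso; move: h1 h2; rewrite !mxE !eqxx/= mulr1 !ler_norml => /andP[h1 _] /andP[_ h2].
lra.
Qed.

End compact_support.

(** * Algebra of truncated expansions *)

Section truncated_expansions.
Context {R : realType} {d : nat}.
Local Notation V := ('rV[R]_d).

Definition bounded_coef (a : V -> R) := measurable_fun setT a /\ exists c, forall x, `|a x| <= c.

Variables (G : V -> bool) (mG : measurable_fun setT G) (r : nat).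

(* Truncated expansions of [F x t] in [t], uniform in [x] in [G] and [norm1 t <= 1]. *)
Definition expandable (F : V -> V -> R) := exists P, poly_le bounded_coef r P /\
  exists2 D, 0 <= D & forall x t, G x -> norm1 t <= 1 -> `|F x t - P x t| <= D * norm1 t ^+ r.+1.

Lemma bounded_coefM a a' : bounded_coef a -> bounded_coef a' -> bounded_coef (fun x => a x * a' x).
Proof.
move=> [ma [c Hc]] [ma' [c' Hc']]; split; first by meas.
by exists (c * c') => x; rewrite normrM ler_pM.
Qed.

Lemma poly_le_growth k P : poly_le bounded_coef k P ->
  exists2 c, 0 <= c & forall x t, `|P x t| <= c * (1 + norm1 t) ^+ k.
Proof.
elim=> [|a l [_ [c Hc]] lk|P1 Q1 _ [c c0 Hc] _ [c' c'0 Hc']].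
- by exists 0 => // x t; rewrite normr0 mul0r.
- exists `|c| => // x t; rewrite normrM ler_pM//.
    exact: le_trans (Hc x) (ler_norm _).
  apply: le_trans (monomial_le _ _) _.
  have t1 : 1 <= 1 + norm1 t by rewrite lerDl norm1_ge0.
  apply: (@le_trans _ _ ((1 + norm1 t) ^+ mi_order l)).
    by rewrite lerXn2r ?nnegrE ?norm1_ge0// ?addr_ge0 ?norm1_ge0// lerDr.
  exact: ler_weXn2l.
- exists (c + c'); first exact: addr_ge0.
  move=> x t; rewrite mulrDl; apply: le_trans (ler_normD _ _) _.
  exact: lerD.
Qed.

Lemma poly_le_lipschitz k P : poly_le bounded_coef k P ->
  exists2 c, 0 <= c & forall x t, norm1 t <= 1 -> `|P x t - P x 0| <= c * norm1 t.
Proof.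
elim=> [|a l [_ [c Hc]] lk|P1 Q1 _ [c c0 Hc] _ [c' c'0 Hc']].
- by exists 0 => // x t _; rewrite subrr normr0 mul0r.
- exists `|c| => // x t t1; rewrite -mulrBr normrM ler_pM//.
    exact: le_trans (Hc x) (ler_norm _).
  have [l0|l0] := posnP (mi_order l).
    have lz i : l i = 0%N.
      apply/eqP; rewrite -leqn0 -l0 /mi_order (bigD1 i)//= leq_addr//.
    rewrite (_ : monomial l t = 1); last by rewrite /monomial big1// => i _; rewrite lz.
    rewrite (_ : monomial l 0 = 1); last by rewrite /monomial big1// => i _; rewrite lz.
    by rewrite subrr normr0 norm1_ge0.
  have -> : monomial l (0 : V) = 0.
    by rewrite -(scale0r (0 : V)) monomialZ expr0n (gtn_eqF l0) mul0r.
  rewrite subr0; apply: le_trans (monomial_le _ _) _.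
  rewrite -[leRHS]expr1; apply: ler_wiXn2l => //; exact: norm1_ge0.
- exists (c + c'); first exact: addr_ge0.
  move=> x t t1; rewrite mulrDl opprD addrACA; apply: le_trans (ler_normD _ _) _.
  by apply: lerD; [exact: Hc|exact: Hc'].
Qed.

Let powle1 (t : V) m n : norm1 t <= 1 -> (m <= n)%N -> norm1 t ^+ n <= norm1 t ^+ m.
Proof. by move=> t1 mn; apply: ler_wiXn2l => //; exact: norm1_ge0. Qed.

Lemma expandable_poly P : poly_le bounded_coef r P -> expandable P.
Proof. by move=> HP; exists P; split => //; exists 0 => // x t _ _; rewrite subrr normr0 mul0r. Qed.

Lemma expandable_coef (a : V -> R) : measurable_fun setT a -> (exists c, forall x, G x -> `|a x| <= c) ->
  expandable (fun x _ => a x).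
Proof.
move=> ma [c Hc].
exists (fun x t => (if G x then a x else 0) * monomial (fun=> 0%N) t); split.
  apply: poly_leM; last by rewrite mi_order0.
  split; first by apply: measurable_fun_ifT.
  exists `|c| => x; case: ifP => Gx; last by rewrite normr0.
  exact: le_trans (Hc x Gx) (ler_norm _).
by exists 0 => // x t Gx _; rewrite Gx monomial0 mulr1 subrr normr0 mul0r.
Qed.

Lemma expandable_near F F' D : 0 <= D -> expandable F' ->
  (forall x t, G x -> norm1 t <= 1 -> `|F x t - F' x t| <= D * norm1 t ^+ r.+1) -> expandable F.
Proof.
move=> D0 [P [HP [D' D'0 HD']]] H; exists P; split => //; exists (D + D'); first exact: addr_ge0.
move=> x t Gx t1; rewrite -(subrKA (F' x t)) mulrDl.
by apply: le_trans (ler_normD _ _) _; apply: lerD; [exact: H|exact: HD'].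
Qed.

Lemma expandable_ext F F' : expandable F' -> (forall x t, F x t = F' x t) -> expandable F.
Proof.
by move=> HF' E; apply: (@expandable_near _ F' 0) => // x t _ _; rewrite E subrr normr0 mul0r.
Qed.

Lemma expandableD F F' : expandable F -> expandable F' -> expandable (fun x t => F x t + F' x t).
Proof.
move=> [P [HP [D D0 HD]]] [P' [HP' [D' D'0 HD']]].
exists (fun x t => P x t + P' x t); split; first exact: poly_leD.
exists (D + D'); first exact: addr_ge0.
move=> x t Gx t1; rewrite opprD addrACA mulrDl.
by apply: le_trans (ler_normD _ _) _; apply: lerD; [exact: HD|exact: HD'].
Qed.

(** Products of monomials of total degree above [r] go into the remainder, since [norm1 t <= 1]
    makes higher powers smaller. *)
Lemma expandable_polyM P Q : poly_le bounded_coef r P -> poly_le bounded_coef r Q ->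
  expandable (fun x t => P x t * Q x t).
Proof.
move=> HP; elim: HP Q => [|a l Ha lr|P1 P2 _ IH1 _ IH2] Q HQ.
- by apply: expandable_ext (expandable_poly (poly_le0 _ _)) _ => x t; rewrite mul0r.
- elim: HQ => [|a' l' Ha' lr'|Q1 Q2 _ IH1 _ IH2].
  + by apply: expandable_ext (expandable_poly (poly_le0 _ _)) _ => x t; rewrite mulr0.
  + have Haa' := bounded_coefM Ha Ha'.
    have E x t : a x * monomial l t * (a' x * monomial l' t) =
        (a x * a' x) * monomial (fun i => l i + l' i)%N t by rewrite monomial_add; ring.
    have [ll'|ll'] := leqP (mi_order l + mi_order l')%N r.
      apply: expandable_ext (expandable_poly (poly_leM (l := fun i => l i + l' i)%N Haa' _)) E.
      by rewrite mi_order_add.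
    have [_ [c Hc]] := Haa'.
    apply: (@expandable_near _ (fun _ _ => 0) `|c|) => //; first exact: expandable_poly (poly_le0 _ _).
    move=> x t _ t1; rewrite E subr0 normrM ler_pM//.
      exact: le_trans (Hc x) (ler_norm _).
    apply: le_trans (monomial_le _ _) _; apply: powle1 => //.
    by rewrite mi_order_add.
  + apply: (@expandable_near _ (fun x t => a x * monomial l t * Q1 x t + a x * monomial l t * Q2 x t) 0) => //.
      exact: expandableD.
    by move=> x t _ _; rewrite mulrDr subrr normr0 mul0r.
- apply: (@expandable_near _ (fun x t => P1 x t * Q x t + P2 x t * Q x t) 0) => //.
    by apply: expandableD; [exact: IH1|exact: IH2].
  by move=> x t _ _; rewrite mulrDl subrr normr0 mul0r.
Qed.

Lemma expandable_bounded F : expandable F ->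
  exists2 c, 0 <= c & forall x t, G x -> norm1 t <= 1 -> `|F x t| <= c.
Proof.
move=> [P [HP [D D0 HD]]]; have [c c0 Hc] := poly_le_growth HP.
exists (D + c * 2 ^+ r); first by rewrite addr_ge0// mulr_ge0// exprn_ge0.
move=> x t Gx t1; rewrite -(subrK (P x t) (F x t)).
apply: le_trans (ler_normD _ _) _; apply: lerD.
  apply: le_trans (HD x t Gx t1) _; rewrite ler_piMr//.
  by rewrite exprn_ile1// norm1_ge0.
apply: le_trans (Hc x t) _; rewrite ler_wpM2l// lerXn2r ?nnegrE//.
  by rewrite addr_ge0// norm1_ge0.
lra.
Qed.

Lemma expandableM F F' : expandable F -> expandable F' -> expandable (fun x t => F x t * F' x t).
Proof.
move=> HF HF'; have [c c0 Hc] := expandable_bounded HF'.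
have [P [HP [D D0 HD]]] := HF; have [P' [HP' [D' D'0 HD']]] := HF'.
have [c' c'0 Hc'] := expandable_bounded (expandable_poly HP).
apply: (@expandable_near _ (fun x t => P x t * P' x t) (D * c + c' * D')).
- by rewrite addr_ge0// mulr_ge0.
- exact: expandable_polyM.
- move=> x t Gx t1.
  rewrite (_ : _ - _ = (F x t - P x t) * F' x t + P x t * (F' x t - P' x t)); last by ring.
  apply: le_trans (ler_normD _ _) _; rewrite !normrM mulrDl; apply: lerD.
    by rewrite mulrAC ler_pM//; [exact: HD|exact: Hc].
  by rewrite -mulrA ler_pM//; [exact: Hc'|exact: HD'].
Qed.

Lemma expandable_cst (c : R) : expandable (fun _ _ => c).
Proof. by apply: expandable_coef => //; exists `|c|. Qed.

Lemma expandableX F n : expandable F -> expandable (fun x t => F x t ^+ n).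
Proof.
move=> HF; elim: n => [|n IH]; first exact: expandable_cst.
apply: (@expandable_near _ (fun x t => F x t * F x t ^+ n) 0) => //; first exact: expandableM.
by move=> x t _ _; rewrite exprS subrr normr0 mul0r.
Qed.

Lemma expandable_sum n (F : 'I_n -> V -> V -> R) : (forall j, expandable (F j)) ->
  expandable (fun x t => \sum_(j < n) F j x t).
Proof.
elim: n F => [|n IH] F HF.
  apply: (@expandable_near _ (fun _ _ => 0) 0) => //; first exact: expandable_cst.
  by move=> x t _ _; rewrite big_ord0 subrr normr0 mul0r.
apply: (@expandable_near _ (fun x t => \sum_(j < n) F (widen_ord (leqnSn n) j) x t + F ord_max x t) 0) => //.
  by apply: expandableD => //; exact: IH.
by move=> x t _ _; rewrite big_ord_recr subrr normr0 mul0r.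
Qed.

Lemma geometric_expansion (a u : R) n : a != 0 -> a + u != 0 ->
  (a + u)^-1 = \sum_(j < n) (- u) ^+ j * (a ^-1) ^+ j.+1 + (- u) ^+ n * (a^-1) ^+ n * (a + u)^-1.
Proof.
move=> a0 au0; elim: n => [|n IH]; first by rewrite big_ord0 !expr0 !mul1r add0r.
rewrite big_ord_recr/= {1}IH -addrA; congr (_ + _).
by rewrite !exprS; field; rewrite a0 au0.
Qed.

End truncated_expansions.

(** * Expansion of the reciprocal of the density *)

Section reciprocal.
Context {R : realType} {d : nat}.
Local Notation V := ('rV[R]_d).

(** Multiplying the coefficients by the indicator of the bounded set [G] makes them globally
    bounded. *)
Lemma poly_le_restrict (G : V -> bool) (rho : R) k (P : V -> V -> R) : measurable_fun setT G ->
  (forall x, G x -> norm1 x <= rho) -> poly_le locally_bounded k P ->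
  exists P', poly_le bounded_coef k P' /\ forall x t, P' x t = if G x then P x t else 0.
Proof.
move=> mG Grho HP.
exists (fun x t => (if G x then 1 else 0) * monomial (fun=> 0%N) t * P x t); split; last first.
  by move=> x t; rewrite monomial0 mulr1; case: ifP; rewrite ?mul1r ?mul0r.
apply: (@poly_leZ _ _ locally_bounded _ k) => //; last by rewrite mi_order0.
move=> a [ma ba]; have [c Hc] := ba rho; split.
  by apply: measurable_funM => //; apply: measurable_fun_ifT.
exists `|c| => x; case: ifP => Gx; last by rewrite mul0r normr0.
by rewrite mul1r (le_trans (Hc x (Grho x Gx)))// ler_norm.
Qed.

Variables (f : V -> R) (r : nat) (P : V -> V -> R) (D : R).
Hypothesis mf : measurable_fun setT f.
Hypothesis HP : poly_le locally_bounded r P.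
Hypothesis D0 : 0 <= D.
Hypothesis HD : forall x t, `|f (x + t) - P x t| <= D * norm1 t ^+ r.+1.

Lemma norm10 : norm1 (0 : V) = 0.
Proof. by rewrite -(scale0r (0 : V)) norm1Z normr0 mul0r. Qed.

Lemma taylor_poly0 x : P x 0 = f x.
Proof.
apply/eqP; rewrite eq_sym -subr_eq0 -normr_le0.
by have := HD x 0; rewrite addr0 norm10 expr0n mulr0.
Qed.

Section restricted.
Variables (G : V -> bool) (rho : R).
Hypothesis mG : measurable_fun setT G.
Hypothesis Grho : forall x, G x -> norm1 x <= rho.

Lemma expandable_translate : expandable G r (fun x t => f (x + t)).
Proof.
have [P' [HP' P'E]] := poly_le_restrict mG Grho HP.
exists P'; split => //; exists D => // x t Gx _.
by rewrite P'E Gx.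
Qed.

Lemma locally_lipschitz : exists2 L, 0 <= L & forall x t, G x -> norm1 t <= 1 ->
  `|f (x + t) - f x| <= L * norm1 t.
Proof.
have [P' [HP' P'E]] := poly_le_restrict mG Grho HP.
have [c c0 Hc] := poly_le_lipschitz HP'.
exists (D + c); first exact: addr_ge0.
move=> x t Gx t1; have := Hc x t t1; rewrite !P'E Gx taylor_poly0 => H.
rewrite -(subrKA (P x t)) mulrDl; apply: le_trans (ler_normD _ _) _; apply: lerD => //.
apply: le_trans (HD x t) _; rewrite ler_wpM2l// -[leRHS]expr1.
by apply: ler_wiXn2l => //; exact: norm1_ge0.
Qed.

End restricted.

(** Only [y] is known to satisfy [b <= f y]; the centre [x] is arbitrary. If [x] is in [G] and
    [t = y - x] is short, a geometric series in [f y - f x] applies, with error constant [D1]. If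
    [norm1 t > 1], everything is absorbed by [norm1 t ^+ r.+1], with constant [D2]. If [t] is short
    and [x] is outside [G], then [f x < b / 2] and [t] cannot be too short, whence [D3]. *)
Lemma reciprocal_expansion (b rho : R) : 0 < b ->
  exists Q, poly_le bounded_coef r Q /\ exists2 D', 0 <= D' & forall x y, norm1 y <= rho -> b <= f y ->
    `|(f y)^-1 - Q x (y - x)| <= D' * norm1 (y - x) ^+ r.+1.
Proof.
move=> b0; pose G x := (b / 2 <= f x) && (norm1 x <= rho + 1).
have mn1 := @measurable_norm1 R d.
have mG : measurable_fun setT G.
  by apply: measurable_and; apply: measurable_fun_ler.
have mG' : measurable_fun setT (fun x : V => norm1 x <= rho) by apply: measurable_fun_ler.
have Grho x : G x -> norm1 x <= rho + 1 by move=> /andP[].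
have [L L0 HL] := locally_lipschitz mG Grho.
have [L' L'0 HL'] := locally_lipschitz (G := fun x => norm1 x <= rho) mG' (fun x h => h).
have Ef := expandable_translate mG Grho.
have fG x : G x -> b / 2 <= f x by move=> /andP[].
have b20 : 0 < b / 2 by rewrite divr_gt0.
have fG0 x : G x -> 0 < f x by move=> /fG; exact: lt_le_trans.
have Ea : expandable G r (fun x _ => (f x)^-1).
  apply: expandable_coef => //; first by meas.
  exists (b / 2)^-1 => x Gx; rewrite gtr0_norm ?invr_gt0 ?fG0//.
  by rewrite lef_pV2 ?posrE ?fG0//; exact: fG.
have Eu : expandable G r (fun x t => f (x + t) - f x).
  apply: expandableD => //; apply: expandable_coef => //; first by meas.
  have [c c0 Hc] := expandable_bounded Ef.
  exists c => x Gx; rewrite normrN.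
  by have := Hc x 0 Gx; rewrite addr0 norm10 ler01; exact.
have EF : expandable G r (fun x t => \sum_(j < r.+1) (- (f (x + t) - f x)) ^+ j * ((f x)^-1) ^+ j.+1).
  apply: expandable_sum => // j; apply: expandableM => //; apply: expandableX => //.
  apply: (@expandable_ext _ _ _ _ _ (fun x t => -1 * (f (x + t) - f x))).
    by apply: expandableM => //; exact: expandable_cst.
  by move=> x t; rewrite mulN1r.
have [Q0 [HQ0 [D0' D0'0 HD0']]] := EF.
have [cQ cQ0 HcQ] := poly_le_growth HQ0.
pose Q x t := (if G x then 1 else 0) * monomial (fun=> 0%N) t * Q0 x t.
have QE x t : Q x t = if G x then Q0 x t else 0.
  by rewrite /Q monomial0 mulr1; case: ifP; rewrite ?mul1r ?mul0r.
exists Q; split.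
  apply: (@poly_leZ _ _ bounded_coef _ r); [|by rewrite mi_order0|exact: HQ0].
  move=> a Ha; apply: bounded_coefM => //; split; first by apply: measurable_fun_ifT.
  by exists 1 => x; case: ifP; rewrite ?normr1 ?normr0.
have bV0 : 0 <= b^-1 by rewrite invr_ge0 ltW.
(* The distance over which a function with Lipschitz constant [L'] can drop from [b] to [b / 2];
   adding 1 keeps the denominator positive. *)
pose delta := b / 2 / (L' + 1).
have L'1 : 0 < L' + 1 by exact: ltr_wpDl.
have delta0 : 0 < delta by rewrite divr_gt0.
pose D1 := D0' + L ^+ r.+1 * (b / 2)^-1 ^+ r.+1 * b^-1.
pose D2 := b^-1 + cQ * 2 ^+ r.
pose D3 := b^-1 * (delta ^+ r.+1)^-1.
have D10 : 0 <= D1.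
  by rewrite addr_ge0// !mulr_ge0 ?exprn_ge0// invr_ge0 ltW.
have D20 : 0 <= D2 by rewrite addr_ge0 ?mulr_ge0 ?exprn_ge0// invr_ge0 ltW.
have D30 : 0 <= D3 by rewrite mulr_ge0 ?invr_ge0 ?exprn_ge0// ltW.
exists (D1 + D2 + D3); first by apply: addr_ge0 => //; exact: addr_ge0.
move=> x y yrho fy; set t := y - x.
have yE : y = x + t by rewrite /t addrC subrK.
have fy0 : 0 < f y by exact: lt_le_trans fy.
have fyb : (f y)^-1 <= b^-1 by rewrite lef_pV2 ?posrE.
have fyV0 : 0 <= (f y)^-1 by rewrite invr_ge0 ltW.
have t0 := norm1_ge0 t.
have tr0 : 0 <= norm1 t ^+ r.+1 by exact: exprn_ge0.
have H : forall D', D' = D1 \/ D' = D2 \/ D' = D3 -> `|(f y)^-1 - Q x t| <= D' * norm1 t ^+ r.+1 ->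
    `|(f y)^-1 - Q x t| <= (D1 + D2 + D3) * norm1 t ^+ r.+1.
  move=> D' DD' /le_trans; apply; rewrite ler_wpM2r//.
  by case: DD' => [->|[->|->]]; lra.
have far : 1 <= norm1 t -> b^-1 <= b^-1 * norm1 t ^+ r.+1.
  by move=> t1; rewrite ler_peMr// exprn_ege1.
rewrite QE in H *; case: ifPn => [Gx|nGx] in H *; last first.
  have [t1|t1] := lerP (norm1 t) 1; last first.
    apply: (H D2); first by right; left.
    rewrite subr0 ger0_norm// (le_trans fyb)// (le_trans (far (ltW t1)))// ler_wpM2r//.
    by rewrite lerDl mulr_ge0 ?exprn_ge0.
  apply: (H D3); first by right; right.
  have xr : norm1 x <= rho + 1.
    rewrite (_ : x = y + (-1) *: t); last by rewrite scaleN1r /t opprB addrC subrK.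
    by apply: le_trans (norm1D _ _) _; rewrite norm1Z normrN1 mul1r lerD.
  have fx : f x < b / 2 by move: nGx; rewrite negb_and xr orbF -ltNge.
  have := HL' y (- t) yrho; rewrite -scaleN1r norm1Z normrN1 mul1r scaleN1r => /(_ t1).
  have -> : y - t = x by rewrite /t opprB addrC subrK.
  move=> H1.
  have dt : delta <= norm1 t.
    rewrite /delta ler_pdivrMr//.
    have h2 : b / 2 <= `|f x - f y| by rewrite distrC; apply: le_trans (ler_norm _); lra.
    by apply: le_trans h2 (le_trans H1 _); rewrite mulrDr mulr1 (mulrC L') lerDl.
  rewrite subr0 ger0_norm// (le_trans fyb)// /D3 -mulrA ler_peMr//.
  rewrite mulrC ler_pdivlMr ?exprn_gt0// mul1r lerXn2r ?nnegrE//; exact: ltW.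
have [t1|t1] := lerP (norm1 t) 1; last first.
  apply: (H D2); first by right; left.
  apply: le_trans (ler_normB _ _) _; rewrite mulrDl lerD//.
    by rewrite ger0_norm// (le_trans fyb)// far// ltW.
  apply: le_trans (HcQ x t) _; rewrite -mulrA ler_wpM2l//.
  apply: (@le_trans _ _ ((2 * norm1 t) ^+ r)).
    rewrite lerXn2r ?nnegrE ?addr_ge0 ?mulr_ge0//; lra.
  by rewrite exprMn ler_wpM2l ?exprn_ge0// exprS ler_peMl ?exprn_ge0// ltW.
apply: (H D1); first by left.
have := geometric_expansion (a := f x) (u := f y - f x) r.+1.
rewrite addrC subrK gt_eqF ?fG0// gt_eqF// => /(_ isT isT) ->.
have := HD0' x t Gx t1; rewrite -yE => H1.
rewrite addrAC mulrDl; apply: le_trans (ler_normD _ _) _; apply: lerD => //.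
have H2 : `|f y - f x| <= L * norm1 t by have := HL x t Gx t1; rewrite -yE.
have fxV : `|(f x)^-1| <= (b / 2)^-1.
  by rewrite gtr0_norm ?invr_gt0 ?fG0// lef_pV2 ?posrE ?fG0//; exact: fG.
rewrite !normrM !normrX normrN (ger0_norm fyV0).
rewrite (_ : L ^+ _ * _ * _ * _ = (L * norm1 t) ^+ r.+1 * (b / 2)^-1 ^+ r.+1 * b^-1); last by rewrite exprMn; ring.
have b2V : 0 <= (b / 2)^-1 by rewrite invr_ge0; exact: ltW.
have H3 : `|f y - f x| ^+ r.+1 <= (L * norm1 t) ^+ r.+1 by rewrite lerXn2r ?nnegrE ?mulr_ge0.
have H4 : `|(f x)^-1| ^+ r.+1 <= (b / 2)^-1 ^+ r.+1 by rewrite lerXn2r ?nnegrE.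
have H5 : 0 <= `|f y - f x| ^+ r.+1 * `|(f x)^-1| ^+ r.+1 by rewrite mulr_ge0 ?exprn_ge0.
by apply: ler_pM => //; apply: ler_pM; rewrite ?exprn_ge0.
Qed.

End reciprocal.

(** * Taylor expansion of the quotient in L2 *)

Section weighted_taylor.
Context {R : realType} {d : nat}.
Local Notation V := ('rV[R]_d).
Local Notation L2 := (L2le (leb R d)).

Lemma powR_between (x s : R) (m n : nat) : 0 <= x -> s <= m%:R -> (m <= n)%N -> 0 < s ->
  x ^+ m <= x `^ s + x ^+ n.
Proof.
move=> x0 sm mn s0; have [x1|x1] := lerP x 1; last first.
  by rewrite (le_trans (ler_weXn2l (ltW x1) mn))// lerDr powR_ge0.
apply: (@le_trans _ _ (x `^ s)); last by rewrite lerDl exprn_ge0.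
have [x00|x00] := eqVneq x 0.
  rewrite x00 expr0n (gtn_eqF (_ : (0 < m)%N)) ?powR_ge0//.
  by rewrite -(ltr_nat R); exact: lt_le_trans sm.
by rewrite -powR_mulrn//; apply: ger_powR => //; rewrite x1 andbT lt_neqAle eq_sym x00.
Qed.

Lemma measurable_poly_le (A : set (V -> R)) k P : A `<=` (fun a => measurable_fun setT a) -> poly_le A k P ->
  measurable_fun [set: V * V] (fun p => P p.1 p.2).
Proof.
move=> Am; elim=> [|a l Aa _|P1 P2 _ IH1 _ IH2]; first exact: measurable_cst.
- have ma := Am a Aa; have ml := @measurable_monomial R d l.
  by meas.
- exact: measurable_funD.
Qed.

(** With [Q] the expansion of [1 / f], the quotient at [x + t] splits into [(1 / f - Q) phi],
    controlled by the L2 norm of [phi], and [Q phi], which is expanded one monomial of [Q] at a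
    time. *)
Lemma taylor_quotient (phi f : V -> R) (s : R) (r : nat) (M b : R) : (1 <= d)%N ->
  nikolskii s phi -> compact (fun_support phi) -> s <= r.+1%:R -> 0 < s ->
  measurable_fun setT f -> partials_exist r.+1 f ->
  (forall w, size w = r.+1 -> forall x, `|iter_partial w f x| <= M) ->
  0 < b -> (forall x, phi x != 0 -> b <= f x) ->
  exists P, poly_le (fun a => measurable_fun setT a) r P /\ exists2 D, 0 <= D & forall t,
    L2 (fun x => phi (x + t) / f (x + t) - P x t) (D * (norm1 t `^ s + norm1 t ^+ r.+1)).
Proof.
move=> d1 nphi cphi sr s0 mf pf fM b0 fb.
have [cphi2 Lphi] := nikolskii_L2 d1 nphi cphi.
have mphi : measurable_fun setT phi by case: Lphi.
have c20 : 0 <= cphi2 by case: Lphi.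
have [rho rho0 Hrho] := compact_support_bounded cphi.
have [Pf [HPf [Df Df0 HDf]]] := taylor_sup mf pf fM.
have [Q [HQ [D' D'0 HD']]] := reciprocal_expansion mf HPf Df0 HDf rho b0.
have [k [alpha [sE /andP[al0 al1] Hk]]] := taylor_L2 nphi.
have kr : (k <= r)%N.
  rewrite -ltnS -(ltr_nat R); apply: lt_le_trans sr; rewrite sE ltrDl//.
(* The increment is not confined to a ball, as it is later integrated against the kernel; one power
   serves small [t], the other large [t]. *)
pose bd (t : V) := norm1 t `^ s + norm1 t ^+ r.+1.
have bd0 t : 0 <= bd t by rewrite addr_ge0 ?powR_ge0// exprn_ge0// norm1_ge0.
have HQphi : exists P, poly_le (fun a : V -> R => measurable_fun setT a) r P /\ exists2 D, 0 <= D & forall t,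
    L2 (fun x => Q x t * phi (x + t) - P x t) (D * bd t).
  elim: HQ => [|a l [ma [c Hc]] lr|Q1 Q2 _ [P1 [HP1 [D1 D10 HD1]]] _ [P2 [HP2 [D2 D20 HD2]]]].
  - exists (fun _ _ => 0); split; first exact: poly_le0.
    exists 0 => // t; rewrite mul0r (_ : (fun x => _) = fun=> 0); first exact: L2le0.
    by apply/funext => x; rewrite mul0r subr0.
  - have Hac (g : V -> R) c' t : L2 g c' -> L2 (fun x => a x * monomial l t * g x) (`|c| * (norm1 t ^+ mi_order l * c')).
      move=> Lg; rewrite (_ : (fun x => _) = (fun x => a x * (monomial l t * g x))); last by apply/funext => x; rewrite mulrA.
      apply: (@L2leMb _ _ _ _ _ a _ `|c|) => //.
        by move=> x; exact: le_trans (Hc x) (ler_norm _).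
      apply: L2leW (L2leZ _ Lg) _; rewrite ler_wpM2r//; last exact: monomial_le.
      by case: Lg.
    (* A monomial of degree [j <= k] meets the expansion of [phi] of order [k - j], with error
       exponent [j + (k - j) + alpha = s]. Above degree [k] the whole product is an error term. *)
    have [lk|lk] := leqP (mi_order l) k.
      have [P [HP [D D0 HD]]] := Hk (k - mi_order l)%N (leq_subr _ _).
      exists (fun x t => a x * monomial l t * P x t); split.
        apply: (@poly_leZ _ _ (fun a => measurable_fun setT a) _ (k - mi_order l)) => //.
          by move=> a' ma'; meas.
        by rewrite subnKC.
      exists (`|c| * D) => [|t]; first by rewrite mulr_ge0.
      have := Hac _ _ t (HD t); rewrite (_ : (fun x => _) = fun x => a x * monomial l t * phi (x + t) - a x * monomial l t * P x t); last first.
        by apply/funext => x; rewrite mulrBr.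
      move/L2leW; apply; rewrite -mulrA ler_wpM2l// mulrCA ler_wpM2l//.
      apply: (@le_trans _ _ (norm1 t `^ s)); last by rewrite lerDl exprn_ge0// norm1_ge0.
      rewrite -powR_mulrn ?norm1_ge0// -powRD; last first.
        by rewrite gt_eqF// ltr_wpDl// ltr_wpDl.
      by rewrite addrA -natrD subnKC// sE.
    exists (fun _ _ => 0); split; first exact: poly_le0.
    exists (`|c| * cphi2) => [|t]; first by rewrite mulr_ge0.
    have := Hac _ _ t (L2le_translate t Lphi).
    rewrite (_ : (fun x => a x * monomial l t * phi (x + t)) = fun x => a x * monomial l t * phi (x + t) - 0); last first.
      by apply/funext => x; rewrite subr0.
    move/L2leW; apply; rewrite -mulrA ler_wpM2l// mulrC ler_wpM2l//.
    apply: powR_between; rewrite ?norm1_ge0//; last exact: leqW.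
    (* [mi_order l > k] forces [mi_order l >= k + alpha = s], as [alpha <= 1] *)
    by rewrite sE (le_trans (lerD (lexx _) al1))// natr1 ler_nat.
  - exists (fun x t => P1 x t + P2 x t); split; first exact: poly_leD.
    exists (2 * (D1 + D2)) => [|t]; first by rewrite mulr_ge0// addr_ge0.
    have := L2leD (HD1 t) (HD2 t); rewrite -mulrDl mulrA; congr L2le.
    by apply/funext => x; rewrite mulrDl opprD addrACA.
have [P [HP [D D0 HD]]] := HQphi.
exists P; split => //; exists (2 * (D + D' * cphi2)) => [|t].
  by rewrite mulr_ge0// addr_ge0// mulr_ge0.
have mQ := measurable_poly_le (fun a (h : bounded_coef a) => h.1) HQ.
have L1 : L2 (fun x => phi (x + t) / f (x + t) - Q x t * phi (x + t)) (D' * cphi2 * bd t).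
  have L0 : L2 (fun x => D' * norm1 t ^+ r.+1 * phi (x + t)) (D' * cphi2 * bd t).
    apply: L2leW (L2leZ _ (L2le_translate t Lphi)) _.
    rewrite ger0_norm; last by rewrite mulr_ge0// exprn_ge0// norm1_ge0.
    rewrite mulrAC ler_wpM2l//; first exact: mulr_ge0.
    by rewrite lerDr powR_ge0.
  apply: (L2le_dom _ _ L0).
  - have mQt : measurable_fun setT (fun x => Q x t).
      by apply: (measurable_fun2_comp (F := Q) mQ); meas.
    by meas.
  - move=> x; have [->|px] := eqVneq (phi (x + t)) 0; first by rewrite mul0r !mulr0 subr0.
    rewrite (_ : _ - _ = ((f (x + t))^-1 - Q x t) * phi (x + t)); last by ring.
    rewrite !normrM ler_wpM2r//.
    have := HD' x (x + t) (Hrho _ px) (fb _ px).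
    rewrite addrAC subrr add0r => /le_trans; apply.
    by rewrite (ger0_norm D'0) ger0_norm// exprn_ge0// norm1_ge0.
have H := L2leD L1 (HD t).
rewrite (_ : 2 * (_ + _) = 2 * (D + D' * cphi2) * bd t) in H; last by ring.
rewrite (_ : (fun x => _) = fun x => phi (x + t) / f (x + t) - P x t) in H => //.
by apply/funext => x; rewrite subrKA.
Qed.

End weighted_taylor.

(** * Integrability and a weighted Cauchy-Schwarz inequality *)

Section integral_bounds.
Context {R : realType} d (T : measurableType d) (mu : {measure set T -> \bar R}).
Implicit Types f g : T -> R.
Local Open Scope ereal_scope.

Lemma integrableZ_real (c : R) f : mu.-integrable setT (EFin \o f) ->
  mu.-integrable setT (EFin \o (fun x => c * f x)%R).
Proof.
move=> mi; rewrite (_ : EFin \o _ = (fun x => c%:E * (EFin \o f) x)) //.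
exact: integrableZl.
Qed.

Lemma integrableD_real f g : mu.-integrable setT (EFin \o f) -> mu.-integrable setT (EFin \o g) ->
  mu.-integrable setT (EFin \o (fun x => f x + g x)%R).
Proof.
move=> mi mi'; rewrite (_ : EFin \o _ = (EFin \o f) \+ (EFin \o g)) //.
exact: integrableD.
Qed.

(** This extracts the integrability of the kernel and of its moments from [kernel_order]: if either
    part had infinite integral, the difference would be infinite as well. *)
Lemma integrable_of_fin_integral g c : measurable_fun setT g -> \int[mu]_x (g x)%:E = c%:E ->
  mu.-integrable setT (EFin \o g).
Proof.
move=> mg; rewrite integralE => H.
have mG : measurable_fun setT (EFin \o g) by exact/measurable_EFinP.
apply/integrableP; split => //.
have p0 : 0 <= \int[mu]_x (EFin \o g)^\+ x by exact: integral_ge0.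
have n0 : 0 <= \int[mu]_x (EFin \o g)^\- x by exact: integral_ge0.
rewrite (_ : \int[mu]_x _ = \int[mu]_x (EFin \o g)^\+ x + \int[mu]_x (EFin \o g)^\- x); last first.
  rewrite -ge0_integralD//; [|exact: measurable_funepos|exact: measurable_funeneg].
  by apply: eq_integral => x _; have /(congr1 (fun F => F x)) := fune_abse (EFin \o g).
move: H p0 n0.
case: (\int[mu]_x (EFin \o g)^\+ x) => [a| |]; case: (\int[mu]_x (EFin \o g)^\- x) => [b| |] //=.
by move=> _ _ _; rewrite -EFinD ltry.
Qed.

(* If [F^2 <= om * u] pointwise then [|F| <= (lam * om + u / lam) / 2] for every [lam > 0];
   the choice [lam = y / A] with [y] the integral of [|F|] gives [y^2 <= A * J]. *)
Lemma cauchy_schwarz_weighted (F om u : T -> R) (A : R) : (0 < A)%R ->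
  measurable_fun setT F -> measurable_fun setT om -> measurable_fun setT u ->
  (forall x, 0 <= om x)%R -> (forall x, 0 <= u x)%R ->
  (forall x, F x ^+ 2 <= om x * u x)%R ->
  \int[mu]_x (om x)%:E <= A%:E ->
  (((\int[mu]_x F x) ^+ 2)%R)%:E <= A%:E * \int[mu]_x (u x)%:E.
Proof.
move=> A0 mF mom mu_ om0 u0 H omA.
have [->|] := eqVneq (\int[mu]_x (u x)%:E) +oo; first by rewrite gt0_muley// leey.
rewrite -ltey => uoo.
have [J J0 JE] : exists2 J, (0 <= J)%R & \int[mu]_x (u x)%:E = J%:E.
  exists (fine (\int[mu]_x (u x)%:E)); first by rewrite fine_ge0// int_ge0.
  by rewrite fineK// ge0_fin_numE// int_ge0.
have bound lam : (0 < lam)%R -> \int[mu]_x (`|F x|%R)%:E <= ((lam * A + lam^-1 * J) / 2)%:E.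
  move=> lam0.
  have lV0 : (0 <= lam^-1)%R by rewrite invr_ge0 ltW.
  apply: (@le_trans _ _ (\int[mu]_x ((lam / 2) * om x + (lam^-1 / 2) * u x)%:E)).
    apply: le_int; [by meas|by meas|by move=> x; exact: normr_ge0|] => x.
    have H1 : (0 <= (lam / 2) * om x + (lam^-1 / 2) * u x)%R.
      by rewrite addr_ge0// mulr_ge0// divr_ge0// ltW.
    rewrite -(@ler_pXn2r _ 2)// ?nnegrE// (real_normK (num_real _)); apply: le_trans (H x) _.
    rewrite -subr_ge0 (_ : _ - _ = ((lam / 2) * om x - (lam^-1 / 2) * u x) ^+ 2)%R ?sqr_ge0//.
    by field; rewrite gt_eqF.
  rewrite intD; [|by meas|by meas|by move=> x; rewrite mulr_ge0// divr_ge0// ltW|by move=> x; rewrite mulr_ge0// divr_ge0].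
  rewrite !intZ//; [|by rewrite divr_ge0|by rewrite divr_ge0// ltW].
  rewrite JE -EFinM (_ : ((lam * A + lam^-1 * J) / 2)%R = lam / 2 * A + lam^-1 / 2 * J)%R; last by field; rewrite gt_eqF.
  rewrite EFinD leeD2r// [X in _ <= X]EFinM lee_wpmul2l//.
  by rewrite lee_fin divr_ge0// ltW.
have Foo : \int[mu]_x (`|F x|%R)%:E < +oo by apply: le_lt_trans (bound 1%R ltr01) (ltry _).
set y := (\int[mu]_x `|F x|)%R.
have yE : \int[mu]_x (`|F x|%R)%:E = y%:E.
  by rewrite /y /Rintegral fineK// ge0_fin_numE// int_ge0.
have iF : mu.-integrable setT (EFin \o F) by exact: int_integrable.
have Fy : (`|\int[mu]_x F x| <= y)%R by exact: le_normr_Rintegral.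
have y0 : (0 <= y)%R by exact: le_trans Fy.
rewrite JE -EFinM lee_fin -(real_normK (num_real _)).
apply: (@le_trans _ _ (y ^+ 2)%R); first by rewrite lerXn2r ?nnegrE.
move: y0; rewrite le_eqVlt => /orP[/eqP <-|y0]; first by rewrite expr0n mulr_ge0// ltW.
have := bound (y / A)%R (divr_gt0 y0 A0); rewrite yE lee_fin invf_div => H2.
have : (y * (2 * y) <= ((y / A * A + A / y * J) / 2) * (2 * y))%R by rewrite ler_pM2r// mulr_gt0.
rewrite (_ : (_ / 2) * _ = y ^+ 2 + A * J)%R; last by field; rewrite !gt_eqF.
by rewrite expr2; lra.
Qed.

End integral_bounds.

(** * Moments of the kernel *)

Section kernel.
Context {R : realType} {d : nat}.
Local Notation V := ('rV[R]_d).
Local Notation mu := (leb R d).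
Local Notation L2 := (L2le (leb R d)).
Variables (r : nat) (K : V -> R) (CK : R).
Hypothesis d1 : (1 <= d)%N.
Hypothesis r1 : (1 <= r)%N.
Hypothesis Kr : kernel_order r K.

Let mK : measurable_fun setT K. Proof. by case: Kr. Qed.

Lemma integrable_monomialK l : (mi_order l <= r)%N -> mu.-integrable setT (EFin \o (fun x => monomial l x * K x)).
Proof.
move=> lr; have [_ K1 Kl] := Kr; have ml := @measurable_monomial R d l.
have [l0|l0] := posnP (mi_order l); last first.
  by apply: integrable_of_fin_integral; [by meas|by apply: Kl; rewrite l0].
apply: (@integrable_of_fin_integral _ _ _ _ _ 1); first by meas.
rewrite -K1; apply: eq_integral => x _; congr (_%:E).
have lz i : l i = 0%N by apply/eqP; rewrite -leqn0 -l0 /mi_order (bigD1 i)//= leq_addr.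
by rewrite (_ : monomial l x = 1) ?mul1r// /monomial big1// => i _; rewrite lz.
Qed.

Lemma norm1_exp_le (x : V) : norm1 x ^+ r <= d%:R ^+ r * \sum_(i < d) `|x ord0 i ^+ r|.
Proof.
pose i0 : 'I_d := Ordinal d1.
have [i Hi] : exists i, forall j, `|x ord0 j| <= `|x ord0 i|.
  have := @Order.TotalTheory.arg_maxP _ _ _ i0 xpredT (fun j => `|x ord0 j|) isT.
  by case => i _ Hi; exists i => j; exact: Hi.
apply: (@le_trans _ _ ((d%:R * `|x ord0 i|) ^+ r)).
  rewrite lerXn2r ?nnegrE ?norm1_ge0 ?mulr_ge0//.
  rewrite /norm1 -[d in d%:R]card_ord -sum1_card natr_sum mulr_suml; apply: ler_sum => j _.
  by rewrite mul1r.
rewrite exprMn ler_wpM2l ?exprn_ge0// (bigD1 i)//= normrX lerDl sumr_ge0//.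
Qed.

(** The weight is dominated by a constant plus the powers [|x_i|^r]; the corresponding moments of
    [K] are integrable by the order conditions for the zero index and for the indices concentrated
    on one axis. *)
Lemma kernel_weight : exists2 kap, 0 < kap &
  (\int[mu]_x (`|K x| * (1 + norm1 x) ^+ r)%:E <= kap%:E)%E.
Proof.
have mn1 := @measurable_norm1 R d.
have mXi i : measurable_fun setT (fun x : V => x ord0 i).
  by apply: measurable_fun_coord; exact: measurable_id.
pose J i := (\int[mu]_x (`|x ord0 i ^+ r * K x|)%:E)%E.
have Joo i : (J i < +oo)%E.
  have /integrableP[_] := integrable_monomialK (l := mi_axis i r) ltac:(by rewrite mi_order_axis).
  by under eq_integral do rewrite /= monomial_axis.
have J0oo : (\int[mu]_x (`|K x|)%:E < +oo)%E.
  have /integrableP[_] := integrable_monomialK (l := fun=> 0%N) ltac:(by rewrite mi_order0).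
  by under eq_integral do rewrite /= monomial0 mul1r.
have le x : `|K x| * (1 + norm1 x) ^+ r <= 2 ^+ r * `|K x| + (2 ^+ r * d%:R ^+ r) * \sum_(i < d) `|x ord0 i ^+ r * K x|.
  have -> : \sum_(i < d) `|x ord0 i ^+ r * K x| = (\sum_(i < d) `|x ord0 i ^+ r|) * `|K x|.
    by rewrite mulr_suml; apply: eq_bigr => i _; rewrite normrM.
  rewrite mulrA -mulrDl mulrC ler_wpM2r//.
  apply: (@le_trans _ _ (2 ^+ r * (1 + norm1 x ^+ r))); last first.
    by rewrite mulrDr mulr1 lerD2l -mulrA ler_wpM2l ?exprn_ge0// norm1_exp_le.
  have n0 := norm1_ge0 x; have [n1|n1] := lerP (norm1 x) 1.
    apply: (@le_trans _ _ (2 ^+ r)); first by rewrite lerXn2r ?nnegrE ?addr_ge0//; lra.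
    by rewrite ler_peMr ?exprn_ge0// lerDl exprn_ge0.
  apply: (@le_trans _ _ (2 ^+ r * norm1 x ^+ r)); last by rewrite ler_wpM2l ?exprn_ge0// lerDr.
  by rewrite -exprMn lerXn2r ?nnegrE ?addr_ge0 ?mulr_ge0//; lra.
have fin : (\int[mu]_x (`|K x| * (1 + norm1 x) ^+ r)%:E < +oo)%E.
  apply: (@le_lt_trans _ _ (\int[mu]_x (2 ^+ r * `|K x| + (2 ^+ r * d%:R ^+ r) * \sum_(i < d) `|x ord0 i ^+ r * K x|)%:E)%E).
    apply: le_int => //; [by meas|by meas|].
    by move=> x; rewrite mulr_ge0// exprn_ge0// addr_ge0// norm1_ge0.
  rewrite intD; [|by meas|by meas| |]; last 2 first.
  - by move=> x; rewrite mulr_ge0// exprn_ge0.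
  - by move=> x; rewrite !mulr_ge0 ?exprn_ge0// sumr_ge0.
  rewrite !intZ ?mulr_ge0 ?exprn_ge0//; [|by meas|by move=> x; exact: sumr_ge0|by meas].
  apply: lte_add_pinfty; first by rewrite lte_mul_pinfty ?lee_fin ?exprn_ge0.
  rewrite lte_mul_pinfty ?lee_fin ?mulr_ge0 ?exprn_ge0//.
  under eq_integral do rewrite -sumEFin.
  rewrite ge0_integral_sum//; last by move=> i; have := mXi i => mX; meas.
  by apply: lte_sum_pinfty => i _; exact: Joo.
exists (fine (\int[mu]_x (`|K x| * (1 + norm1 x) ^+ r)%:E)%E + 1); first rewrite ltr_wpDl// fine_ge0//.
  by apply: int_ge0 => x; rewrite mulr_ge0// exprn_ge0// addr_ge0// norm1_ge0.
rewrite EFinD fineK; first by rewrite leeDl.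
rewrite ge0_fin_numE//; apply: int_ge0 => x.
by rewrite mulr_ge0// exprn_ge0// addr_ge0// norm1_ge0.
Qed.

(** A kernel of order [r] reproduces polynomials of degree at most [r]: the non-constant monomials
    integrate to 0 and the constant term is what remains at [t = 0]. *)
Lemma poly_moment (A : set (V -> R)) k P (x : V) (h : R) : (k <= r)%N -> poly_le A k P ->
  mu.-integrable setT (EFin \o (fun z => K z * P x (h *: z))) /\
  (\int[mu]_z (K z * P x (h *: z))%:E = (P x 0)%:E)%E.
Proof.
move=> kr; elim=> [|a l Aa lk|P1 P2 _ [i1 I1] _ [i2 I2]].
- under eq_fun do rewrite mulr0; under eq_integral do rewrite mulr0.
  by rewrite integral0; split => //; exact: integrable0.
- have lr := leq_trans lk kr.
  have iK := integrable_monomialK lr.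
  have E z : K z * (a x * monomial l (h *: z)) = (a x * h ^+ mi_order l) * (monomial l z * K z).
    by rewrite monomialZ; ring.
  under eq_fun do rewrite E; under eq_integral do rewrite E EFinM.
  split; first exact: integrableZ_real.
  rewrite integralZl//; have [_ K1 Kl] := Kr; have [l0|l0] := posnP (mi_order l); last first.
    rewrite Kl ?l0// mule0 -(scale0r (0 : V)) monomialZ expr0n (gtn_eqF l0) mul0r mulr0//.
  have lz i : l i = 0%N by apply/eqP; rewrite -leqn0 -l0 /mi_order (bigD1 i)//= leq_addr.
  have m1 z : monomial l z = 1 :> R by rewrite /monomial big1// => i _; rewrite lz.
  rewrite l0 expr0 mulr1 m1 mulr1; under eq_integral do rewrite m1 mul1r.
  by rewrite K1 mule1.
- have E z : K z * (P1 x (h *: z) + P2 x (h *: z)) = K z * P1 x (h *: z) + K z * P2 x (h *: z) by rewrite mulrDr.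
  under eq_fun do rewrite E; under eq_integral do rewrite E EFinD.
  split; first exact: integrableD_real.
  by rewrite integralD// I1 I2.
Qed.

End kernel.

Section integral_bounds_real.
Context {R : realType} d (T : measurableType d) (mu : {measure set T -> \bar R}).

Lemma integrable_le (F G : T -> R) c : measurable_fun setT F -> measurable_fun setT G ->
  (forall x, `|F x| <= G x) -> (\int[mu]_x (G x)%:E <= c%:E)%E -> mu.-integrable setT (EFin \o F).
Proof.
move=> mF mG FG Gc; apply: int_integrable => //; apply: le_lt_trans (ltry c).
by apply: le_trans Gc; apply: le_int => //; meas.
Qed.

Lemma Rintegral_le_bound (F G : T -> R) c : measurable_fun setT F -> measurable_fun setT G ->
  (forall x, `|F x| <= G x) -> (\int[mu]_x (G x)%:E <= c%:E)%E -> `|\int[mu]_x F x| <= c.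
Proof.
move=> mF mG FG Gc; have iF := integrable_le mF mG FG Gc.
apply: le_trans (le_normr_Rintegral _ iF) _ => //.
have H : (\int[mu]_x (`|F x|)%:E <= c%:E)%E by apply: le_trans Gc; apply: le_int => //; meas.
rewrite -lee_fin /Rintegral fineK// ge0_fin_numE ?int_ge0//.
exact: le_lt_trans H (ltry _).
Qed.

End integral_bounds_real.

(** * Smoothing by the kernel and its bias *)

Section convolution.
Context {R : realType} {d : nat}.
Local Notation V := ('rV[R]_d).
Local Notation mu := (leb R d).
Local Notation L2 := (L2le (leb R d)).

Lemma int_affine_signed (a : R) (u : V) (g : V -> R) : a != 0 -> measurable_fun setT g ->
  (\int[mu]_x (g (a *: x + u))%:E = (`|a| ^- d)%:E * \int[mu]_x (g x)%:E)%E.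
Proof.
move=> a0 mg.
have mgp : measurable_fun setT g^\+ by exact: measurable_funrpos.
have mgn : measurable_fun setT g^\- by exact: measurable_funrneg.
have Ep (k : V -> R) : (fun x => (k x)%:E)^\+%E = (fun x => (k^\+ x)%:E).
  by apply/funext => x; rewrite funeposE /funrpos /= EFin_max.
have En (k : V -> R) : (fun x => (k x)%:E)^\-%E = (fun x => (k^\- x)%:E).
  by apply/funext => x; rewrite funenegE /funrneg /= EFin_max EFinN.
rewrite integralE [in RHS]integralE !Ep !En.
rewrite (int_affine u a0 mgp); last by move=> x; exact: funrpos_ge0.
rewrite (int_affine u a0 mgn); last by move=> x; exact: funrneg_ge0.
have c0 : 0 < `|a| ^- d by rewrite invr_gt0 exprn_gt0// normr_gt0.
case: (\int[mu]_x (g^\+ x)%:E)%E => [p| |]; case: (\int[mu]_x (g^\- x)%:E)%E => [q| |] //;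
  rewrite ?gt0_muley ?gt0_muleNy ?lte_fin//= ?gt0_muley ?gt0_muleNy ?lte_fin//.
by rewrite -[(p%:E - q%:E)%E]EFinB -!EFinM -EFinB mulrBr.
Qed.

Variables (K : V -> R) (kap : R) (r : nat).
Hypothesis mK : measurable_fun setT K.
Hypothesis kap0 : 0 < kap.
Hypothesis Kw : (\int[mu]_x (`|K x| * (1 + norm1 x) ^+ r)%:E <= kap%:E)%E.

(** Convolution after the substitution [y = x + h z], the form in which a Taylor expansion at [x]
    can be inserted. *)
Definition ksmooth (g : V -> R) (h : R) (x : V) : R := (\int[mu]_z (K z * g (x + h *: z)))%R.

Lemma measurable_ksmooth (g : V -> R) h : measurable_fun setT g -> measurable_fun setT (ksmooth g h).
Proof.
move=> mg; apply: (@measurable_fun_Rintegral _ _ _ _ _ mu (fun x z : V => K z * g (x + h *: z))).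
by meas.
Qed.

Lemma kernel_L1 : (\int[mu]_x (`|K x|)%:E <= kap%:E)%E.
Proof.
have mn1 := @measurable_norm1 R d.
apply: le_trans Kw; apply: le_int => //; [by meas|by meas|].
by move=> x; rewrite ler_peMr// exprn_ege1// lerDl norm1_ge0.
Qed.

(** Young's inequality: Cauchy-Schwarz in [z] with weight [|K|], then Tonelli and translation
    invariance. Each of the two steps costs a factor [kap]. *)
Lemma ksmooth_L2 g h c : L2 g c -> L2 (ksmooth g h) (kap * c).
Proof.
move=> [mg c0 gc]; split; [exact: measurable_ksmooth|by rewrite mulr_ge0// ltW|].
have mF : measurable_fun [set: V * V] (fun p => `|K p.2| * g (p.1 + h *: p.2) ^+ 2) by meas.
have nn x z : 0 <= `|K z| * g (x + h *: z) ^+ 2 by rewrite mulr_ge0 ?sqr_ge0.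
apply: (@le_trans _ _ (\int[mu]_x (kap%:E * \int[mu]_z (`|K z| * g (x + h *: z) ^+ 2)%:E))%E).
  apply: ge0_le_integral => //.
  - by move=> x _; rewrite lee_fin sqr_ge0.
  - by have mc := measurable_ksmooth h mg; meas.
  - by apply: measurable_funeM; apply: (@measurable_fun_integral _ _ _ _ _ mu (fun x z : V => (`|K z| * g (x + h *: z) ^+ 2)%:E)); apply/measurable_EFinP.
  - move=> x _; apply: (cauchy_schwarz_weighted (om := fun z => `|K z|)) => //; [by meas|by meas|by meas| |exact: kernel_L1].
    by move=> z; rewrite exprMn -(real_normK (num_real (K z))) [`|K z| ^+ 2]expr2 -mulrA.
rewrite ge0_integralZl_EFin ?(ltW kap0)//; last 2 first.
- by move=> x _; exact: int_ge0.
- by apply: (@measurable_fun_integral _ _ _ _ _ mu (fun x z : V => (`|K z| * g (x + h *: z) ^+ 2)%:E)); apply/measurable_EFinP.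
rewrite exprMn expr2 -mulrA EFinM lee_pmul2l// int_tonelli//.
apply: (@le_trans _ _ (\int[mu]_z ((c ^+ 2) * `|K z|)%:E)%E).
  apply: ge0_le_integral => //.
  - by move=> z _; apply: int_ge0.
  - apply: (@measurable_fun_integral _ _ _ _ _ mu (fun z x : V => (`|K z| * g (x + h *: z) ^+ 2)%:E)); apply/measurable_EFinP; meas.
  - by meas.
  - move=> z _; rewrite intZ//; [|by meas|by move=> x; exact: sqr_ge0].
    rewrite mulrC EFinM lee_wpmul2l//.
    rewrite (int_translate (h *: z) (g := fun x => g x ^+ 2))//; first by meas.
    by move=> x; exact: sqr_ge0.
rewrite intZ ?sqr_ge0//; last by meas.
rewrite [leRHS](_ : _ = (c ^+ 2)%:E * kap%:E)%E; last by rewrite -EFinM mulrC.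
by rewrite lee_wpmul2l ?kernel_L1// lee_fin sqr_ge0.
Qed.

Lemma ksmooth_change (g : V -> R) h x : 0 < h -> measurable_fun setT g ->
  mu.-integrable setT (EFin \o (fun z => K z * g (x + h *: z))) ->
  \int[mu]_y ((h ^+ d)^-1 * K (h^-1 *: (y - x)) * g y) = ksmooth g h x.
Proof.
move=> h0 mg iKg; have hn0 : h != 0 by rewrite gt_eqF.
pose G y := (h ^+ d)^-1 * K (h^-1 *: (y - x)) * g y.
have mG : measurable_fun setT G by rewrite /G; meas.
have := int_affine_signed x hn0 mG; rewrite (gtr0_norm h0).
under eq_integral => z _.
  rewrite (_ : G (h *: z + x) = (h ^+ d)^-1 * (K z * g (x + h *: z))); last first.
    by rewrite /G addrK scalerA mulVf// scale1r -mulrA (addrC x).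
  rewrite EFinM; over.
rewrite integralZl// => H.
rewrite /ksmooth /Rintegral; congr fine.
transitivity ((h ^+ d)%:E * ((h ^- d)%:E * \int[mu]_y (G y)%:E))%E.
  by rewrite muleA -EFinM divff ?expf_neq0// mul1e.
by rewrite -H muleA -EFinM divff ?expf_neq0// mul1e.
Qed.

Lemma ksmooth_bound (g : V -> R) h (M : R) x : measurable_fun setT g -> (forall y, `|g y| <= M) ->
  `|ksmooth g h x| <= M * kap.
Proof.
move=> mg gM; have M0 : 0 <= M by exact: le_trans (gM 0).
apply: (@Rintegral_le_bound _ _ _ _ _ (fun z => M * `|K z|)); [by meas|by meas| |].
  by move=> z; rewrite normrM mulrC ler_wpM2r.
rewrite intZ//; last by meas.
by rewrite EFinM lee_wpmul2l ?lee_fin// kernel_L1.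
Qed.

(** From [|w| <= 1 + w^2] the integrand is dominated by [|K| + CK w^2]. This gives integrability at
    every [x], so that smoothed functions can be manipulated pointwise. *)
Lemma integrable_ksmooth (w : V -> R) (c CK h : R) x : 0 < h -> L2 w c -> (forall z, `|K z| <= CK) ->
  mu.-integrable setT (EFin \o (fun z => K z * w (x + h *: z))).
Proof.
move=> h0 [mw c0 wc] KCK; have CK0 : 0 <= CK by exact: le_trans (KCK 0).
apply: (@integrable_le _ _ _ _ _ (fun z => `|K z| + CK * w (x + h *: z) ^+ 2) (kap + CK * (h ^- d * c ^+ 2))); [by meas|by meas| |].
  move=> z; rewrite normrM; apply: (@le_trans _ _ (`|K z| * (1 + w (x + h *: z) ^+ 2))).
    rewrite ler_wpM2l// -(real_normK (num_real (w _))).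
    by have := sqr_ge0 (`|w (x + h *: z)| - 1); nra.
  by rewrite mulrDr mulr1 lerD2l ler_wpM2r ?sqr_ge0.
rewrite intD; [|by meas|by meas|by []|by move=> z; rewrite mulr_ge0 ?sqr_ge0].
rewrite EFinD leeD ?kernel_L1// intZ//; [|by meas|by move=> z; exact: sqr_ge0].
rewrite EFinM lee_wpmul2l//.
under eq_integral do rewrite addrC.
rewrite (int_affine x (g := fun y => w y ^+ 2)) ?gt_eqF//; [|by meas|by move=> y; exact: sqr_ge0].
by rewrite (gtr0_norm h0) EFinM lee_wpmul2l// lee_fin invr_ge0 exprn_ge0 ?(ltW h0).
Qed.

Hypothesis Kr : kernel_order r K.

Lemma integrableK_bounded (g : V -> R) (M : R) : measurable_fun setT g -> (forall y, `|g y| <= M) ->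
  mu.-integrable setT (EFin \o (fun z => K z * g z)).
Proof.
move=> mg gM; have M0 : 0 <= M by exact: le_trans (gM 0).
apply: (@integrable_le _ _ _ _ _ (fun z => M * `|K z|) (M * kap)); [by meas|by meas| |].
  by move=> z; rewrite normrM mulrC ler_wpM2r.
rewrite intZ//; last by meas.
by rewrite EFinM lee_wpmul2l ?lee_fin// kernel_L1.
Qed.

Lemma ksmooth_taylor_sup (A : set (V -> R)) (f : V -> R) (M D : R) k P h x : (k <= r)%N -> poly_le A k P ->
  A `<=` (fun a => measurable_fun setT a) ->
  measurable_fun setT f -> (forall y, `|f y| <= M) -> 0 <= D -> 0 <= h ->
  (forall t, `|f (x + t) - P x t| <= D * norm1 t ^+ r) -> P x 0 = f x ->
  `|ksmooth f h x - f x| <= D * kap * h ^+ r.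
Proof.
move=> kr HP Am mf fM D0 h0 HD Px0.
have mn1 := @measurable_norm1 R d.
have mP := measurable_poly_le Am HP.
have [iP IP] := poly_moment Kr x h kr HP.
have mPx : measurable_fun setT (fun z : V => P x (h *: z)).
  by apply: (@measurable_fun2_comp _ _ _ _ _ _ _ _ P (fun=> x) (fun z : V => h *: z) mP); meas.
have iF : mu.-integrable setT (EFin \o (fun z => K z * f (x + h *: z))).
  apply: (@integrableK_bounded (fun z => f (x + h *: z)) M); first by meas.
  by move=> z; exact: fM.
have -> : ksmooth f h x - f x = \int[mu]_z (K z * (f (x + h *: z) - P x (h *: z))).
  rewrite -Px0 [P x 0](_ : _ = \int[mu]_z (K z * P x (h *: z))); last by rewrite /Rintegral IP.
  rewrite /ksmooth -RintegralB//; apply: eq_Rintegral => z _.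
  by rewrite mulrBr.
apply: (@Rintegral_le_bound _ _ _ _ _ (fun z => D * h ^+ r * (`|K z| * (1 + norm1 z) ^+ r))); [by meas|by meas| |].
  move=> z; rewrite normrM mulrCA ler_wpM2l//; apply: le_trans (HD _) _.
  rewrite norm1Z ger0_norm// exprMn -mulrA ler_wpM2l// ler_wpM2l ?exprn_ge0//.
  by rewrite lerXn2r ?nnegrE ?norm1_ge0 ?addr_ge0 ?norm1_ge0// lerDr.
rewrite intZ ?mulr_ge0 ?exprn_ge0//; [|by meas|by move=> z; rewrite mulr_ge0// exprn_ge0// addr_ge0// norm1_ge0].
rewrite [leRHS](_ : _ = (D * h ^+ r)%:E * kap%:E)%E; last by rewrite -EFinM mulrAC.
by rewrite lee_wpmul2l ?lee_fin ?mulr_ge0 ?exprn_ge0.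
Qed.

(** The kernel reproduces [P], so only the remainder is smoothed. The factor 4 consists of a 2 for
    the two powers in the bound and a 2 from [L2leD]. *)
Lemma ksmooth_taylor_L2 (w : V -> R) (c CK D s : R) k P h : (k <= r)%N ->
  poly_le (fun a => measurable_fun setT a) k P -> L2 w c -> (forall x, `|K x| <= CK) ->
  0 <= D -> 0 < h <= 1 -> 0 < s <= r%:R ->
  (forall t, L2 (fun x => w (x + t) - P x t) (D * (norm1 t `^ s + norm1 t ^+ r))) ->
  L2 (fun x => ksmooth w h x - w x) (4 * D * kap * h `^ s).
Proof.
move=> kr HP Lw KCK D0 /andP[h0 h1] /andP[s0 sr] HD.
have mn1 := @measurable_norm1 R d.
have [mw c0 wc] := Lw.
have mP : measurable_fun setT (fun p : V * V => P p.1 p.2) by exact: measurable_poly_le HP.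
have CK0 : 0 <= CK by exact: le_trans (KCK 0).
have h0' := ltW h0.
(* At [t = 0] the bound is 0, since [s] and [r] are positive; hence [P x 0] and [w x] agree as
   elements of L2. *)
have L0 : L2 (fun x => P x 0 - w x) 0.
  have r0 : (0 < r)%N by rewrite -(ltr_nat R); exact: lt_le_trans sr.
  have E0 : (0 : R) `^ s + 0 ^+ r = 0 by rewrite powR0 ?gt_eqF// expr0n (gtn_eqF r0) addr0.
  have := HD 0; rewrite norm10 E0 mulr0 => H; apply: L2le_dom H.
    have mP0 : measurable_fun setT (fun x => P x 0) by apply: (measurable_fun2_comp (F := P) mP); meas.
    by meas.
  by move=> x; rewrite addr0 distrC.
have iw x := integrable_ksmooth x h0 Lw KCK.
have E x : ksmooth w h x - P x 0 = \int[mu]_z (K z * (w (x + h *: z) - P x (h *: z))).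
  have [iP IP] := poly_moment Kr x h kr HP.
  rewrite [P x 0](_ : _ = \int[mu]_z (K z * P x (h *: z))); last by rewrite /Rintegral IP.
  rewrite /ksmooth -RintegralB//; apply: eq_Rintegral => z _.
  by rewrite mulrBr.
have n0 (z : V) : 0 < (1 + norm1 z) ^+ r by rewrite exprn_gt0// ltr_pwDl// norm1_ge0.
(* The weight [(1 + norm1 z)^r] is put on one side of Cauchy-Schwarz and divided out on the other;
   the squared remainder, of order [(1 + norm1 z)^(2 r)], then leaves the integrable
   [|K| (1 + norm1 z)^r] on both sides. *)
pose u (x z : V) := `|K z| / (1 + norm1 z) ^+ r * (w (x + h *: z) - P x (h *: z)) ^+ 2.
have mu_ : measurable_fun setT (fun p : V * V => u p.1 p.2).
  have mP' : measurable_fun setT (fun p : V * V => P p.1 (h *: p.2)).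
    by apply: (measurable_fun2_comp (F := P) mP); meas.
  by rewrite /u; meas.
have u0 x z : 0 <= u x z by rewrite mulr_ge0 ?sqr_ge0// divr_ge0// ltW.
have LE : L2 (fun x => ksmooth w h x - P x 0) (2 * D * kap * h `^ s).
  have mP0 : measurable_fun setT (fun x => P x 0) by apply: (measurable_fun2_comp (F := P) mP); meas.
  have mc := measurable_ksmooth h mw.
  split; [by meas|by rewrite !mulr_ge0 ?powR_ge0// ltW|].
  apply: (@le_trans _ _ (\int[mu]_x (kap%:E * \int[mu]_z (u x z)%:E))%E).
    apply: ge0_le_integral => //.
    - by move=> x _; rewrite lee_fin sqr_ge0.
    - by meas.
    - by apply: measurable_funeM; apply: (@measurable_fun_integral _ _ _ _ _ mu (fun x z : V => (u x z)%:E)); apply/measurable_EFinP.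
    - move=> x _; rewrite E.
      have mPx : measurable_fun setT (fun z : V => P x (h *: z)).
        by apply: (@measurable_fun2_comp _ _ _ _ _ _ _ _ P (fun=> x) (fun z : V => h *: z) mP); meas.
      apply: (cauchy_schwarz_weighted (om := fun z => `|K z| * (1 + norm1 z) ^+ r)) => //; [by meas|by meas| | |].
      + by apply: (measurable_fun2_comp (F := u) mu_); meas.
      + by move=> z; rewrite mulr_ge0// ltW.
      + move=> z; rewrite /u exprMn -[in leLHS](real_normK (num_real (K z))).
        rewrite [leRHS](_ : _ = `|K z| ^+ 2 * (w (x + h *: z) - P x (h *: z)) ^+ 2) ?lexx//.
        by field; rewrite gt_eqF// ltr_pwDl// norm1_ge0.
  rewrite ge0_integralZl_EFin ?(ltW kap0)//; last 2 first.
  - by move=> x _; exact: int_ge0.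
  - by apply: (@measurable_fun_integral _ _ _ _ _ mu (fun x z : V => (u x z)%:E)); apply/measurable_EFinP.
  rewrite int_tonelli//.
  apply: (@le_trans _ _ (kap%:E * \int[mu]_z ((2 * D * h `^ s) ^+ 2 * (`|K z| * (1 + norm1 z) ^+ r))%:E)%E).
    rewrite lee_pmul2l//; apply: ge0_le_integral => //.
    - by move=> z _; apply: int_ge0.
    - apply: (@measurable_fun_integral _ _ _ _ _ mu (fun z x : V => (u x z)%:E)); apply/measurable_EFinP.
      by apply: (measurable_fun2_comp (F := u) mu_); meas.
    - by meas.
    - move=> z _; rewrite /u intZ//; last 3 first.
      + have [m1 _ _] := HD (h *: z); by apply: measurable_funX.
      + by rewrite divr_ge0// ltW.
      + by move=> x; exact: sqr_ge0.
      have [_ cz Hz] := HD (h *: z).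
      apply: le_trans (lee_wpmul2l _ Hz) _; first by rewrite lee_fin divr_ge0// ltW.
      rewrite -EFinM lee_fin.
      have bz : D * (norm1 (h *: z) `^ s + norm1 (h *: z) ^+ r) <= 2 * D * h `^ s * (1 + norm1 z) ^+ r.
        rewrite norm1Z (gtr0_norm h0) powRM ?norm1_ge0// exprMn.
        have z1 : 1 <= 1 + norm1 z by rewrite lerDl norm1_ge0.
        have h1' : norm1 z `^ s <= (1 + norm1 z) ^+ r.
          apply: (@le_trans _ _ ((1 + norm1 z) `^ s)).
            by rewrite ge0_ler_powR ?nnegrE ?norm1_ge0 ?addr_ge0 ?norm1_ge0 ?lerDr// ltW.
          by rewrite -powR_mulrn ?addr_ge0 ?norm1_ge0//; exact: ler_powR.
        have h2 : norm1 z ^+ r <= (1 + norm1 z) ^+ r.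
          by rewrite lerXn2r ?nnegrE ?norm1_ge0 ?addr_ge0 ?norm1_ge0// lerDr.
        have h3 : h ^+ r <= h `^ s.
          by rewrite -powR_mulrn//; apply: ger_powR => //; rewrite h0.
        rewrite (_ : 2 * D * _ * _ = D * (h `^ s * (1 + norm1 z) ^+ r + h `^ s * (1 + norm1 z) ^+ r)); last by ring.
        rewrite ler_wpM2l// lerD//; first by rewrite ler_wpM2l// powR_ge0.
        by rewrite ler_pM ?exprn_ge0 ?norm1_ge0.
      apply: (@le_trans _ _ (`|K z| / (1 + norm1 z) ^+ r * (2 * D * h `^ s * (1 + norm1 z) ^+ r) ^+ 2)).
        by rewrite ler_wpM2l ?divr_ge0 ?(ltW (n0 z))// lerXn2r ?nnegrE// (le_trans cz).
      by rewrite exprMn [leRHS](_ : _ = `|K z| / (1 + norm1 z) ^+ r * ((2 * D * h `^ s) ^+ 2 * (1 + norm1 z) ^+ r ^+ 2))//; field; rewrite gt_eqF// ltr_pwDl// norm1_ge0.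
  rewrite intZ ?sqr_ge0//; [|by meas|by move=> z; rewrite mulr_ge0// ltW].
  apply: (@le_trans _ _ (kap%:E * (((2 * D * h `^ s) ^+ 2)%:E * kap%:E))%E).
    by rewrite lee_pmul2l// lee_wpmul2l// lee_fin sqr_ge0.
  by rewrite -!EFinM lee_fin [leLHS](_ : _ = (2 * D * kap * h `^ s) ^+ 2)//; ring.
have := L2leD LE L0; rewrite addr0 (_ : 2 * (_) = 4 * D * kap * h `^ s); last by ring.
by congr L2le; apply/funext => x; rewrite subrKA.
Qed.

End convolution.

(** * The law of the sample and the resampling identity *)

Section resampling.
Context {disp : measure_display} {Omega : measurableType disp} {R : realType}.
Variable P : probability Omega R.
Context {d' : measure_display} {T : measurableType d'}.
Variable n : nat.
Local Notation S := 'rV[T]_n.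

Definition upd (v : S) (i : 'I_n) (x : T) : S := \row_j (if j == i then x else v ord0 j).

Lemma updE v i x j : upd v i x ord0 j = if j == i then x else v ord0 j.
Proof. by rewrite mxE. Qed.

Lemma upd_same v i x : upd v i x ord0 i = x.
Proof. by rewrite mxE eqxx. Qed.

Lemma upd_other v i x j : j != i -> upd v i x ord0 j = v ord0 j.
Proof. by move=> /negPf ji; rewrite mxE ji. Qed.

Lemma measurable_upd i : measurable_fun [set: S * T] (fun p => upd p.1 i p.2).
Proof. by rewrite /upd; meas. Qed.

Variable X : nat -> {RV P >-> T}.

Definition sample (w : Omega) : S := \row_j X j w.

Lemma measurable_sample : measurable_fun setT sample.
Proof. by rewrite /sample; apply: measurable_fun_rowP => j. Qed.

HB.instance Definition _ := isMeasurableFun.Build _ _ _ _ sample measurable_sample.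

Definition sample_law : probability S R := distribution P (sample : {mfun Omega >-> S}).

Definition box (A : 'I_n -> set T) : set S := [set v | forall j, A j (v ord0 j)].

Lemma measurable_box A : (forall j, measurable (A j)) -> measurable (box A).
Proof.
move=> mA; rewrite (_ : box A = \bigcap_(j in [set: 'I_n]) (rV_coord j @^-1` A j)); last first.
  by apply/seteqP; split => [v h j _|v h j]; [exact: h|exact: (h j I)].
apply: fin_bigcap_measurable => // j _.
by rewrite -[X in measurable X]setTI; exact: measurable_rV_coord.
Qed.

Lemma box_generates :
  measurable = <<s [set B : set S | exists2 A, (forall j, measurable (A j)) & B = box A] >>.
Proof.
apply/seteqP; split; last first.
  apply: smallest_sub; first exact: sigma_algebra_measurable.
  by move=> B [A mA ->]; exact: measurable_box.
apply: smallest_sub; first exact: smallest_sigma_algebra.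
rewrite -bigcup_seq/=; apply: bigcup_sub => i _ B [C mC <-].
apply: sub_sigma_algebra; exists (fun j => if j == i then C else setT).
  by move=> j; case: ifP.
rewrite setTI; apply/seteqP; split => [v h j|v h]; first by case: eqVneq => [->|].
by have := h i; rewrite eqxx.
Qed.

Lemma measure_rV_eq (m1 m2 : {measure set S -> \bar R}) : (m1 setT < +oo)%E ->
  (forall A, (forall j, measurable (A j)) -> m1 (box A) = m2 (box A)) ->
  forall B, measurable B -> m1 B = m2 B.
Proof.
move=> m1oo H.
apply: (measure_unique _ (fun=> setT) box_generates) => //.
- move=> B C [A mA ->] [A' mA' ->]; exists (fun j => A j `&` A' j).
    by move=> j; exact: measurableI.
  by apply/seteqP; split => [v [h h'] j|v h]; [split; [exact: h|exact: h']|split => j; case: (h j)].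
- by move=> _; exists (fun=> setT) => //; apply/seteqP; split.
- by rewrite bigcup_const//; exists 0%N.
- by move=> B [A mA ->]; exact: H.
Qed.

Hypothesis X_iid : iid X.

Let mu := distribution P (X 0%N).

Lemma prob_box (A : 'I_n -> set T) : (forall j, measurable (A j)) ->
  sample_law (box A) = (\prod_(j < n) mu (A j))%E.
Proof.
move=> mA; rewrite -[LHS]/(P (sample @^-1` box A)); move: mA.
have [ind id] := X_iid => mA.
pose A' (j : nat) := if insub j is Some i then A i else setT.
have A'E (i : 'I_n) : A' i = A i by rewrite /A' valK.
have mA' j : measurable (A' j) by rewrite /A'; case: insub.
have := ind (iota 0 n) A' (iota_uniq _ _) mA'.
have -> : \bigcap_(j in [set` iota 0 n]) (X j @^-1` A' j) = sample @^-1` box A.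
  apply/seteqP; split => [w h j|w h j] /=; first by rewrite mxE -A'E; apply: (h j); rewrite /= mem_iota /=.
  rewrite mem_iota /= add0n => jn; have := h (Ordinal jn); rewrite mxE -A'E; exact.
move=> ->; rewrite (_ : iota 0 n = index_iota 0 n) ?big_mkord; last by rewrite /index_iota subn0.
 apply: eq_bigr => i _.
by rewrite A'E /mu (id 0%N i).
Qed.

(** Replacing one coordinate by an independent draw preserves the law of the sample: both laws agree
    on boxes by independence, and boxes are stable under intersection and generate the
    sigma-algebra. *)
Lemma resample (F : S -> \bar R) i : measurable_fun setT F -> (forall v, 0 <= F v)%E ->
  (\int[sample_law]_v F v = \int[sample_law]_v \int[mu]_x F (upd v i x))%E.
Proof.
move=> mF F0.
pose G (p : S * T) := upd p.1 i p.2.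
have mG : measurable_fun setT G := @measurable_upd i.
have key B : measurable B -> sample_law B = pushforward (sample_law \x mu)%E G B.
  apply: (measure_rV_eq (m1 := sample_law) (m2 := pushforward (sample_law \x mu)%E G)).
    by apply: (@le_lt_trans _ _ 1%:E); [exact: probability_le1|exact: ltry].
  move=> A mA; rewrite /pushforward; 
  pose A' j := if j == i then setT else A j.
  have mA' j : measurable (A' j) by rewrite /A'; case: ifP.
  have E : G @^-1` box A = box A' `*` A i.
    apply/seteqP; split => [[v x] /= h|[v x] /= [h hi] j].
      split; last by have := h i; rewrite upd_same.
      by move=> j; rewrite /A'; case: eqVneq => // ji; have := h j; rewrite /G /= upd_other.
    by rewrite /G /= updE; case: eqVneq => [->//|ji]; have := h j; rewrite /A' (negPf ji).
  rewrite -[RHS]/((sample_law \x mu)%E (G @^-1` box A)) E product_measure1E//; last exact: measurable_box.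
  apply: etrans (prob_box mA) _; rewrite [X in _ = (X * _)%E](prob_box mA').
  have mu1 : mu setT = 1%E by exact: (@probability_setT _ _ _ (distribution P (X 0%N))).
  rewrite (bigD1 i)//= [in RHS](bigD1 i)//= {1}/A' eqxx mu1 mul1e muleC; congr (_ * _)%E.
  by apply: eq_bigr => j ji; rewrite /A' (negPf ji).
transitivity (\int[pushforward (sample_law \x mu)%E G]_v F v)%E.
  apply: eq_measure_integral => B mB _; exact: key.
rewrite ge0_integral_pushforward//.
rewrite preimage_setT; apply: (@fubini_tonelli1 _ _ _ _ _ sample_law mu (F \o G)).
  exact: measurableT_comp.
by move=> p; exact: F0.
Qed.

End resampling.

(** * Elementary exponential inequalities *)

Section exponential_bounds.
Context {R : realType}.
Implicit Types x y : R.

(** From [1 - y <= exp (- y)] one gets [exp y * (1 - y) <= 1], while [(1 + y + 2 y^2) (1 - y) - 1 =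
    y^2 (1 - 2 y)] is nonnegative. *)
Lemma expR_le_quad y : `|y| <= 2^-1 -> expR y <= 1 + y + 2 * y ^+ 2.
Proof.
rewrite ler_norml => /andP[y1 y2].
have y0 : 0 < 1 - y by lra.
have h := expR_ge1Dx (- y).
have e0 := expR_gt0 y; have e1 := expRxMexpNx_1 y.
rewrite -(@ler_pM2r _ (1 - y))//.
have h1 : expR y * (1 - y) <= 1 by rewrite -[leRHS]e1 ler_wpM2l// ltW.
apply: le_trans h1 _; rewrite -subr_ge0.
rewrite (_ : _ - _ = y ^+ 2 * (1 - 2 * y)); last by ring.
by rewrite mulr_ge0 ?sqr_ge0//; lra.
Qed.

Lemma expr_le_fact_expR m x : 0 <= x -> x ^+ m <= m`!%:R * expR x.
Proof.
move=> x0; case: m => [|m]; first by rewrite expr0 fact0 mul1r -expR0 ler_expR.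
have := expR_ge1Dxn m x0 => h.
rewrite -ler_pdivrMl ?ltr0n ?fact_gt0// mulrC; apply: le_trans h.
by rewrite lerDr.
Qed.

Lemma expr_even_le_expR m y : y ^+ (2 * m) <= (2 * m)`!%:R * (expR y + expR (- y)).
Proof.
have e1 := expR_ge0 y; have e2 := expR_ge0 (- y).
have f0 : 0 <= (2 * m)`!%:R :> R by [].
have [y0|y0] := leP 0 y.
  by apply: le_trans (expr_le_fact_expR _ y0) _; rewrite ler_wpM2l// lerDl.
rewrite (_ : y ^+ (2 * m) = (- y) ^+ (2 * m)); last by rewrite !exprM sqrrN.
apply: le_trans (expr_le_fact_expR (2 * m) (x := - y) _) _; first by rewrite oppr_ge0 ltW.
by rewrite ler_wpM2l// lerDr.
Qed.

Lemma half_pow_le2 n : (1 + (2 * n%:R)^-1) ^+ n <= 2 :> R.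
Proof.
case: n => [|n]; first by rewrite expr0 ler1n.
have n0 : 0 < n.+1%:R :> R by rewrite ltr0n.
apply: (@le_trans _ _ (expR (2 * n.+1%:R)^-1 ^+ n.+1)).
  by rewrite lerXn2r ?nnegrE ?addr_ge0 ?invr_ge0 ?mulr_ge0 ?expR_ge0// expR_ge1Dx.
rewrite -expRM_natl [X in expR X](_ : _ = 2^-1); last by rewrite invfM mulrCA divff ?mulr1// gt_eqF.
by apply: le_trans (expR_le_quad _) _; rewrite ?ger0_norm//; lra.
Qed.

End exponential_bounds.

(** * L1 bounds and second moments of sums *)

Section L1.
Context {R : realType} d (T : measurableType d) (mu : {measure set T -> \bar R}).
Implicit Types f g : T -> R.

Definition L1le g (c : R) := [/\ measurable_fun setT g, 0 <= c & (\int[mu]_x (`|g x|)%:E <= c%:E)%E].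

Lemma L1leW g c c' : L1le g c -> c <= c' -> L1le g c'.
Proof.
by move=> [mg c0 gc] cc'; split => //; [exact: le_trans cc'|apply: le_trans gc _; rewrite lee_fin].
Qed.

Lemma L1le_dom f g c : measurable_fun setT f -> (forall x, `|f x| <= `|g x|) -> L1le g c -> L1le f c.
Proof. by move=> mf fg [mg c0 gc]; split => //; apply: le_trans gc; apply: le_int => //; meas. Qed.

Lemma L1leD f g c c' : L1le f c -> L1le g c' -> L1le (fun x => f x + g x) (c + c').
Proof.
move=> [mf c0 fc] [mg c'0 gc]; split; [by meas|exact: addr_ge0|].
apply: (@le_trans _ _ (\int[mu]_x (`|f x| + `|g x|)%:E)%E).
  by apply: le_int; [by meas|by meas|by []|by move=> x; exact: ler_normD].
by rewrite intD//; [rewrite EFinD leeD|by meas|by meas].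
Qed.

Lemma L1leZ a g c : L1le g c -> L1le (fun x => a * g x) (`|a| * c).
Proof.
move=> [mg c0 gc]; split; [by meas|by rewrite mulr_ge0|].
under eq_integral do rewrite normrM.
by rewrite intZ//; [rewrite EFinM lee_wpmul2l|by meas].
Qed.

Lemma L1leZn a a' g c : 0 <= a <= a' -> L1le g c -> L1le (fun x => a * g x) (a' * c).
Proof.
move=> /andP[a0 aa'] Lg; have [_ c0 _] := Lg.
by apply: L1leW (L1leZ a Lg) _; rewrite ger0_norm// ler_wpM2r.
Qed.

Lemma L1le_dom2 (a b : R) f g g' c c' : 0 <= a -> 0 <= b -> measurable_fun setT f ->
  (forall x, `|f x| <= a * `|g x| + b * `|g' x|) -> L1le g c -> L1le g' c' -> L1le f (a * c + b * c').
Proof.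
move=> a0 b0 mf H Lg Lg'; have [mg _ _] := Lg; have [mg' _ _] := Lg'.
have Lf : L1le (fun x => a * `|g x| + b * `|g' x|) (a * c + b * c').
  apply: L1leD.
    apply: L1leZn; [by rewrite a0 lexx|].
    by apply: (L1le_dom _ _ Lg); [by meas|by move=> x; rewrite normr_id].
  apply: L1leZn; [by rewrite b0 lexx|].
  by apply: (L1le_dom _ _ Lg'); [by meas|by move=> x; rewrite normr_id].
apply: L1le_dom Lf => // x; rewrite [leRHS]ger0_norm//.
by rewrite addr_ge0// mulr_ge0.
Qed.

Lemma L1le_sum (I : finType) (F : I -> T -> R) c : 0 <= c -> (forall i, L1le (F i) c) ->
  L1le (fun x => \sum_i F i x) (#|I|%:R * c).
Proof.
move=> c0 LF; rewrite cardE -/(enum I) (_ : (fun x => \sum_i F i x) = (fun x => \sum_(i <- enum I) F i x)).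
  elim: (enum I) => [|i s IH].
    rewrite (_ : (fun x => _) = cst 0) ?mul0r; last by apply/funext => x; rewrite big_nil.
    split => //; under eq_integral do rewrite normr0.
    by rewrite integral0.
  under eq_fun do rewrite big_cons.
  by rewrite /= -natr1 mulrDl mul1r addrC; exact: L1leD.
by apply/funext => x; rewrite big_enum.
Qed.

(** The square is expanded into covariances, which are at most 0 unless [t] is a neighbour of [s].
    Two kinds of neighbours are kept apart, so that a large bound [B1] may be shared by few indices
    and a small bound [B2] by many. *)
Lemma sum_sq_le (I : finType) (th : I -> T -> R) (N1 N2 : I -> seq I) (B1 B2 k1 k2 : R) :
  0 <= B1 -> 0 <= B2 ->
  (forall s, measurable_fun setT (th s)) -> (forall s, \int[mu]_v (th s v ^+ 2)%:E < +oo)%E ->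
  (forall s t, \int[mu]_v (th s v * th t v)%:E <= (B1 * (t \in N1 s)%:R + B2 * (t \in N2 s)%:R)%:E)%E ->
  (forall s, (size (N1 s))%:R <= k1) -> (forall s, (size (N2 s))%:R <= k2) ->
  (\int[mu]_v ((\sum_s th s v) ^+ 2)%:E <= (#|I|%:R * (B1 * k1 + B2 * k2))%:E)%E.
Proof.
move=> B10 B20 mth th2 H N1k N2k.
have ith s t : mu.-integrable setT (EFin \o (fun v => th s v * th t v)).
  apply: int_integrable; first by have := mth s; have := mth t => *; meas.
  apply: (@le_lt_trans _ _ (\int[mu]_v (th s v ^+ 2 + th t v ^+ 2)%:E)%E).
    have ms := mth s; have mt := mth t.
    apply: le_int; [by meas|by meas|by []|] => v.
    rewrite normrM -(real_normK (num_real (th s v))) -(real_normK (num_real (th t v))).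
    have := normr_ge0 (th s v); have := normr_ge0 (th t v).
    move: `|th s v| `|th t v| => a b a0 b0.
    by have := sqr_ge0 (a - b); nra.
  rewrite intD; [|by have := mth s => *; meas|by have := mth t => *; meas|by move=> v; exact: sqr_ge0|by move=> v; exact: sqr_ge0].
  by apply: lte_add_pinfty.
under eq_integral => v _ do rewrite expr2 mulr_suml -sumEFin.
under eq_integral => v _.
  under eq_bigr => s _ do rewrite mulr_sumr -sumEFin.
  over.
rewrite integral_sum//; last by move=> s; apply: integrable_sum => // t _; exact: ith.
apply: (@le_trans _ _ (\sum_(s : I) (B1 * k1 + B2 * k2)%:E)%E); last first.
  by rewrite sumEFin lee_fin sumr_const -[leLHS]mulr_natl.
apply: lee_sum => s _; rewrite integral_sum//; last by move=> t; exact: ith.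
apply: (@le_trans _ _ (\sum_(t : I) (B1 * (t \in N1 s)%:R + B2 * (t \in N2 s)%:R)%:E)%E).
  by apply: lee_sum => t _; exact: H.
have cnt (N : seq I) : \sum_(t : I) (t \in N)%:R <= (size N)%:R :> R.
  rewrite -natr_sum ler_nat; apply: leq_trans (card_size N).
  by rewrite -sum1_card [leqRHS]big_mkcond /=; apply: leq_sum => t _; case: (t \in N).
rewrite sumEFin lee_fin big_split/= -!mulr_sumr lerD// ler_wpM2l//.
  exact: le_trans (cnt _) (N1k s).
exact: le_trans (cnt _) (N2k s).
Qed.

End L1.

Lemma int_prob_cst {R : realType} d (T : measurableType d) (mu : probability T R) (c : \bar R) :
  (\int[mu]_x c = c)%E.
Proof.
apply: etrans (integral_cst mu measurableT c) _.
by rewrite [X in (_ * X)%E](_ : _ = 1%E) ?mule1//; exact: probability_setT.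
Qed.

Lemma L1le_of_L2 {R : realType} d (T : measurableType d) (mu : probability T R) (g : T -> R) c :
  L2le mu g c -> L1le mu g c.
Proof.
move=> [mg c0 gc].
have := @cauchy_schwarz_weighted R d T mu (fun x => `|g x|) (fun=> 1) (fun x => g x ^+ 2) 1 ltr01.
move=> /(_ _ _ _ (fun=> ler01) (fun x => sqr_ge0 _)).
have mn : measurable_fun setT (fun x => `|g x|) by meas.
have ms : measurable_fun setT (fun x => g x ^+ 2) by meas.
move=> /(_ mn ltac:(by meas) ms).
have h1 x : `|g x| ^+ 2 <= 1 * g x ^+ 2 by rewrite mul1r real_normK// num_real.
have h2 : (\int[mu]_x (1 : R)%:E <= 1%:E)%E.
  by rewrite int_prob_cst.
move=> /(_ h1 h2); rewrite mul1e => H.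
have ig : mu.-integrable setT (EFin \o g).
  apply: (@integrable_le _ _ _ _ _ (fun x => 1 + g x ^+ 2) (1 + c ^+ 2)); [by []|by meas| |].
    move=> x; rewrite -(real_normK (num_real (g x))).
    by have := sqr_ge0 (`|g x| - 1); have := normr_ge0 (g x); nra.
  by rewrite intD; [rewrite int_prob_cst EFinD leeD|by meas|by meas|by []|by move=> x; exact: sqr_ge0].
have fin : (\int[mu]_x (`|g x|)%:E)%E \is a fin_num.
  rewrite ge0_fin_numE; last by exact: int_ge0.
  by have /integrableP[_] := ig.
split => //; rewrite -(fineK fin) lee_fin -(@ler_pXn2r _ 2)// ?nnegrE ?fine_ge0 ?int_ge0//.
rewrite -lee_fin; apply: le_trans H _; exact: gc.
Qed.

(** * Integrating out one coordinate at a time *)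

Section resampled_law.
Context {R : realType} {d' : measure_display} {T : measurableType d'} {n : nat}.
Local Notation S := 'rV[T]_n.
Variables (mu : probability T R) (Q : probability S R).
Hypothesis RS : forall (F : S -> \bar R) (i : 'I_n), measurable_fun setT F -> (forall v, 0 <= F v)%E ->
  (\int[Q]_v F v = \int[Q]_v \int[mu]_x F (upd v i x))%E.
Implicit Types (i j : 'I_n) (v : S).

Lemma peel (F G : S -> R) c i : measurable_fun setT F -> measurable_fun setT G ->
  (forall v, 0 <= F v) -> (forall v, 0 <= G v) -> 0 <= c ->
  (forall v, \int[mu]_x (F (upd v i x))%:E <= (c * G v)%:E)%E ->
  (\int[Q]_v (F v)%:E <= c%:E * \int[Q]_v (G v)%:E)%E.
Proof.
move=> mF mG F0 G0 c0 H; rewrite (RS (F := fun v => (F v)%:E) i); [|by meas|by move=> v; rewrite lee_fin].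
rewrite -intZ//; apply: ge0_le_integral => //.
- by move=> v _; apply: int_ge0.
- apply: (@measurable_fun_integral _ _ _ _ _ mu (fun v x => (F (upd v i x))%:E)).
  by have mu_ := @measurable_upd _ T n i; meas.
- by meas.
Qed.

Lemma marginal (g : T -> R) i : measurable_fun setT g -> (forall x, 0 <= g x) ->
  (\int[Q]_v (g (v ord0 i))%:E = \int[mu]_x (g x)%:E)%E.
Proof.
move=> mg g0; rewrite (RS (F := fun v => (g (v ord0 i))%:E) i); [|by meas|by move=> v; rewrite lee_fin].
under eq_integral => v _.
  under eq_integral do rewrite upd_same.
  over.
by rewrite int_prob_cst.
Qed.

(** The resampling identity concerns nonnegative functions; it is applied to the positive and the
    negative part, whose inner integrals coincide by the hypothesis. *)
Lemma centered0 (F : S -> R) i : measurable_fun setT F -> Q.-integrable setT (EFin \o F) ->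
  (forall v, \int[mu]_x (F (upd v i x))%:E = 0)%E -> (\int[Q]_v (F v)%:E = 0)%E.
Proof.
move=> mF iF H.
have m1 : measurable_fun setT (EFin \o F) by exact/measurable_EFinP.
have mp := measurable_funepos m1; have mn := measurable_funeneg m1.
rewrite integralE (RS i mp)// (RS i mn)//.
have E v : (\int[mu]_x (EFin \o F)^\+ (upd v i x) = \int[mu]_x (EFin \o F)^\- (upd v i x))%E.
  have := H v; rewrite integralE.
  rewrite (_ : (fun x => (F (upd v i x))%:E)^\+%E = (fun x => (EFin \o F)^\+%E (upd v i x))); last by apply/funext => x; rewrite !funeposE.
  rewrite (_ : (fun x => (F (upd v i x))%:E)^\-%E = (fun x => (EFin \o F)^\-%E (upd v i x))); last by apply/funext => x; rewrite !funenegE.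
  have p0 : (0 <= \int[mu]_x (EFin \o F)^\+ (upd v i x))%E by apply: integral_ge0.
  have n0 : (0 <= \int[mu]_x (EFin \o F)^\- (upd v i x))%E by apply: integral_ge0.
  move: p0 n0; case: integral => [a| |]; case: integral => [b| |] //= _ _.
  by move/eqP; rewrite -EFinB eqe subr_eq0 => /eqP ->.
under eq_integral do rewrite E.
rewrite subee// -RS//.
have := integral_fune_fin_num (f := (EFin \o F)^\-%E) measurableT (integrable_funeneg measurableT iF).
by [].
Qed.

(** Given the coordinate [i], the other factors are independent and are removed one by one, each at
    the cost of [c]; the number of factors is rounded up to [n] using [1 <= c]. *)
Lemma product_moment (g : T -> R) (e : T -> T -> R) c i : 1 <= c ->
  measurable_fun setT g -> (forall x, 0 <= g x) ->
  measurable_fun [set: T * T] (fun p => e p.1 p.2) -> (forall x y, 0 <= e x y) ->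
  (forall x, \int[mu]_y (e x y)%:E <= c%:E)%E ->
  (\int[Q]_v (g (v ord0 i) * \prod_(j < n | j != i) e (v ord0 i) (v ord0 j))%:E <=
   (c ^+ n)%:E * \int[mu]_x (g x)%:E)%E.
Proof.
move=> c1 mg g0 me e0 ec.
have c0 : 0 <= c by exact: le_trans c1.
have key (s : seq 'I_n) : uniq s -> i \notin s ->
    (\int[Q]_v (g (v ord0 i) * \prod_(j <- s) e (v ord0 i) (v ord0 j))%:E <=
     (c ^+ size s)%:E * \int[mu]_x (g x)%:E)%E.
  elim: s => [|j s IH] /=.
    under eq_integral do rewrite big_nil mulr1.
    by rewrite marginal// expr0 mul1e.
  move=> /andP[js us]; rewrite inE negb_or => /andP[ij is_].
  apply: (@le_trans _ _ (c%:E * \int[Q]_v (g (v ord0 i) * \prod_(k <- s) e (v ord0 i) (v ord0 k))%:E)%E); last first.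
    by rewrite exprS EFinM -muleA lee_wpmul2l// IH.
  apply: (@peel _ _ c j) => //; [by meas|by meas| | |].
  - by move=> v; rewrite mulr_ge0// prodr_ge0.
  - by move=> v; rewrite mulr_ge0// prodr_ge0.
  move=> v; under eq_integral => x _.
    rewrite big_cons upd_same !(upd_other _ _ ij).
    rewrite (eq_big_seq (fun k => e (v ord0 i) (v ord0 k))); last first.
      by move=> k ks; rewrite (@upd_other _ _ _ _ _ _ k)//; apply: contraNneq js => <-.
    rewrite [X in X%:E](_ : _ = (g (v ord0 i) * \prod_(k <- s) e (v ord0 i) (v ord0 k)) * e (v ord0 i) x); last by rewrite mulrCA mulrC.
    over.
  have mex : measurable_fun setT (e (v ord0 i)) by apply: (measurable_fun2_comp (f := fun=> v ord0 i) (g := id) me).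
  rewrite intZ//; last by rewrite mulr_ge0// prodr_ge0.
  rewrite [leRHS](_ : _ = (g (v ord0 i) * \prod_(k <- s) e (v ord0 i) (v ord0 k))%:E * c%:E)%E; last by rewrite -EFinM mulrC.
  by rewrite lee_wpmul2l// lee_fin mulr_ge0// prodr_ge0.
have := key [seq j <- index_enum 'I_n | j != i] (filter_uniq _ (index_enum_uniq _)).
rewrite mem_filter eqxx => /(_ isT).
under eq_integral do rewrite big_filter.
move=> h; apply: le_trans h _.
rewrite lee_wpmul2r ?int_ge0// lee_fin ler_weXn2l// size_filter.
apply: leq_trans (count_size _ _) _.
by rewrite -[in leqRHS](card_ord n) cardT enumT.
Qed.

Lemma exp_moment (g : T -> R) (k : T -> T -> R) i :
  measurable_fun setT g -> (forall x, 0 <= g x) ->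
  measurable_fun [set: T * T] (fun p => k p.1 p.2) ->
  (forall x, \int[mu]_y (expR (k x y))%:E <= (1 + (2 * n%:R)^-1)%:E)%E ->
  (\int[Q]_v (g (v ord0 i) * expR (\sum_(j < n | j != i) k (v ord0 i) (v ord0 j)))%:E <=
   2%:E * \int[mu]_x (g x)%:E)%E.
Proof.
move=> mg g0 mk H.
under eq_integral do rewrite expR_sum.
apply: le_trans (product_moment (e := fun x y => expR (k x y)) i _ mg g0 _ _ H) _.
- by rewrite lerDl invr_ge0 mulr_ge0.
- by meas.
- by move=> x y; exact: expR_ge0.
by rewrite lee_wpmul2r ?int_ge0// lee_fin half_pow_le2.
Qed.

(** In [exp k <= 1 + k + 2 k^2] the linear term has mean 0 and the quadratic one mean at most
    [1 / (2 n)]; a product of at most [n] factors [1 + 1 / (2 n)] is at most 2. *)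
Lemma exp_moment_centered (g : T -> R) (k : T -> T -> R) i :
  measurable_fun setT g -> (forall x, 0 <= g x) ->
  measurable_fun [set: T * T] (fun p => k p.1 p.2) ->
  (forall x y, `|k x y| <= 2^-1) -> (forall x, \int[mu]_y (k x y)%:E = 0)%E ->
  (forall x, \int[mu]_y (2 * k x y ^+ 2)%:E <= ((2 * n%:R)^-1)%:E)%E ->
  (\int[Q]_v (g (v ord0 i) * expR (\sum_(j < n | j != i) k (v ord0 i) (v ord0 j)))%:E <=
   2%:E * \int[mu]_x (g x)%:E)%E.
Proof.
move=> mg g0 mk k2 k0 kV; apply: exp_moment => // x.
have mkx : measurable_fun setT (fun y => k x y) by meas.
have one : (\int[mu]_y (1 : R)%:E = 1%:E)%E by rewrite int_prob_cst.
have ik : mu.-integrable setT (EFin \o k x).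
  apply: (@integrable_le _ _ _ _ _ (fun=> 2^-1) 2^-1) => //.
  by rewrite int_prob_cst.
have i1 : mu.-integrable setT (EFin \o (fun=> (1 : R))).
  by apply: (@integrable_le _ _ _ _ _ (fun=> 1) 1) => //; [move=> y; rewrite normr1|rewrite one].
have i2 : mu.-integrable setT (EFin \o (fun y => 2 * k x y ^+ 2)).
  apply: (@integrable_le _ _ _ _ _ (fun y => 2 * k x y ^+ 2) (2 * n%:R)^-1); [by meas|by meas| |by []].
  by move=> y; rewrite ger0_norm// mulr_ge0 ?sqr_ge0.
apply: (@le_trans _ _ (\int[mu]_y ((1 + k x y) + 2 * k x y ^+ 2)%:E)%E).
  apply: le_int; [by meas|by meas|by move=> y; exact: expR_ge0|].
  by move=> y; exact: expR_le_quad.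
under eq_integral do rewrite EFinD.
rewrite integralD//; last exact: integrableD_real.
under eq_integral do rewrite EFinD.
by rewrite integralD// one k0 adde0 EFinD leeD2l.
Qed.

End resampled_law.

Ltac nneg := repeat match goal with
  | |- forall _, _ => move=> ?
  | |- is_true (0 <= _ ^+ 2) => exact: sqr_ge0
  | |- is_true (0 <= _ ^+ _) => apply: exprn_ge0
  | |- is_true (0 <= _ * _) => apply: mulr_ge0
  | |- is_true (0 <= _ + _) => apply: addr_ge0
  | |- is_true (0 <= _^-1) => rewrite invr_ge0
  | |- is_true (0 <= `|_|) => exact: normr_ge0
  | |- is_true (0 <= expR _) => exact: expR_ge0
  | |- is_true (0 <= \sum_(_ <- _ | _) _) => apply: sumr_ge0 => ? _
  | |- _ => done
  | |- _ => by apply: ltW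
  end.

(** * Overlaps of index tuples *)

Section indices.
Variable I : eqType.
Implicit Types i j k : I.
(** Two pairs of distinct indices that differ as sets leave an index of the first outside the
    second; integration over that coordinate annihilates the covariance. *)
Lemma pair_outside i j i' j' : i != j -> i' != j' -> (i', j') \notin [:: (i, j); (j, i)] ->
  (i \notin [:: i'; j']) || (j \notin [:: i'; j']).
Proof.
move=> ij ij' h; rewrite -negb_and; apply/negP; rewrite !inE => /andP[].
by do 2 (case/orP => /eqP ?; subst); move: ij ij' h; rewrite !inE ?eqxx ?orbT.
Qed.
(** Third-order terms are centred in their last two indices, so only [j], [k], [j'], [k'] are
    candidates. If each lies in the other triple while the pairs differ as sets, these indices
    exhaust both triples, which are then permutations of each other. *)
Lemma triple_outside i j k i' j' k' : i != j -> i != k -> j != k -> i' != j' -> i' != k' -> j' != k' ->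
  (i', j', k') \notin [:: (i, j, k); (i, k, j); (j, i, k); (j, k, i); (k, i, j); (k, j, i)] ->
  (j', k') \notin [:: (j, k); (k, j)] ->
  [|| j \notin [:: i'; j'; k'], k \notin [:: i'; j'; k'], j' \notin [:: i; j; k] | k' \notin [:: i; j; k]].
Proof.
move=> h1 h2 h3 h4 h5 h6 h7 h8; rewrite -!negb_and; apply/negP => /and4P[].
rewrite !inE.
by do 4 (case/or3P => /eqP ?; subst); move: h1 h2 h3 h4 h5 h6 h7 h8; rewrite !inE ?eqxx ?orbT.
Qed.
End indices.

Section products.
Context {R : realType} d (T : measurableType d) (mu : {measure set T -> \bar R}).

Lemma intZ_le (c k : R) (g : T -> R) : measurable_fun setT g -> 0 <= c -> (forall x, 0 <= g x) ->
  (\int[mu]_v (g v)%:E <= k%:E)%E -> (\int[mu]_v (c * g v)%:E <= (c * k)%:E)%E.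
Proof. by move=> mg c0 g0 gk; rewrite intZ// [leRHS]EFinM lee_wpmul2l. Qed.

Lemma int_mul_amgm (F G : T -> R) B : measurable_fun setT F -> measurable_fun setT G ->
  (\int[mu]_v (F v ^+ 2)%:E <= B%:E)%E -> (\int[mu]_v (G v ^+ 2)%:E <= B%:E)%E ->
  (\int[mu]_v (`|F v * G v|)%:E <= B%:E)%E.
Proof.
move=> mF mG F2 G2.
apply: (@le_trans _ _ (\int[mu]_v (2^-1 * (F v ^+ 2 + G v ^+ 2))%:E)%E).
  apply: le_int; [by meas|by meas|by []|] => v.
  rewrite normrM -(real_normK (num_real (F v))) -(real_normK (num_real (G v))).
  by have := sqr_ge0 (`|F v| - `|G v|); move: `|F v| `|G v| => a b; nra.
rewrite intZ//; [|by meas|by move=> v; rewrite addr_ge0// sqr_ge0].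
rewrite intD; [|by meas|by meas|by move=> v; exact: sqr_ge0|by move=> v; exact: sqr_ge0].
apply: (@le_trans _ _ ((2^-1)%:E * (B%:E + B%:E))%E); first by rewrite lee_wpmul2l// leeD.
by rewrite -EFinD -EFinM lee_fin; lra.
Qed.

Lemma int_le_abs (F : T -> R) B : measurable_fun setT F ->
  (\int[mu]_v (`|F v|)%:E <= B%:E)%E -> (\int[mu]_v (F v)%:E <= B%:E)%E.
Proof.
move=> mF FB; have iF : mu.-integrable setT (EFin \o F).
  by apply: int_integrable => //; exact: le_lt_trans FB (ltry _).
apply: le_trans FB; apply: le_trans (lee_abs _) _.
by apply: le_abse_integral => //; exact/measurable_EFinP.
Qed.

End products.

(** * Markov's inequality outside an exceptional event *)

Section markov.
Context {R : realType} d (T : measurableType d) (Q : probability T R).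

(** The indicator of [|Z| > t] is at most [F + |D| / (M rho)]: where [F >= 1] the first term
    suffices, and elsewhere [|D|] exceeds [t >= M rho]. *)
Lemma markov_combine (Z D F : T -> R) (rho f k M t : R) : 0 < rho -> 0 < M -> M * rho <= t ->
  measurable_fun setT Z -> (forall v, 0 <= F v) ->
  (forall v, F v < 1 -> `|Z v| <= D v) ->
  L1le Q F f -> L1le Q D (k * rho) ->
  (Q [set v | (t < `|Z v|)%R] <= (f + k / M)%:E)%E.
Proof.
move=> rho0 M0 Mt mZ F0 H [mF f0 Ff] [mD k0 Dk].
have mA : measurable [set v | t < `|Z v|].
  have mn : measurable_fun setT (fun v => `|Z v|) by meas.
  rewrite (_ : mkset _ = setT `&` (fun v => `|Z v|) @^-1` `]t, +oo[); first by apply: mn => //; exact: measurable_itv.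
  by rewrite setTI; apply/seteqP; split => v /=; rewrite in_itv/= andbT.
pose G v := F v + (M * rho)^-1 * `|D v|.
have mG : measurable_fun setT G by rewrite /G; meas.
have G0 v : 0 <= G v by rewrite /G addr_ge0// mulr_ge0// invr_ge0 mulr_ge0 ?(ltW M0)// ltW.
have -> : Q [set v | t < `|Z v|] = (\int[Q]_v (\1_[set v | (t < `|Z v|)%R] v)%:E)%E.
  by rewrite integral_indic// setIT.
apply: (@le_trans _ _ (\int[Q]_v (G v)%:E)%E).
  apply: le_int => //.
  move=> v; rewrite indicE; case: (boolP (v \in _)) => //=; rewrite inE /= => vA.
  rewrite /G; have [F1|F1] := ltrP (F v) 1; last first.
    by apply: le_trans F1 _; rewrite lerDl mulr_ge0// invr_ge0 mulr_ge0 ?(ltW M0)// ltW.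
  have h := le_trans Mt (le_trans (ltW vA) (le_trans (H v F1) (ler_norm _))).
  rewrite -[1]add0r lerD//.
  by rewrite mulrC ler_pdivlMr ?mulr_gt0// mul1r.
rewrite /G intD; [|by meas|by meas|by []|by move=> v; rewrite mulr_ge0// invr_ge0 mulr_ge0 ?(ltW M0)// ltW].
rewrite EFinD leeD//.
  by apply: le_trans Ff; rewrite le_eqVlt; apply/orP; left; apply/eqP; apply: eq_integral => v _; rewrite ger0_norm.
rewrite (_ : k / M = (M * rho)^-1 * (k * rho)); last by field; rewrite !gt_eqF.
by apply: intZ_le => //; [meas|rewrite invr_ge0 mulr_ge0// ltW].
Qed.

End markov.

(** * Moments of the leave-one-out errors *)

(* [xi] is the centred scaled kernel, [p] the smoothed density and [eta = h^d],
   while [nu = n^(-1/2)] and [eps = (n eta)^(-1/2)]; [RS] says that the law [Q] of the sample is the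
   product law, without mentioning products of measures. *)
Section array.
Context {R : realType} {d' : measure_display} {T : measurableType d'} {n : nat}.
Local Notation S := 'rV[T]_n.
Variables (mu : probability T R) (Q : probability S R).
Hypothesis RS : forall (F : S -> \bar R) (i : 'I_n), measurable_fun setT F -> (forall v, 0 <= F v)%E ->
  (\int[Q]_v F v = \int[Q]_v \int[mu]_x F (upd v i x))%E.
Variables (xi : T -> T -> R) (p phi : T -> R) (C eta eps nu : R).
Hypothesis n4 : (4 <= n)%N.
Hypothesis C1 : 1 <= C.
Hypothesis eta0 : 0 < eta.
Hypothesis nu0 : 0 < nu.
Hypothesis nueps : nu <= eps.
Hypothesis eps1 : eps <= 1.
Hypothesis nuE : nu ^+ 2 * n%:R = 1.
Hypothesis epsE : eps ^+ 2 * (n%:R * eta) = 1.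
Hypothesis mxi : measurable_fun [set: T * T] (fun z => xi z.1 z.2).
Hypothesis mp : measurable_fun setT p.
Hypothesis xi_sup : forall x y, `|xi x y| <= C / eta.
Hypothesis xi_sq : forall x, (\int[mu]_y (xi x y ^+ 2)%:E <= (C / eta)%:E)%E.
Hypothesis xi_0 : forall x, (\int[mu]_y (xi x y)%:E = 0)%E.
Hypothesis xi_L1r : forall x, (\int[mu]_y (`|xi x y|)%:E <= C%:E)%E.
Hypothesis xi_L1l : forall y, (\int[mu]_x (`|xi x y|)%:E <= C%:E)%E.
Hypothesis p_sup : forall x, `|p x| <= C.
Hypothesis p_low : forall x, phi x != 0 -> C^-1 <= p x.
Hypothesis phi_L2 : L2le mu phi C.
Implicit Types (i j : 'I_n) (v : S).

Let eps0 : 0 < eps. Proof. exact: lt_le_trans nueps. Qed.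
Let C0 : 0 < C. Proof. exact: lt_le_trans C1. Qed.
Let n0 : 0 < n%:R :> R. Proof. by rewrite ltr0n (leq_trans _ n4). Qed.
Let mphi : measurable_fun setT phi. Proof. by case: phi_L2. Qed.
Let Ceta0 : 0 <= C / eta. Proof. by rewrite divr_ge0// ltW. Qed.
Let nE : n%:R = nu ^- 2.
Proof.
have nz : nu ^+ 2 != 0 by rewrite expf_neq0// gt_eqF.
by apply: (mulfI nz); rewrite divff.
Qed.
Let nV : n%:R^-1 = nu ^+ 2. Proof. by rewrite nE invrK. Qed.
Let etaE : eta^-1 = eps ^+ 2 * n%:R.
Proof.
have e0 : eta != 0 by rewrite gt_eqF.
by apply: (mulfI e0); rewrite divff// -[LHS]epsE; ring.
Qed.
Let nu1 : nu <= 1. Proof. exact: le_trans eps1. Qed.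
Let nueps_pow m : nu ^+ m <= eps ^+ m.
Proof. by rewrite lerXn2r ?nnegrE ?(ltW nu0) ?(ltW eps0). Qed.

Definition ksum i v : R := \sum_(j < n | j != i) xi (v ord0 i) (v ord0 j).
Definition ksum2 i v : R := \sum_(j < n | j != i) xi (v ord0 i) (v ord0 j) ^+ 2.
(** The term [- p / n] arises because a sum over [n - 1] indices is divided by [n]. *)
Definition delta i v : R := (ksum i v - p (v ord0 i)) / n%:R.

Lemma measurable_ksum i : measurable_fun setT (ksum i).
Proof. by rewrite /ksum; meas. Qed.

Lemma measurable_ksum2 i : measurable_fun setT (ksum2 i).
Proof. by rewrite /ksum2; meas. Qed.

Lemma measurable_delta i : measurable_fun setT (delta i).
Proof. by have m := measurable_ksum i; rewrite /delta; meas. Qed.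

(** The scale at which [exp_moment_centered] applies: [lam C / eta = eps / 2] is at most [1 / 2],
    and [2 lam^2 C / eta = 1 / (2 n C)] at most [1 / (2 n)]. Since [1 / (n lam) = 2 C eps], the
    moments of [ksum / n] come out in powers of [eps]. *)
Let lam := (2 * C * n%:R * eps)^-1.

Let lam0 : 0 < lam. Proof. by rewrite invr_gt0 !mulr_gt0. Qed.

Let lamE : lam * (2 * C * eps) = n%:R^-1.
Proof. by rewrite /lam; field; rewrite !gt_eqF. Qed.

Let lam_xi x y : `|lam * xi x y| <= 2^-1.
Proof.
rewrite normrM (gtr0_norm lam0); apply: (@le_trans _ _ (lam * (C / eta))).
  by rewrite ler_wpM2l// ltW.
rewrite etaE /lam [leLHS](_ : _ = eps / 2); first by rewrite ler_pdivrMr// mulVf.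
by field; rewrite !gt_eqF.
Qed.

Let lam_sq x : (\int[mu]_y (2 * (lam * xi x y) ^+ 2)%:E <= ((2 * n%:R)^-1)%:E)%E.
Proof.
under eq_integral do rewrite exprMn mulrA.
have l2 : 0 <= 2 * lam ^+ 2 by rewrite mulr_ge0 ?sqr_ge0.
rewrite intZ//; [|by meas|by move=> y; exact: sqr_ge0].
apply: le_trans (lee_wpmul2l _ (xi_sq x)) _; first by rewrite lee_fin.
rewrite -EFinM lee_fin etaE /lam [leLHS](_ : _ = C^-1 * (2 * n%:R)^-1); last first.
  by field; rewrite !gt_eqF.
by rewrite ler_piMl ?invr_ge0 ?mulr_ge0 ?(ltW n0)// invf_le1.
Qed.

(** The 4 stands for two exponentials of mean at most 2 each, the factorial for the comparison of a
    power with an exponential, and [2 C] for [1 / (n lam eps)]. *)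
Definition mconst (m : nat) : R := 4 * (2 * m)`!%:R * (2 * C) ^+ (2 * m).

Lemma mconst_ge0 m : 0 <= mconst m.
Proof. by rewrite /mconst !mulr_ge0// exprn_ge0// mulr_ge0// ltW. Qed.

(** An even power is dominated by the exponentials of [lam ksum] and of its opposite; the weight
    [g], evaluated at the coordinate [i], is carried through unchanged. *)
Lemma ksum_moment (g : T -> R) m i : measurable_fun setT g -> (forall x, 0 <= g x) ->
  (\int[Q]_v (g (v ord0 i) * (ksum i v / n%:R) ^+ (2 * m))%:E <=
    (mconst m * eps ^+ (2 * m))%:E * \int[mu]_x (g x)%:E)%E.
Proof.
move=> mg g0; have mS := measurable_ksum i.
pose K := (2 * C * eps) ^+ (2 * m) * (2 * m)`!%:R.
have K0 : 0 <= K by rewrite mulr_ge0 ?exprn_ge0 ?mulr_ge0// ltW.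
have mk (s : R) : measurable_fun [set: T * T] (fun z => s * xi z.1 z.2) by meas.
have E (s : R) v : \sum_(j < n | j != i) s * xi (v ord0 i) (v ord0 j) = s * ksum i v.
  by rewrite mulr_sumr.
have H (s : R) : s ^+ 2 = lam ^+ 2 -> `|s| = lam ->
    (\int[Q]_v (g (v ord0 i) * expR (s * ksum i v))%:E <= 2%:E * \int[mu]_x (g x)%:E)%E.
  move=> s2 s1; under eq_integral do rewrite -E.
  apply: (exp_moment_centered RS (k := fun x y => s * xi x y) i mg g0 (mk s)).
  - by move=> x y; rewrite normrM s1 -[lam](gtr0_norm lam0) -normrM.
  - move=> x; under eq_integral do rewrite EFinM.
    rewrite integralZl//; first by rewrite xi_0 mule0.
    apply: (@integrable_of_fin_integral _ _ _ _ _ 0) => //.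
    by apply: (measurable_fun2_comp (f := fun=> x) (g := id) mxi).
  - by move=> x; under eq_integral do rewrite exprMn s2 -exprMn.
apply: (@le_trans _ _ (\int[Q]_v (K * (g (v ord0 i) * expR (lam * ksum i v) + g (v ord0 i) * expR (- lam * ksum i v)))%:E)%E).
  apply: le_int; [by meas|by meas| |].
    by move=> v; rewrite exprM mulr_ge0// exprn_ge0// sqr_ge0.
  move=> v; rewrite -mulrDr mulrCA ler_wpM2l//.
  rewrite [leLHS](_ : _ = (2 * C * eps) ^+ (2 * m) * (lam * ksum i v) ^+ (2 * m)); last first.
    by rewrite -exprMn -lamE; congr (_ ^+ _); ring.
  rewrite /K -[leRHS]mulrA ler_wpM2l//.
    by rewrite exprn_ge0// !mulr_ge0// ltW.
  by rewrite mulNr; exact: expr_even_le_expR.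
rewrite intZ//; [|by meas|by move=> v; rewrite addr_ge0// mulr_ge0// expR_ge0].
rewrite intD; [|by meas|by meas|by move=> v; rewrite mulr_ge0// expR_ge0|by move=> v; rewrite mulr_ge0// expR_ge0].
apply: (@le_trans _ _ (K%:E * (2%:E * \int[mu]_x (g x)%:E + 2%:E * \int[mu]_x (g x)%:E))%E).
  rewrite lee_wpmul2l// leeD// H// ?sqrrN ?normrN ?gtr0_norm//.
rewrite -ge0_muleDl// muleA -EFinD -EFinM.
rewrite [X in (X%:E * _)%E](_ : _ = mconst m * eps ^+ (2 * m))//.
by rewrite /K /mconst exprMn; ring.
Qed.

Lemma ksum2_moment (g : T -> R) m i : measurable_fun setT g -> (forall x, 0 <= g x) ->
  (\int[Q]_v (g (v ord0 i) * (ksum2 i v / n%:R ^+ 2) ^+ m)%:E <=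
    (mconst m * eps ^+ (2 * m))%:E * \int[mu]_x (g x)%:E)%E.
Proof.
move=> mg g0; have mS := measurable_ksum2 i.
pose K := (2 * C * eps) ^+ (2 * m) * m`!%:R.
have K0 : 0 <= K by rewrite mulr_ge0 ?exprn_ge0 ?mulr_ge0// ltW.
have S0 v : 0 <= ksum2 i v by apply: sumr_ge0 => j _; exact: sqr_ge0.
have H : (\int[Q]_v (g (v ord0 i) * expR (lam ^+ 2 * ksum2 i v))%:E <= 2%:E * \int[mu]_x (g x)%:E)%E.
  under eq_integral do rewrite mulr_sumr.
  apply: (exp_moment RS (k := fun x y => lam ^+ 2 * xi x y ^+ 2) i mg g0); first by meas.
  move=> x; apply: (@le_trans _ _ (\int[mu]_y (1 + 2 * (lam * xi x y) ^+ 2)%:E)%E).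
    apply: le_int; [by meas|by meas|by move=> y; exact: expR_ge0|].
    (* With [z^2 <= 1/4] one has [exp (z^2) <= 1 + z^2 + 2 z^4 <= 1 + 2 z^2], so the second-moment
       bound on [lam xi] serves again. *)
    move=> y; have := lam_xi x y; rewrite -exprMn; move: (lam * xi x y) => z z2.
    have z4 : z ^+ 2 <= 4^-1.
      rewrite -(real_normK (num_real z)) (_ : 4^-1 = 2^-1 ^+ 2); last by field.
      by rewrite lerXn2r ?nnegrE.
    have z0 := sqr_ge0 z.
    by apply: le_trans (expR_le_quad _) _; rewrite ?ger0_norm//; move: (z ^+ 2) z4 z0 => t; nra.
  rewrite intD; [|by meas|by meas|by []|by move=> y; rewrite mulr_ge0 ?sqr_ge0].
  by rewrite int_prob_cst EFinD leeD2l.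
apply: (@le_trans _ _ (\int[Q]_v (K * (g (v ord0 i) * expR (lam ^+ 2 * ksum2 i v)))%:E)%E).
  apply: le_int; [by meas|by meas| |].
    by move=> v; rewrite mulr_ge0// exprn_ge0// divr_ge0// sqr_ge0.
  move=> v; rewrite mulrCA ler_wpM2l//.
  rewrite [leLHS](_ : _ = (2 * C * eps) ^+ (2 * m) * (lam ^+ 2 * ksum2 i v) ^+ m); last first.
    by rewrite exprM -exprMn -exprVn -lamE; congr (_ ^+ _); ring.
  rewrite /K -[leRHS]mulrA ler_wpM2l//.
    by rewrite exprM exprn_ge0// sqr_ge0.
  by rewrite expr_le_fact_expR// mulr_ge0// sqr_ge0.
rewrite intZ//; [|by meas|by move=> v; rewrite mulr_ge0// expR_ge0].
apply: (@le_trans _ _ (K%:E * (2%:E * \int[mu]_x (g x)%:E))%E); first by rewrite lee_wpmul2l.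
rewrite muleA -EFinM lee_wpmul2r ?int_ge0// lee_fin /K /mconst.
rewrite (_ : _ * 2 = 2 * m`!%:R * ((2 * C) ^+ (2 * m) * eps ^+ (2 * m))); last by rewrite exprMn; ring.
rewrite -[leRHS]mulrA ler_wpM2r ?mulr_ge0 ?exprn_ge0 ?mulr_ge0 ?(ltW eps0) ?(ltW C0)//.
rewrite ler_pM// ?ler_nat//; last first.
  apply: (homo_leq (f := factorial) (r := leq) leqnn (fun b a c => @leq_trans b a c)); last by rewrite leq_pmull.
  by move=> k; rewrite factS leq_pmull.
Qed.

Let phiL1 : (\int[mu]_x (`|phi x|)%:E <= C%:E)%E.
Proof. by have [] := L1le_of_L2 phi_L2. Qed.

Lemma phi_ksum m i : L1le Q (fun v => phi (v ord0 i) * (ksum i v / n%:R) ^+ (2 * m)) (mconst m * C * eps ^+ (2 * m)).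
Proof.
have mS := measurable_ksum i.
split; [by meas|by rewrite mulr_ge0 ?exprn_ge0 ?(ltW eps0)// mulr_ge0 ?mconst_ge0 ?(ltW C0)|].
have S0 v : 0 <= (ksum i v / n%:R) ^+ (2 * m) by rewrite exprM exprn_ge0// sqr_ge0.
under eq_integral do rewrite normrM (ger0_norm (S0 _)).
apply: le_trans (ksum_moment (g := fun x => `|phi x|) m i _ _) _; [by meas|by []|].
apply: le_trans (lee_wpmul2l _ phiL1) _; first by rewrite lee_fin mulr_ge0 ?mconst_ge0 ?exprn_ge0 ?(ltW eps0).
by rewrite -EFinM lee_fin mulrAC.
Qed.

Lemma phi_ksum2 m i : L1le Q (fun v => phi (v ord0 i) * (ksum2 i v / n%:R ^+ 2) ^+ m) (mconst m * C * eps ^+ (2 * m)).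
Proof.
have mS := measurable_ksum2 i.
have S0 v : 0 <= (ksum2 i v / n%:R ^+ 2) ^+ m.
  by rewrite exprn_ge0// divr_ge0 ?sqr_ge0//; apply: sumr_ge0 => j _; exact: sqr_ge0.
split; [by meas|by rewrite mulr_ge0 ?exprn_ge0 ?(ltW eps0)// mulr_ge0 ?mconst_ge0 ?(ltW C0)|].
under eq_integral do rewrite normrM (ger0_norm (S0 _)).
apply: le_trans (ksum2_moment (g := fun x => `|phi x|) m i _ _) _; [by meas|by []|].
apply: le_trans (lee_wpmul2l _ phiL1) _; first by rewrite lee_fin mulr_ge0 ?mconst_ge0 ?exprn_ge0 ?(ltW eps0).
by rewrite -EFinM lee_fin mulrAC.
Qed.

Lemma phi_marginal i : L1le Q (fun v => phi (v ord0 i)) C.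
Proof.
split; [by meas|exact: ltW|].
by rewrite (marginal RS (g := fun x => `|phi x|)) //; meas.
Qed.

Definition d2const : R := 2 * (mconst 1 * C + C ^+ 3).
Definition d4const : R := 8 * (mconst 2 * C + C ^+ 5).

Lemma phi_delta2 i : L1le Q (fun v => phi (v ord0 i) * delta i v ^+ 2) (d2const * eps ^+ 2).
Proof.
have H1 := phi_ksum 1 i; have H0 := phi_marginal i; have md := measurable_delta i.
apply: L1leW (L1le_dom2 (a := 2) (b := 2 * (C ^+ 2 * nu ^+ 4)) _ _ _ _ H1 H0) _ => //.
- by rewrite !mulr_ge0 ?exprn_ge0 ?(ltW nu0) ?(ltW C0).
- by meas.
- move=> v; rewrite muln1 !(normrM (phi (v ord0 i))) !normrX.
  rewrite [leRHS](_ : _ = `|phi (v ord0 i)| * (2 * `|ksum i v / n%:R| ^+ 2 + 2 * (C ^+ 2 * nu ^+ 4))); last by ring.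
  rewrite ler_wpM2l//.
  rewrite /delta mulrBl nV; move: (ksum i v * nu ^+ 2) => s.
  have h : (p (v ord0 i) * nu ^+ 2) ^+ 2 <= C ^+ 2 * nu ^+ 4.
    rewrite exprMn -exprM ler_wpM2r ?exprn_ge0 ?(ltW nu0)// -(real_normK (num_real (p _))).
    by rewrite lerXn2r ?nnegrE ?(ltW C0).
  rewrite !real_normK ?num_real//.
  have := sqr_ge0 (s + p (v ord0 i) * nu ^+ 2); move: (p _ * _) h => q h; nra.
have h4 : nu ^+ 4 <= eps ^+ 2 by rewrite (exprD nu 2 2) -[leRHS]mulr1 ler_pM ?sqr_ge0// exprn_ile1// ltW.
have : C ^+ 3 * nu ^+ 4 <= C ^+ 3 * eps ^+ 2 by rewrite ler_wpM2l ?exprn_ge0// ltW.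
rewrite /d2const muln1 (exprS C 2); move: (mconst 1) (nu ^+ 4) (eps ^+ 2) (C ^+ 2) => a b c e; nra.
Qed.

Lemma phi_delta4 i : L1le Q (fun v => phi (v ord0 i) * delta i v ^+ 4) (d4const * eps ^+ 4).
Proof.
have H1 := phi_ksum 2 i; have H0 := phi_marginal i; have md := measurable_delta i.
apply: L1leW (L1le_dom2 (a := 8) (b := 8 * (C ^+ 4 * nu ^+ 8)) _ _ _ _ H1 H0) _ => //.
- by rewrite !mulr_ge0 ?exprn_ge0 ?(ltW nu0) ?(ltW C0).
- by meas.
- move=> v; rewrite !(normrM (phi (v ord0 i))) !normrX.
  rewrite [leRHS](_ : _ = `|phi (v ord0 i)| * (8 * `|ksum i v / n%:R| ^+ (2 * 2) + 8 * (C ^+ 4 * nu ^+ 8))); last by ring.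
  rewrite ler_wpM2l// -[(2 * 2)%N]/4%N.
  rewrite /delta mulrBl nV; move: (ksum i v * nu ^+ 2) => s.
  have h : (p (v ord0 i) * nu ^+ 2) ^+ 4 <= C ^+ 4 * nu ^+ 8.
    rewrite exprMn -exprM ler_wpM2r ?exprn_ge0 ?(ltW nu0)//.
    rewrite !(exprM _ 2 2) lerXn2r ?nnegrE ?sqr_ge0// -(real_normK (num_real (p _))).
    by rewrite lerXn2r ?nnegrE ?(ltW C0).
  move: (p _ * _) h => q; rewrite -!normrX.
  have e4 (z : R) : z ^+ 4 = z ^+ 2 ^+ 2 by rewrite -exprM.
  rewrite !ger0_norm ?e4 ?sqr_ge0// => h.
  apply: (@le_trans _ _ (8 * s ^+ 2 ^+ 2 + 8 * q ^+ 2 ^+ 2)); last by rewrite lerD2l ler_wpM2l// (le_trans h)// -exprM.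
  have k1 : (s - q) ^+ 2 <= 2 * s ^+ 2 + 2 * q ^+ 2 by have := sqr_ge0 (s + q); nra.
  have k2 := sqr_ge0 (s - q); have k3 := sqr_ge0 (s ^+ 2 - q ^+ 2).
  have := sqr_ge0 s; have := sqr_ge0 q.
  move: ((s - q) ^+ 2) (s ^+ 2) (q ^+ 2) k1 k2 k3 => u a b *.
  have : u ^+ 2 <= (2 * a + 2 * b) ^+ 2 by rewrite lerXn2r ?nnegrE//; lra.
  nra.
have h4 : nu ^+ 8 <= eps ^+ 4 by rewrite (exprD nu 4 4) -[leRHS]mulr1 ler_pM ?exprn_ge0 ?(ltW nu0)// exprn_ile1// ltW.
have : C ^+ 5 * nu ^+ 8 <= C ^+ 5 * eps ^+ 4 by rewrite ler_wpM2l ?exprn_ge0// ltW.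
rewrite /d4const (exprS C 4); move: (mconst 2) (nu ^+ 8) (eps ^+ 4) (C ^+ 4) => a b c e; nra.
Qed.

Lemma phi_ksum2_1 i : L1le Q (fun v => phi (v ord0 i) * (ksum2 i v / n%:R ^+ 2)) (mconst 1 * C * eps ^+ 2).
Proof. exact: (phi_ksum2 1 i). Qed.

(** Odd moments are interpolated between even ones: if [F^2] has order [eps^(j + 1)] and [G^2] order
    [eps^(j - 1)], both halves of the bound have order [eps^j]. *)
Lemma L1le_young (F G : S -> R) i (a b : R) : measurable_fun setT F -> measurable_fun setT G ->
  L1le Q (fun v => phi (v ord0 i) * F v ^+ 2) a -> L1le Q (fun v => phi (v ord0 i) * G v ^+ 2) b ->
  L1le Q (fun v => phi (v ord0 i) * (F v * G v)) ((eps^-1 * a + eps * b) / 2).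
Proof.
move=> mF mG LF LG.
apply: L1leW (L1le_dom2 (a := eps^-1 / 2) (b := eps / 2) _ _ _ _ LF LG) _ => //.
- by rewrite divr_ge0 ?invr_ge0// ltW.
- by rewrite divr_ge0// ltW.
- by meas.
- move=> v; rewrite !(normrM (phi (v ord0 i))) !normrX.
  rewrite [leRHS](_ : _ = `|phi (v ord0 i)| * (eps^-1 / 2 * `|F v| ^+ 2 + eps / 2 * `|G v| ^+ 2)); last by ring.
  rewrite ler_wpM2l// normrM; move: `|F v| `|G v| => f g.
  rewrite -subr_ge0 (_ : _ - _ = eps^-1 / 2 * (f - eps * g) ^+ 2); last by field; rewrite gt_eqF.
  by rewrite mulr_ge0 ?sqr_ge0// divr_ge0 ?invr_ge0// ltW.
by rewrite le_eqVlt (_ : _ == _) //; apply/eqP; ring.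
Qed.

Definition d3const : R := (d4const + d2const) / 2.

Lemma phi_delta3 i : L1le Q (fun v => phi (v ord0 i) * delta i v ^+ 3) (d3const * eps ^+ 3).
Proof.
have md := measurable_delta i.
have H4 : L1le Q (fun v => phi (v ord0 i) * (delta i v ^+ 2) ^+ 2) (d4const * eps ^+ 4).
  by under eq_fun do rewrite -exprM; exact: phi_delta4.
have md2 : measurable_fun setT (fun v => delta i v ^+ 2) by meas.
have := L1le_young md2 md H4 (phi_delta2 i).
under eq_fun do rewrite -exprSr.
move=> H; apply: L1leW H _; rewrite le_eqVlt (_ : _ == _) //; apply/eqP.
by rewrite /d3const; field; rewrite gt_eqF.
Qed.

Lemma phi_delta1 i : L1le Q (fun v => phi (v ord0 i) * delta i v) ((d2const + C) / 2 * eps).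
Proof.
have md := measurable_delta i.
have H0 : L1le Q (fun v => phi (v ord0 i) * 1 ^+ 2) C.
  by under eq_fun do rewrite expr1n mulr1; exact: phi_marginal.
have := L1le_young md (measurable_cst (1 : R)) (phi_delta2 i) H0.
under eq_fun do rewrite mulr1.
move=> H; apply: L1leW H _; rewrite le_eqVlt (_ : _ == _) //; apply/eqP.
by field; rewrite gt_eqF.
Qed.

Lemma phi_ksum2_delta i : L1le Q (fun v => phi (v ord0 i) * (ksum2 i v / n%:R ^+ 2 * delta i v))
  ((mconst 2 * C + d2const) / 2 * eps ^+ 3).
Proof.
have md := measurable_delta i; have mk := measurable_ksum2 i.
have m2 : measurable_fun setT (fun v => ksum2 i v / n%:R ^+ 2) by meas.
have := L1le_young m2 md (phi_ksum2 2 i) (phi_delta2 i).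
move=> H; apply: L1leW H _; rewrite le_eqVlt (_ : _ == _) //; apply/eqP.
by field; rewrite gt_eqF.
Qed.

Let etaV : eta^-1 = eps ^+ 2 / nu ^+ 2. Proof. by rewrite etaE nE. Qed.

(** [F] has mean 0 in the coordinate [i] and [G] does not depend on it, so the product is centred in
    that coordinate; square integrability makes it integrable. *)
Lemma cross0 (F G : S -> R) i : measurable_fun setT F -> measurable_fun setT G ->
  (\int[Q]_v (F v ^+ 2)%:E < +oo)%E -> (\int[Q]_v (G v ^+ 2)%:E < +oo)%E ->
  (forall v x, G (upd v i x) = G v) ->
  (forall v, mu.-integrable setT (EFin \o (fun x => F (upd v i x)))) ->
  (forall v, \int[mu]_x (F (upd v i x))%:E = 0)%E ->
  (\int[Q]_v (F v * G v)%:E = 0)%E.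
Proof.
move=> mF mG F2 G2 GE iF IF.
have b1 (H : S -> R) : (\int[Q]_v (H v ^+ 2)%:E < +oo)%E -> exists2 B, 0 <= B & (\int[Q]_v (H v ^+ 2)%:E = B%:E)%E.
  move=> H2; exists (fine (\int[Q]_v (H v ^+ 2)%:E)); first by rewrite fine_ge0 ?int_ge0// => v; exact: sqr_ge0.
  by rewrite fineK// ge0_fin_numE// int_ge0// => v; exact: sqr_ge0.
have [BF BF0 FE] := b1 _ F2; have [BG BG0 GE'] := b1 _ G2.
apply: (centered0 RS (i := i)); first by meas.
  apply: int_integrable; first by meas.
  apply: (@le_lt_trans _ _ (BF + BG)%:E); last exact: ltry.
  by apply: int_mul_amgm; rewrite ?FE ?GE' ?lee_fin ?lerDl ?lerDr.
move=> v; under eq_integral do rewrite GE mulrC EFinM.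
by rewrite integralZl ?IF ?mule0//; exact: iF.
Qed.

Lemma linear_statistic_L2 psi sg : L2le mu psi sg -> (\int[mu]_x (psi x)%:E = 0)%E ->
  L2le Q (fun v => nu ^+ 2 * \sum_(i < n) psi (v ord0 i)) (nu * sg).
Proof.
move=> [mpsi sg0 psi2] psi0.
have Lpsi : mu.-integrable setT (EFin \o psi).
  by apply: (@integrable_of_fin_integral _ _ _ _ _ 0).
have m2 i : (\int[Q]_v (psi (v ord0 i) ^+ 2)%:E <= (sg ^+ 2)%:E)%E.
  by rewrite (marginal RS (g := fun x => psi x ^+ 2))//; [meas|move=> x; exact: sqr_ge0].
have mi i : measurable_fun setT (fun v : S => psi (v ord0 i)) by meas.
have := @sum_sq_le _ _ _ Q 'I_n (fun i v => psi (v ord0 i)) (fun i => [:: i]) (fun=> [::]) (sg ^+ 2) 0 1 0.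
move=> /(_ (sqr_ge0 _) (lexx _) mi (fun i => le_lt_trans (m2 i) (ltry _))) H.
split; [by meas|by rewrite mulr_ge0// ltW|].
under eq_integral do rewrite exprMn.
rewrite intZ ?exprn_ge0 ?(ltW nu0)//; [|by meas|by move=> v; exact: sqr_ge0].
apply: le_trans (lee_wpmul2l _ (H _ _ _)) _; rewrite ?lee_fin ?exprn_ge0 ?(ltW nu0)//.
- move=> i j; rewrite inE in_nil mul0r addr0; have [->|ij] := eqVneq j i.
    by rewrite mulr1; apply: int_le_abs; [by meas|apply: int_mul_amgm].
  rewrite mulr0 (@cross0 _ _ i) ?(le_lt_trans (m2 _) (ltry _))//.
  + by move=> v x; rewrite upd_other.
  + by move=> v; under eq_fun do rewrite upd_same.
  + by move=> v; under eq_integral do rewrite upd_same.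
rewrite card_ord le_eqVlt; apply/orP; left; apply/eqP; rewrite nE.
by field; rewrite gt_eqF.
Qed.

(** * The degenerate statistic of order two *)

Section order2.
Variables (a : T -> R) (A : R).
Hypothesis La : L2le mu a A.

(** Hajek projection of [a(x) xi(x, y)] on its second variable; the projection on the first is 0
    because [xi] is centred in [y]. *)
Definition proj2 y : R := \int[mu]_x (a x * xi x y).
Definition theta2 (s : 'I_n * 'I_n) v : R :=
  if s.1 != s.2 then a (v ord0 s.1) * xi (v ord0 s.1) (v ord0 s.2) - proj2 (v ord0 s.2) else 0.

Let ma : measurable_fun setT a. Proof. by case: La. Qed.
Let A0 : 0 <= A. Proof. by case: La. Qed.
Let a2 : (\int[mu]_x (a x ^+ 2)%:E <= (A ^+ 2)%:E)%E. Proof. by case: La. Qed.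

Lemma measurable_proj2 : measurable_fun setT proj2.
Proof.
by apply: (@measurable_fun_Rintegral _ _ _ _ _ mu (fun y x : T => a x * xi x y)); meas.
Qed.

Let int_a_xi y : mu.-integrable setT (EFin \o (fun x => a x * xi x y)).
Proof.
have [_ _ a1] := L1le_of_L2 La.
apply: (@integrable_le _ _ _ _ _ (fun x => C / eta * `|a x|) (C / eta * A)); [by meas|by meas| |].
  by move=> x; rewrite normrM mulrC ler_wpM2r.
by apply: intZ_le => //; meas.
Qed.

Lemma proj2_sq : (\int[mu]_y (proj2 y ^+ 2)%:E <= (A ^+ 2 * (C / eta))%:E)%E.
Proof.
have mb := measurable_proj2.
apply: (@le_trans _ _ (\int[mu]_y \int[mu]_x (a x ^+ 2 * xi x y ^+ 2)%:E)%E).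
  apply: ge0_le_integral => //.
  - by move=> y _; rewrite lee_fin sqr_ge0.
  - by meas.
  - by apply: (@measurable_fun_integral _ _ _ _ _ mu (fun y x : T => (a x ^+ 2 * xi x y ^+ 2)%:E)); meas.
  - move=> y _; rewrite -[leRHS]mul1e.
    apply: (cauchy_schwarz_weighted (om := fun=> 1)) => //; [by meas|by meas| | |].
    + by move=> x; rewrite mulr_ge0 ?sqr_ge0.
    + by move=> x; rewrite exprMn mul1r.
    + by rewrite int_prob_cst.
rewrite (@int_tonelli _ _ _ _ _ mu mu (fun y x => a x ^+ 2 * xi x y ^+ 2)); [|by meas|by move=> *; rewrite mulr_ge0 ?sqr_ge0].
apply: (@le_trans _ _ (\int[mu]_x (C / eta * a x ^+ 2)%:E)%E).
  apply: ge0_le_integral => //.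
  - by move=> x _; apply: int_ge0 => y; rewrite mulr_ge0 ?sqr_ge0.
  - by apply: (@measurable_fun_integral _ _ _ _ _ mu (fun x y : T => (a x ^+ 2 * xi x y ^+ 2)%:E)); meas.
  - by meas.
  - move=> x _; rewrite (mulrC (C / eta)).
    by apply: intZ_le; [by meas|exact: sqr_ge0|by move=> y; exact: sqr_ge0|].
by rewrite (mulrC (A ^+ 2)); apply: intZ_le; [by meas|by []|by move=> x; exact: sqr_ge0|].
Qed.

(** The bound is crude, of order [eta^(-1/2) = eps / nu]; quantitatively it enters [lin_L1] only in
    a term with an additional factor [1 / n], where it gives [eps nu]. *)
Lemma proj2_L2 : L2le mu proj2 (A * C * (eps / nu)).
Proof.
split; [exact: measurable_proj2|by nneg|].
apply: le_trans proj2_sq _; rewrite lee_fin etaV !exprMn exprVn -mulrA ler_wpM2l ?sqr_ge0//.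
rewrite ler_wpM2r ?divr_ge0 ?sqr_ge0//.
by rewrite expr2 ler_peMr// ltW.
Qed.

Let int_proj2 : mu.-integrable setT (EFin \o proj2).
Proof.
have [m c0 H] := L1le_of_L2 proj2_L2.
by apply: int_integrable => //; exact: le_lt_trans H (ltry _).
Qed.

Lemma proj2_centered : (\int[mu]_y (proj2 y)%:E = 0)%E.
Proof.
have E y : (proj2 y)%:E = (\int[mu]_x (a x * xi x y)%:E)%E.
  by rewrite /proj2 /Rintegral fineK//; exact: integral_fune_fin_num (int_a_xi y).
under eq_integral do rewrite E.
have [_ _ a1] := L1le_of_L2 La.
rewrite (@int_fubini _ _ _ _ _ mu mu (fun y x => a x * xi x y)); [|by meas|].
  rewrite -[RHS](@integral0 _ _ _ mu setT); apply: eq_integral => x _.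
  under eq_integral do rewrite EFinM.
  rewrite integralZl ?xi_0 ?mule0//.
  apply: (@integrable_of_fin_integral _ _ _ _ _ 0) => //.
  by apply: (measurable_fun2_comp (f := fun=> x) (g := id) mxi).
apply: (@le_lt_trans _ _ (\int[mu]_y (C / eta * A)%:E)%E); last by rewrite int_prob_cst ltry.
apply: ge0_le_integral => //.
- by move=> y _; apply: int_ge0.
- by apply: (@measurable_fun_integral _ _ _ _ _ mu (fun y x : T => (`|a x * xi x y|)%:E)); meas.
- move=> y _; apply: (@le_trans _ _ (\int[mu]_x (C / eta * `|a x|)%:E)%E).
    apply: le_int => //; [by meas|by meas|].
    by move=> x; rewrite normrM mulrC ler_wpM2r.
  by apply: intZ_le => //; meas.
Qed.

Lemma measurable_theta2 s : measurable_fun setT (theta2 s).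
Proof. by have mb := measurable_proj2; rewrite /theta2; meas. Qed.

Let theta2_sq s : (\int[Q]_v (theta2 s v ^+ 2)%:E <= (4 * A ^+ 2 * (C / eta))%:E)%E.
Proof.
have mb := measurable_proj2; case: s => i j; rewrite /theta2 /=.
have [ij|ij] := eqVneq i j => /=.
  under eq_integral do rewrite expr0n.
  by rewrite integral0 lee_fin mulr_ge0 ?Ceta0// mulr_ge0// sqr_ge0.
apply: (@le_trans _ _ (\int[Q]_v (2 * (a (v ord0 i) ^+ 2 * xi (v ord0 i) (v ord0 j) ^+ 2) + 2 * proj2 (v ord0 j) ^+ 2)%:E)%E).
  apply: le_int; [by meas|by meas|by move=> v; exact: sqr_ge0|] => v.
  rewrite -exprMn; move: (a _ * _) (proj2 _) => x y.
  by have := sqr_ge0 (x + y); nra.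
rewrite intD; [|by meas|by meas| |]; last 2 first.
- by nneg.
- by nneg.
rewrite !intZ//; [|by meas|by move=> v; exact: sqr_ge0|by meas|by nneg].
rewrite (marginal RS (g := fun x => proj2 x ^+ 2)); [|by meas|by move=> x; exact: sqr_ge0].
have H : (\int[Q]_v (a (v ord0 i) ^+ 2 * xi (v ord0 i) (v ord0 j) ^+ 2)%:E <= (A ^+ 2 * (C / eta))%:E)%E.
  apply: le_trans (peel RS (G := fun v => a (v ord0 i) ^+ 2) (c := C / eta) (i := j) _ _ _ _ _ _) _ => //; [by meas|by meas| | | |].
  - by move=> v; rewrite mulr_ge0 ?sqr_ge0.
  - by move=> v; exact: sqr_ge0.
  - move=> v; under eq_integral do rewrite upd_same upd_other//.
    rewrite (mulrC (C / eta)).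
    by apply: intZ_le; [by meas|exact: sqr_ge0|by move=> x; exact: sqr_ge0|].
  rewrite (marginal RS (g := fun x => a x ^+ 2)); [|by meas|by move=> x; exact: sqr_ge0].
  by rewrite (mulrC (A ^+ 2)) [leRHS]EFinM lee_wpmul2l.
apply: (@le_trans _ _ (2%:E * (A ^+ 2 * (C / eta))%:E + 2%:E * (A ^+ 2 * (C / eta))%:E)%E).
  by rewrite leeD// lee_wpmul2l// proj2_sq.
by rewrite -EFinM -EFinD lee_fin le_eqVlt; apply/orP; left; apply/eqP; ring.
Qed.

Let theta2_null1 i j v : i != j ->
  mu.-integrable setT (EFin \o (fun x => theta2 (i, j) (upd v i x))) /\
  (\int[mu]_x (theta2 (i, j) (upd v i x))%:E = 0)%E.
Proof.
move=> ij; rewrite /theta2 /= ij.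
under eq_fun do rewrite upd_same upd_other 1?eq_sym//.
under eq_integral do rewrite upd_same upd_other 1?eq_sym//.
have ic : mu.-integrable setT (EFin \o (fun x : T => - proj2 (v ord0 j))).
  by apply: (@integrable_le _ _ _ _ _ (fun=> `|proj2 (v ord0 j)|) `|proj2 (v ord0 j)|) => //; [move=> x; rewrite normrN|rewrite int_prob_cst].
split; first exact: integrableD_real.
under eq_integral do rewrite EFinD.
transitivity (\int[mu]_x (a x * xi x (v ord0 j))%:E + \int[mu]_x (- proj2 (v ord0 j))%:E)%E.
  exact: (integralD measurableT (int_a_xi _) ic).
rewrite (int_prob_cst mu (- proj2 (v ord0 j))%:E).
rewrite (_ : (\int[mu]_x (a x * xi x (v ord0 j))%:E)%E = (proj2 (v ord0 j))%:E) -?EFinD ?subrr//.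
by rewrite /proj2 /Rintegral fineK//; exact: integral_fune_fin_num (int_a_xi _).
Qed.

Let theta2_null2 i j v : i != j ->
  mu.-integrable setT (EFin \o (fun x => theta2 (i, j) (upd v j x))) /\
  (\int[mu]_x (theta2 (i, j) (upd v j x))%:E = 0)%E.
Proof.
move=> ij; rewrite /theta2 /= ij.
under eq_fun do rewrite upd_same upd_other//.
under eq_integral do rewrite upd_same upd_other//.
have ix : mu.-integrable setT (EFin \o (xi (v ord0 i))).
  apply: (@integrable_of_fin_integral _ _ _ _ _ 0) => //.
  by apply: (measurable_fun2_comp (f := fun=> v ord0 i) (g := id) mxi).
have i1 := integrableZ_real (a (v ord0 i)) ix.
have i2 := integrableZ_real (-1) int_proj2.
under eq_fun do rewrite -mulN1r.
split; first exact: integrableD_real.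
under eq_integral do rewrite -mulN1r EFinD.
rewrite integralD//; under eq_integral do rewrite EFinM.
rewrite integralZl// xi_0 mule0 add0e; under eq_integral do rewrite EFinM.
by rewrite integralZl// proj2_centered mule0.
Qed.

(** A pair correlates only with itself and its reversal. The variance is thus at most [nu^8 n^2 * 2
    * 4 A^2 C / eta = 8 A^2 C eps^2 nu^2], and 8 is rounded up to the square 9. *)
Lemma theta2_sum : L2le Q (fun v => nu ^+ 4 * \sum_s theta2 s v) (3 * A * C * eps * nu).
Proof.
have mt := measurable_theta2.
split; [by meas|by nneg|].
pose N (s : 'I_n * 'I_n) := [:: s; (s.2, s.1)].
have B0 : 0 <= 4 * A ^+ 2 * (C / eta) by nneg.
have fin s : (\int[Q]_v (theta2 s v ^+ 2)%:E < +oo)%E := le_lt_trans (theta2_sq s) (ltry _).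
have := @sum_sq_le _ _ _ Q _ theta2 N (fun=> [::]) (4 * A ^+ 2 * (C / eta)) 0 2 0 B0 (lexx 0) mt fin.
move=> H; under eq_integral do rewrite exprMn.
rewrite intZ ?sqr_ge0//; [|by meas|by move=> v; exact: sqr_ge0].
apply: le_trans (lee_wpmul2l _ (H _ _ _)) _; rewrite ?lee_fin ?sqr_ge0//; last first.
  rewrite card_prod card_ord natrM nE etaV.
  rewrite [leLHS](_ : _ = 8 * A ^+ 2 * C * (eps ^+ 2 * nu ^+ 2)); last by field; rewrite gt_eqF.
  rewrite [leRHS](_ : _ = 9 * A ^+ 2 * C ^+ 2 * (eps ^+ 2 * nu ^+ 2)); last by ring.
  apply: ler_wpM2r; first by nneg.
  apply: ler_pM; [by nneg|by nneg| |by rewrite expr2 ler_peMr// ltW].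
  by rewrite ler_wpM2r ?sqr_ge0// ler_nat.
move=> [i j] [i' j']; rewrite in_nil mul0r addr0 /N /=.
case: (boolP ((i', j') \in [:: (i, j); (j, i)])) => [_|]; rewrite ?mulr1 ?mulr0.
  by apply: int_le_abs; [have := mt (i, j); have := mt (i', j') => *; meas|apply: int_mul_amgm].
move=> Hne.
have [ij|ij] := eqVneq i j.
  by rewrite /theta2 /= ij eqxx /=; under eq_integral do rewrite mul0r; rewrite integral0.
have [ij'|ij'] := eqVneq i' j'.
  by rewrite /theta2 /= ij' eqxx /=; under eq_integral do rewrite mulr0; rewrite integral0.
have outside (k : 'I_n) v x : k \notin [:: i'; j'] -> theta2 (i', j') (upd v k x) = theta2 (i', j') v.
  rewrite !inE negb_or => /andP[l1 l2].
  have [l3 l4] : i' != k /\ j' != k by rewrite ![_ == k]eq_sym.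
  by rewrite /theta2 /= !upd_other.
have /orP[k1|k1] := pair_outside ij ij' Hne.
  rewrite (@cross0 _ _ i)//.
  - by move=> v x; exact: outside.
  - by move=> v; have [] := theta2_null1 v ij.
  - by move=> v; have [] := theta2_null1 v ij.
rewrite (@cross0 _ _ j)//.
- by move=> v x; exact: outside.
- by move=> v; have [] := theta2_null2 v ij.
- by move=> v; have [] := theta2_null2 v ij.
Qed.

End order2.

(** * The degenerate statistic of order three *)

Section order3.
Variables (g : T -> R) (A : R).
Hypothesis Lg : L2le mu g A.

Let mg : measurable_fun setT g. Proof. by case: Lg. Qed.
Let A0 : 0 <= A. Proof. by case: Lg. Qed.
Let g2 : (\int[mu]_x (g x ^+ 2)%:E <= (A ^+ 2)%:E)%E. Proof. by case: Lg. Qed.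

Definition theta3 (s : 'I_n * 'I_n * 'I_n) v : R :=
  if [&& s.1.1 != s.1.2, s.1.1 != s.2 & s.1.2 != s.2]
  then g (v ord0 s.1.1) * (xi (v ord0 s.1.1) (v ord0 s.1.2) * xi (v ord0 s.1.1) (v ord0 s.2)) else 0.

Lemma measurable_theta3 s : measurable_fun setT (theta3 s).
Proof. by rewrite /theta3; meas. Qed.

Let theta3_sq s : (\int[Q]_v (theta3 s v ^+ 2)%:E <= ((C / eta) ^+ 2 * A ^+ 2)%:E)%E.
Proof.
case: s => [[i j] k]; rewrite /theta3 /=.
case: (boolP [&& i != j, i != k & j != k]) => [/and3P[ij ik jk]|_]; last first.
  by under eq_integral do rewrite expr0n; rewrite integral0 lee_fin; nneg.
under eq_integral do rewrite !exprMn.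
have H1 : (\int[Q]_v (g (v ord0 i) ^+ 2 * (xi (v ord0 i) (v ord0 j) ^+ 2 * xi (v ord0 i) (v ord0 k) ^+ 2))%:E
    <= (C / eta)%:E * \int[Q]_v (g (v ord0 i) ^+ 2 * xi (v ord0 i) (v ord0 j) ^+ 2)%:E)%E.
  apply: (peel RS (i := k)) => //; [by meas|by meas|by nneg|by nneg|].
  move=> v; under eq_integral do rewrite upd_same !upd_other// mulrA.
  by rewrite (mulrC (C / eta)); apply: intZ_le; [by meas|by nneg|by nneg|].
have H2 : (\int[Q]_v (g (v ord0 i) ^+ 2 * xi (v ord0 i) (v ord0 j) ^+ 2)%:E <= (C / eta)%:E * \int[Q]_v (g (v ord0 i) ^+ 2)%:E)%E.
  apply: (peel RS (i := j)) => //; [by meas|by meas|by nneg|by nneg|].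
  move=> v; under eq_integral do rewrite upd_same !upd_other//.
  by rewrite (mulrC (C / eta)); apply: intZ_le; [by meas|by nneg|by nneg|].
apply: le_trans H1 _; rewrite [leRHS](_ : _ = (C / eta)%:E * (C / eta * A ^+ 2)%:E)%E; last by rewrite -EFinM; congr EFin; ring.
rewrite lee_wpmul2l//.
apply: le_trans H2 _; rewrite [leRHS]EFinM lee_wpmul2l//.
by rewrite (marginal RS (g := fun x => g x ^+ 2)) //; [meas|nneg].
Qed.

(** The coordinates [k], [i'], [j] are integrated out in this order; each then occurs in a single
    factor [|xi|], whose row or column integral is at most [C], so no power of [1 / eta] is lost. *)
Let cycle_moment i j k i' : i != j -> i != k -> j != k -> i' != i -> i' != j -> i' != k ->
  (\int[Q]_v (g (v ord0 i) ^+ 2 * (`|xi (v ord0 i) (v ord0 j)| * (`|xi (v ord0 i') (v ord0 j)| * `|xi (v ord0 i) (v ord0 k)|)))%:E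
    <= (C * (C * (C * A ^+ 2)))%:E)%E.
Proof.
move=> ij ik jk i'i i'j i'k.
have H1 : (\int[Q]_v (g (v ord0 i) ^+ 2 * (`|xi (v ord0 i) (v ord0 j)| * (`|xi (v ord0 i') (v ord0 j)| * `|xi (v ord0 i) (v ord0 k)|)))%:E
    <= C%:E * \int[Q]_v (g (v ord0 i) ^+ 2 * (`|xi (v ord0 i) (v ord0 j)| * `|xi (v ord0 i') (v ord0 j)|))%:E)%E.
  apply: (peel RS (i := k)); [by meas|by meas|by nneg|by nneg|by nneg|].
  move=> v; under eq_integral do rewrite upd_same !upd_other// !mulrA.
  by rewrite (mulrC C) mulrA; apply: intZ_le; [by meas|by nneg|by nneg|].
have H2 : (\int[Q]_v (g (v ord0 i) ^+ 2 * (`|xi (v ord0 i) (v ord0 j)| * `|xi (v ord0 i') (v ord0 j)|))%:E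
    <= C%:E * \int[Q]_v (g (v ord0 i) ^+ 2 * `|xi (v ord0 i) (v ord0 j)|)%:E)%E.
  apply: (peel RS (i := i')); [by meas|by meas|by nneg|by nneg|by nneg|].
  move=> v; under eq_integral do rewrite upd_same !upd_other 1?eq_sym// mulrA.
  by rewrite (mulrC C); apply: intZ_le; [by meas|by nneg|by nneg|].
have H3 : (\int[Q]_v (g (v ord0 i) ^+ 2 * `|xi (v ord0 i) (v ord0 j)|)%:E <= C%:E * \int[Q]_v (g (v ord0 i) ^+ 2)%:E)%E.
  apply: (peel RS (i := j)); [by meas|by meas|by nneg|by nneg|by nneg|].
  move=> v; under eq_integral do rewrite upd_same !upd_other//.
  by rewrite (mulrC C); apply: intZ_le; [by meas|by nneg|by nneg|].
have CE : (0 <= C%:E)%E by rewrite lee_fin ltW.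
apply: le_trans H1 _; rewrite EFinM lee_wpmul2l//.
apply: le_trans H2 _; rewrite EFinM lee_wpmul2l//.
apply: le_trans H3 _; rewrite EFinM lee_wpmul2l//.
by rewrite (marginal RS (g := fun x => g x ^+ 2)) //; [meas|nneg].
Qed.

(** For two centres [i] and [i'] with the same outer pair, the inequality [2 g g' <= g^2 + g'^2]
    leaves four kernels forming a cycle. One of them is bounded by its supremum and the other three
    in L1, which costs one factor [1 / eta] in place of two. *)
Let cross_moment i j k i' : i != j -> i != k -> j != k -> i' != i -> i' != j -> i' != k ->
  (\int[Q]_v (`|g (v ord0 i) * (xi (v ord0 i) (v ord0 j) * xi (v ord0 i) (v ord0 k)) *
     (g (v ord0 i') * (xi (v ord0 i') (v ord0 j) * xi (v ord0 i') (v ord0 k)))|)%:E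
    <= (C / eta * (C * (C * (C * A ^+ 2))))%:E)%E.
Proof.
move=> ij ik jk i'i i'j i'k.
have ii' : i != i' by rewrite eq_sym.
pose F1 v := g (v ord0 i) ^+ 2 * (`|xi (v ord0 i) (v ord0 j)| * (`|xi (v ord0 i') (v ord0 j)| * `|xi (v ord0 i) (v ord0 k)|)).
pose F2 v := g (v ord0 i') ^+ 2 * (`|xi (v ord0 i') (v ord0 j)| * (`|xi (v ord0 i) (v ord0 j)| * `|xi (v ord0 i') (v ord0 k)|)).
apply: (@le_trans _ _ (\int[Q]_v (C / eta * (2^-1 * (F1 v + F2 v)))%:E)%E); last first.
  have F10 v : 0 <= F1 v by rewrite /F1; nneg.
  have F20 v : 0 <= F2 v by rewrite /F2; nneg.
  have mF1 : measurable_fun setT F1 by rewrite /F1; meas.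
  have mF2 : measurable_fun setT F2 by rewrite /F2; meas.
  apply: intZ_le; [by meas|by []|by move=> v; rewrite mulr_ge0// addr_ge0|].
  rewrite intZ//; [|by meas|by move=> v; exact: addr_ge0].
  rewrite intD// [leRHS](_ : _ = (2^-1)%:E * ((C * (C * (C * A ^+ 2)))%:E + (C * (C * (C * A ^+ 2)))%:E))%E; last first.
    by rewrite -EFinD -EFinM; congr EFin; field.
  by rewrite lee_wpmul2l// leeD//; exact: cycle_moment.
apply: le_int; [by meas|by rewrite /F1 /F2; meas|by []|] => v.
rewrite /F1 /F2 !normrM -(real_normK (num_real (g (v ord0 i)))) -(real_normK (num_real (g (v ord0 i')))).
have h1 := xi_sup (v ord0 i') (v ord0 k); have h2 := xi_sup (v ord0 i) (v ord0 k).
have p1 := normr_ge0 (g (v ord0 i)); have p2 := normr_ge0 (g (v ord0 i')).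
have p3 := normr_ge0 (xi (v ord0 i) (v ord0 j)); have p4 := normr_ge0 (xi (v ord0 i) (v ord0 k)).
have p5 := normr_ge0 (xi (v ord0 i') (v ord0 j)); have p6 := normr_ge0 (xi (v ord0 i') (v ord0 k)).
move: `|g (v ord0 i)| `|g (v ord0 i')| `|xi (v ord0 i) (v ord0 j)| `|xi (v ord0 i) (v ord0 k)| `|xi (v ord0 i') (v ord0 j)| `|xi (v ord0 i') (v ord0 k)| (C / eta) h1 h2 p1 p2 p3 p4 p5 p6.
move=> G G' a c a' c' K h1 h2 p1 p2 p3 p4 p5 p6.
apply: (@le_trans _ _ (2^-1 * ((G ^+ 2 * (a * a' * c)) * c' + (G' ^+ 2 * (a * a' * c')) * c))).
  rewrite -subr_ge0 (_ : _ - _ = 2^-1 * (a * a' * c * c') * (G - G') ^+ 2); last by field.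
  by nneg.
have e1 : G ^+ 2 * (a * a' * c) * c' <= G ^+ 2 * (a * a' * c) * K by rewrite ler_wpM2l//; nneg.
have e2 : G' ^+ 2 * (a * a' * c') * c <= G' ^+ 2 * (a * a' * c') * K by rewrite ler_wpM2l//; nneg.
rewrite (_ : K * _ = 2^-1 * (G ^+ 2 * (a * a' * c) * K + G' ^+ 2 * (a * a' * c') * K)); last by ring.
by rewrite ler_wpM2l// lerD.
Qed.

Let theta3_null j' i j k v : i != j -> i != k -> j != k -> j' \in [:: j; k] ->
  mu.-integrable setT (EFin \o (fun x => theta3 (i, j, k) (upd v j' x))) /\
  (\int[mu]_x (theta3 (i, j, k) (upd v j' x))%:E = 0)%E.
Proof.
move=> ij ik jk; rewrite /theta3 /= ij ik jk /=.
have ix : mu.-integrable setT (EFin \o (xi (v ord0 i))).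
  apply: (@integrable_of_fin_integral _ _ _ _ _ 0) => //.
  by apply: (measurable_fun2_comp (f := fun=> v ord0 i) (g := id) mxi).
have H (F : T -> R) c : (forall x, F x = c * xi (v ord0 i) x) ->
    mu.-integrable setT (EFin \o F) /\ (\int[mu]_x (F x)%:E = 0)%E.
  move=> /funext ->; split; first exact: integrableZ_real.
  by under eq_integral do rewrite EFinM; rewrite integralZl// xi_0 mule0.
have kj : k != j by rewrite eq_sym.
rewrite !inE => /orP[/eqP ->|/eqP ->].
- apply: (H _ (g (v ord0 i) * xi (v ord0 i) (v ord0 k))) => x.
  by rewrite upd_same !upd_other//; ring.
- apply: (H _ (g (v ord0 i) * xi (v ord0 i) (v ord0 j))) => x.
  by rewrite upd_same !upd_other//; ring.
Qed.

(** [N1] holds the six permutations, with covariance of order [eta^(-2)]; [N2] holds the [2 n]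
    triples with the same outer pair, with covariance of order [eta^(-1)]. After scaling, the
    contributions are of order [eps^4 nu^2] and [eps^2 nu^2]. *)
Lemma theta3_sum : L2le Q (fun v => nu ^+ 6 * \sum_s theta3 s v) (3 * A * C ^+ 2 * eps * nu).
Proof.
have mt := measurable_theta3.
split; [by meas|by nneg|].
pose N1 (s : 'I_n * 'I_n * 'I_n) := let i := s.1.1 in let j := s.1.2 in let k := s.2 in
  [:: (i, j, k); (i, k, j); (j, i, k); (j, k, i); (k, i, j); (k, j, i)].
pose N2 (s : 'I_n * 'I_n * 'I_n) := [seq (x, s.1.2, s.2) | x <- enum 'I_n] ++ [seq (x, s.2, s.1.2) | x <- enum 'I_n].
pose B1 := (C / eta) ^+ 2 * A ^+ 2; pose B2 := C / eta * (C * (C * (C * A ^+ 2))).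
have B10 : 0 <= B1 by rewrite /B1; nneg.
have B20 : 0 <= B2 by rewrite /B2; nneg.
have fin s : (\int[Q]_v (theta3 s v ^+ 2)%:E < +oo)%E := le_lt_trans (theta3_sq s) (ltry _).
have := @sum_sq_le _ _ _ Q _ theta3 N1 N2 B1 B2 6 (2 * n%:R) B10 B20 mt fin.
move=> H; under eq_integral do rewrite exprMn.
rewrite intZ ?sqr_ge0//; [|by meas|by move=> v; exact: sqr_ge0].
apply: le_trans (lee_wpmul2l _ (H _ _ _)) _; rewrite ?lee_fin ?sqr_ge0//; last first.
- rewrite !card_prod card_ord !natrM nE /B1 /B2 etaV.
  rewrite [leLHS](_ : _ = 6 * A ^+ 2 * C ^+ 2 * eps ^+ 2 * (eps ^+ 2 * nu ^+ 2) + 2 * A ^+ 2 * C ^+ 4 * (eps ^+ 2 * nu ^+ 2)); last by field; rewrite gt_eqF.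
  rewrite [leRHS](_ : _ = 7 * A ^+ 2 * C ^+ 4 * (eps ^+ 2 * nu ^+ 2) + 2 * A ^+ 2 * C ^+ 4 * (eps ^+ 2 * nu ^+ 2)); last by ring.
  apply: lerD => //; apply: ler_wpM2r; first by nneg.
  have e1 : eps ^+ 2 <= 1 by rewrite exprn_ile1// ltW.
  have c2 : C ^+ 2 <= C ^+ 4 by rewrite ler_weXn2l.
  have a0 := sqr_ge0 A.
  apply: (@le_trans _ _ (6 * A ^+ 2 * C ^+ 2)); first by rewrite ler_piMr//; nneg.
  apply: ler_pM; [by nneg|by nneg|by rewrite ler_wpM2r// ler_nat|by []].
- by move=> s; rewrite size_cat !size_map -enumT size_enum_ord natrD; lra.
move=> [[i j] k] [[i' j'] k'].
have R0 : 0 <= B1 * ((i', j', k') \in N1 (i, j, k))%:R + B2 * ((i', j', k') \in N2 (i, j, k))%:R.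
  by rewrite addr_ge0// mulr_ge0.
case: (boolP [&& i != j, i != k & j != k]) => [/and3P[ij ik jk]|nd]; last first.
  by rewrite /theta3 /= (negPf nd); under eq_integral do rewrite mul0r; rewrite integral0 lee_fin.
case: (boolP [&& i' != j', i' != k' & j' != k']) => [/and3P[ij' ik' jk']|nd]; last first.
  by rewrite /theta3 /= (negPf nd); under eq_integral do rewrite mulr0; rewrite integral0 lee_fin.
have m1 := mt (i, j, k); have m2 := mt (i', j', k').
case: (boolP ((i', j', k') \in N1 (i, j, k))) => [_|n1].
  apply: (@le_trans _ _ B1%:E); last by rewrite lee_fin mulr1 lerDl mulr_ge0.
  by apply: int_le_abs; [meas|apply: int_mul_amgm => //; exact: theta3_sq].
rewrite mulr0 add0r.
case: (boolP ((j', k') \in [:: (j, k); (k, j)])) => [hjk|n2].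
  have -> : (i', j', k') \in N2 (i, j, k).
    rewrite mem_cat; move: hjk; rewrite !inE !xpair_eqE => /orP[/andP[/eqP -> /eqP ->]|/andP[/eqP -> /eqP ->]].
      by apply/orP; left; apply/mapP; exists i' => //; rewrite mem_enum.
    by apply/orP; right; apply/mapP; exists i' => //; rewrite mem_enum.
  rewrite mulr1; apply: int_le_abs; first by meas.
  have i'i : i' != i.
    apply: contra n1 => /eqP ->; move: hjk; rewrite !inE !xpair_eqE eqxx /=.
    by case/orP => ->; rewrite ?orbT.
  move: ij' ik' jk' hjk; rewrite !inE !xpair_eqE => ij' ik' jk' /orP[/andP[/eqP e1 /eqP e2]|/andP[/eqP e1 /eqP e2]]; subst j' k'.
    by rewrite /theta3 /= ij ik jk ij' ik' /=; exact: cross_moment.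
  rewrite /theta3 /= ij ik jk ij' ik' jk' /=.
  by under eq_integral do rewrite (mulrC (xi (_ ord0 i') (_ ord0 k))); exact: cross_moment.
have outs (l a b c : 'I_n) v x : l \notin [:: a; b; c] -> theta3 (a, b, c) (upd v l x) = theta3 (a, b, c) v.
  rewrite !inE !negb_or => /and3P[l1 l2 l3].
  have [l4 l5 l6] : [/\ a != l, b != l & c != l] by rewrite ![_ == l]eq_sym.
  by rewrite /theta3 /= !upd_other.
have /or4P[out|out|out|out] := triple_outside ij ik jk ij' ik' jk' n1 n2.
- rewrite (@cross0 _ _ j)// => [|v x|v|v]; first by rewrite lee_fin mulr_ge0.
  + exact: outs.
  + by have [] := theta3_null (j' := j) v ij ik jk; rewrite ?mem_head.
  + by have [] := theta3_null (j' := j) v ij ik jk; rewrite ?mem_head.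
- rewrite (@cross0 _ _ k)// => [|v x|v|v]; first by rewrite lee_fin mulr_ge0.
  + exact: outs.
  + by have [] := theta3_null (j' := k) v ij ik jk; rewrite ?inE ?eqxx ?orbT.
  + by have [] := theta3_null (j' := k) v ij ik jk; rewrite ?inE ?eqxx ?orbT.
- under eq_integral do rewrite mulrC.
  rewrite (@cross0 _ _ j')// => [|v x|v|v]; first by rewrite lee_fin mulr_ge0.
  + exact: outs.
  + by have [] := theta3_null (j' := j') v ij' ik' jk'; rewrite ?mem_head.
  + by have [] := theta3_null (j' := j') v ij' ik' jk'; rewrite ?mem_head.
- under eq_integral do rewrite mulrC.
  rewrite (@cross0 _ _ k')// => [|v x|v|v]; first by rewrite lee_fin mulr_ge0.
  + exact: outs.
  + by have [] := theta3_null (j' := k') v ij' ik' jk'; rewrite ?inE ?eqxx ?orbT.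
  + by have [] := theta3_null (j' := k') v ij' ik' jk'; rewrite ?inE ?eqxx ?orbT.
Qed.

End order3.

(** * Linearisation of the plain estimator *)

Variables (c I0 sigma tau : R).
Let psi y := phi y / p y - proj2 (fun x => phi x / p x ^+ 2) y - c.
Hypothesis psi_L2 : L2le mu psi sigma.
Hypothesis psi_0 : (\int[mu]_y (psi y)%:E = 0)%E.
Hypothesis c_bias : `|c - I0| <= tau.
Hypothesis nu_small : 4 * C ^+ 2 * nu ^+ 2 <= 1.
Let a x := phi x / p x ^+ 2.
Let g x := phi x / p x ^+ 3.
Let b := proj2 a.

Local Notation ks := ksum.
Local Notation ks2 := ksum2.
Local Notation dl := delta.

Let quotient_le k x : `|phi x / p x ^+ k| <= C ^+ k * `|phi x|.
Proof.
have [->|px] := eqVneq (phi x) 0; first by rewrite mul0r normr0 mulr0.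
have pC := p_low px; have p0 : 0 < p x by apply: lt_le_trans pC; rewrite invr_gt0.
rewrite normrM mulrC ler_wpM2r// normfV normrX (gtr0_norm p0).
rewrite -[C ^+ k]invrK lef_pV2 ?posrE ?exprn_gt0 ?invr_gt0 ?exprn_gt0//.
by rewrite -exprVn lerXn2r ?nnegrE ?invr_ge0 ?(ltW C0) ?(ltW p0).
Qed.

Let quotient_L2 k : L2le mu (fun x => phi x / p x ^+ k) (C ^+ k.+1).
Proof.
rewrite exprSr -[C ^+ k]ger0_norm ?exprn_ge0 ?(ltW C0)//.
apply: L2le_dom (L2leZ (C ^+ k) phi_L2); first by meas.
by move=> x; rewrite [leRHS]normrM (ger0_norm (exprn_ge0 _ (ltW C0))).
Qed.

Let mb : measurable_fun setT b.
Proof. by have [] := proj2_L2 (quotient_L2 2). Qed.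

Definition fh i v : R := n%:R^-1 * \sum_(j < n | j != i) (xi (v ord0 i) (v ord0 j) + p (v ord0 i)).
Definition vh i v : R := ((n%:R - 1) * (n%:R - 2))^-1 *
  \sum_(j < n | j != i) (xi (v ord0 i) (v ord0 j) + p (v ord0 i) - fh i v) ^+ 2.

Let sum_const i (z : R) : \sum_(j < n | j != i) z = (n%:R - 1) * z.
Proof.
rewrite sumr_const -[LHS]mulr_natl; congr (_ * _).
have -> : #|[pred j : 'I_n | j != i]| = n.-1 by rewrite (cardC1 i) card_ord.
by rewrite -subn1 natrB// (leq_trans _ n4).
Qed.

Lemma fhE i v : fh i v = p (v ord0 i) + dl i v.
Proof.
rewrite /fh big_split/= sum_const /delta -/(ks i v).
by field; rewrite gt_eqF.
Qed.

Let ksE i v : ks i v = n%:R * dl i v + p (v ord0 i).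
Proof. by rewrite /delta; field; rewrite gt_eqF. Qed.

Let kap : R := ((n%:R - 1) * (n%:R - 2))^-1.

(** Each summand is [(xi - delta)^2], and the sum of the [xi] is [n delta + p]; the coefficient
    [n + 1] is [2 n - (n - 1)]. *)
Lemma vhE i v : vh i v = kap * (ks2 i v - (n%:R + 1) * dl i v ^+ 2 - 2 * dl i v * p (v ord0 i)).
Proof.
rewrite /vh -/kap; congr (_ * _).
rewrite (eq_bigr (fun j => xi (v ord0 i) (v ord0 j) ^+ 2 + ((- 2 * dl i v) * xi (v ord0 i) (v ord0 j) + dl i v ^+ 2))); last first.
  by move=> j _; rewrite fhE; ring.
rewrite !big_split/= sum_const -mulr_sumr -/(ks i v) -/(ks2 i v) ksE.
by ring.
Qed.

Definition Iplain v : R := n%:R^-1 * \sum_(i < n) phi (v ord0 i) / fh i v.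
Definition Icorr v : R := n%:R^-1 * \sum_(i < n) phi (v ord0 i) / fh i v * (1 - vh i v / fh i v ^+ 2).

(* [bad v < 1] forces every single [|delta i v|] to be small. *)
Definition bad v : R := \sum_(i < n) (4 * C) ^+ 6 * (ks i v / n%:R) ^+ 6.

Let mdl i : measurable_fun setT (dl i).
Proof. exact: measurable_delta. Qed.
Let mks i : measurable_fun setT (ks i).
Proof. exact: measurable_ksum. Qed.
Let mks2 i : measurable_fun setT (ks2 i).
Proof. exact: measurable_ksum2. Qed.

Let pow6_ge0 (z : R) : 0 <= z ^+ 6. Proof. by rewrite (exprM z 2 3) exprn_ge0// sqr_ge0. Qed.

Lemma bad_ge0 v : 0 <= bad v.
Proof. by apply: sumr_ge0 => i _; rewrite mulr_ge0// exprn_ge0// mulr_ge0// ltW. Qed.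

(** The sum of [n] sixth moments has order [n eps^6], the square of [n^-1 h^(-3 d / 2)], which is a
    term of the rate in (b). Fourth moments would give [n eps^4 = n^-1 h^(-2 d)], which need not
    vanish under the assumptions of (b). *)
Lemma bad_L1 : L1le Q bad ((4 * C) ^+ 6 * mconst 3 * (eps ^+ 3 / nu) ^+ 2).
Proof.
have c6 : 0 <= (4 * C) ^+ 6 by exact: pow6_ge0.
have m0 : 0 <= mconst 3 by exact: mconst_ge0.
have L1 i : L1le Q (fun v => (4 * C) ^+ 6 * (ks i v / n%:R) ^+ 6) ((4 * C) ^+ 6 * (mconst 3 * eps ^+ 6)).
  have m6 : 0 <= mconst 3 * eps ^+ 6 by rewrite mulr_ge0// exprn_ge0// ltW.
  split; [by meas|by rewrite mulr_ge0|].
  rewrite (eq_integral (fun v => ((4 * C) ^+ 6 * (ks i v / n%:R) ^+ 6)%:E)); last first.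
    by move=> v _; rewrite ger0_norm// mulr_ge0.
  apply: intZ_le; [by meas|by []|by []|].
  have := ksum_moment (g := fun=> 1) 3 i (measurable_cst _) (fun=> ler01).
  move=> h; apply: le_trans (le_trans _ h) _; last by rewrite int_prob_cst mule1.
  by rewrite le_eqVlt; apply/orP; left; apply/eqP; apply: eq_integral => v _; rewrite mul1r.
apply: L1leW (L1le_sum _ L1) _; first by nneg.
rewrite card_ord nE le_eqVlt; apply/orP; left; apply/eqP.
by field; rewrite gt_eqF.
Qed.

(** If [fh < 1 / (2 C)] while [p >= 1 / C], then [delta < - 1 / (2 C)], and [nu_small] gives
    [4 C ksum / n <= -2 + 4 C^2 nu^2 <= -1]. The summand of index [i] alone then makes [bad v] at
    least 1. *)
Lemma not_bad v i : bad v < 1 -> phi (v ord0 i) != 0 -> (2 * C)^-1 <= fh i v.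
Proof.
move=> vb ph; rewrite leNgt; apply/negP => fs; move: vb; rewrite ltNge => /negP; apply.
rewrite /bad (bigD1 i)//=; apply: (@le_trans _ _ (1 + 0)); first by rewrite addr0.
apply: lerD; last by apply: sumr_ge0 => j _; rewrite mulr_ge0// exprn_ge0// mulr_ge0// ltW.
rewrite -exprMn; set s := (4 * C) * _.
suff s1 : s <= -1.
  rewrite (_ : s ^+ 6 = (- s) ^+ 6); last by rewrite (exprM s 2 3) (exprM (- s) 2 3) sqrrN.
  by rewrite exprn_ege1//; lra.
have pC := p_low ph; have pC' := p_sup (v ord0 i).
have d1 : dl i v < (2 * C)^-1 - C^-1 by move: fs; rewrite fhE; lra.
have e : ks i v / n%:R = dl i v + p (v ord0 i) * nu ^+ 2 by rewrite ksE -nV; field; rewrite gt_eqF.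
have pn : p (v ord0 i) * nu ^+ 2 <= C * nu ^+ 2 by rewrite ler_wpM2r ?sqr_ge0// (le_trans (ler_norm _) pC').
have h : ks i v / n%:R <= (2 * C)^-1 - C^-1 + C * nu ^+ 2 by rewrite e; lra.
rewrite /s; apply: (@le_trans _ _ (4 * C * ((2 * C)^-1 - C^-1 + C * nu ^+ 2))).
  by rewrite ler_wpM2l// mulr_ge0// ltW.
rewrite (_ : 4 * C * _ = -2 + 4 * C ^+ 2 * nu ^+ 2).
  by apply: (@le_trans _ _ (-2 + 1)); [rewrite lerD2l|lra].
by field; rewrite gt_eqF.
Qed.

Definition lin v : R := n%:R^-1 * \sum_(i < n) (phi (v ord0 i) / p (v ord0 i) - a (v ord0 i) * dl i v) - I0.

(** Hoeffding decomposition. The sum with factor [nu^4] collects what the normalisation by [n]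
    misses: the projection [b] occurs [n - 1] times for each index, and [delta] contains
    [- p / n]. *)
Lemma lin_decomposition v : lin v = nu ^+ 2 * (\sum_(i < n) psi (v ord0 i)) + (c - I0)
  + nu ^+ 4 * (\sum_(i < n) (phi (v ord0 i) / p (v ord0 i) + b (v ord0 i)))
  - nu ^+ 4 * \sum_s theta2 a s v.
Proof.
have E2 : \sum_s theta2 a s v = \sum_(i < n) a (v ord0 i) * ks i v - (n%:R - 1) * \sum_(i < n) b (v ord0 i).
  rewrite -(pair_bigA _ (fun i j => theta2 a (i, j) v))/=.
  have E i : \sum_(j < n) theta2 a (i, j) v = a (v ord0 i) * ks i v - \sum_(j < n | i != j) b (v ord0 j).
    have -> : ks i v = \sum_(j < n | i != j) xi (v ord0 i) (v ord0 j) by apply: eq_bigl => j; rewrite eq_sym.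
    rewrite mulr_sumr -sumrB [RHS]big_mkcond; apply: eq_bigr => j _.
    by rewrite /theta2 /=; case: ifP.
  rewrite (eq_bigr _ (fun i _ => E i)) sumrB; congr (_ - _).
  rewrite (exchange_big_dep xpredT)//= mulr_sumr; apply: eq_bigr => j _.
  exact: sum_const.
have Eps : \sum_(i < n) psi (v ord0 i) = \sum_(i < n) phi (v ord0 i) / p (v ord0 i) - \sum_(i < n) b (v ord0 i) - n%:R * c.
  by rewrite /psi !sumrB sumr_const card_ord mulr_natl.
have Ed : \sum_(i < n) (phi (v ord0 i) / p (v ord0 i) - a (v ord0 i) * dl i v) =
    \sum_(i < n) phi (v ord0 i) / p (v ord0 i) - nu ^+ 2 * (\sum_(i < n) a (v ord0 i) * ks i v - \sum_(i < n) phi (v ord0 i) / p (v ord0 i)).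
  rewrite sumrB; congr (_ - _); rewrite -sumrB mulr_sumr; apply: eq_bigr => i _.
  rewrite /delta nV /a; have [->|ph] := eqVneq (phi (v ord0 i)) 0; first by rewrite !mul0r subrr mulr0.
  field; rewrite gt_eqF//; apply: lt_le_trans (p_low ph); by rewrite invr_gt0.
rewrite /lin Ed Eps E2 big_split/= nE.
move: (\sum_(i < n) phi _ / p _) (\sum_(i < n) b _) (\sum_(i < n) a _ * _) => x y z.
by field; rewrite gt_eqF.
Qed.

Let nu_le_eps2 : nu ^+ 2 <= eps * nu. Proof. by rewrite expr2 ler_wpM2r// ltW. Qed.

Lemma lin_L1 : L1le Q lin (nu * sigma + tau + (C ^+ 2 + 4 * C ^+ 4) * (eps * nu)).
Proof.
have H1 := L1le_of_L2 (linear_statistic_L2 psi_L2 psi_0).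
have H2 := L1le_of_L2 (theta2_sum (quotient_L2 2)).
have H3 : L1le Q (fun=> c - I0) tau.
  by split => //; [exact: le_trans c_bias|rewrite int_prob_cst lee_fin].
have q0 : 0 <= C ^+ 2 + C ^+ 3 * C * (eps / nu) by nneg.
have H4 i : L1le Q (fun v => phi (v ord0 i) / p (v ord0 i) + b (v ord0 i)) (C ^+ 2 + C ^+ 3 * C * (eps / nu)).
  have Lb := proj2_L2 (quotient_L2 2).
  have [m1 c1 i1] := L1leD (L1le_of_L2 (quotient_L2 1)) (L1le_of_L2 Lb).
  split => //; first by meas.
  rewrite (marginal RS (g := fun x => `|phi x / p x + b x|)) //; by meas.
have H4s := L1leZ (nu ^+ 4) (L1le_sum q0 H4).
have HH := L1leD (L1leD (L1leD H1 H3) H4s) (L1leZ (-1) H2).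
rewrite (_ : lin = fun v => nu ^+ 2 * (\sum_(i < n) psi (v ord0 i)) + (c - I0)
  + nu ^+ 4 * (\sum_(i < n) (phi (v ord0 i) / p (v ord0 i) + b (v ord0 i)))
  + -1 * (nu ^+ 4 * \sum_s theta2 a s v)); last first.
  by apply/funext => v; rewrite lin_decomposition mulN1r.
apply: L1leW HH _; rewrite -!addrA lerD2l lerD2l normrN1 mul1r card_ord nE ger0_norm ?exprn_ge0 ?(ltW nu0)//.
rewrite (_ : nu ^+ 4 * _ = C ^+ 2 * nu ^+ 2 + C ^+ 4 * (eps * nu)); last by field; rewrite gt_eqF.
rewrite (_ : 3 * _ * _ * _ * _ = 3 * C ^+ 4 * (eps * nu)); last by ring.
have : C ^+ 2 * nu ^+ 2 <= C ^+ 2 * (eps * nu) by rewrite ler_wpM2l ?sqr_ge0.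
by move: (eps * nu) (nu ^+ 2) (C ^+ 2) (C ^+ 4) => x y z t; nra.
Qed.

Let rational2 v i : bad v < 1 ->
  `|phi (v ord0 i) / fh i v - (phi (v ord0 i) / p (v ord0 i) - a (v ord0 i) * dl i v)| <=
  2 * C ^+ 3 * `|phi (v ord0 i) * dl i v ^+ 2|.
Proof.
move=> vb; have [p0|ph] := eqVneq (phi (v ord0 i)) 0.
  by rewrite /a p0 !mul0r !subrr normr0 mulr0.
have pC := p_low ph; have p0 : 0 < p (v ord0 i) by apply: lt_le_trans pC; rewrite invr_gt0.
have fC := not_bad vb ph; have f0 : 0 < fh i v by apply: lt_le_trans fC; rewrite invr_gt0 mulr_gt0.
have fpd : p (v ord0 i) + dl i v != 0 by rewrite -fhE gt_eqF.
rewrite (_ : _ - _ = (phi (v ord0 i) * dl i v ^+ 2) * ((p (v ord0 i))^-1 ^+ 2 * (fh i v)^-1)); last first.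
  by rewrite /a fhE; field; rewrite fpd gt_eqF.
rewrite normrM mulrC ler_wpM2r// ger0_norm; last first.
  by rewrite mulr_ge0 ?exprn_ge0 ?invr_ge0// ltW.
have h1 : (p (v ord0 i))^-1 <= C by rewrite -[C]invrK lef_pV2 ?posrE ?invr_gt0.
have c2 : 0 < 2 * C by rewrite mulr_gt0.
have h2 : (fh i v)^-1 <= 2 * C by rewrite -[2 * C]invrK lef_pV2 ?posrE ?invr_gt0.
rewrite (_ : 2 * C ^+ 3 = C ^+ 2 * (2 * C)); last by ring.
by apply: ler_pM => //; rewrite ?exprn_ge0 ?invr_ge0 ?(ltW p0) ?(ltW f0)// lerXn2r ?nnegrE ?invr_ge0 ?(ltW p0) ?(ltW C0).
Qed.

Definition plain_bound v : R := `|lin v| + n%:R^-1 * \sum_(i < n) 2 * C ^+ 3 * `|phi (v ord0 i) * dl i v ^+ 2|.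

Lemma plain_bound_le v : bad v < 1 -> `|Iplain v - I0| <= plain_bound v.
Proof.
move=> vb; rewrite (_ : Iplain v - I0 = lin v + n%:R^-1 *
   \sum_(i < n) (phi (v ord0 i) / fh i v - (phi (v ord0 i) / p (v ord0 i) - a (v ord0 i) * dl i v))); last first.
  rewrite /lin /Iplain; have -> : \sum_(i < n) (phi (v ord0 i) / fh i v - (phi (v ord0 i) / p (v ord0 i) - a (v ord0 i) * dl i v)) =
    \sum_(i < n) phi (v ord0 i) / fh i v - \sum_(i < n) (phi (v ord0 i) / p (v ord0 i) - a (v ord0 i) * dl i v) by rewrite sumrB.
  by ring.
apply: le_trans (ler_normD _ _) _; rewrite lerD2l normrM ger0_norm ?invr_ge0 ?(ltW n0)//.
rewrite ler_wpM2l ?invr_ge0 ?(ltW n0)//; apply: le_trans (ler_norm_sum _ _ _) _.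
by apply: ler_sum => i _; exact: rational2.
Qed.

Definition plain_const : R := 1 + (C ^+ 2 + 4 * C ^+ 4) + 2 * C ^+ 3 * d2const.

Let d2_ge0 : 0 <= d2const.
Proof. by rewrite /d2const; have := mconst_ge0 1 => h; nneg. Qed.

Let average_L1 (F : 'I_n -> S -> R) k : 0 <= k -> (forall i, L1le Q (F i) k) ->
  L1le Q (fun v => n%:R^-1 * \sum_(i < n) F i v) k.
Proof.
move=> k0 HF; apply: L1leW (L1leZ n%:R^-1 (L1le_sum k0 HF)) _.
by rewrite card_ord ger0_norm ?invr_ge0 ?(ltW n0)// mulKf// gt_eqF.
Qed.

Lemma abs_L1 (F : S -> R) k : L1le Q F k -> L1le Q (fun v => `|F v|) k.
Proof. by move=> [mF k0 Fk]; apply: (L1le_dom _ _ (And3 mF k0 Fk)); [by meas|by move=> v; rewrite normr_id]. Qed.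

Hypothesis sigma0 : 0 <= sigma.
Hypothesis tau0 : 0 <= tau.

Lemma plain_L1 : L1le Q plain_bound (plain_const * (nu * sigma + tau + eps ^+ 2)).
Proof.
have k0 : 0 <= 2 * C ^+ 3 * (d2const * eps ^+ 2) by nneg.
have H2 i : L1le Q (fun v => 2 * C ^+ 3 * `|phi (v ord0 i) * dl i v ^+ 2|) (2 * C ^+ 3 * (d2const * eps ^+ 2)).
  have c0 : 0 <= 2 * C ^+ 3 by rewrite mulr_ge0// exprn_ge0// ltW.
  apply: L1leZn; [by rewrite c0 lexx|]; apply: abs_L1.
  exact: (phi_delta2 i).
apply: L1leW (L1leD (abs_L1 lin_L1) (average_L1 k0 H2)) _.
have h1 : eps * nu <= eps ^+ 2 by rewrite expr2 ler_wpM2l// ltW.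
have h2 : 0 <= nu * sigma by rewrite mulr_ge0// ltW.
have K0 : 0 <= C ^+ 2 + 4 * C ^+ 4 by rewrite addr_ge0 ?mulr_ge0 ?exprn_ge0// ltW.
have L0 : 0 <= 2 * C ^+ 3 * d2const by rewrite mulr_ge0// mulr_ge0// exprn_ge0// ltW.
rewrite /plain_const (mulrA (2 * C ^+ 3)); have e0 := sqr_ge0 eps.
move: (C ^+ 2 + _) (2 * _ * _) (nu * sigma) (eps * nu) (eps ^+ 2) K0 L0 h1 h2 e0 => x y z t u *.
by move: tau0; nra.
Qed.

Let mfh i : measurable_fun setT (fh i).
Proof. by rewrite /fh; meas. Qed.

Let mvh i : measurable_fun setT (vh i).
Proof. by have m := mfh i; rewrite /vh; meas. Qed.

Theorem plain_tail M t : 0 < M -> M * (nu * sigma + tau + eps ^+ 2) <= t ->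
  (Q [set v | (t < `|Iplain v - I0|)%R] <=
  ((4 * C) ^+ 6 * mconst 3 * (eps ^+ 3 / nu) ^+ 2 + plain_const / M)%:E)%E.
Proof.
move=> M0 Mt; apply: (markov_combine (F := bad) (D := plain_bound) _ M0 Mt) => //.
- by rewrite ltr_wpDl ?exprn_gt0// addr_ge0// mulr_ge0// ltW.
- by rewrite /Iplain; meas.
- exact: bad_ge0.
- exact: plain_bound_le.
- exact: bad_L1.
- exact: plain_L1.
Qed.

(** * Expansion of the corrected estimator *)

Let C3_ge0 : 0 <= C ^+ 3. Proof. by nneg. Qed.
Let C4_ge0 : 0 <= C ^+ 4. Proof. by nneg. Qed.

Let N4 : 4 <= n%:R :> R. Proof. by rewrite ler_nat. Qed.

(** The constant [3 / 8] is the value of the ratio at [n = 4]. *)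
Let den_ge : 3 / 8 * n%:R ^+ 2 <= (n%:R - 1) * (n%:R - 2) :> R.
Proof. by have := N4; move: (n%:R) => N h; nra. Qed.

Let den_gt0 : 0 < (n%:R - 1) * (n%:R - 2) :> R.
Proof. by apply: lt_le_trans den_ge; rewrite mulr_gt0// exprn_gt0. Qed.

Let kap_ge0 : 0 <= kap. Proof. by rewrite /kap invr_ge0 ltW. Qed.

Let kap_n2 : kap * n%:R ^+ 2 <= 3.
Proof. by rewrite /kap mulrC ler_pdivrMr//; have := den_ge; have := sqr_ge0 (n%:R : R); lra. Qed.

Let kap_le : kap <= 3 * nu ^+ 4.
Proof.
rewrite (_ : kap = (kap * n%:R ^+ 2) * nu ^+ 4); first by rewrite ler_wpM2r// exprn_ge0// ltW.
by rewrite nE; field; rewrite gt_eqF.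
Qed.

Let kap_n : kap * (n%:R + 1) <= 6 * nu ^+ 2.
Proof.
apply: (@le_trans _ _ (kap * (2 * n%:R))); first by rewrite ler_wpM2l//; have := N4; lra.
rewrite (_ : kap * _ = (kap * n%:R ^+ 2) * (2 * nu ^+ 2)); last by rewrite nE; field; rewrite gt_eqF.
by have := kap_n2; have := sqr_ge0 nu; move: (kap * _) (nu ^+ 2) => x y; nra.
Qed.

Let kap_diff : `|n%:R ^+ 2 * (n%:R ^- 2 - kap)| <= 9 * nu ^+ 2.
Proof.
have nz : n%:R != 0 :> R by rewrite gt_eqF.
have dz : (n%:R - 1) * (n%:R - 2) != 0 :> R by rewrite gt_eqF.
rewrite (_ : _ * _ = - ((3 * n%:R - 2) * kap)); last first.
  move: dz; rewrite /kap mulf_eq0 negb_or => /andP[d1 d2].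
  by field; rewrite nz d1 d2.
have p2 : 0 <= 3 * n%:R - 2 :> R by have := N4; lra.
rewrite normrN ger0_norm; last by rewrite mulr_ge0.
apply: (@le_trans _ _ (3 * n%:R * kap)); first by rewrite ler_wpM2r//; lra.
rewrite (_ : _ * kap = 3 * (kap * n%:R ^+ 2) * nu ^+ 2); last by rewrite nE; field; rewrite gt_eqF.
by rewrite ler_wpM2r ?sqr_ge0//; have := kap_n2; lra.
Qed.

Let nu4_le2 : nu ^+ 4 <= nu ^+ 2.
Proof. by rewrite (exprD nu 2 2) ler_piMr ?sqr_ge0// exprn_ile1// ltW. Qed.
Let nu2_le1 : nu ^+ 2 <= 1. Proof. by rewrite exprn_ile1// ltW. Qed.

Lemma theta3_sumE v : \sum_s theta3 g s v = \sum_(i < n) g (v ord0 i) * (ks i v ^+ 2 - ks2 i v).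
Proof.
rewrite -(pair_bigA _ (fun s k => theta3 g (s, k) v))/=.
rewrite -(pair_bigA _ (fun i j => \sum_k theta3 g (i, j, k) v))/=; apply: eq_bigr => i _.
rewrite expr2 {1}/ksum /ksum2 mulr_suml -sumrB mulr_sumr [RHS]big_mkcond/=; apply: eq_bigr => j _.
case: (eqVneq j i) => [->|ji] /=; first by rewrite big1// => k _; rewrite /theta3 /= eqxx.
rewrite /ksum [X in _ * (_ * X - _)](bigD1 j)//=.
rewrite [X in _ = _ * X](_ : _ = xi (v ord0 i) (v ord0 j) * \sum_(k < n | (k != i) && (k != j)) xi (v ord0 i) (v ord0 k)); last by ring.
rewrite mulr_sumr mulr_sumr [RHS]big_mkcond/=.
apply: eq_bigr => k _; rewrite /theta3 /= (eq_sym i j) ji /= (eq_sym i k) (eq_sym j k).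
by case: ifP.
Qed.

Definition rest_bound i v : R := C ^+ 3 * (9 * nu ^+ 2 * `|phi (v ord0 i) * (ks2 i v / n%:R ^+ 2)|
  + 8 * C * nu ^+ 2 * `|phi (v ord0 i) * dl i v| + C ^+ 2 * nu ^+ 4 * `|phi (v ord0 i)|
  + 6 * nu ^+ 2 * `|phi (v ord0 i) * dl i v ^+ 2|).

Definition cubic_bound i v : R := C ^+ 4 * (86 * `|phi (v ord0 i) * dl i v ^+ 3|
  + 42 * `|phi (v ord0 i) * (ks2 i v / n%:R ^+ 2 * dl i v)| + 84 * C * nu ^+ 4 * `|phi (v ord0 i) * dl i v ^+ 2|).

Let g_le x : `|g x| <= C ^+ 3 * `|phi x|. Proof. exact: quotient_le. Qed.

(** To leading order [vh] is [ksum2 / n^2], the diagonal of [(ksum / n)^2]. What remains of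
    [delta^2 - vh] beside the off-diagonal sum carries an additional factor [nu^2]. *)
Let quadratic_rest i v : `|g (v ord0 i) * (dl i v ^+ 2 - vh i v) - nu ^+ 4 * (g (v ord0 i) * (ks i v ^+ 2 - ks2 i v))|
  <= rest_bound i v.
Proof.
have pC := p_sup (v ord0 i); have gC := g_le (v ord0 i).
have E : dl i v ^+ 2 - vh i v - nu ^+ 4 * (ks i v ^+ 2 - ks2 i v) =
    n%:R ^+ 2 * (n%:R ^- 2 - kap) * (ks2 i v / n%:R ^+ 2) + 2 * p (v ord0 i) * (kap - nu ^+ 2) * dl i v
    - nu ^+ 4 * p (v ord0 i) ^+ 2 + kap * (n%:R + 1) * dl i v ^+ 2.
  by rewrite vhE ksE nE; move: (ks2 i v) kap => w k; field; rewrite gt_eqF.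
rewrite mulrCA -mulrBr E normrM; move: gC; set G := `|g _|; move=> gC.
set A := `|_ + _|.
suff AB : A <= 9 * nu ^+ 2 * `|ks2 i v / n%:R ^+ 2| + 8 * C * nu ^+ 2 * `|dl i v| + C ^+ 2 * nu ^+ 4 + 6 * nu ^+ 2 * `|dl i v ^+ 2|.
  rewrite /rest_bound !(normrM (phi (v ord0 i))).
  apply: (@le_trans _ _ ((C ^+ 3 * `|phi (v ord0 i)|) * (9 * nu ^+ 2 * `|ks2 i v / n%:R ^+ 2| + 8 * C * nu ^+ 2 * `|dl i v| + C ^+ 2 * nu ^+ 4 + 6 * nu ^+ 2 * `|dl i v ^+ 2|))).
    by apply: ler_pM => //; exact: normr_ge0.
  by rewrite le_eqVlt; apply/orP; left; apply/eqP; ring.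
rewrite /A; apply: le_trans (ler_normD _ _) _; apply: lerD; last first.
  by rewrite normrM ler_wpM2r// ger0_norm ?mulr_ge0 ?addr_ge0.
apply: le_trans (ler_normB _ _) _; apply: lerD; last first.
  have n40 : 0 <= nu ^+ 4 by nneg.
  rewrite normrM (ger0_norm n40) [leRHS]mulrC ler_wpM2l//.
  by rewrite normrX lerXn2r ?nnegrE ?(ltW C0).
apply: le_trans (ler_normD _ _) _; apply: lerD; first by rewrite normrM ler_wpM2r.
rewrite normrM ler_wpM2r// !normrM ger0_norm//.
have k1 : `|kap - nu ^+ 2| <= 4 * nu ^+ 2.
  have := kap_le; have := kap_ge0; have := sqr_ge0 nu; have := nu4_le2.
  by move=> *; rewrite ler_norml; apply/andP; split; lra.
rewrite (_ : 8 * C * nu ^+ 2 = 2 * C * (4 * nu ^+ 2)); last by ring.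
by apply: ler_pM => //; rewrite ?mulr_ge0// ler_wpM2l.
Qed.

(** With [P = 1 / p] and [F = 1 / fh] the difference equals [- phi delta^3 P^3 F + phi vh delta (P^3
    F + P^2 F^2 + P F^3)]. As [P <= C] and [F <= 2 C], the brackets are at most [2 C^4] and
    [(2 + 4 + 8) C^4]; inserting [vhE] for [vh] gives [86 = 2 + 14 * 6], [42 = 14 * 3] and
    [84 = 14 * 6]. *)
Let cubic i v : bad v < 1 -> `|phi (v ord0 i) / fh i v * (1 - vh i v / fh i v ^+ 2) -
  (phi (v ord0 i) / p (v ord0 i) - a (v ord0 i) * dl i v + g (v ord0 i) * (dl i v ^+ 2 - vh i v))| <= cubic_bound i v.
Proof.
move=> vb; have [p0|ph] := eqVneq (phi (v ord0 i)) 0.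
  rewrite (_ : _ - _ = 0) ?normr0; first by rewrite /cubic_bound; nneg.
  by rewrite /a /g p0 !mul0r addr0 !subr0.
have pC := p_low ph; have p0 : 0 < p (v ord0 i) by apply: lt_le_trans pC; rewrite invr_gt0.
have fC := not_bad vb ph; have f0 : 0 < fh i v by apply: lt_le_trans fC; rewrite invr_gt0 mulr_gt0.
have c2 : 0 < 2 * C by rewrite mulr_gt0.
have h1 : (p (v ord0 i))^-1 <= C by rewrite -[C]invrK lef_pV2 ?posrE ?invr_gt0.
have h2 : (fh i v)^-1 <= 2 * C by rewrite -[2 * C]invrK lef_pV2 ?posrE ?invr_gt0.
have E : phi (v ord0 i) / fh i v * (1 - vh i v / fh i v ^+ 2) -
  (phi (v ord0 i) / p (v ord0 i) - a (v ord0 i) * dl i v + g (v ord0 i) * (dl i v ^+ 2 - vh i v)) =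
  - (phi (v ord0 i) * dl i v ^+ 3) * ((p (v ord0 i))^-1 ^+ 3 * (fh i v)^-1) +
  (phi (v ord0 i) * (vh i v * dl i v)) * ((p (v ord0 i))^-1 ^+ 3 * (fh i v)^-1 + (p (v ord0 i))^-1 ^+ 2 * (fh i v)^-1 ^+ 2
    + (p (v ord0 i))^-1 * (fh i v)^-1 ^+ 3).
  have fpd : p (v ord0 i) + dl i v != 0 by rewrite -fhE gt_eqF.
  by rewrite /a /g fhE; move: (vh i v) => w; field; rewrite fpd gt_eqF.
have P0 : 0 <= (p (v ord0 i))^-1 by rewrite invr_ge0 ltW.
have Q0 : 0 <= (fh i v)^-1 by rewrite invr_ge0 ltW.
have b1 : (p (v ord0 i))^-1 ^+ 3 * (fh i v)^-1 <= C ^+ 3 * (2 * C).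
  by apply: ler_pM; rewrite ?exprn_ge0// lerXn2r ?nnegrE ?(ltW C0).
have b2 : (p (v ord0 i))^-1 ^+ 2 * (fh i v)^-1 ^+ 2 <= C ^+ 2 * (2 * C) ^+ 2.
  by apply: ler_pM; rewrite ?exprn_ge0// lerXn2r ?nnegrE ?(ltW C0) ?(ltW c2).
have b3 : (p (v ord0 i))^-1 * (fh i v)^-1 ^+ 3 <= C * (2 * C) ^+ 3.
  by apply: ler_pM; rewrite ?exprn_ge0// lerXn2r ?nnegrE ?(ltW C0) ?(ltW c2).
rewrite E; apply: le_trans (ler_normD _ _) _.
apply: (@le_trans _ _ (2 * C ^+ 4 * `|phi (v ord0 i) * dl i v ^+ 3| + 14 * C ^+ 4 * `|phi (v ord0 i) * (vh i v * dl i v)|)).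
  apply: lerD.
    rewrite normrM normrN mulrC ler_wpM2r// ger0_norm ?mulr_ge0 ?exprn_ge0//.
    by apply: le_trans b1 _; rewrite (exprSr C 3); lra.
  rewrite normrM mulrC ler_wpM2r// ger0_norm; last by rewrite !addr_ge0 ?mulr_ge0 ?exprn_ge0.
  rewrite (_ : 14 * C ^+ 4 = C ^+ 3 * (2 * C) + C ^+ 2 * (2 * C) ^+ 2 + C * (2 * C) ^+ 3); last by ring.
  by rewrite !lerD.
have V : `|phi (v ord0 i) * (vh i v * dl i v)| <= 3 * `|phi (v ord0 i) * (ks2 i v / n%:R ^+ 2 * dl i v)|
    + 6 * `|phi (v ord0 i) * dl i v ^+ 3| + 6 * C * nu ^+ 4 * `|phi (v ord0 i) * dl i v ^+ 2|.
  have -> : phi (v ord0 i) * (vh i v * dl i v) = (kap * n%:R ^+ 2) * (phi (v ord0 i) * (ks2 i v / n%:R ^+ 2 * dl i v))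
      - (kap * (n%:R + 1)) * (phi (v ord0 i) * dl i v ^+ 3) - (2 * kap * p (v ord0 i)) * (phi (v ord0 i) * dl i v ^+ 2).
    by rewrite vhE; move: kap => k; field; rewrite gt_eqF.
  apply: le_trans (ler_normB _ _) _; apply: lerD; last first.
    rewrite normrM ler_wpM2r// !normrM !ger0_norm// ?(ltW p0)//.
    rewrite (_ : 6 * C * _ = 2 * (3 * nu ^+ 4) * C); last by ring.
    apply: ler_pM; [by nneg|exact: ltW|by rewrite ler_wpM2l|exact: le_trans (ler_norm _) (p_sup _)].
  apply: le_trans (ler_normB _ _) _; apply: lerD.
    by rewrite normrM ler_wpM2r// ger0_norm// mulr_ge0// sqr_ge0.
  rewrite normrM ler_wpM2r// ger0_norm ?mulr_ge0 ?addr_ge0//.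
  by apply: le_trans kap_n _; rewrite -[leRHS]mulr1 ler_wpM2l.
have V' : 14 * C ^+ 4 * `|phi (v ord0 i) * (vh i v * dl i v)| <= 14 * C ^+ 4 * (3 * `|phi (v ord0 i) * (ks2 i v / n%:R ^+ 2 * dl i v)|
    + 6 * `|phi (v ord0 i) * dl i v ^+ 3| + 6 * C * nu ^+ 4 * `|phi (v ord0 i) * dl i v ^+ 2|).
  by apply: ler_wpM2l => //; nneg.
apply: (le_trans (lerD (lexx _) V')); rewrite /cubic_bound le_eqVlt; apply/orP; left; apply/eqP.
by move: `|_| `|_| `|_| => x y z; ring.
Qed.

Definition corr_bound v : R := `|lin v| + `|nu ^+ 6 * \sum_s theta3 g s v|
  + n%:R^-1 * (\sum_(i < n) rest_bound i v) + n%:R^-1 * (\sum_(i < n) cubic_bound i v).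

Lemma corr_bound_le v : bad v < 1 -> `|Icorr v - I0| <= corr_bound v.
Proof.
move=> vb.
pose X i := phi (v ord0 i) / fh i v * (1 - vh i v / fh i v ^+ 2).
pose Y i := phi (v ord0 i) / p (v ord0 i) - a (v ord0 i) * dl i v.
pose Z i := g (v ord0 i) * (dl i v ^+ 2 - vh i v).
pose W i := nu ^+ 4 * (g (v ord0 i) * (ks i v ^+ 2 - ks2 i v)).
have E : Icorr v - I0 = lin v + nu ^+ 6 * (\sum_s theta3 g s v)
    + n%:R^-1 * (\sum_(i < n) (Z i - W i)) + n%:R^-1 * (\sum_(i < n) (X i - (Y i + Z i))).
  rewrite theta3_sumE /lin /Icorr -/(X _).
  have -> : \sum_(i < n) (Z i - W i) = \sum_(i < n) Z i - nu ^+ 4 * \sum_(i < n) g (v ord0 i) * (ks i v ^+ 2 - ks2 i v).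
    by rewrite sumrB mulr_sumr.
  have -> : \sum_(i < n) (X i - (Y i + Z i)) = \sum_(i < n) X i - (\sum_(i < n) Y i + \sum_(i < n) Z i).
    by rewrite sumrB big_split.
  rewrite -/(Y _) (exprD nu 2 4) -nV.
  have -> : \sum_(i < n) (phi (v ord0 i) / p (v ord0 i) - a (v ord0 i) * dl i v) = \sum_(i < n) Y i by [].
  have -> : \sum_(i < n) phi (v ord0 i) / fh i v * (1 - vh i v / fh i v ^+ 2) = \sum_(i < n) X i by [].
  by ring.
have nVge : 0 <= n%:R^-1 :> R by rewrite invr_ge0 ltW.
rewrite E /corr_bound; apply: le_trans (ler_normD _ _) _; apply: lerD; last first.
  rewrite normrM ger0_norm// ler_wpM2l//; apply: le_trans (ler_norm_sum _ _ _) _.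
  by apply: ler_sum => i _; exact: cubic.
apply: le_trans (ler_normD _ _) _; apply: lerD; last first.
  rewrite normrM ger0_norm// ler_wpM2l//; apply: le_trans (ler_norm_sum _ _ _) _.
  by apply: ler_sum => i _; exact: quadratic_rest.
exact: ler_normD.
Qed.

Definition rest_const : R := C ^+ 3 * (9 * (mconst 1 * C) + 8 * C * ((d2const + C) / 2) + C ^+ 2 * C + 6 * d2const).
Definition cubic_const : R := C ^+ 4 * (86 * d3const + 42 * ((mconst 2 * C + d2const) / 2) + 84 * C * d2const).
Definition corr_const : R := 1 + (C ^+ 2 + 4 * C ^+ 4) + 3 * C ^+ 4 * C ^+ 2 + rest_const + cubic_const.

Let d4_ge0 : 0 <= d4const.
Proof. by rewrite /d4const; have := mconst_ge0 2 => h; nneg. Qed.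
Let d3_ge0 : 0 <= d3const.
Proof. by rewrite /d3const; nneg. Qed.
Let m1_ge0 : 0 <= mconst 1. Proof. exact: mconst_ge0. Qed.
Let m2_ge0 : 0 <= mconst 2. Proof. exact: mconst_ge0. Qed.
Let rest_const_ge0 : 0 <= rest_const. Proof. by rewrite /rest_const; nneg. Qed.
Let cubic_const_ge0 : 0 <= cubic_const. Proof. by rewrite /cubic_const; nneg. Qed.

Let scaled (F : S -> R) (x k y : R) : 0 <= x -> L1le Q F k -> L1le Q (fun v => x * `|F v|) (x * k).
Proof. by move=> x0 LF; apply: L1leZn; [rewrite x0 lexx|exact: abs_L1]. Qed.

Lemma rest_L1 i : L1le Q (rest_bound i) (rest_const * (eps * nu)).
Proof.
have H1 := phi_ksum2_1 i.
have H2 := phi_delta1 i.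
have H3 := phi_marginal i.
have H4 := phi_delta2 i.
have q1 : 0 <= 9 * nu ^+ 2 by nneg.
have q2 : 0 <= 8 * C * nu ^+ 2 by nneg.
have q3 : 0 <= C ^+ 2 * nu ^+ 4 by nneg.
have q4 : 0 <= 6 * nu ^+ 2 by nneg.
have L := L1leD (L1leD (L1leD (scaled 0 q1 H1) (scaled 0 q2 H2)) (scaled 0 q3 H3)) (scaled 0 q4 H4).
have c33 : 0 <= C ^+ 3 <= C ^+ 3 by rewrite C3_ge0 lexx.
apply: L1leW (L1leZn c33 L) _.
rewrite /rest_const -[leRHS]mulrA ler_wpM2l//.
have s1 : nu ^+ 2 * eps ^+ 2 <= eps * nu.
  rewrite (_ : _ * _ = (eps * nu) * (eps * nu)); last by ring.
  by rewrite ler_piMr ?mulr_ge0 ?(ltW eps0) ?(ltW nu0)// mulr_ile1 ?(ltW eps0) ?(ltW nu0).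
have s2 : nu ^+ 2 * eps <= eps * nu by rewrite mulrC ler_wpM2l ?(ltW eps0)// expr2 ler_piMr// ltW.
have s3 : nu ^+ 4 <= eps * nu by apply: le_trans nu4_le2 _.
rewrite [leLHS](_ : _ = 9 * (mconst 1 * C) * (nu ^+ 2 * eps ^+ 2) + 8 * C * ((d2const + C) / 2) * (nu ^+ 2 * eps)
  + C ^+ 2 * C * nu ^+ 4 + 6 * d2const * (nu ^+ 2 * eps ^+ 2)); last by ring.
apply: (@le_trans _ _ (9 * (mconst 1 * C) * (eps * nu) + 8 * C * ((d2const + C) / 2) * (eps * nu)
  + C ^+ 2 * C * (eps * nu) + 6 * d2const * (eps * nu))).
  by apply: lerD; [apply: lerD; [apply: lerD|]|]; apply: ler_wpM2l => //; nneg.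
by rewrite le_eqVlt; apply/orP; left; apply/eqP; ring.
Qed.

Lemma cubic_L1 i : L1le Q (cubic_bound i) (cubic_const * eps ^+ 3).
Proof.
have H1 := phi_delta3 i.
have H2 := phi_ksum2_delta i.
have H3 := phi_delta2 i.
have q1 : 0 <= 86 :> R by [].
have q2 : 0 <= 42 :> R by [].
have q3 : 0 <= 84 * C * nu ^+ 4 by nneg.
have L := L1leD (L1leD (scaled 0 q1 H1) (scaled 0 q2 H2)) (scaled 0 q3 H3).
have c44 : 0 <= C ^+ 4 <= C ^+ 4 by rewrite C4_ge0 lexx.
apply: L1leW (L1leZn c44 L) _.
rewrite /cubic_const -[leRHS]mulrA ler_wpM2l//.
have s1 : nu ^+ 4 * eps ^+ 2 <= eps ^+ 3.
  rewrite (exprS eps 2) ler_wpM2r ?sqr_ge0//.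
  by apply: le_trans nu4_le2 _; apply: le_trans nu_le_eps2 _; rewrite ler_piMr// ltW.
rewrite [leLHS](_ : _ = 86 * d3const * eps ^+ 3 + 42 * ((mconst 2 * C + d2const) / 2) * eps ^+ 3
  + 84 * C * d2const * (nu ^+ 4 * eps ^+ 2)); last by ring.
rewrite [leRHS]mulrDl [X in _ <= X + _]mulrDl lerD2l.
by apply: ler_wpM2l => //; nneg.
Qed.

Lemma corr_L1 : L1le Q corr_bound (corr_const * (nu * sigma + tau + eps * nu + eps ^+ 3)).
Proof.
have H3 := L1le_of_L2 (theta3_sum (quotient_L2 3)).
have r0 : 0 <= rest_const * (eps * nu) by rewrite mulr_ge0// mulr_ge0// ltW.
have c0 : 0 <= cubic_const * eps ^+ 3 by rewrite mulr_ge0// exprn_ge0// ltW.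
have L := L1leD (L1leD (L1leD (abs_L1 lin_L1) (abs_L1 H3)) (average_L1 r0 rest_L1)) (average_L1 c0 cubic_L1).
apply: L1leW L _.
rewrite (_ : 3 * C ^+ 4 * C ^+ 2 * eps * nu = 3 * C ^+ 4 * C ^+ 2 * (eps * nu)); last by ring.
have L0 : 0 <= C ^+ 2 + 4 * C ^+ 4 by nneg.
have T0 : 0 <= 3 * C ^+ 4 * C ^+ 2 by nneg.
have e0 : 0 <= eps * nu by rewrite mulr_ge0// ltW.
have e3 : 0 <= eps ^+ 3 by rewrite exprn_ge0// ltW.
have s0 : 0 <= nu * sigma by rewrite mulr_ge0// ltW.
rewrite /corr_const; move: tau0 rest_const_ge0 cubic_const_ge0 L0 T0 e0 e3 s0.
move: (C ^+ 2 + _) (3 * _ * _) (eps * nu) (eps ^+ 3) (nu * sigma) rest_const cubic_const tau => x y z t u rc cc ta *.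
have h1 : 0 <= x * (u + ta + t) by nneg.
have h2 : 0 <= y * (u + ta + t) by nneg.
have h3 : 0 <= rc * (u + ta + t) by nneg.
have h4 : 0 <= cc * (u + ta + z) by nneg.
by lra.
Qed.

Theorem corr_tail M t : 0 < M -> M * (nu * sigma + tau + eps * nu + eps ^+ 3) <= t ->
  (Q [set v | (t < `|Icorr v - I0|)%R] <=
  ((4 * C) ^+ 6 * mconst 3 * (eps ^+ 3 / nu) ^+ 2 + corr_const / M)%:E)%E.
Proof.
move=> M0 Mt; apply: (markov_combine (F := bad) (D := corr_bound) _ M0 Mt) => //.
- by rewrite ltr_wpDl ?exprn_gt0// !addr_ge0// mulr_ge0// ltW.
- by rewrite /Icorr; meas.
- exact: bad_ge0.
- exact: corr_bound_le.
- exact: bad_L1.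
- exact: corr_L1.
Qed.

End array.

(** * Integration against a law with bounded density *)

Section density.
Context {R : realType} {disp : measure_display} {Omega : measurableType disp} (P : probability Omega R).
Context {d : nat}.
Local Notation V := ('rV[R]_d).
Variables (X0 : {RV P >-> V}) (f : V -> R).
Hypothesis fX : has_density X0 f.
Let mu := distribution P X0.
Implicit Types g : V -> R.

Let mf : measurable_fun setT f. Proof. by case: fX. Qed.
Let f0 x : 0 <= f x. Proof. by case: fX. Qed.

Let level_measure (y : R) : 0 <= y ->
  (\int[lebesgue_measure]_s (if (0 <= s) && (s < y) then (1 : R) else 0)%:E = y%:E)%E.
Proof.
move=> y0; transitivity (\int[@lebesgue_measure R]_s (\1_(`[0, y[%classic : set R) s)%:E)%E.
  apply: eq_integral => s _; rewrite indicE; congr EFin.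
  by case: ifPn => h; [rewrite mem_set//= in_itv|rewrite memNset//= in_itv; exact/negP].
transitivity (@lebesgue_measure R `[0, y[%classic); first by rewrite integral_indic// setIT.
rewrite lebesgue_measure_itv/= lte_fin.
by case: ltP => // ?; [rewrite sube0|congr EFin; apply/le_anti/andP].
Qed.

(** Layer-cake representation: a density speaks about measures of sets, and Tonelli reduces the
    integral of [g] to the measures of its level sets. *)
Lemma int_density g : measurable_fun setT g -> (forall x, 0 <= g x) ->
  (\int[mu]_x (g x)%:E = \int[leb R d]_x (g x * f x)%:E)%E.
Proof.
move=> mg g0.
pose lev (s y : R) : R := if (0 <= s) && (s < y) then 1 else 0.
have lev0 s y : 0 <= lev s y by rewrite /lev; case: ifP.
have mlev (d1 : measure_display) (U : measurableType d1) (F G : U -> R) : measurable_fun setT F ->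
    measurable_fun setT G -> measurable_fun setT (fun u => lev (F u) (G u)).
  move=> mF mG; apply: measurable_fun_ifT; [|by meas|by meas].
  by apply: measurable_and; [exact: measurable_fun_ler|exact: measurable_fun_ltr].
transitivity (\int[mu]_x \int[lebesgue_measure]_s (lev s (g x))%:E)%E.
  by apply: eq_integral => x _; rewrite level_measure.
have mgx : measurable_fun [set: V * R] (fun p => lev p.2 (g p.1)) by apply: mlev; meas.
rewrite (@int_tonelli _ _ _ _ _ mu lebesgue_measure (fun x s => lev s (g x)))//.
transitivity (\int[lebesgue_measure]_s \int[leb R d]_x (lev s (g x) * f x)%:E)%E.
  apply: eq_integral => s _.
  have mls : measurable_fun setT (fun x : V => lev s (g x)) by apply: mlev; meas.
  pose A := [set x : V | lev s (g x) = 1].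
  have mA : measurable A.
    rewrite (_ : A = setT `&` (fun x => lev s (g x)) @^-1` [set 1]); first exact: mls.
    by rewrite setTI.
  transitivity (mu A).
    transitivity (\int[mu]_x (\1_A x)%:E)%E; last by rewrite integral_indic// setIT.
    apply: eq_integral => x _; congr EFin; rewrite indicE.
    have [e|e] := eqVneq (lev s (g x)) 1; first by rewrite mem_set.
    rewrite memNset; last by move=> /eqP; exact/negP.
    by move: e; rewrite /lev; case: ifP => //; rewrite eqxx.
  have [_ _ fA] := fX; rewrite /mu fA//.
  rewrite integral_mkcond; apply: eq_integral => x _; rewrite patchE.
  have [e|e] := eqVneq (lev s (g x)) 1; first by rewrite mem_set// e mul1r.
  rewrite memNset; last by move=> /eqP; exact/negP.
  by move: e; rewrite /lev; case: ifP => //; rewrite ?eqxx ?mul0r.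
rewrite -(@int_tonelli _ _ _ _ _ (leb R d) lebesgue_measure (fun x s => lev s (g x) * f x)); [|by meas|by move=> *; rewrite mulr_ge0].
apply: eq_integral => x _.
under eq_integral do rewrite mulrC.
by rewrite intZ// ?level_measure// 1?mulrC//; apply: mlev; meas.
Qed.

Lemma int_density_signed g : measurable_fun setT g ->
  (\int[mu]_x (g x)%:E = \int[leb R d]_x (g x * f x)%:E)%E.
Proof.
move=> mg.
have Ep (k : V -> R) : (fun x => (k x)%:E)^\+%E = (fun x => (k^\+ x)%:E).
  by apply/funext => x; rewrite funeposE /funrpos /= EFin_max.
have En (k : V -> R) : (fun x => (k x)%:E)^\-%E = (fun x => (k^\- x)%:E).
  by apply/funext => x; rewrite funenegE /funrneg /= EFin_max EFinN.
rewrite integralE [in RHS]integralE !Ep !En.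
rewrite !int_density; [|exact: measurable_funrneg|exact: funrneg_ge0|exact: measurable_funrpos|exact: funrpos_ge0].
by congr (_ - _)%E; apply: eq_integral => x _; congr EFin; rewrite /funrpos /funrneg maxr_pMl ?mul0r// mulNr.
Qed.

Variable M : R.
Hypothesis fM : forall x, f x <= M.

Lemma int_density_le g : measurable_fun setT g -> (forall x, 0 <= g x) ->
  (\int[mu]_x (g x)%:E <= M%:E * \int[leb R d]_x (g x)%:E)%E.
Proof.
move=> mg g0; have M0 : 0 <= M by exact: le_trans (f0 0) (fM 0).
rewrite int_density// -intZ//; apply: le_int; [by meas|by meas|by move=> x; rewrite mulr_ge0|].
by move=> x; rewrite mulrC ler_wpM2r.
Qed.

(** The factor comes from [M <= (1 + M)^2], which avoids a square root. *)
Lemma L2le_density g c : L2le (leb R d) g c -> L2le mu g ((1 + M) * c).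
Proof.
move=> [mg c0 gc]; have M0 : 0 <= M by exact: le_trans (f0 0) (fM 0).
split => //; first by rewrite mulr_ge0// addr_ge0.
apply: le_trans (int_density_le _ _) _; [by meas|by move=> x; exact: sqr_ge0|].
apply: (@le_trans _ _ (M%:E * (c ^+ 2)%:E)%E); first by rewrite lee_wpmul2l.
by rewrite -EFinM lee_fin exprMn ler_wpM2r ?sqr_ge0//; nra.
Qed.

End density.

(** * The centred kernel and the projection of the linear statistic *)

Section kernel_array.
Context {R : realType} {disp : measure_display} {Omega : measurableType disp} (P : probability Omega R).
Context {d : nat}.
Local Notation V := ('rV[R]_d).
Local Notation L2 := (L2le (leb R d)).
Variables (X0 : {RV P >-> V}) (f : V -> R).
Hypothesis fX : has_density X0 f.
Let mu := distribution P X0.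
Variables (K : V -> R) (r : nat) (kap CK M : R).
Hypothesis K_sym : symmetric_kernel K.
Hypothesis mK : measurable_fun setT K.
Hypothesis kap0 : 0 < kap.
Hypothesis K_weight : (\int[leb R d]_x (`|K x| * (1 + norm1 x) ^+ r)%:E <= kap%:E)%E.
Hypothesis K_sup : forall x, `|K x| <= CK.
Hypothesis fM : forall x, f x <= M.
Variable h : R.
Hypothesis h0 : 0 < h.
Hypothesis h1 : h <= 1.

Let mf : measurable_fun setT f. Proof. by case: fX. Qed.
Let f0 x : 0 <= f x. Proof. by case: fX. Qed.
Let fM' x : `|f x| <= M. Proof. by rewrite ger0_norm. Qed.
Let M0 : 0 <= M. Proof. exact: le_trans (f0 0) (fM 0). Qed.
Let CK0 : 0 <= CK. Proof. exact: le_trans (K_sup 0). Qed.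
Let kap0' : 0 <= kap. Proof. exact: ltW. Qed.
Let hd0 : 0 < h ^+ d. Proof. exact: exprn_gt0. Qed.
Let hd1 : 1 <= (h ^+ d)^-1.
Proof. by rewrite invf_ge1// exprn_ile1// ltW. Qed.

Definition scaled_kernel (x y : V) : R := (h ^+ d)^-1 * K (h^-1 *: (y - x)).
(** The subtracted term is the mean of the scaled kernel in [y]. The function is centred in [y] for
    each [x] and not in [x], which is why a projection survives. *)
Definition centered_kernel (x y : V) : R := scaled_kernel x y - ksmooth K f h x.

Local Notation Kh := scaled_kernel.
Local Notation p := (ksmooth K f h).

Lemma scaled_kernel_sym x y : Kh x y = Kh y x.
Proof. by rewrite /Kh -K_sym -scalerN opprB. Qed.

Lemma scaled_kernel_sup x y : `|Kh x y| <= CK / h ^+ d.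
Proof. by rewrite normrM ger0_norm ?invr_ge0 ?(ltW hd0)// mulrC ler_wpM2r// invr_ge0 ltW. Qed.

Lemma measurable_scaled_kernel : measurable_fun [set: V * V] (fun z => Kh z.1 z.2).
Proof. by rewrite /scaled_kernel; meas. Qed.

Let mp : measurable_fun setT p. Proof. exact: measurable_ksmooth. Qed.

Lemma measurable_centered_kernel : measurable_fun [set: V * V] (fun z => centered_kernel z.1 z.2).
Proof. by have := measurable_scaled_kernel => m; rewrite /centered_kernel; meas. Qed.

Let mKh x : measurable_fun setT (Kh x).
Proof. exact: (measurable_fun2_comp (f := fun=> x) (g := id) measurable_scaled_kernel). Qed.

Let p_sup x : `|p x| <= M * kap. Proof. exact: (ksmooth_bound mK K_weight). Qed.

Lemma scaled_kernel_L1 x : (\int[leb R d]_y (`|Kh x y|)%:E <= kap%:E)%E.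
Proof.
have hV : h^-1 != 0 by rewrite invr_neq0// gt_eqF.
have E y : `|Kh x y| = (h ^+ d)^-1 * `|K (h^-1 *: y + - (h^-1 *: x))|.
  by rewrite normrM ger0_norm ?invr_ge0 ?(ltW hd0)// scalerBr.
under eq_integral do rewrite E.
rewrite intZ ?invr_ge0 ?(ltW hd0)//; last by meas.
rewrite (int_affine (- (h^-1 *: x)) hV (g := fun z => `|K z|)) //; last by meas.
rewrite ger0_norm ?invr_ge0 ?(ltW h0)// exprVn invrK muleA -EFinM mulVf ?gt_eqF// mul1e.
exact: kernel_L1 K_weight.
Qed.

Lemma scaled_kernel_mu x : (\int[mu]_y (`|Kh x y|)%:E <= (M * kap)%:E)%E.
Proof.
apply: le_trans (int_density_le fX fM _ _) _ => //; first by have := mKh x => m; meas.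
by rewrite EFinM lee_wpmul2l// scaled_kernel_L1.
Qed.

Let int_Kh x : mu.-integrable setT (EFin \o Kh x).
Proof.
apply: int_integrable => //; exact: le_lt_trans (scaled_kernel_mu x) (ltry _).
Qed.

Let Kh_mean x : (\int[mu]_y (Kh x y)%:E = (p x)%:E)%E.
Proof.
have iK : (leb R d).-integrable setT (EFin \o (fun z => K z * f (x + h *: z))).
  apply: (integrableK_bounded mK K_weight (g := fun z => f (x + h *: z)) (M := M)) => //.
  by meas.
rewrite -(ksmooth_change mK h0 mf iK) /Rintegral fineK; first exact: (int_density_signed fX).
rewrite (_ : (\int[leb R d]_y _)%E = (\int[mu]_y (Kh x y)%:E)%E); last by rewrite (int_density_signed fX).
exact: integral_fune_fin_num (int_Kh x).
Qed.

Lemma centered_kernel_sup x y : `|centered_kernel x y| <= (CK + M * kap) / h ^+ d.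
Proof.
apply: le_trans (ler_normB _ _) _; rewrite mulrDl lerD ?scaled_kernel_sup//.
by apply: le_trans (p_sup x) _; rewrite ler_peMr// mulr_ge0.
Qed.

Lemma centered_kernel_mean x : (\int[mu]_y (centered_kernel x y)%:E = 0)%E.
Proof.
have ip : mu.-integrable setT (EFin \o (fun _ : V => - p x)).
  by apply: (@integrable_le _ _ _ _ _ (fun=> `|p x|) `|p x|) => //; [move=> y; rewrite normrN|rewrite int_prob_cst].
transitivity (\int[mu]_y (Kh x y)%:E + \int[mu]_y (- p x)%:E)%E.
  exact: (integralD measurableT (int_Kh x) ip).
by rewrite (int_prob_cst mu (- p x)%:E) Kh_mean -EFinD subrr.
Qed.

Lemma centered_kernel_sq x : (\int[mu]_y (centered_kernel x y ^+ 2)%:E <=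
  ((2 * CK * (M * kap) + 2 * (M * kap) ^+ 2) / h ^+ d)%:E)%E.
Proof.
have mk := mKh x.
apply: (@le_trans _ _ (\int[mu]_y (2 * (CK / h ^+ d) * `|Kh x y| + 2 * (M * kap) ^+ 2)%:E)%E).
  apply: le_int; [by rewrite /centered_kernel; meas|by meas|by nneg|] => y.
  apply: (@le_trans _ _ (2 * Kh x y ^+ 2 + 2 * p x ^+ 2)).
    by rewrite /centered_kernel; have := sqr_ge0 (Kh x y + p x); nra.
  apply: lerD.
    rewrite -(real_normK (num_real (Kh x y))) -mulrA ler_wpM2l// expr2 ler_wpM2r//.
    exact: scaled_kernel_sup.
  rewrite ler_wpM2l// -(real_normK (num_real (p x))) lerXn2r ?nnegrE ?mulr_ge0//; exact: p_sup.
have q0 : 0 <= 2 * (CK / h ^+ d) by nneg.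
rewrite intD; [|by meas|by meas|by nneg|by nneg].
rewrite int_prob_cst.
apply: (@le_trans _ _ ((2 * (CK / h ^+ d) * (M * kap))%:E + (2 * (M * kap) ^+ 2)%:E)%E).
  rewrite leeD2r//; apply: intZ_le => //; [by meas|exact: scaled_kernel_mu].
rewrite -EFinD lee_fin [X in _ <= X]mulrDl lerD//; first by rewrite le_eqVlt; apply/orP; left; apply/eqP; ring.
by rewrite ler_peMr// mulr_ge0// sqr_ge0.
Qed.

Lemma centered_kernel_L1r x : (\int[mu]_y (`|centered_kernel x y|)%:E <= (2 * (M * kap))%:E)%E.
Proof.
have mk := mKh x.
apply: (@le_trans _ _ (\int[mu]_y (`|Kh x y| + M * kap)%:E)%E).
  apply: le_int; [by rewrite /centered_kernel; meas|by meas|by nneg|] => y.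
  by apply: le_trans (ler_normB _ _) _; rewrite lerD2l p_sup.
rewrite intD; [|by meas|by meas|by nneg|by nneg].
rewrite int_prob_cst (_ : 2 * (M * kap) = M * kap + M * kap); last by ring.
by rewrite EFinD leeD2r// scaled_kernel_mu.
Qed.

Lemma centered_kernel_L1l y : (\int[mu]_x (`|centered_kernel x y|)%:E <= (2 * (M * kap))%:E)%E.
Proof.
have mk := measurable_scaled_kernel.
have mk' : measurable_fun setT (fun x => Kh x y) by meas.
apply: (@le_trans _ _ (\int[mu]_x (`|Kh x y| + M * kap)%:E)%E).
  apply: le_int; [by rewrite /centered_kernel; meas|by meas|by nneg|] => x.
  by apply: le_trans (ler_normB _ _) _; rewrite lerD2l p_sup.
rewrite intD; [|by meas|by meas|by nneg|by nneg].
rewrite int_prob_cst (_ : 2 * (M * kap) = M * kap + M * kap); last by ring.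
rewrite EFinD leeD2r//; under eq_integral do rewrite scaled_kernel_sym.
exact: scaled_kernel_mu.
Qed.

Variables (phi : V -> R) (b cphi D Dw s : R).
Hypothesis b0 : 0 < b.
Hypothesis D0 : 0 <= D.
Hypothesis Dw0 : 0 <= Dw.
Hypothesis phi_L2 : L2 phi cphi.
Hypothesis f_low : forall x, phi x != 0 -> b <= f x.
Hypothesis p_bias : forall x, `|p x - f x| <= D * h ^+ r.
Hypothesis h_small : D * h ^+ r <= b / 2.
Hypothesis w_bias : L2 (fun x => ksmooth K (fun x => phi x / f x) h x - phi x / f x) (Dw * h `^ s).
Hypothesis hrs : h ^+ r <= h `^ s.

Let mphi : measurable_fun setT phi. Proof. by case: phi_L2. Qed.
Let cphi0 : 0 <= cphi. Proof. by case: phi_L2. Qed.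
Let phi_mu : L2le mu phi ((1 + M) * cphi). Proof. exact: (L2le_density fX fM). Qed.

Lemma smoothed_low x : phi x != 0 -> b / 2 <= p x.
Proof.
move=> px; have := f_low px; have := p_bias x; rewrite ler_norml => /andP[h2 _].
by move: h_small h2; lra.
Qed.

Let pos x : phi x != 0 -> [/\ 0 < f x, 0 < p x, (f x)^-1 <= b^-1 & (p x)^-1 <= 2 / b].
Proof.
move=> px; have fb := f_low px; have pb := smoothed_low px.
have f0' : 0 < f x by exact: lt_le_trans fb.
have p0 : 0 < p x by apply: lt_le_trans pb; rewrite divr_gt0.
split => //; first by rewrite lef_pV2 ?posrE.
by rewrite -[2 / b]invrK lef_pV2 ?posrE// ?invr_gt0 ?divr_gt0// invf_div.
Qed.

Let L2_dom_phi (g : V -> R) k : 0 <= k -> measurable_fun setT g -> (forall x, `|g x| <= k * `|phi x|) -> L2 g (k * cphi).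
Proof.
move=> k0 mg gk; rewrite -[k in k * cphi](ger0_norm k0); apply: L2le_dom (L2leZ k phi_L2) => //.
by move=> x; rewrite [leRHS]normrM (ger0_norm k0).
Qed.

Let q_w : L2 (fun x => phi x / p x - phi x / f x) (2 / b ^+ 2 * (D * h ^+ r) * cphi).
Proof.
apply: L2_dom_phi; [by nneg|by meas|] => x.
have [->|px] := eqVneq (phi x) 0; first by rewrite !mul0r subrr normr0 mulr0.
have [f_0 p_0 fb pb] := pos px.
rewrite (_ : _ - _ = (p x)^-1 * (f x)^-1 * (f x - p x) * phi x); last by field; rewrite !gt_eqF.
rewrite !normrM ler_wpM2r//; apply: ler_pM => //; last by rewrite distrC.
rewrite !ger0_norm ?invr_ge0 ?(ltW f_0) ?(ltW p_0)//.
rewrite (_ : 2 / b ^+ 2 = 2 / b * b^-1); last by field; rewrite gt_eqF.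
by apply: ler_pM; rewrite ?invr_ge0 ?(ltW f_0) ?(ltW p_0).
Qed.

Let a x := phi x / p x ^+ 2.

Let ma : measurable_fun setT a. Proof. by rewrite /a; meas. Qed.

Let a_le x : `|a x| <= (2 / b) ^+ 2 * `|phi x|.
Proof.
rewrite /a; have [->|px] := eqVneq (phi x) 0; first by rewrite !mul0r normr0 mulr0.
have [f_0 p_0 fb pb] := pos px.
rewrite normrM mulrC ler_wpM2r// ger0_norm -?exprVn ?exprn_ge0 ?invr_ge0 ?(ltW p_0)//.
by rewrite lerXn2r ?nnegrE ?invr_ge0 ?divr_ge0 ?(ltW p_0) ?(ltW b0).
Qed.

Let w_g : L2 (fun x => phi x / f x - a x * f x) (6 / b ^+ 2 * (D * h ^+ r) * cphi).
Proof.
apply: L2_dom_phi; [by nneg|by meas|] => x.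
have [p0|px] := eqVneq (phi x) 0; first by rewrite /a p0 !mul0r subrr normr0 mulr0.
have [f_0 p_0 fb pb] := pos px.
rewrite (_ : _ - _ = ((p x)^-1 * (f x)^-1 + (p x)^-1 ^+ 2) * (p x - f x) * phi x); last first.
  by rewrite /a; field; rewrite !gt_eqF.
rewrite !normrM ler_wpM2r//; apply: ler_pM => //.
have fV : 0 <= (f x)^-1 by rewrite invr_ge0 ltW.
have pV : 0 <= (p x)^-1 by rewrite invr_ge0 ltW.
rewrite ger0_norm ?addr_ge0 ?mulr_ge0 ?exprn_ge0//.
rewrite (_ : 6 / b ^+ 2 = 2 / b * b^-1 + (2 / b) ^+ 2); last by field; rewrite gt_eqF.
by apply: lerD; [exact: ler_pM|rewrite lerXn2r ?nnegrE ?divr_ge0 ?(ltW b0)].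
Qed.

Let w_L2 : L2 (fun x => phi x / f x) (b^-1 * cphi).
Proof.
apply: L2_dom_phi; [by nneg|by meas|] => x.
have [->|px] := eqVneq (phi x) 0; first by rewrite !mul0r normr0 mulr0.
have [f_0 p_0 fb pb] := pos px.
by rewrite normrM mulrC ler_wpM2r// ger0_norm ?invr_ge0 ?(ltW f_0).
Qed.

Let g_L2 : L2 (fun x => a x * f x) ((2 / b) ^+ 2 * M * cphi).
Proof.
apply: L2_dom_phi; [by nneg|by meas|] => x.
rewrite normrM (ger0_norm (f0 x)) mulrAC.
by apply: ler_pM => //; exact: a_le.
Qed.

Lemma ksmoothB : ksmooth K (fun x => phi x / f x - a x * f x) h =
  fun x => ksmooth K (fun x => phi x / f x) h x - ksmooth K (fun x => a x * f x) h x.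
Proof.
apply/funext => x; rewrite /ksmooth -RintegralB//.
- by apply: eq_Rintegral => z _; rewrite mulrBr.
- exact: (integrable_ksmooth mK K_weight x h0 w_L2 K_sup).
- exact: (integrable_ksmooth mK K_weight x h0 g_L2 K_sup).
Qed.

Let c := (\int[mu]_x (phi x / p x))%R.

Let a_mu : L2le mu a ((1 + M) * ((2 / b) ^+ 2 * cphi)).
Proof. by apply: (L2le_density fX fM); apply: L2_dom_phi => //; nneg. Qed.

Let q_mu : L2le mu (fun x => phi x / p x) ((1 + M) * (2 / b * cphi)).
Proof.
apply: (L2le_density fX fM); apply: L2_dom_phi; [by nneg|by meas|] => x.
have [->|px] := eqVneq (phi x) 0; first by rewrite !mul0r normr0 mulr0.
have [f_0 p_0 fb pb] := pos px.
by rewrite normrM mulrC ler_wpM2r// ger0_norm ?invr_ge0 ?(ltW p_0).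
Qed.

Let int_q : mu.-integrable setT (EFin \o (fun x => phi x / p x)).
Proof.
by have [m _ H] := L1le_of_L2 q_mu; apply: int_integrable => //; exact: le_lt_trans H (ltry _).
Qed.

(** By symmetry of the kernel the integral over [x] is again a smoothing, of [a f]; the subtracted
    mean contributes [a p = phi / p], whose integral is [c]. *)
Lemma projectionE y : proj2 mu centered_kernel a y = ksmooth K (fun x => a x * f x) h y - c.
Proof.
have iaK : mu.-integrable setT (EFin \o (fun x => a x * Kh x y)).
  have [m _ H] := L1le_of_L2 a_mu.
  have mk := measurable_scaled_kernel.
  apply: (@integrable_le _ _ _ _ _ (fun x => CK / h ^+ d * `|a x|) (CK / h ^+ d * ((1 + M) * ((2 / b) ^+ 2 * cphi)))).
  - by meas.
  - by meas.
  - by move=> x; rewrite normrM mulrC ler_wpM2r// scaled_kernel_sup.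
  - by apply: intZ_le => //; [meas|nneg].
have -> : proj2 mu centered_kernel a y = \int[mu]_x (a x * Kh x y - phi x / p x).
  apply: eq_Rintegral => x _; rewrite /centered_kernel mulrBr; congr (_ - _); rewrite /a.
  have [->|px] := eqVneq (phi x) 0; first by rewrite !mul0r.
  have [f_0 p_0 _ _] := pos px.
  by field; rewrite gt_eqF.
rewrite RintegralB//; congr (_ - _).
rewrite -(ksmooth_change mK h0 _ (integrable_ksmooth mK K_weight y h0 g_L2 K_sup)); last by meas.
rewrite /Rintegral (int_density_signed fX); last by have mk := measurable_scaled_kernel; meas.
congr fine; apply: eq_integral => x _; congr EFin.
by rewrite -/(Kh y x) scaled_kernel_sym; ring.
Qed.

Definition sigma_const : R := (1 + M) * (2 * (2 * (2 / b ^+ 2 * D * cphi + Dw) + kap * (6 / b ^+ 2 * D * cphi))).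

(** With [w = phi / f] the function is [(phi / p - w) - (w_h - w) + (w - a f)_h], the constant [c]
    cancelling. The outer brackets are of order [h^r] because [p - f] is; the middle one is the
    smoothing bias of [w], of order [h^s]. *)
Lemma linear_term_L2 : L2le mu (fun y => phi y / p y - proj2 mu centered_kernel a y - c) (sigma_const * h `^ s).
Proof.
rewrite (_ : (fun y => _) = fun y => (phi y / p y - phi y / f y + - 1 * (ksmooth K (fun x => phi x / f x) h y - phi y / f y))
   + ksmooth K (fun x => phi x / f x - a x * f x) h y); last first.
  by apply/funext => y; rewrite projectionE ksmoothB; ring.
have L := L2leD (L2leD q_w (L2leZ (-1) w_bias)) (ksmooth_L2 mK kap0 K_weight h w_g).
apply: L2leW (L2le_density fX fM L) _.
rewrite normrN1 mul1r /sigma_const -!(mulrA (1 + M)) ler_wpM2l ?addr_ge0//.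
have e1 : 2 / b ^+ 2 * (D * h ^+ r) * cphi <= 2 / b ^+ 2 * D * cphi * h `^ s.
  rewrite (_ : _ * cphi = 2 / b ^+ 2 * D * cphi * h ^+ r); last by ring.
  by rewrite ler_wpM2l//; nneg.
have e2 : kap * (6 / b ^+ 2 * (D * h ^+ r) * cphi) <= kap * (6 / b ^+ 2 * D * cphi) * h `^ s.
  rewrite (_ : kap * _ = kap * (6 / b ^+ 2 * D * cphi) * h ^+ r); last by ring.
  by rewrite ler_wpM2l//; nneg.
by move: e1 e2; lra.
Qed.

Lemma linear_term_mean : (\int[mu]_y (phi y / p y - proj2 mu centered_kernel a y - c)%:E = 0)%E.
Proof.
have mxi := measurable_centered_kernel.
pose C := 1 + (CK + M * kap).
have C1 : 1 <= C by rewrite /C lerDl addr_ge0// mulr_ge0.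
have hd : 0 < h ^+ d by [].
have sup x y : `|centered_kernel x y| <= C / h ^+ d.
  by apply: le_trans (centered_kernel_sup x y) _; rewrite ler_wpM2r ?invr_ge0 ?(ltW hd)// /C lerDr.
have pc := proj2_centered C1 hd mxi sup centered_kernel_mean a_mu.
have ip : mu.-integrable setT (EFin \o proj2 mu centered_kernel a).
  apply: (@integrable_of_fin_integral _ _ _ _ _ 0) => //.
  exact: (measurable_proj2 mxi a_mu).
have ic : mu.-integrable setT (EFin \o (fun _ : V => - c)).
  by apply: (@integrable_le _ _ _ _ _ (fun=> `|c|) `|c|) => //; [move=> y; rewrite normrN|rewrite int_prob_cst].
have ip' := integrableZ_real (-1) ip.
transitivity (\int[mu]_y (phi y / p y + -1 * proj2 mu centered_kernel a y)%:E + \int[mu]_y (- c)%:E)%E.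
  rewrite -(integralD measurableT (integrableD_real int_q ip') ic).
  by apply: eq_integral => y _; rewrite -EFinD mulN1r.
rewrite (int_prob_cst mu (- c)%:E).
have -> : (\int[mu]_y (phi y / p y + -1 * proj2 mu centered_kernel a y)%:E = c%:E + 0)%E.
  transitivity (\int[mu]_y (phi y / p y)%:E + \int[mu]_y (-1 * proj2 mu centered_kernel a y)%:E)%E.
    by rewrite -(integralD measurableT int_q ip').
  congr (_ + _)%E; first by rewrite /c /Rintegral fineK//; exact: integral_fune_fin_num int_q.
  by under eq_integral do rewrite EFinM; rewrite integralZl// pc mule0.
by rewrite adde0 -EFinD subrr.
Qed.

Definition tau_const : R := 2 / b * D * (b^-1 * ((1 + M) * cphi)).

(** The difference is the integral of [phi (f - p) / p]. The L1 norm of [phi] for Lebesgue measure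
    is obtained from the one for the law of the observation, since [f >= b] where [phi] does not
    vanish. *)
Lemma mean_bias : `|c - \int[leb R d]_x phi x| <= tau_const * h ^+ r.
Proof.
have phi1 : (\int[leb R d]_x (`|phi x|)%:E <= (b^-1 * ((1 + M) * cphi))%:E)%E.
  have [_ _ H] := L1le_of_L2 phi_mu.
  apply: (@le_trans _ _ (\int[leb R d]_x (b^-1 * (`|phi x| * f x))%:E)%E).
    apply: le_int; [by meas|by meas|by []|] => x.
    have [->|px] := eqVneq (phi x) 0; first by rewrite normr0 mul0r mulr0.
    rewrite mulrCA ler_peMr// mulrC ler_pdivlMr// mul1r; exact: f_low.
  apply: intZ_le; [by meas|by nneg|by nneg|].
  by rewrite -(int_density fX (g := fun x => `|phi x|)) //; meas.
have iphi : (leb R d).-integrable setT (EFin \o phi).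
  by apply: int_integrable => //; exact: le_lt_trans phi1 (ltry _).
have E : c = \int[leb R d]_x (phi x / p x * f x).
  by rewrite /c /Rintegral (int_density_signed fX)//; meas.
have Fin : (\int[mu]_x (phi x / p x)%:E)%E \is a fin_num by exact: integral_fune_fin_num int_q.
have iqf : (leb R d).-integrable setT (EFin \o (fun x => phi x / p x * f x)).
  apply: (@integrable_of_fin_integral _ _ _ _ _ (fine (\int[mu]_x (phi x / p x)%:E)%E)); first by meas.
  by rewrite fineK// (int_density_signed fX)//; meas.
rewrite E -RintegralB//.
apply: (@Rintegral_le_bound _ _ _ _ _ (fun x => 2 / b * D * h ^+ r * `|phi x|)); [by meas|by meas| |].
  move=> x; have [->|px] := eqVneq (phi x) 0; first by rewrite !mul0r subrr normr0 mulr0.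
  have [f_0 p_0 fb pb] := pos px.
  rewrite (_ : _ - _ = (p x)^-1 * (f x - p x) * phi x); last by field; rewrite gt_eqF.
  rewrite !normrM ler_wpM2r// -mulrA; apply: ler_pM => //; last by rewrite distrC.
  by rewrite ger0_norm// invr_ge0 ltW.
rewrite /tau_const (_ : _ * h ^+ r = 2 / b * D * h ^+ r * (b^-1 * ((1 + M) * cphi))); last by ring.
by apply: intZ_le => //; [meas|nneg].
Qed.

End kernel_array.

(** * The estimators as functions of the sample vector *)

Section sample_estimators.
Context {R : realType} {d : nat}.
Variables (K phi p : 'rV[R]_d -> R) (h : R) (n : nat) (X : nat -> 'rV[R]_d).
Hypothesis K_sym : symmetric_kernel K.
Let xi x y := scaled_kernel K h x y - p x.
Let v : 'rV['rV[R]_d]_n := \row_j X j.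

Lemma fhat_sample (i : 'I_n) : fhat K h n X i (X i) = fh xi p i v.
Proof.
rewrite /fhat /fh invfM -mulrA big_mkord; congr (_ * _); rewrite mulr_sumr.
apply: eq_bigr => j _; rewrite /v !mxE /xi subrK; congr (_ * K (_ *: _)).
Qed.

Lemma vhat_sample (i : 'I_n) : vhat K h n X i (X i) = vh xi p i v.
Proof.
rewrite /vhat /vh big_mkord; congr (_ * _); apply: eq_bigr => j _.
rewrite fhat_sample {1}/v !mxE /xi subrK; congr ((_ - _) ^+ 2).
by rewrite /scaled_kernel -K_sym -scalerN opprB.
Qed.

Lemma Ihat_sample : Ihat K h n X phi = Iplain xi p phi v.
Proof.
rewrite /Ihat /Iplain big_mkord; congr (_ * _); apply: eq_bigr => i _.
by rewrite fhat_sample /v mxE.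
Qed.

Lemma Icor_sample : Icor K h n X phi = Icorr xi p phi v.
Proof.
rewrite /Icor /Icorr big_mkord; congr (_ * _); apply: eq_bigr => i _.
by rewrite fhat_sample vhat_sample /v mxE.
Qed.

End sample_estimators.

(** * Non-asymptotic tail bounds *)

Section tails.
Context {R : realType} {disp : measure_display} {Omega : measurableType disp}.
Variable P : probability Omega R.
Variables (d : nat) (r : nat) (s : R) (X : nat -> {RV P >-> 'rV[R]_d}).
Variables (phi f K : 'rV[R]_d -> R) (b CK M Mr : R).
Hypothesis d1 : (1 <= d)%N.
Hypothesis s0 : 0 < s.
Hypothesis sr : s <= r.+1%:R.
Hypothesis X_iid : iid X.
Hypothesis phi_nik : nikolskii s phi.
Hypothesis phi_cpt : compact (fun_support phi).
Hypothesis f_dens : has_density (X 0%N) f.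
Hypothesis f_bound : forall x, `|f x| <= M.
Hypothesis f_part : partials_exist r.+1 f.
Hypothesis f_deriv : forall w : seq 'I_d, size w = r.+1 -> forall x, `|iter_partial w f x| <= Mr.
Hypothesis b0 : 0 < b.
Hypothesis f_low : forall x, phi x != 0 -> b <= f x.
Hypothesis K_sym : symmetric_kernel K.
Hypothesis K_ord : kernel_order r.+1 K.
Hypothesis K_sup : forall x, `|K x| <= CK.

Let I0 : R := \int[leb R d]_x phi x.

(** The constants are chosen before [n] and [h], so a single statement serves every bandwidth
    sequence. The order is written [r + 1], so that Taylor polynomials have degree [r]. *)
Lemma estimator_tails : exists (C A B h0 : R), [/\ 1 <= C, 0 <= A, 0 < B, 0 < h0 &
  forall n h, (4 <= n)%N -> 0 < h <= h0 ->
  let nu := (Num.sqrt n%:R)^-1 in let eps := nu * h `^ (- (d%:R / 2)) in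
  eps <= 1 -> 4 * C ^+ 2 * nu ^+ 2 <= 1 -> forall N t, 0 < N ->
  (N * (C * (nu * h `^ s + h ^+ r.+1 + eps ^+ 2)) <= t ->
   (P [set w | (t < `|Ihat K h n (fun i => X i w) phi - I0|)%R] <= (A * (eps ^+ 3 / nu) ^+ 2 + B / N)%:E)%E) /\
  (N * (C * (nu * h `^ s + h ^+ r.+1 + eps * nu + eps ^+ 3)) <= t ->
   (P [set w | (t < `|Icor K h n (fun i => X i w) phi - I0|)%R] <= (A * (eps ^+ 3 / nu) ^+ 2 + B / N)%:E)%E)].
Proof.
have [mf f0 _] := f_dens; have [mK _ _] := K_ord.
have fM x : f x <= M by apply: le_trans (ler_norm _) (f_bound x).
have M0 : 0 <= M by exact: le_trans (f_bound 0).
have CK0 : 0 <= CK by exact: le_trans (K_sup 0).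
have [kap kap0 K_w] := kernel_weight d1 K_ord.
have [cphi phi_L2] := nikolskii_L2 d1 phi_nik phi_cpt.
have cphi0 : 0 <= cphi by case: phi_L2.
have [mphi _ _] := phi_L2.
have [Pf [HPf [D D0 HD]]] := taylor_sup mf f_part f_deriv.
have [Pw [HPw [Dw Dw0 HDw]]] := taylor_quotient d1 phi_nik phi_cpt sr s0 mf f_part f_deriv b0 f_low.
have w_L2 : L2le (leb R d) (fun x => phi x / f x) (b^-1 * cphi).
  rewrite -[b^-1]ger0_norm ?invr_ge0 ?(ltW b0)//.
  apply: L2le_dom (L2leZ b^-1 phi_L2); first by meas.
  move=> x; have [->|px] := eqVneq (phi x) 0; first by rewrite mul0r mulr0.
  have fx0 : 0 < f x by exact: lt_le_trans (f_low px).
  rewrite mulrC !normrM ler_wpM2r// !ger0_norm ?invr_ge0 ?(ltW b0)//.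
  by rewrite lef_pV2 ?posrE// f_low.
pose D' := D * kap; pose Dw' := 4 * Dw * kap.
have D'0 : 0 <= D' by rewrite mulr_ge0// ltW.
have Dw'0 : 0 <= Dw' by rewrite !mulr_ge0// ltW.
have kap0' := ltW kap0; have b0' := ltW b0.
pose c1 := CK + M * kap; pose c2 := 2 * CK * (M * kap) + 2 * (M * kap) ^+ 2.
pose c3 := 2 * (M * kap); pose c4 := M * kap; pose c5 := 2 / b; pose c6 := (1 + M) * cphi.
pose c7 := sigma_const kap M b cphi D' Dw'; pose c8 := tau_const M b cphi D'.
have c10 : 0 <= c1 by rewrite /c1; nneg.
have c20 : 0 <= c2 by rewrite /c2; nneg.
have c30 : 0 <= c3 by rewrite /c3; nneg.
have c40 : 0 <= c4 by rewrite /c4; nneg.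
have c50 : 0 <= c5 by rewrite /c5; nneg.
have c60 : 0 <= c6 by rewrite /c6; nneg.
have c70 : 0 <= c7 by rewrite /c7 /sigma_const; nneg.
have c80 : 0 <= c8 by rewrite /c8 /tau_const; nneg.
(* One constant dominating all the bounds required of the array. *)
pose C := 1 + (c1 + c2 + c3 + c4 + c5 + c6 + c7 + c8).
have [C1 C2 C3 C4] : [/\ c1 <= C, c2 <= C, c3 <= C & c4 <= C] by rewrite /C; split; lra.
have [C5 C6 C7 C8] : [/\ c5 <= C, c6 <= C, c7 <= C & c8 <= C] by rewrite /C; split; lra.
have Cge1 : 1 <= C by rewrite /C; lra.
have C0 : 0 < C by exact: lt_le_trans Cge1.
have A0 : 0 <= (4 * C) ^+ 6 * mconst C 3 by rewrite mulr_ge0 ?mconst_ge0// exprn_ge0// mulr_ge0// ltW.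
pose B := `|plain_const C| + `|corr_const C| + 1.
(* Below [h0] one has [h <= 1], and the bias [D' h^(r + 1)] is at most [b / 2], which keeps the
   smoothed density above [b / 2] on the support of [phi]. *)
pose h0 := Num.min 1 (b / 2 / (D' + 1)).
have h00 : 0 < h0 by rewrite lt_min ltr01/= divr_gt0 ?divr_gt0// ltr_wpDl.
have B0 : 0 < B by rewrite /B ltr_wpDl// addr_ge0.
exists C, ((4 * C) ^+ 6 * mconst C 3), B, h0; split => // n h n4 /andP[hp hh0] nu eps eps1 nus N t N0.
have h1 : h <= 1 by apply: le_trans hh0 _; rewrite ge_min lexx.
have h2 : h <= b / 2 / (D' + 1) by apply: le_trans hh0 _; rewrite ge_min lexx orbT.
have hd0 : 0 < h ^+ d by exact: exprn_gt0.
have hr : h ^+ r.+1 <= h by rewrite exprS ler_piMr ?(ltW hp)// exprn_ile1// ltW.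
have h_small : D' * h ^+ r.+1 <= b / 2.
  apply: (@le_trans _ _ (D' * (b / 2 / (D' + 1)))); first by rewrite ler_wpM2l// (le_trans hr).
  rewrite mulrCA ler_piMr ?divr_ge0// ler_pdivrMr ?mul1r ?lerDl// ltr_wpDl//.
have hrs : h ^+ r.+1 <= h `^ s by rewrite -powR_mulrn ?(ltW hp)//; apply: ger_powR => //; rewrite hp.
have p_bias x : `|ksmooth K f h x - f x| <= D' * h ^+ r.+1.
  apply: (ksmooth_taylor_sup mK K_w K_ord (k := r) _ HPf _ mf f_bound D0 (ltW hp) (HD x)) => //.
  - by move=> a [].
  - exact: taylor_poly0 HD x.
have w_bias : L2le (leb R d) (fun x => ksmooth K (fun x => phi x / f x) h x - phi x / f x) (Dw' * h `^ s).
  apply: (ksmooth_taylor_L2 mK kap0 K_w K_ord (k := r) _ HPw w_L2 K_sup Dw0 _ _ HDw) => //; first by rewrite hp.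
  by rewrite s0.
have n0 : 0 < n%:R :> R by rewrite ltr0n (leq_trans _ n4).
have sn0 : 0 < Num.sqrt n%:R :> R by rewrite sqrtr_gt0.
have nu0 : 0 < nu by rewrite invr_gt0.
have nuE : nu ^+ 2 * n%:R = 1 by rewrite exprVn sqr_sqrtr ?(ltW n0)// mulVf// gt_eqF.
have q2 : (h `^ (- (d%:R / 2))) ^+ 2 = (h ^+ d)^-1.
  rewrite -powR_mulrn ?powR_ge0// -powRrM mulNr mulfVK// powRN -powR_mulrn ?(ltW hp)//.
have q0 : 0 < h `^ (- (d%:R / 2)) by rewrite powR_gt0.
have hdV1 : 1 <= (h ^+ d)^-1 by rewrite invf_ge1// exprn_ile1// ltW.
have q1 : 1 <= h `^ (- (d%:R / 2)) by rewrite -(@ler_pXn2r _ 2)// ?nnegrE ?(ltW q0)// q2 expr1n.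
have nueps : nu <= eps by rewrite /eps ler_peMr// ltW.
have epsE : eps ^+ 2 * (n%:R * h ^+ d) = 1.
  rewrite /eps exprMn q2 (_ : _ * _ = (nu ^+ 2 * n%:R) * ((h ^+ d)^-1 * h ^+ d)); last by ring.
  by rewrite nuE mulVf ?gt_eqF// mul1r.
pose mu := distribution P (X 0%N).
pose p := ksmooth K f h; pose xi := centered_kernel f K h.
pose Q := sample_law n X.
have RS := @resample _ _ _ P _ _ n X X_iid.
have mxi := measurable_centered_kernel f_dens mK h.
have mp : measurable_fun setT p by exact: measurable_ksmooth.
have xi_sup x y : `|xi x y| <= C / h ^+ d.
  apply: le_trans (centered_kernel_sup f_dens mK kap0 K_w K_sup fM hp h1 x y) _.
  by rewrite ler_wpM2r// invr_ge0 ltW.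
have xi_sq x : (\int[mu]_y (xi x y ^+ 2)%:E <= (C / h ^+ d)%:E)%E.
  apply: le_trans (centered_kernel_sq f_dens mK kap0 K_w K_sup fM hp h1 x) _.
  by rewrite lee_fin ler_wpM2r// invr_ge0 ltW.
have xi_0 := centered_kernel_mean f_dens mK K_w fM hp.
have xi_L1r x : (\int[mu]_y (`|xi x y|)%:E <= C%:E)%E.
  by apply: le_trans (centered_kernel_L1r f_dens mK kap0 K_w fM hp x) _; rewrite lee_fin.
have xi_L1l x : (\int[mu]_y (`|xi y x|)%:E <= C%:E)%E.
  by apply: le_trans (centered_kernel_L1l f_dens K_sym mK kap0 K_w fM hp x) _; rewrite lee_fin.
have p_sup x : `|p x| <= C.
  by apply: le_trans (ksmooth_bound mK K_w h x mf f_bound) _.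
have p_low x : phi x != 0 -> C^-1 <= p x.
  move=> px; apply: le_trans (smoothed_low f_low p_bias h_small px).
  by rewrite -[b / 2]invrK lef_pV2 ?posrE ?invr_gt0 ?divr_gt0// invf_div.
have phi_mu : L2le mu phi C.
  by apply: L2leW (L2le_density f_dens fM phi_L2) _.
have psi_L2 := linear_term_L2 f_dens K_sym mK kap0 K_w K_sup fM hp b0 D'0 phi_L2 f_low p_bias h_small w_bias hrs.
have psi_0 := linear_term_mean f_dens mK kap0 K_w K_sup fM hp h1 b0 phi_L2 f_low p_bias h_small.
have c_bias := mean_bias f_dens mK fM hp b0 D'0 phi_L2 f_low p_bias h_small.
have sg0 : 0 <= sigma_const kap M b cphi D' Dw' * h `^ s by rewrite mulr_ge0// powR_ge0.
have ta0 : 0 <= tau_const M b cphi D' * h ^+ r.+1 by rewrite mulr_ge0// exprn_ge0// ltW.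
have e1 : nu * (c7 * h `^ s) <= C * (nu * h `^ s) by rewrite mulrCA ler_wpM2r// mulr_ge0 ?powR_ge0// ltW.
have e2 : c8 * h ^+ r.+1 <= C * h ^+ r.+1 by rewrite ler_wpM2r// exprn_ge0// ltW.
have grow z : 0 <= z -> z <= C * z by move=> z0; rewrite ler_peMl.
have e3 := grow _ (sqr_ge0 eps).
have eps0 : 0 < eps by exact: lt_le_trans nueps.
have e4 : eps * nu <= C * (eps * nu) by apply: grow; rewrite mulr_ge0// ltW.
have e5 : eps ^+ 3 <= C * eps ^+ 3 by apply: grow; rewrite exprn_ge0// ltW.
split => Ht.
  have -> : [set w | (t < `|Ihat K h n (fun i => X i w) phi - I0|)%R] =
      sample n X @^-1` [set v | (t < `|Iplain xi p phi v - I0|)%R].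
    by apply/seteqP; split => w /=; rewrite (Ihat_sample _ _ p).
  apply: le_trans (plain_tail RS n4 Cge1 hd0 nu0 nueps eps1 nuE epsE mxi mp xi_sup xi_sq xi_0 p_sup p_low phi_mu
    psi_L2 psi_0 c_bias nus sg0 ta0 N0 (t := t) _) _.
    by apply: le_trans Ht; rewrite ler_pM2l//; rewrite -/c7 -/c8; lra.
  rewrite lee_fin lerD2l ler_pM2r ?invr_gt0//.
  by apply: le_trans (ler_norm _) _; rewrite /B -addrA lerDl addr_ge0.
have -> : [set w | (t < `|Icor K h n (fun i => X i w) phi - I0|)%R] =
    sample n X @^-1` [set v | (t < `|Icorr xi p phi v - I0|)%R].
  by apply/seteqP; split => w /=; rewrite (Icor_sample phi p).
apply: le_trans (corr_tail RS n4 Cge1 hd0 nu0 nueps eps1 nuE epsE mxi mp xi_sup xi_sq xi_0 xi_L1r xi_L1l p_sup p_low phi_mu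
  psi_L2 psi_0 c_bias nus sg0 ta0 N0 (t := t) _) _.
  by apply: le_trans Ht; rewrite ler_pM2l//; rewrite -/c7 -/c8; lra.
rewrite lee_fin lerD2l ler_pM2r ?invr_gt0//.
by apply: le_trans (ler_norm _) _; rewrite /B addrAC lerDr addr_ge0.
Qed.

End tails.

(** * From tail bounds to boundedness in probability *)

Section big_O.
Context {R : realType} {disp : measure_display} {Omega : measurableType disp}.
Variable P : probability Omega R.

(** The level [N = 2 B / e] makes [B / N] equal to [e / 2], and [A * rate n] falls below [e / 2]
    eventually. The threshold [kappa] is there because the tail bounds require a small bandwidth,
    which is deduced from a small rate. *)
Lemma bigO_P_of_tail (Z : nat -> Omega -> R) (rate : nat -> R) (A B C kappa : R) :
  0 <= A -> 0 < B -> 0 < C -> 0 < kappa -> rate n @[n --> \oo] --> 0 ->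
  (\forall n \near \oo, rate n < kappa -> 0 < rate n /\ forall N, 0 < N ->
     (P [set w | (N * C < `|Z n w / rate n|)%R] <= (A * rate n + B / N)%:E)%E) ->
  bigO_P P Z rate.
Proof.
move=> A0 B0 C0 kappa0 rate0 H e e0.
exists (2 * B / e * C).
have k0 : 0 < Num.min kappa (e / 2 / (A + 1)).
  by rewrite lt_min kappa0/= !divr_gt0// ltr_wpDl.
move/cvgrPdist_lt : rate0 => /(_ _ k0) rate0; near=> n.
have : `|0 - rate n| < Num.min kappa (e / 2 / (A + 1)) by near: n.
rewrite sub0r normrN lt_min => /andP[r1 r2].
have r1' : rate n < kappa by exact: le_lt_trans (ler_norm _) r1.
have Hn : rate n < kappa -> 0 < rate n /\ forall N, 0 < N ->
     (P [set w | (N * C < `|Z n w / rate n|)%R] <= (A * rate n + B / N)%:E)%E by near: n.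
have [rp {}Hn] := Hn r1'.
have N0 : 0 < 2 * B / e by rewrite divr_gt0// mulr_gt0.
apply: le_trans (Hn _ N0) _; rewrite lee_fin.
have -> : B / (2 * B / e) = e / 2 by field; rewrite !gt_eqF.
have : A * rate n <= e / 2; last lra.
have A1 : 0 < A + 1 by rewrite ltr_wpDl.
apply: (@le_trans _ _ ((A + 1) * (e / 2 / (A + 1)))).
  by rewrite ler_pM// ?(ltW rp)// ?lerDl// (le_trans (ler_norm _))// ltW.
by rewrite mulrC divfK// gt_eqF.
Unshelve. all: by end_near.
Qed.

End big_O.

(** * The rates of the plain and of the corrected estimator *)

Theorem theorem1 (R : realType) (disp : measure_display)
  (Omega : measurableType disp) (P : probability Omega R)
  (d : nat) (hd : (1 <= d)%N) (r : nat) (hr : (1 <= r)%N)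
  (s : R) (hs : 0 < s) (hsr : s <= r%:R)
  (X : nat -> {RV P >-> 'rV[R]_d}) (hX : iid X)
  (h : nat -> R) (hh : forall n : nat, (1 <= n)%N -> 0 < h n)
  (phi : 'rV[R]_d -> R) (hphi : nikolskii s phi)
  (hphiQ : compact (fun_support phi))
  (f : 'rV[R]_d -> R) (hf : has_density (X 0%N) f)
  (hfbd : exists M : R, forall x : 'rV[R]_d, `|f x| <= M)
  (hfr : partials_exist r f)
  (hfrbd : exists M : R, forall w : seq 'I_d, size w = r ->
     forall x : 'rV[R]_d, `|iter_partial w f x| <= M)
  (b : R) (hb : 0 < b)
  (hfb : forall x : 'rV[R]_d, fun_support phi x -> b <= f x)
  (K : 'rV[R]_d -> R) (hKsym : symmetric_kernel K) (hKr : kernel_order r K)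
  (C1 C2 : R) (hC1 : 0 < C1) (hC2 : 0 < C2)
  (hKexp : forall x : 'rV[R]_d, `|K x| <= C1 * expR (- C2 * enorm x)) :
  (((h n `^ s + Num.sqrt n%:R * h n ^+ r
       + (Num.sqrt n%:R)^-1 * (h n ^+ d)^-1) @[n --> \oo] --> 0) ->
   bigO_P P
     (fun (n : nat) (w : Omega) => Num.sqrt n%:R *
        (Ihat K (h n) n (fun i => X i w) phi - \int[leb R d]_x phi x))
     (fun n : nat => h n `^ s + Num.sqrt n%:R * h n ^+ r
       + (Num.sqrt n%:R)^-1 * (h n ^+ d)^-1))
  /\
  (((h n `^ s + Num.sqrt n%:R * h n ^+ r
       + (Num.sqrt n%:R)^-1 * h n `^ (- (d%:R / 2))
       + n%:R^-1 * h n `^ (- (3 * d%:R / 2))) @[n --> \oo] --> 0) ->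
   bigO_P P
     (fun (n : nat) (w : Omega) => Num.sqrt n%:R *
        (Icor K (h n) n (fun i => X i w) phi - \int[leb R d]_x phi x))
     (fun n : nat => h n `^ s + Num.sqrt n%:R * h n ^+ r
       + (Num.sqrt n%:R)^-1 * h n `^ (- (d%:R / 2))
       + n%:R^-1 * h n `^ (- (3 * d%:R / 2)))).
Proof.
case: r hr hsr hfr hfrbd hKr => // r _ hsr hfr [Mr hfrbd] hKr.
have [M fM] := hfbd.
have f_low x : phi x != 0 -> b <= f x.
  by move=> px; apply: hfb; exact: subset_closure.
have K_sup x : `|K x| <= C1.
  apply: le_trans (hKexp x) _; rewrite ler_piMr ?(ltW hC1)//.
  by rewrite expR_le1 mulNr oppr_le0 mulr_ge0 ?(ltW hC2)// sqrtr_ge0.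
have [C [A [B [h0 [Cge1 A0 B0 h00 tails]]]]] :=
  estimator_tails hd hs hsr hX hphi hphiQ hf fM hfr hfrbd hb f_low hKsym hKr K_sup.
have C0 : 0 < C by exact: lt_le_trans Cge1.
(* As [h^s] is a term of the rate, a rate below [h0^s] forces [h <= h0]; a rate below 1 serves to
   obtain [eps <= 1]. *)
pose kappa := Num.min 1 (h0 `^ s).
have kappa0 : 0 < kappa by rewrite lt_min ltr01/= powR_gt0.
have basic n (nu := (Num.sqrt n%:R)^-1 : R) (q := h n `^ (- (d%:R / 2)) : R) : (4 <= n)%N -> 4 * C ^+ 2 <= n%:R ->
    [/\ 0 < h n, 0 < nu & 0 < q] /\ [/\ nu <= 1, nu ^+ 2 = n%:R^-1, 4 * C ^+ 2 * nu ^+ 2 <= 1,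
      q ^+ 2 = (h n ^+ d)^-1 & q ^+ 3 = h n `^ (- (3 * d%:R / 2))].
  move=> n4 nC; have n1 : (1 <= n)%N by exact: leq_trans n4.
  have hp := hh n n1.
  have n0 : 0 < n%:R :> R by rewrite ltr0n.
  have sn0 : 0 < Num.sqrt n%:R :> R by rewrite sqrtr_gt0.
  have nu2 : nu ^+ 2 = n%:R^-1 by rewrite exprVn sqr_sqrtr// ltW.
  split; first by split; rewrite ?invr_gt0 ?powR_gt0.
  split => //.
  - by rewrite -(@ler_pXn2r _ 2)// ?nnegrE ?invr_ge0 ?(ltW sn0)// nu2 expr1n invf_le1// ler1n.
  - by rewrite nu2 ler_pdivrMr// mul1r.
  - by rewrite -powR_mulrn ?powR_ge0// -powRrM mulNr mulfVK// powRN powR_mulrn ?(ltW hp).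
  - rewrite -powR_mulrn ?powR_ge0// -powRrM; congr (_ `^ _); by field.
have h_le n : 0 < h n -> h n `^ s < h0 `^ s -> h n <= h0.
  move=> hp; apply: contraTT; rewrite -ltNge -leNgt => lt.
  by rewrite ge0_ler_powR ?nnegrE ?(ltW hs) ?(ltW hp) ?(ltW h00)// ltW.
have event (nu rt z a : R) : 0 < nu -> 0 < rt -> (a < `|nu^-1 * z / rt|) = (a * rt * nu < `|z|).
  move=> nu0 rt0; rewrite !normrM !normfV (gtr0_norm nu0) (gtr0_norm rt0).
  by rewrite ltr_pdivlMr// ltr_pdivlMl// (mulrC nu).
split => cv.
- apply: (bigO_P_of_tail A0 B0 C0 kappa0 cv); near=> n.
  have n4 : (4 <= n)%N by near: n; exact: nbhs_infty_ge.
  have nC : 4 * C ^+ 2 <= n%:R by near: n; exact: nbhs_infty_ger.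
  have [[hp nu0 q0] [nu1 nu2 nuC q2 _]] := basic n n4 nC.
  set nu := (Num.sqrt n%:R)^-1 in nu0 nu1 nu2 nuC *; set q := h n `^ (- (d%:R / 2)) in q0 q2.
  set rate := (_ + _ + _); move=> rk.
  have sE : Num.sqrt n%:R = nu^-1 :> R by rewrite invrK.
  have rE : rate = h n `^ s + nu^-1 * h n ^+ r.+1 + nu * q ^+ 2 by rewrite /rate sE q2.
  have p1 : 0 < h n `^ s by exact: powR_gt0.
  have p2 : 0 < nu^-1 * h n ^+ r.+1 by apply: mulr_gt0; [rewrite invr_gt0|exact: exprn_gt0].
  have p3 : 0 < nu * q ^+ 2 by rewrite mulr_gt0// exprn_gt0.
  move: rk; rewrite rE lt_min => /andP[rk1 rk2].
  split=> [|N N0]; first by rewrite !addr_gt0.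
  have hn0 : h n <= h0 by apply: h_le => //; lra.
  (* The rate in (a) contains [nu q^2] and not [nu q = eps]; but [eps^2 = nu (nu q^2)], a product of
     two factors at most 1. *)
  have eps1 : nu * q <= 1.
    rewrite -(@ler_pXn2r _ 2)// ?nnegrE ?mulr_ge0 ?(ltW nu0) ?(ltW q0)// expr1n.
    rewrite (_ : (nu * q) ^+ 2 = nu * (nu * q ^+ 2)); last by ring.
    by rewrite mulr_ile1 ?(ltW nu0) ?(ltW p3)//; lra.
  have hb2 : 0 < h n <= h0 by rewrite hp.
  set rt := h n `^ s + _ + _ in rk1 rk2 *.
  have rt0 : 0 < rt by rewrite !addr_gt0.
  have [H _] := tails n (h n) n4 hb2 eps1 nuC N (N * C * rt * nu) N0.
  rewrite -/nu -/q in H; clearbody nu q.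
  rewrite (_ : [set w | _] = [set w | N * C * rt * nu < `|Ihat K (h n) n (fun i => X i w) phi - \int[leb R d]_x phi x|]); last first.
    by apply/seteqP; split => w /=; rewrite sE event.
  apply: le_trans (H _) _.
    rewrite -!mulrA ler_pM2l// ler_pM2l// le_eqVlt; apply/orP; left; apply/eqP.
    by rewrite /rt; field; rewrite gt_eqF.
  rewrite lee_fin lerD2r ler_wpM2l//.
  (* The probability of the exceptional event is [(eps^3 / nu)^2 = nu (nu q^2)^3], dominated by the
     last term of the rate. *)
  rewrite [leLHS](_ : _ = nu * (nu * q ^+ 2) ^+ 3); last by field; rewrite gt_eqF.
  have t1 : nu * q ^+ 2 <= 1 by rewrite /rt in rk1; lra.
  apply: (@le_trans _ _ (nu * q ^+ 2)); last by rewrite /rt; lra.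
  rewrite -[leRHS]mul1r; apply: ler_pM; [exact: ltW|by rewrite exprn_ge0// ltW|by []|].
  by rewrite exprSr ler_piMl ?(ltW p3)// exprn_ile1// ltW.
- apply: (bigO_P_of_tail A0 B0 C0 kappa0 cv); near=> n.
  have n4 : (4 <= n)%N by near: n; exact: nbhs_infty_ge.
  have nC : 4 * C ^+ 2 <= n%:R by near: n; exact: nbhs_infty_ger.
  have [[hp nu0 q0] [nu1 nu2 nuC _ q3]] := basic n n4 nC.
  rewrite -q3 -nu2.
  set nu := (Num.sqrt n%:R)^-1 in nu0 nu1 nu2 nuC *; set q := h n `^ (- (d%:R / 2)) in q0 q3 *.
  have sE : Num.sqrt n%:R = nu^-1 :> R by rewrite invrK.
  have p1 : 0 < h n `^ s by exact: powR_gt0.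
  have p2 : 0 < nu^-1 * h n ^+ r.+1 by apply: mulr_gt0; [rewrite invr_gt0|exact: exprn_gt0].
  have p3 : 0 < nu * q by rewrite mulr_gt0.
  have p4 : 0 < nu ^+ 2 * q ^+ 3 by rewrite mulr_gt0// exprn_gt0.
  rewrite sE; set rt := h n `^ s + _ + _ + _; rewrite lt_min => /andP[rk1 rk2].
  have rt0 : 0 < rt by rewrite !addr_gt0.
  split=> // N N0.
  have hn0 : h n <= h0 by apply: h_le => //; rewrite /rt in rk2; lra.
  have eps1 : nu * q <= 1 by rewrite /rt in rk1; lra.
  have hb2 : 0 < h n <= h0 by rewrite hp.
  have [_ H] := tails n (h n) n4 hb2 eps1 nuC N (N * C * rt * nu) N0.
  rewrite -/nu -/q in H; clearbody nu q.
  rewrite (_ : [set w | _] = [set w | N * C * rt * nu < `|Icor K (h n) n (fun i => X i w) phi - \int[leb R d]_x phi x|]); last first.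
    by apply/seteqP; split => w /=; rewrite event.
  apply: le_trans (H _) _.
    rewrite -!mulrA ler_pM2l// ler_pM2l// le_eqVlt; apply/orP; left; apply/eqP.
    by rewrite /rt; field; rewrite gt_eqF.
  rewrite lee_fin lerD2r ler_wpM2l//.
  (* Here [eps^3 / nu] is itself the last term of the rate; being at most 1, it dominates its
     square. *)
  rewrite (_ : (nu * q) ^+ 3 / nu = nu ^+ 2 * q ^+ 3); last by field; rewrite gt_eqF.
  have t1 : nu ^+ 2 * q ^+ 3 <= 1 by rewrite /rt in rk1; lra.
  apply: (@le_trans _ _ (nu ^+ 2 * q ^+ 3)); last by rewrite /rt; lra.
  by rewrite expr2 ler_piMl// ltW.
Unshelve. all: by end_near.
Qed.
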